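(* Let $r\in\{9,10\}$, $n\geq 4$ and $d\geq 1$. Then the Grassmann cactus variety $\mathfrak{K}_{r,2}(\nu_d(\mathbb{P}^n))$ is irreducible and coincides with the Grassmann secant variety $\sigma_{r,2}(\nu_d(\mathbb{P}^n))$.
   Context: $\mathbb{K}$ is an algebraically closed field of characteristic zero. $\nu_d:\mathbb{P}^n\to\mathbb{P}^N$ is the degree $d$ Veronese embedding. For a projective variety $X\subset\mathbb{P}^N=\mathbb{P}(\mathbb{K}^{N+1})$ and positive integers $r,k$, the Grassmann secant variety $\sigma_{r,k}(X)\subset \operatorname{Gr}(k,\mathbb{K}^{N+1})$ is the closure of the set of $k$-dimensional linear subspaces $V$ such that $\mathbb{P}(V)$ is contained in the linear span of some $r$ points of $X$. The Grassmann cactus variety is $\mathfrak{K}_{r,k}(X)=\overline{\{[V]\in\operatorname{Gr}(k,\mathbb{K}^{N+1}) : \mathbb{P}(V)\subset\langle R\rangle \text{ for some finite subscheme } R\subset X \text{ with } \dim_{\mathbb{K}} H^0(R,\mathcal{O}_R)\leq r\}}$, where $\langle R\rangle$ is the linear span of $R$. *)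

(* Defs.v *)
From HB Require Import structures.
From mathcomp Require Import all_boot all_order all_algebra.
From mathcomp Require Import mpoly.
Set Implicit Arguments.
Unset Strict Implicit.
Unset Printing Implicit Defensive.
Import GRing.Theory.
Local Open Scope ring_scope.

(* Conventions.
   - P^n = P(K^{n+1}); homogeneous coordinate ring S = K[x_0..x_n] = {mpoly K[n.+1]}.
   - P^N = P(K^{N+1}) with N+1 = #(monomials of degree d in n+1 variables);
     coordinates of K^{N+1} are indexed by the degree-d monomials (type [vidx n d]),
     and nu_d([p]) = [(p^alpha)_alpha].
   - A point [V] of Gr(2, K^{N+1}) is represented by a pair (u,v) of linearly
     independent vectors spanning V; Zariski topology on Gr(2,K^{N+1}) is induced by
     the Pluecker embedding (homogeneous polynomials in the Pluecker coordinates
     u_a v_b - u_b v_a, a b ranging over all pairs of indices).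
   - Finite subschemes R of P^n of length <= r are encoded by their saturated
     homogeneous ideals I with dim_K (S/I)_t <= r for every t; the linear span of
     nu_d(R) is the common zero set of the linear forms corresponding to I_d. *)

Section GrassmannCactus.
Variable K : fieldType.
Variables n d : nat.

Local Notation Poly := {mpoly K[n.+1]}.

Definition vidx := {m : 'X_{1..n.+1 < d.+1} | mdeg (bmnm m) == d}.

Definition vmon (a : vidx) : 'X_{1..n.+1} := bmnm (val a).

Local Notation Vec := (vidx -> K).

Definition veronese (p : 'I_n.+1 -> K) : Vec :=
  fun a => \prod_(i < n.+1) p i ^+ (vmon a i).

Local Notation plane := (Vec * Vec)%type.

Definition plane_ok (P : plane) : Prop :=
  forall a b : K, (forall x, a * P.1 x + b * P.2 x = 0) -> a = 0 /\ b = 0.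

Definition pidx := (vidx * vidx)%type.
Local Notation PlPoly := {mpoly K[#|{: pidx}|]}.

Definition pluecker (P : plane) : 'I_#|{: pidx}| -> K :=
  fun k => let ab := enum_val k in P.1 ab.1 * P.2 ab.2 - P.1 ab.2 * P.2 ab.1.

Definition gr_closure (S : plane -> Prop) (P : plane) : Prop :=
  plane_ok P /\
  forall (Q : PlPoly) (t : nat), Q \is t.-homog ->
    (forall P', S P' -> Q.@[pluecker P'] = 0) -> Q.@[pluecker P] = 0.

Definition gr_closed (Z : plane -> Prop) : Prop :=
  exists F : PlPoly -> Prop,
    (forall Q, F Q -> exists t, Q \is t.-homog) /\
    (forall P, Z P <-> plane_ok P /\ forall Q, F Q -> Q.@[pluecker P] = 0).

Definition gr_irreducible (Z : plane -> Prop) : Prop :=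
  (exists P, Z P) /\
  forall Z1 Z2, gr_closed Z1 -> gr_closed Z2 ->
    (forall P, Z P -> Z1 P \/ Z2 P) ->
    (forall P, Z P -> Z1 P) \/ (forall P, Z P -> Z2 P).

Definition in_span_points (r : nat) (p : 'I_r -> 'I_n.+1 -> K) (w : Vec) : Prop :=
  exists c : 'I_r -> K, forall x, w x = \sum_(j < r) c j * veronese (p j) x.

Definition secant_set (r : nat) (P : plane) : Prop :=
  plane_ok P /\
  exists p : 'I_r -> 'I_n.+1 -> K,
    (forall j, exists i, p j i != 0) /\
    in_span_points p P.1 /\ in_span_points p P.2.

Definition grassmann_secant (r : nat) : plane -> Prop :=
  gr_closure (secant_set r).

Definition hcomp (t : nat) (f : Poly) : Poly :=
  \sum_(m <- msupp f | mdeg m == t) f@_m *: 'X_[m].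

Definition is_ideal (I : Poly -> Prop) : Prop :=
  I 0 /\ (forall f g, I f -> I g -> I (f + g)) /\ (forall f g, I g -> I (f * g)).

Definition is_homogeneous_ideal (I : Poly -> Prop) : Prop :=
  is_ideal I /\ forall f t, I f -> I (hcomp t f).

Definition is_saturated (I : Poly -> Prop) : Prop :=
  forall f, (exists k, forall i : 'I_n.+1, I ('X_i ^+ k * f)) -> I f.

(* dim_K (S/I)_t <= r for all t *)
Definition hilbert_le (I : Poly -> Prop) (r : nat) : Prop :=
  forall (t : nat) (g : 'I_r.+1 -> Poly), (forall j, g j \is t.-homog) ->
    exists c : 'I_r.+1 -> K, (exists j, c j != 0) /\ I (\sum_(j < r.+1) c j *: g j).

Definition finite_scheme_ideal (r : nat) (I : Poly -> Prop) : Prop :=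
  is_homogeneous_ideal I /\ is_saturated I /\ hilbert_le I r.

(* w lies in the linear span of nu_d(R), R = Proj(S/I) *)
Definition in_span_scheme (I : Poly -> Prop) (w : Vec) : Prop :=
  forall f, I f -> f \is d.-homog -> \sum_(a : vidx) f@_(vmon a) * w a = 0.

Definition cactus_set (r : nat) (P : plane) : Prop :=
  plane_ok P /\
  exists I, finite_scheme_ideal r I /\ in_span_scheme I P.1 /\ in_span_scheme I P.2.

Definition grassmann_cactus (r : nat) : plane -> Prop :=
  gr_closure (cactus_set r).

End GrassmannCactus.

(* Main.v *)
Require Import Defs.
From HB Require Import structures.
From mathcomp Require Import all_boot all_order all_algebra all_field.
From mathcomp Require Import mpoly.
From mathcomp Require Import ring zify.
From Stdlib Require Import Classical ClassicalEpsilon.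
Set Implicit Arguments.
Unset Strict Implicit.
Unset Printing Implicit Defensive.
Import GRing.Theory.
Local Open Scope ring_scope.

(** Let [I] be the ideal of a finite scheme of length at most 10.  Dividing by a linear form
    that is a nonzerodivisor modulo [I], a pair of functionals [f_b] on the forms of degree [d]
    that kills [I] becomes [w |-> r X^w f_b], where [w] runs over words in the variables and
    the [X_i] are commuting matrices of size [m <= 10].  It is enough that such a pair is a
    limit of pairs of combinations of [m] common point evaluations, and this is proved by
    induction on [m].  If some [X_i] has two eigenvalues, the pair splits.  If a matrix [E] with
    [m tr(E^2) <> (tr E)^2] commutes with all generators but one, that generator plus [t E]
    has two eigenvalues for generic [t], and the pair is a limit of split ones.  What is left
    is a local algebra [(A, N)] with socle of dimension at most two.  There, according to
    the dimensions of the powers of [N], one finds such an [E], often of rank one, possibly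
    after a deformation of the multiplication; when [N^4 = 0] one also uses that the cubic and
    quadratic forms which occur are limits of simultaneous sums of powers.
    Irreducibility follows since two secant planes are joined by a rational curve of secant
    planes. *)

(** * Limits of point evaluations *)

(** The algebras of length at most 10 are not all limits of reduced ones: a general local algebra
    with Hilbert function (1, 4, 3) is not. So the scheme itself cannot be the object that is
    approximated. Restricting to the cyclic module generated by [r] and dividing by what both
    functionals kill replaces it by a smaller algebra; as there are only two functionals, its socle
    has dimension at most two, and this excludes the bad algebras. The condition
    [m tr(E^2) <> (tr E)^2] is chosen because it is polynomial: it fails when [E] has a single
    eigenvalue, and if [E] satisfies it, so does [X + t E] for all but finitely many [t]. The number
    10 enters through dimension counts. With at least three generators and [m <= 10] few Hilbert
    functions are left; and when [N^4 = 0] the points spent on the leading forms and on the rest add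
    up to at most [m], often exactly: [2 e + 2] for (1, e, e, 1), [4 + 5] for (1, 3, 4, 1), [4 + 6]
    for (1, 3, 4, 2). *)

Section Generic.
Variable K : closedFieldType.

Lemma poly_eq0 (q : {poly K}) : (forall t, q.[t] = 0) -> q = 0.
Proof.
(* An algebraically closed field is infinite. Here: [q + 1] takes only the value 1, so it has no
   root and must be a constant. *)
move=> q0; have nr : ~ exists x, root (q + 1) x.
  by case=> x; rewrite /root hornerD q0 add0r hornerC oner_eq0.
have /size_poly1P [c c0 qc] : size (q + 1) == 1.
  by apply: contraT => /closed_rootP /nr.
have : (q + 1).[0] = c by rewrite qc hornerC.
rewrite hornerD q0 hornerC add0r => c1; move: qc; rewrite -c1.
by move/(congr1 (fun p => p - 1)); rewrite addrK polyC1 subrr.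
Qed.

(** A one-parameter substitute for dense open sets: such predicates are closed under conjunction
    and, [K] being infinite, never empty. *)
Definition gen (P : K -> Prop) := exists2 g : {poly K}, g != 0 & forall t, g.[t] != 0 -> P t.

Lemma gen_all (P : K -> Prop) : (forall t, P t) -> gen P.
Proof. by move=> h; exists 1; rewrite ?oner_neq0. Qed.

Lemma gen_mono (P Q : K -> Prop) : (forall t, P t -> Q t) -> gen P -> gen Q.
Proof. by move=> h [g g0 gP]; exists g => // t /gP /h. Qed.

Lemma gen_and (P Q : K -> Prop) : gen P -> gen Q -> gen (fun t => P t /\ Q t).
Proof.
move=> [g g0 gP] [h h0 hQ]; exists (g * h); rewrite ?mulf_neq0 // => t.
by rewrite hornerM mulf_eq0 negb_or => /andP [/gP ? /hQ].
Qed.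

Lemma gen_ne (p : {poly K}) : p != 0 -> gen (fun t => p.[t] != 0).
Proof. by move=> p0; exists p. Qed.

Lemma gen_neC (c : K) : gen (fun t => t != c).
Proof.
exists ('X - c%:P); first by rewrite polyXsubC_eq0.
by move=> t; rewrite hornerXsubC subr_eq0.
Qed.

Lemma poly_neq0_ex (g : {poly K}) : g != 0 -> exists t, g.[t] != 0.
Proof.
move=> g0; have /closed_nonrootP [x nx] := g0; by exists x.
Qed.

Lemma gen_ex (P : K -> Prop) : gen P -> exists t, P t.
Proof. by move=> [g /poly_neq0_ex [t gt] gP]; exists t; apply: gP. Qed.

Lemma gen_bad (p : {poly K}) t0 : p.[t0] != 0 -> gen (fun t => p.[t] != 0).
Proof. by move=> h; apply: gen_ne; apply: contraNneq h => ->; rewrite horner0. Qed.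

Lemma poly_gen0 (p : {poly K}) : gen (fun t => p.[t] = 0) -> p = 0.
Proof.
move=> [g g0 gP]; suff /eqP : p * g = 0 by rewrite mulf_eq0 (negbTE g0) orbF => /eqP.
apply: poly_eq0 => t; rewrite hornerM; have [->|/gP ->] := eqVneq g.[t] 0.
  by rewrite mulr0.
by rewrite mul0r.
Qed.

Lemma gen_fin (T : finType) (P : T -> K -> Prop) : (forall x, gen (P x)) -> gen (fun t => forall x, P x t).
Proof.
move=> h.
have H (s : seq T) : gen (fun t => forall x, x \in s -> P x t).
  elim: s => [|x s IH]; first exact: gen_all.
  apply: gen_mono (gen_and (h x) IH) => t [h1 h2] y; rewrite inE => /orP [/eqP ->|] //; exact: h2.
by apply: gen_mono (H (enum T)) => t H1 x; apply: H1; rewrite mem_enum.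
Qed.

End Generic.

Section Closure.
Variable K : closedFieldType.

(** The coordinates are indexed by an arbitrary type, later by words, of which there are infinitely
    many; hence an inductive class instead of [mpoly]. [pf_ext] closes it under pointwise equality,
    which replaces function extensionality. *)
Inductive polyfun (I : Type) : ((I -> K) -> K) -> Prop :=
| pf_const c : polyfun (fun _ => c)
| pf_coord i : polyfun (fun Psi => Psi i)
| pf_add F G : polyfun F -> polyfun G -> polyfun (fun Psi => F Psi + G Psi)
| pf_mul F G : polyfun F -> polyfun G -> polyfun (fun Psi => F Psi * G Psi)
| pf_ext F G : polyfun F -> F =1 G -> polyfun G.

Lemma polyfun_eq (I : Type) (F : (I -> K) -> K) Psi Phi :
  polyfun F -> Psi =1 Phi -> F Psi = F Phi.
Proof.
move=> pF e; elim: pF => //= {F}.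
- by move=> F G _ -> _ ->.
- by move=> F G _ -> _ ->.
- by move=> F G _ h FG; rewrite -!FG.
Qed.

Lemma pf_sum (I : Type) (T : Type) (s : seq T) (F : T -> (I -> K) -> K) :
  (forall x, polyfun (F x)) -> polyfun (fun Psi => \sum_(x <- s) F x Psi).
Proof.
move=> h; elim: s => [|x s IH].
  by apply: (pf_ext (pf_const I 0)) => Psi; rewrite big_nil.
by apply: (pf_ext (pf_add (h x) IH)) => Psi; rewrite big_cons.
Qed.

Lemma pf_prod (I : Type) (T : Type) (s : seq T) (F : T -> (I -> K) -> K) :
  (forall x, polyfun (F x)) -> polyfun (fun Psi => \prod_(x <- s) F x Psi).
Proof.
move=> h; elim: s => [|x s IH].
  by apply: (pf_ext (pf_const I 1)) => Psi; rewrite big_nil.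
by apply: (pf_ext (pf_mul (h x) IH)) => Psi; rewrite big_cons.
Qed.

Lemma pf_comp (I J : Type) (F : (I -> K) -> K) (G : (J -> K) -> I -> K) :
  polyfun F -> (forall i, polyfun (fun Psi => G Psi i)) -> polyfun (fun Psi => F (G Psi)).
Proof.
move=> pF pG; elim: pF => {F}.
- by move=> c; apply: pf_const.
- exact: pG.
- by move=> F H _ ? _ ?; apply: pf_add.
- by move=> F H _ ? _ ?; apply: pf_mul.
- by move=> F H _ h FH; apply: (pf_ext h) => Psi.
Qed.

Lemma pf_poly (I : Type) (F : (I -> K) -> K) (P : I -> {poly K}) :
  polyfun F -> exists p : {poly K}, forall t, F (fun i => (P i).[t]) = p.[t].
Proof.
elim=> {F}.
- by move=> c; exists c%:P => t; rewrite hornerC.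
- by move=> i; exists (P i).
- by move=> F G _ [p hp] _ [q hq]; exists (p + q) => t; rewrite hornerD hp hq.
- by move=> F G _ [p hp] _ [q hq]; exists (p * q) => t; rewrite hornerM hp hq.
- by move=> F G _ [p hp] FG; exists p => t; rewrite -FG.
Qed.

(** Zariski closure, in a possibly infinite-dimensional affine space. *)
Definition zcl (I : Type) (S : (I -> K) -> Prop) (Phi : I -> K) :=
  forall F, polyfun F -> (forall Psi, S Psi -> F Psi = 0) -> F Phi = 0.

Lemma zcl_sub (I : Type) (S : (I -> K) -> Prop) Phi : S Phi -> zcl S Phi.
Proof. by move=> h F _; apply. Qed.

Lemma zcl_ext (I : Type) (S : (I -> K) -> Prop) Phi Psi : Phi =1 Psi -> zcl S Phi -> zcl S Psi.
Proof. by move=> e h F pF FS; rewrite -(polyfun_eq pF e); apply: h. Qed.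

Lemma zcl_map (I J : Type) (S : (I -> K) -> Prop) (T : (J -> K) -> Prop)
    (G : (I -> K) -> J -> K) Phi :
  (forall j, polyfun (fun Psi => G Psi j)) -> (forall Psi, S Psi -> zcl T (G Psi)) ->
  zcl S Phi -> zcl T (G Phi).
Proof.
move=> pG GS hP F pF FT; apply: (hP (fun Psi => F (G Psi))); first exact: pf_comp.
by move=> Psi /GS; apply.
Qed.

(** An equation of [S] restricted to the curve is a polynomial in [t] that vanishes for all but
    finitely many [t], hence also at [t0]. Most limits below are taken in this way. *)
Lemma zcl_lim (I : Type) (S : (I -> K) -> Prop) (P : I -> {poly K}) t0 :
  gen (fun t => zcl S (fun i => (P i).[t])) -> zcl S (fun i => (P i).[t0]).
Proof.
move=> h F pF FS; have [p hp] := pf_poly P pF; rewrite hp.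
suff -> : p = 0 by rewrite horner0.
by apply: poly_gen0; apply: gen_mono h => t; rewrite -hp; apply.
Qed.

End Closure.

Section Good.
Variable K : closedFieldType.

Definition zsum (J : Type) (m : nat) (Phi : bool * seq J -> K) :=
  exists (c : 'I_m -> bool -> K) (y : 'I_m -> J -> K),
    forall b w, Phi (b, w) = \sum_(j < m) c j b * \prod_(i <- w) y j i.

(* The pair [w |-> Phi (b, w)], b : bool, of functionals on words is a limit of pairs of
   combinations of the same [m] points [w |-> \prod_(i <- w) y i]. *)
Definition good (J : Type) (m : nat) := zcl (@zsum J m).

Lemma good_ext J m (Phi Psi : bool * seq J -> K) :
  (forall b w, Phi (b, w) = Psi (b, w)) -> good m Phi -> good m Psi.
Proof. by move=> e; apply: zcl_ext => -[b w]. Qed.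

Lemma good_lim J m (P : bool * seq J -> {poly K}) t0 :
  gen (fun t => good m (fun i => (P i).[t])) -> good m (fun i => (P i).[t0]).
Proof. exact: zcl_lim. Qed.

Lemma zsum_add J m1 m2 (Phi Psi : bool * seq J -> K) :
  zsum m1 Phi -> zsum m2 Psi -> zsum (m1 + m2) (fun i => Phi i + Psi i).
Proof.
move=> [c [y h]] [c' [y' h']].
exists (fun j => match split j with inl i => c i | inr i => c' i end),
  (fun j => match split j with inl i => y i | inr i => y' i end) => b w.
rewrite big_split_ord /= h h'; congr (_ + _); apply: eq_bigr => j _.
  by rewrite (unsplitK (inl j)).
by rewrite (unsplitK (inr j)).
Qed.

Lemma good_add J m1 m2 (Phi Psi : bool * seq J -> K) :
  good m1 Phi -> good m2 Psi -> good (m1 + m2) (fun i => Phi i + Psi i).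
Proof.
move=> h1; apply: (@zcl_map _ _ _ _ _ (fun Psi i => Phi i + Psi i)) => [i|Psi' s2].
  by apply: pf_add; [exact: pf_const | exact: pf_coord].
move: h1; apply: (@zcl_map _ _ _ _ _ (fun Phi i => Phi i + Psi' i)) => [i|Phi' s1].
  by apply: pf_add; [exact: pf_coord | exact: pf_const].
by apply: zcl_sub; apply: zsum_add.
Qed.

Lemma good0 J m : good m (fun _ : bool * seq J => 0).
Proof.
apply: zcl_sub; exists (fun _ _ => 0), (fun _ _ => 0) => b w.
by rewrite big1 // => j _; rewrite mul0r.
Qed.

Lemma good_leq J m m' (Phi : bool * seq J -> K) : (m <= m')%N -> good m Phi -> good m' Phi.
Proof.
move=> /subnKC <- h; apply: (good_ext _ (good_add h (@good0 J (m' - m)))) => b w.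
by rewrite addr0.
Qed.

(** A linear map that sends every one-point pair to a one-point pair preserves [zsum m], hence its
    closure. Substitution of letters and mixing of the two functionals are the two instances
    used. *)
Lemma good_lin J J' m (T : bool * seq J' -> seq (K * (bool * seq J))) (Phi : bool * seq J -> K) :
  (forall (c : bool -> K) (y : J -> K), exists cy : (bool -> K) * (J' -> K), forall b w,
     \sum_(x <- T (b, w)) x.1 * (c x.2.1 * \prod_(i <- x.2.2) y i) = cy.1 b * \prod_(i <- w) cy.2 i) ->
  good m Phi -> good m (fun i => \sum_(x <- T i) x.1 * Phi x.2).
Proof.
move=> h; apply: (@zcl_map _ _ _ _ _ (fun Phi i => \sum_(x <- T i) x.1 * Phi x.2)) => [i|Psi [c [y hs]]].
  by apply: pf_sum => x; apply: pf_mul; [exact: pf_const | exact: pf_coord].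
have /fin_all_exists [cy hcy] : forall j, exists cy : (bool -> K) * (J' -> K), forall b w,
     \sum_(x <- T (b, w)) x.1 * (c j x.2.1 * \prod_(i <- x.2.2) y j i) = cy.1 b * \prod_(i <- w) cy.2 i.
  by move=> j; apply: h.
apply: zcl_sub; exists (fun j => (cy j).1), (fun j => (cy j).2) => b w.
under [RHS]eq_bigr => j _ do rewrite -hcy.
rewrite exchange_big /=; apply: eq_bigr => -[a [b' w']] _ /=.
by rewrite hs mulr_sumr.
Qed.

End Good.

Section Words.
Variables (K : fieldType) (J J' : Type).

(** A polynomial in the letters of [J] is a list of pairs of a coefficient and a word. *)
Definition peval (A : comAlgType K) (y : J -> A) (l : seq (K * seq J)) : A :=
  \sum_(x <- l) x.1 *: \prod_(i <- x.2) y i.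

Definition pmulw (l l' : seq (K * seq J)) : seq (K * seq J) :=
  [seq (x.1 * y.1, x.2 ++ y.2) | x <- l, y <- l'].

Lemma peval_cat (A : comAlgType K) (y : J -> A) l l' : peval y (l ++ l') = peval y l + peval y l'.
Proof. by rewrite /peval big_cat. Qed.

Lemma peval_mul (A : comAlgType K) (y : J -> A) l l' : peval y (pmulw l l') = peval y l * peval y l'.
Proof.
rewrite /peval /pmulw big_allpairs_dep /= mulr_suml; apply: eq_bigr => x _.
rewrite mulr_sumr; apply: eq_bigr => z _ /=.
by rewrite big_cat /= -scalerAl -scalerAr scalerA.
Qed.

Fixpoint expandw (s : J' -> seq (K * seq J)) (w : seq J') : seq (K * seq J) :=
  if w is j :: w' then pmulw (s j) (expandw s w') else [:: (1, [::])].

Lemma peval_expandw (A : comAlgType K) (y : J -> A) s w :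
  peval y (expandw s w) = \prod_(j <- w) peval y (s j).
Proof.
elim: w => [|j w IH] /=; first by rewrite big_nil /peval big_seq1 big_nil scale1r.
by rewrite peval_mul IH big_cons.
Qed.

End Words.

Section GoodSubst.
Variable K : closedFieldType.

(** Replacing each letter by a polynomial in other letters moves the points by a polynomial map and
    keeps their number and their coefficients. *)
Lemma good_subst J J' m (s : J' -> seq (K * seq J)) (Phi : bool * seq J -> K) :
  good m Phi ->
  good m (fun i : bool * seq J' => \sum_(x <- expandw s i.2) x.1 * Phi (i.1, x.2)).
Proof.
move=> h.
apply: (good_ext _ (@good_lin K J J' m (fun i => [seq (x.1, (i.1, x.2)) | x <- expandw s i.2]) Phi _ h)).
  by move=> b w; rewrite big_map.
move=> c y; exists (c, fun j => peval (y : J -> K^o) (s j)) => b w /=.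
rewrite big_map -(peval_expandw (y : J -> K^o)) /peval mulr_sumr /=.
by apply: eq_bigr => x _; rewrite mulrCA.
Qed.

(** Multiplying by polynomials before applying the functionals, and mixing these, changes only the
    coefficients: each new one is a combination of the old ones at the same point. *)
Lemma good_mix J m (u : bool -> seq (K * (bool * seq J))) (Phi : bool * seq J -> K) :
  good m Phi ->
  good m (fun i : bool * seq J => \sum_(x <- u i.1) x.1 * Phi (x.2.1, x.2.2 ++ i.2)).
Proof.
move=> h.
apply: (good_ext _ (@good_lin K J J m (fun i => [seq (x.1, (x.2.1, x.2.2 ++ i.2)) | x <- u i.1]) Phi _ h)).
  by move=> b w; rewrite big_map.
move=> c y; exists (fun b => \sum_(x <- u b) x.1 * (c x.2.1 * \prod_(i <- x.2.2) y i), y) => b w /=.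
rewrite big_map mulr_suml; apply: eq_bigr => x _ /=.
by rewrite big_cat /= !mulrA.
Qed.

End GoodSubst.

(** * Commuting matrices *)

Section MatWords.
Variables (R : comNzRingType) (J : Type).

Definition mword m (X : J -> 'M[R]_m) (w : seq J) : 'M[R]_m := foldr (fun j M => X j *m M) 1%:M w.

Definition matfam m (X : J -> 'M[R]_m) (r : 'rV[R]_m) (f : bool -> 'cV[R]_m) (i : bool * seq J) : R :=
  (r *m mword X i.2 *m f i.1) 0 0.

Lemma mword_comm m (X : J -> 'M[R]_m) (E : 'M[R]_m) w :
  (forall j, X j *m E = E *m X j) -> mword X w *m E = E *m mword X w.
Proof.
move=> h; elim: w => [|j w IH] /=; first by rewrite mul1mx mulmx1.
by rewrite -mulmxA IH !mulmxA h.
Qed.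

Lemma mword_cat m (X : J -> 'M[R]_m) w w' : mword X (w ++ w') = mword X w *m mword X w'.
Proof. by elim: w => [|j w IH] /=; rewrite ?mul1mx // IH mulmxA. Qed.

Lemma mword_intertwine m p (X : J -> 'M[R]_m) (X' : J -> 'M[R]_p) (D : 'M_(m, p)) w :
  (forall j, X j *m D = D *m X' j) -> mword X w *m D = D *m mword X' w.
Proof.
move=> h; elim: w => [|j w IH] /=; first by rewrite mul1mx mulmx1.
by rewrite -mulmxA IH !mulmxA h.
Qed.

End MatWords.

Section CM.
Variable K : closedFieldType.

Definition CM m := forall (J : Type) (X : J -> 'M[K]_m) r f,
  (forall i j, X i *m X j = X j *m X i) -> good m (matfam X r f).

Lemma CM0 : CM 0.
Proof.
move=> J X r f _; apply: (good_ext _ (@good0 K J 0)) => b w.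
by rewrite /matfam /= [r *m _]thinmx0 mul0mx mxE.
Qed.

(** Only the vectors [r X^w] matter, and they stay in [U]; so the matrices may be replaced by their
    restrictions to [U]. *)
Lemma good_restrict J m k (X : J -> 'M[K]_m) r f (U : 'M_(k, m)) :
  (forall i j, X i *m X j = X j *m X i) -> CM (\rank U) ->
  (r <= U)%MS -> (forall j, U *m X j <= U)%MS -> good (\rank U) (matfam X r f).
Proof.
move=> cX cU rU sU; pose B := row_base U; pose X' j := B *m X j *m pinvmx B.
have XB j : X' j *m B = B *m X j.
  apply: mulmxKpV; rewrite (eqmxMr _ (eq_row_base U)) eq_row_base; exact: sU.
have rB : r *m pinvmx B *m B = r by apply: mulmxKpV; rewrite eq_row_base.
have Bf : row_free B by exact: row_base_free.
apply: (good_ext _ (cU J X' (r *m pinvmx B) (fun b => B *m f b) _)) => [b w|i j].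
  rewrite /matfam /=; congr ((_ : 'M_1) 0 0).
  by rewrite mulmxA -(mulmxA _ _ B) (mword_intertwine w XB) mulmxA rB.
by apply: (row_free_inj Bf) => /=; rewrite -mulmxA XB mulmxA XB -mulmxA cX mulmxA -XB -mulmxA -XB mulmxA.
Qed.

(** Dual to [good_restrict]: everything descends to the quotient by [U]. The quotient is realised by
    the transposes acting on the kernel of [U^T]. *)
Lemma good_corestrict J m k (X : J -> 'M[K]_m) r f (U : 'M_(k, m)) :
  (forall i j, X i *m X j = X j *m X i) -> CM (m - \rank U) ->
  (forall b, U *m f b = 0) -> (forall j, U *m X j <= U)%MS -> good (m - \rank U) (matfam X r f).
Proof.
move=> cX cU fU sU; pose B := row_base (kermx U^T).
have rB : \rank (kermx U^T) = (m - \rank U)%N by rewrite mxrank_ker mxrank_tr.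
rewrite -rB in cU *.
pose X' j := (B *m (X j)^T *m pinvmx B)^T.
have XB j : X j *m B^T = B^T *m X' j.
  apply: trmx_inj; rewrite !trmx_mul !trmxK; symmetry; apply: mulmxKpV.
  rewrite (eqmxMr _ (eq_row_base _)) eq_row_base; apply/sub_kermxP.
  have /submxP [Z hZ] := sU j.
  by rewrite -mulmxA -trmx_mul hZ trmx_mul mulmxA mulmx_ker mul0mx.
clearbody X'.
have fB b : B^T *m ((f b)^T *m pinvmx B)^T = f b.
  apply: trmx_inj; rewrite trmx_mul !trmxK; apply: mulmxKpV; rewrite eq_row_base.
  by apply/sub_kermxP; rewrite -trmx_mul fU trmx0.
have Bf : row_free B by exact: row_base_free.
apply: (good_ext _ (cU J X' (r *m B^T) (fun b => ((f b)^T *m pinvmx B)^T) _)) => [b w|i j].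
  rewrite /matfam /=; congr ((_ : 'M_1) 0 0).
  by rewrite -(mulmxA r) -(mword_intertwine w XB) -!mulmxA fB.
clearbody B; apply: trmx_inj; apply: (row_free_inj Bf); apply: trmx_inj.
rewrite /= !trmx_mul !trmxK.
have e i' j' : B^T *m (X' i' *m X' j') = X i' *m X j' *m B^T.
  by rewrite mulmxA -XB -[LHS]mulmxA -XB mulmxA.
by rewrite !e cX.
Qed.

Lemma good_split J m (X : J -> 'M[K]_m) r f (U V : 'M_m) :
  (forall k, (k < m)%N -> CM k) ->
  (forall i j, X i *m X j = X j *m X i) ->
  (forall j, U *m X j <= U)%MS -> (forall j, V *m X j <= V)%MS ->
  row_full (U + V)%MS -> (\rank U + \rank V <= m)%N -> (\rank U < m)%N -> (\rank V < m)%N ->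
  good m (matfam X r f).
Proof.
move=> IH cX sU sV full rUV rU rV.
have /sub_addsmxP [[u v] /= ruv] := submx_full r full.
apply: (good_leq rUV).
have gU := good_restrict (r := u *m U) f cX (IH _ rU) (submxMl _ _) sU.
have gV := good_restrict (r := v *m V) f cX (IH _ rV) (submxMl _ _) sV.
apply: (good_ext _ (good_add gU gV)) => b w.
by rewrite /matfam /= ruv !mulmxDl [RHS]mxE.
Qed.

End CM.

(** * Matrices with two eigenvalues *)

Section Nonlocal.
Variable K : closedFieldType.

(** Factor the characteristic polynomial as [q * ('X - l) ^ k] with [q] prime to ['X - l]. The
    kernels of the two factors are complementary and stable under whatever commutes with [Y]. An
    eigenvector for [l] is not killed by [q], and by hypothesis the other kernel is not
    everything. *)
Lemma split_nonlocal n (Y : 'M[K]_n.+1) :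
  (forall l, (Y - l%:M) ^+ n.+1 != 0) ->
  exists U V : 'M_n.+1, [/\ row_full (U + V)%MS, (\rank U + \rank V <= n.+1)%N,
    (\rank U < n.+1)%N, (\rank V < n.+1)%N
    & forall Z, Z *m Y = Y *m Z -> (U *m Z <= U)%MS /\ (V *m Z <= V)%MS].
Proof.
move=> nl; pose p := char_poly Y.
have p0 : p != 0 by rewrite monic_neq0 ?char_poly_monic.
have [l rl] : exists l, root p l.
  by apply/closed_rootP; rewrite size_char_poly.
case: (multiplicity_XsubC p l) => k [q]; rewrite p0 /= => nq pq.
have cop : coprimep q (('X - l%:P) ^+ k).
  by rewrite coprimep_expr // coprimep_XsubC.
have k1 : (k <= n.+1)%N.
  have := size_char_poly Y; rewrite -/p pq size_proper_mul; last first.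
    by rewrite (monicP (monic_exp _ (monicXsubC _))) mulr1 lead_coef_eq0;
       apply: contraNneq nq => ->; rewrite root0.
  have q0 : (0 < size q)%N by rewrite size_poly_gt0; apply: contraNneq nq => ->; rewrite root0.
  by rewrite size_exp_XsubC; move: q0; lia.
exists (kermxpoly Y q), (kermxpoly Y (('X - l%:P) ^+ k)).
have full : row_full (kermxpoly Y q + kermxpoly Y (('X - l%:P) ^+ k))%MS.
  by rewrite -sub1mx -(kermxpolyM Y cop) -pq (kermxpoly_min (mxminpoly_dvd_char Y)).
split=> //.
- rewrite -mxrank_sum_cap (mxdirect_kermxpoly _ cop) mxrank0 addn0; exact: rank_leq_col.
- rewrite ltn_neqAle rank_leq_row andbT; apply/negP => rf.
  have /eigenvalueP [v vY v0] : eigenvalue Y l by rewrite eigenvalue_root_char.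
  have : (v <= kermxpoly Y q)%MS by apply: submx_full.
  move=> /sub_kermxP; rewrite (_ : v *m horner_mx Y q = q.[l] *: v).
    by move/eqP; rewrite scaler_eq0 (negbTE v0) orbF; apply/negP.
  elim/poly_ind: q {pq nq cop k1 full rf} => [|q c IH]; first by rewrite rmorph0 mulmx0 horner0 scale0r.
  rewrite rmorphD rmorphM /= horner_mx_X horner_mx_C mulmxDr mulmxA IH -scalemxAl vY hornerMXaddC.
  by rewrite scalerA mul_mx_scalar scalerDl.
- rewrite ltn_neqAle rank_leq_row andbT; apply/negP => rf.
  have : (1%:M <= kermxpoly Y (('X - l%:P) ^+ k))%MS by apply: submx_full.
  move=> /sub_kermxP; rewrite mul1mx rmorphXn rmorphB /= horner_mx_X horner_mx_C => h.
  have /eqP [] := nl l.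
  have -> : (Y - l%:M) ^+ n.+1 = (Y - l%:M) ^+ k * (Y - l%:M) ^+ (n.+1 - k) by rewrite -exprD subnKC.
  by rewrite h mul0r.
- by move=> Z ZY; split; apply: comm_mx_stable_kermxpoly; exact: esym.
Qed.

Lemma mxtrace_nil n (Y : 'M[K]_n.+1) k : Y ^+ k = 0 -> \tr Y = 0.
Proof.
move=> Yk; have [s cs] := closed_field_poly_normal (char_poly Y).
rewrite (monicP (char_poly_monic Y)) scale1r in cs.
have s0 z : z \in s -> z = 0.
  move=> zs; have /eigenvalueP [v vY v0] : eigenvalue Y z.
    by rewrite eigenvalue_root_char cs root_prod_XsubC.
  have : v *m (Y ^+ k) = z ^+ k *: v.
    elim: k {Yk} => [|k IH]; first by rewrite expr0 mulmx1 expr0 scale1r.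
    by rewrite exprS mulmxA vY -scalemxAl IH scalerA -exprS.
  rewrite Yk mulmx0 => /esym /eqP; rewrite scaler_eq0 (negbTE v0) orbF expf_eq0.
  by case/andP => _ /eqP.
have ct : char_poly Y = 'X^(size s).
  rewrite cs big_seq (eq_bigr (fun _ => 'X)) => [|z /s0 ->]; last by rewrite subr0.
  by rewrite -big_seq big_const_seq count_predT; elim: (size s) => //= m ->; rewrite exprS.
have := @char_poly_trace _ _ Y isT; rewrite ct coefXn.
have := size_char_poly Y; rewrite ct size_polyXn => -[->].
by rewrite ltn_eqF //= => /esym /eqP; rewrite oppr_eq0 => /eqP.
Qed.

(** If [Y] were [l] plus a nilpotent, then [tr Y = m l] and [tr (Y Y) = m l^2], with [m] the size,
    since nilpotent matrices have trace 0. *)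
Lemma trace_nonlocal n (Y : 'M[K]_n.+1) :
  n.+1%:R * \tr (Y *m Y) != (\tr Y) ^+ 2 -> forall l, (Y - l%:M) ^+ n.+1 != 0.
Proof.
move=> h l; apply: contraNneq h => nil; set Z := Y - l%:M in nil.
have tZ := mxtrace_nil nil.
have tZ2 : \tr (Z *m Z) = 0.
  by apply: (@mxtrace_nil _ _ n.+1); rewrite -[Z *m Z]/(Z * Z) -expr2 -exprM mulnC exprM nil expr0n.
have -> : Y = Z + l%:M by rewrite subrK.
move: Z {nil} tZ tZ2 => Z tZ tZ2.
rewrite mulmxDl !mulmxDr !mul_mx_scalar !mul_scalar_mx !mxtraceD !mxtraceZ tZ tZ2 !mxtrace_scalar.
apply/eqP; move: (n.+1) => k; by rewrite -(mulr_natl l); ring.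
Qed.

Lemma good_nonlocal J m (X : J -> 'M[K]_m) r f j0 :
  (forall k, (k < m)%N -> CM K k) -> (forall i j, X i *m X j = X j *m X i) ->
  m%:R * \tr (X j0 *m X j0) != (\tr (X j0)) ^+ 2 -> good m (matfam X r f).
Proof.
case: m X r f => [|n] X r f IH cX h; first by apply: CM0.
have [U [V [full rUV rU rV st]]] := split_nonlocal (trace_nonlocal h).
by apply: (good_split r f IH cX _ _ full rUV rU rV) => j; have [? ?] := st (X j) (cX _ _).
Qed.

Lemma matfam_poly J m (X : J -> 'M[{poly K}]_m) (r : 'rV[{poly K}]_m) f i t :
  (matfam X r f i).[t] = matfam (fun j => map_mx (horner_eval t) (X j)) (map_mx (horner_eval t) r)
     (fun b => map_mx (horner_eval t) (f b)) i.
Proof.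
rewrite /matfam; set w := i.2.
have -> : mword (fun j => map_mx (horner_eval t) (X j)) w = map_mx (horner_eval t) (mword X w).
  elim: w => [|j w IH] /=; first by rewrite map_mx1.
  by rewrite IH map_mxM.
by rewrite -!map_mxM [RHS]mxE.
Qed.

Lemma map_polyC_eval p q (A : 'M[K]_(p, q)) t : map_mx (horner_eval t) (map_mx polyC A) = A.
Proof. by apply/matrixP => i j; rewrite !mxE /horner_eval hornerC. Qed.

(** Only the generator [None] is moved, along [E]; the family stays commuting because [E] commutes
    with all the others. *)
Lemma good_deform_one J m (X : option J -> 'M[K]_m) (E : 'M[K]_m) r f :
  (forall k, (k < m)%N -> CM K k) -> (forall i j, X i *m X j = X j *m X i) ->
  (forall j, E *m X (Some j) = X (Some j) *m E) ->
  m%:R * \tr (E *m E) != (\tr E) ^+ 2 -> good m (matfam X r f).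
Proof.
move=> IH cX cE h.
pose XP j := map_mx polyC (X j) + (if j is None then 'X else 0) *: map_mx polyC E.
pose P i := matfam XP (map_mx polyC r) (fun b => map_mx polyC (f b)) i.
pose Xt t j := X j + (if j is None then t else 0) *: E.
have PE t b w : (P (b, w)).[t] = matfam (Xt t) r f (b, w).
  rewrite /P matfam_poly; rewrite /matfam map_polyC_eval /= map_polyC_eval.
  congr ((_ *m _ *m _) 0 0); elim: w => //= j w ->; congr (_ *m _).
  apply/matrixP => i k; rewrite /XP /Xt !mxE /horner_eval hornerD hornerM !hornerC.
  by case: j => [j|]; rewrite ?horner0 ?hornerX.
have X0 : good m (fun i => (P i).[0]) -> good m (matfam X r f).
  apply: good_ext => b w; rewrite PE /matfam; congr ((_ *m _ *m _) 0 0).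
  elim: w => //= j w ->; congr (_ *m _); rewrite /Xt; case: j => [j|]; by rewrite scale0r addr0.
apply: X0; apply: good_lim.
(* The value of [q] at [t] is the difference of the two sides of the trace condition for
   [X None + t E]; its coefficient of ['X^2] is this difference for [E], hence nonzero. *)
pose q : {poly K} := (m%:R * \tr (E *m E) - (\tr E) ^+ 2) *: 'X^2
  + (m%:R * (\tr (X None *m E) + \tr (E *m X None)) - 2%:R * (\tr (X None) * \tr E)) *: 'X
  + (m%:R * \tr (X None *m X None) - \tr (X None) ^+ 2)%:P.
have q0 : q != 0.
  have : q`_2 != 0.
    by rewrite /q !coefD !coefZ coefXn coefX coefC /= !mulr0 !addr0 mulr1 subr_eq0.
  by apply: contraNneq => ->; rewrite coef0.
exists q => // t qt.
apply: (good_ext (fun b w => esym (PE t b w))).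
apply: (@good_nonlocal _ _ _ _ _ None) => // [[i|] [j|]|].
- by rewrite /Xt !scale0r !addr0.
- rewrite /Xt !scale0r !addr0 mulmxDl mulmxDr cX; congr (_ + _).
  by rewrite -scalemxAl -scalemxAr cE.
- rewrite /Xt !scale0r !addr0 mulmxDl mulmxDr cX; congr (_ + _).
  by rewrite -scalemxAl -scalemxAr cE.
- by [].
rewrite -subr_eq0 /Xt; move: qt; apply: contraNneq => <-; apply/eqP.
rewrite /q !hornerD !hornerZ !hornerXn hornerX hornerC.
rewrite mulmxDl !mulmxDr -!scalemxAl -!scalemxAr scalerA !mxtraceD !mxtraceZ.
by ring.
Qed.

End Nonlocal.

(** * Finite-dimensional commutative algebras *)

(* The carrier is fixed, so that a deformation only changes the multiplication. *)
Record calg (K : fieldType) (m : nat) := Calg {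
  cmul : 'rV[K]_m -> 'rV[K]_m -> 'rV[K]_m;
  cone : 'rV[K]_m;
  cmulA : associative cmul;
  cmulC : commutative cmul;
  cmul1 : left_id cone cmul;
  cmulDl : left_distributive cmul +%R;
  cmulZ : forall k u v, k *: cmul u v = cmul (k *: u) v;
  cone0 : cone != 0 }.

Definition car (K : fieldType) m (A : calg K m) := 'rV[K]_m.

HB.instance Definition _ (K : fieldType) m (A : calg K m) := Vector.on (car A).
HB.instance Definition _ (K : fieldType) m (A : calg K m) :=
  GRing.Zmodule_isComNzRing.Build (car A) (@cmulA K m A) (@cmulC K m A) (@cmul1 K m A)
    (@cmulDl K m A) (@cone0 K m A).
HB.instance Definition _ (K : fieldType) m (A : calg K m) :=
  GRing.Lmodule_isLalgebra.Build K (car A) (@cmulZ K m A).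
HB.instance Definition _ (K : fieldType) m (A : calg K m) :=
  GRing.Lalgebra_isComAlgebra.Build K (car A).
HB.instance Definition _ (K : fieldType) m (A : calg K m) :=
  Algebra_isFalgebra.Build K (car A).

Section Functionals.
Variables (K : fieldType) (m : nat).
Implicit Types u v : 'rV[K]_m.

Definition pr (l : 'cV[K]_m) (u : 'rV[K]_m) : K := (u *m l) 0 0.

Lemma prD l u v : pr l (u + v) = pr l u + pr l v.
Proof. by rewrite /pr mulmxDl mxE. Qed.
Lemma prZ l a u : pr l (a *: u) = a * pr l u.
Proof. by rewrite /pr -scalemxAl mxE. Qed.
Lemma pr0 l : pr l 0 = 0.
Proof. by rewrite /pr mul0mx mxE. Qed.
Lemma prN l u : pr l (- u) = - pr l u.
Proof. by rewrite -scaleN1r prZ mulN1r. Qed.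
Lemma pr_sum l (I : Type) (s : seq I) (F : I -> 'rV[K]_m) : pr l (\sum_(i <- s) F i) = \sum_(i <- s) pr l (F i).
Proof. by elim: s => [|i s IH]; rewrite ?big_nil ?pr0 // !big_cons prD IH. Qed.

End Functionals.

Section Calg.
Variable K : fieldType.
Variables (m : nat) (A : calg K m).
Implicit Types (u v : car A) (U V : {vspace car A}).

Definition lmx (u : car A) : 'M[K]_m := \matrix_(i < m) ((delta_mx 0 i : car A) * u : car A).

Lemma mul_lmx (v u : car A) : (v : 'rV_m) *m lmx u = v * u.
Proof.
rewrite [X in _ = X * u]row_sum_delta mulr_suml mulmx_sum_row; apply: eq_bigr => i _.
rewrite rowK; exact: (@scalerAl K (car A)).
Qed.

Lemma lmx_comm u v : lmx u *m lmx v = lmx v *m lmx u.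
Proof.
apply/row_matrixP => i; rewrite !rowE !mulmxA.
by rewrite !(mul_lmx (delta_mx 0 i)) !mul_lmx mulrAC.
Qed.

Lemma mword_lmx J (x : J -> car A) w (v : car A) :
  (v : 'rV_m) *m mword (fun j => lmx (x j)) w = v * \prod_(j <- w) x j.
Proof.
elim: w v => [|j w IH] v /=; first by rewrite big_nil mulr1 mulmx1.
by rewrite mulmxA mul_lmx IH big_cons mulrA.
Qed.

Definition algfam J (x : J -> car A) (f : bool -> 'cV[K]_m) (i : bool * seq J) : K :=
  pr (f i.1) (\prod_(j <- i.2) x j : car A).

Lemma algfam_mat J (x : J -> car A) f b w :
  algfam x f (b, w) = matfam (fun j => lmx (x j)) (1 : car A) f (b, w).
Proof. by rewrite /algfam /matfam mword_lmx mul1r. Qed.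

(** The difference of [u] and its projection to [U] has a nonzero coordinate; the same coordinate of
    [v - projv U v], rescaled, is the functional. *)
Lemma pr_sep U (u : car A) : u \notin U -> exists l, pr l u = 1 /\ forall v, v \in U -> pr l v = 0.
Proof.
move=> nu; pose w := (u - projv U u).
have w0 : w != 0.
  by rewrite subr_eq0; apply: contraNneq nu => ->; apply: memv_proj.
have [i wi] : exists i, w 0 i != 0.
  case: (pickP (fun i => w 0 i != 0)) => [i wi|h]; first by exists i.
  by case/eqP: w0; apply/rowP => j; rewrite [RHS]mxE; have /negbFE /eqP := h j.
pose g := (\1 - projv U)%VF : 'End(car A).
exists (\col_j ((w 0 i)^-1 * (g (delta_mx 0 j : car A) : 'rV_m) 0 i)).
have E v : pr (\col_j ((w 0 i)^-1 * (g (delta_mx 0 j : car A) : 'rV_m) 0 i)) v = (w 0 i)^-1 * (g v : 'rV_m) 0 i.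
  rewrite /pr [X in g X](row_sum_delta v) linear_sum /= summxE mulr_sumr mxE; apply: eq_bigr => j _.
  by rewrite linearZ /= !mxE mulrCA.
have gE v : g v = v - projv U v by rewrite /g add_lfunE opp_lfunE id_lfunE.
split=> [|v vU]; rewrite E gE; first by rewrite -/w mulVf.
by rewrite projv_id // subrr [X in _ * X]mxE mulr0.
Qed.

Lemma prodv_ind (U V : {vspace car A}) (P : car A -> Prop) :
  P 0 -> (forall u v, P u -> P v -> P (u + v)) -> (forall k u, P u -> P (k *: u)) ->
  (forall u v, u \in U -> v \in V -> P (u * v)) -> forall w, w \in (U * V)%VS -> P w.
Proof.
move=> P0 PD PZ PM w; rewrite /prodv unlock /=.
have : forall x, x \in [seq u * v | u <- vbasis U, v <- vbasis V] -> P x.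
  by move=> x /allpairsP [[a b] /= [ha hb ->]]; apply: PM; apply: vbasis_mem.
elim: [seq u * v | u <- vbasis U, v <- vbasis V] w => [|x s IH] w h; first by rewrite span_nil memv0 => /eqP ->.
rewrite span_cons => /memv_addP [a /vlineP [k ->] [b bs ->]]; apply: PD.
  by apply: PZ; apply: h; rewrite mem_head.
by apply: IH bs => y ys; apply: h; rewrite inE ys orbT.
Qed.

Lemma prodvC U V : (U * V = V * U)%VS.
Proof.
by apply/eqP; rewrite eqEsubv; apply/andP; split; apply/prodvP => u v uU vV; rewrite mulrC memv_mul.
Qed.

Lemma agenv_peval U J (y : J -> car A) :
  (forall u, u \in U -> exists l, u = peval y l) ->
  forall u, u \in agenv U -> exists l, u = peval y l.
Proof.
move=> hU.
have P0 : exists l, 0 = peval y l by exists [::]; rewrite /peval big_nil.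
have PD u v : (exists l, u = peval y l) -> (exists l, v = peval y l) -> exists l, u + v = peval y l.
  by move=> [l ->] [l' ->]; exists (l ++ l'); rewrite peval_cat.
have P1 : exists l, 1 = peval y l.
  by exists [:: (1, [::])]; rewrite /peval big_seq1 big_nil scale1r.
have PM u v : (exists l, u = peval y l) -> (exists l, v = peval y l) -> exists l, u * v = peval y l.
  by move=> [l ->] [l' ->]; exists (pmulw l l'); rewrite peval_mul.
have PZ k u : (exists l, u = peval y l) -> exists l, k *: u = peval y l.
  move=> [l ->]; exists [seq (k * x.1, x.2) | x <- l]; rewrite /peval big_map scaler_sumr /=.
  by apply: eq_bigr => x _; rewrite scalerA.
move=> u /memv_sumP [v_ hv ->].
elim/big_ind: _ => // i _.
have := hv i isT; move: (v_ i); elim: (val i) => [|k IH] w.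
  by rewrite expv0 => /vlineP [c ->]; apply: PZ.
rewrite expvSl; move: w; apply: (@prodv_ind U (U ^+ k)%VS (fun w => exists l, w = peval y l)) => // a b /hU ha /IH hb; exact: PM.
Qed.

End Calg.

Section GoodA.
Variable K : closedFieldType.

Definition goodA m (A : calg K m) := forall (J : Type) (x : J -> car A) f, good m (algfam x f).

(** Any family in [A] arises from a generating one by substituting polynomials, which [good_subst]
    allows. *)
Lemma goodA_gen m (A : calg K m) (J0 : choiceType) (y : J0 -> car A) :
  (forall u, exists l, u = peval y l) -> (forall f, good m (algfam y f)) -> goodA A.
Proof.
move=> gy gd J x f.
have h j : exists l, x j == peval y l by have [l ->] := gy (x j); exists l.
pose s j := xchoose (h j).
apply: (good_ext _ (good_subst s (gd f))) => b w /=.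
have -> : algfam x f (b, w) = pr (f b) (peval y (expandw s w) : car A).
  rewrite peval_expandw /algfam /=; congr (pr _ _); apply: eq_bigr => j _.
  by apply/eqP; exact: (xchooseP (h j)).
rewrite /peval pr_sum; apply: eq_bigr => i _.
by rewrite prZ.
Qed.

(* If multiplication by a generator may be moved inside the commutant of the other
   generators to a matrix with two distinct eigenvalues, the algebra splits generically. *)
Lemma goodA_E m (A : calg K m) (U : {vspace car A}) (y : car A) (E : 'M[K]_m) :
  (forall k, (k < m)%N -> CM K k) -> agenv (<[y]> + U)%VS = fullv ->
  (forall u v, u \in U -> (v * u : 'rV_m) *m E = (v *m E : car A) * u) ->
  m%:R * \tr (E *m E) != (\tr E) ^+ 2 -> goodA A.
Proof.
move=> IH gU cE tE.
(* The letter [None] is the generator that will move; a basis of [U] supplies those with which [E]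
   has to commute. *)
pose x (j : option 'I_(\dim U)) : car A := if j is Some i then (vbasis U)`_i else y.
apply: (@goodA_gen m A _ x) => [u|f].
  apply: (@agenv_peval _ _ _ (<[y]> + U)%VS); last by rewrite gU memvf.
  move=> {}u /memv_addP [a /vlineP [k ->] [b bU ->]].
  exists ((k, [:: None]) :: [seq (coord (vbasis U) i b, [:: Some i]) | i <- enum 'I_(\dim U)]).
  rewrite /peval big_cons big_seq1 /= big_map /= [in LHS](coord_vbasis bU); congr (_ + _).
  by rewrite big_enum /=; apply: eq_bigr => i _; rewrite big_seq1.
apply: (good_ext _ (@good_deform_one _ _ m (fun j => lmx (x j)) E (1 : car A) f IH _ _ tE)).
- by move=> b w; rewrite algfam_mat.
- by move=> i j; apply: lmx_comm.
move=> j; apply/row_matrixP => i; rewrite !rowE !mulmxA.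
rewrite (mul_lmx (delta_mx 0 i : car A)) (mul_lmx (delta_mx 0 i *m E : car A)) cE //.
by apply: vbasis_mem; rewrite mem_nth // size_tuple.
Qed.

Hypothesis K0 : [pchar K] =i pred0.

Lemma natK_neq0 k : (k.+1%:R : K) != 0.
Proof. by rewrite ((pcharf0P K).1 K0). Qed.

(** The case [E = l p] of rank one: [v E = pr l v *: p]. Both sides of the commutation with [U]
    vanish, one because [l] kills [U A], the other because [p] kills [U]. Since [tr E = pr l p] and
    [tr (E E) = (pr l p)^2], the trace condition reduces to [m <> 1]. *)
Lemma goodA_E1 m (A : calg K m) (U : {vspace car A}) (y p : car A) (l : 'cV[K]_m) :
  (forall k, (k < m)%N -> CM K k) -> agenv (<[y]> + U)%VS = fullv -> (1 < m)%N ->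
  (forall u, u \in U -> p * u = 0) -> (forall u v, u \in U -> pr l (u * v) = 0) ->
  pr l p != 0 -> goodA A.
Proof.
move=> IH gU m1 pU lU lp.
have vE (v : 'rV_m) : v *m (l *m (p : 'rV_m)) = pr l v *: p.
  rewrite mulmxA [v *m l]mx11_scalar mul_scalar_mx; congr (_ *: _).
apply: (goodA_E IH gU (E := l *m (p : 'rV_m))).
  move=> u v uU; rewrite !vE -scalerAl pU // scaler0 mulrC lU // scale0r //.
have tE : \tr (l *m (p : 'rV_m)) = pr l p by rewrite mxtrace_mulC [in LHS](mx11_scalar (p *m l)) mxtrace_scalar.
have -> : l *m (p : 'rV_m) *m (l *m (p : 'rV_m)) = pr l p *: (l *m (p : 'rV_m)).
  by rewrite -mulmxA vE -scalemxAr.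
rewrite mxtraceZ tE -expr2 -subr_eq0 -[X in _ - X]mul1r -mulrBl mulf_neq0 ?expf_neq0 //.
by case: m m1 {A U y p l IH gU pU lU lp vE tE} => [|[|n]] // _; rewrite -addn1 natrD addrK natK_neq0.
Qed.

(** Take the functional [v |-> pr l (v * p)] with [pr l (p * p) = 1]; it kills [U A] because [p]
    kills [U]. *)
Lemma goodA_sq m (A : calg K m) (U : {vspace car A}) (y p : car A) :
  (forall k, (k < m)%N -> CM K k) -> agenv (<[y]> + U)%VS = fullv -> (1 < m)%N ->
  (forall u, u \in U -> p * u = 0) -> p * p != 0 -> goodA A.
Proof.
move=> IH gU m1 pU pp.
have /pr_sep [l [l1 _]] : p * p \notin (0%VS : {vspace car A}) by rewrite memv0.
pose l' := lmx p *m l : 'cV_m.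
have E (v : car A) : pr l' v = pr l (v * p) by rewrite /pr /l' mulmxA mul_lmx.
apply: (goodA_E1 (l := l') IH gU m1 pU) => [u v uU|].
  by rewrite E mulrAC [u * p]mulrC pU // mul0r pr0.
by rewrite E l1 oner_neq0.
Qed.

(** The carrier does not move, so every value of a family is a polynomial in [t], the products of
    basis vectors being such; [A] is the fibre at 0. *)
Lemma goodA_deform m (A : calg K m) (At : K -> calg K m) (B C : 'rV[K]_m -> 'rV[K]_m -> 'rV[K]_m) :
  (forall t, cone (At t) = cone A) ->
  (forall t u v, cmul (At t) u v = cmul A u v + t *: B u v + t ^+ 2 *: C u v) ->
  gen (fun t => goodA (At t)) -> goodA A.
Proof.
move=> h1 hm hg J x f.
pose d i : 'rV[K]_m := delta_mx 0 i.
pose M i j : 'rV[{poly K}]_m := map_mx polyC (cmul A (d i) (d j)) + 'X *: map_mx polyC (B (d i) (d j))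
   + 'X^2 *: map_mx polyC (C (d i) (d j)).
(* The product with [t] as an indeterminate, extended bilinearly to rows of polynomials. *)
pose pm (u v : 'rV[{poly K}]_m) := \sum_i \sum_j (u 0 i * v 0 j) *: M i j.
pose P (i : bool * seq J) : {poly K} := (foldr (fun j u => pm (map_mx polyC (x j)) u) (map_mx polyC (cone A)) i.2
   *m map_mx polyC (f i.1)) 0 0.
pose ev t (u : 'rV[{poly K}]_m) : 'rV[K]_m := map_mx (horner_eval t) u.
have evM t i j : ev t (M i j) = cmul (At t) (d i) (d j).
  rewrite hm; apply/rowP => k; rewrite /ev /M !mxE /horner_eval !hornerE.
  by [].
have evZ t a u : ev t (a *: u) = a.[t] *: ev t u.
  by apply/rowP => k; rewrite !mxE /horner_eval hornerM.
have evS t (F : 'I_m -> 'rV_m) : ev t (\sum_i F i) = \sum_i ev t (F i).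
  by apply/rowP => k; rewrite !(mxE, summxE) /horner_eval horner_sum; apply: eq_bigr => i _; rewrite mxE.
have evpm t u v : ev t (pm u v) = cmul (At t) (ev t u) (ev t v).
  rewrite -[RHS]/((ev t u : car (At t)) * (ev t v : car (At t))).
  rewrite [in RHS](row_sum_delta (ev t u)) [in RHS](row_sum_delta (ev t v)).
  rewrite mulr_suml /pm evS; apply: eq_bigr => i _; rewrite mulr_sumr evS.
  by apply: eq_bigr => j _; rewrite -scalerAl -scalerAr scalerA evZ evM hornerM !mxE.
have PE t b w : (P (b, w)).[t] = algfam (x : J -> car (At t)) f (b, w).
  rewrite -[LHS]/(horner_eval t (P (b, w))) /P /algfam /pr /=.
  transitivity ((ev t (foldr (fun j u => pm (map_mx polyC (x j)) u) (map_mx polyC (cone A)) w) *m f b) 0 0).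
    by rewrite /ev -{2}(map_polyC_eval (f b) t) -map_mxM [RHS]mxE.
  congr ((_ *m _) 0 0); elim: w => [|j w IH] /=.
    by rewrite big_nil /ev map_polyC_eval -(h1 t).
  by rewrite big_cons evpm IH /ev map_polyC_eval.
have e0 b w : (P (b, w)).[0] = algfam x f (b, w).
  rewrite PE /algfam /=; congr (pr _ _); elim: w => [|j w IH]; first by rewrite !big_nil -[LHS]/(cone (At 0)) h1.
  rewrite !big_cons IH -[LHS]/(cmul (At 0) (x j) (\prod_(j <- w) x j)) hm scale0r expr0n /= scale0r !addr0 //.
apply: (@good_ext _ _ _ (fun i => (P i).[0]) _ e0); apply: (@good_lim _ _ _ P 0); apply: (gen_mono _ hg) => t gt.
by apply: (good_ext (fun b w => esym (PE t b w))).
Qed.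

End GoodA.

Section Nilpotent.
Variable R : comNzRingType.
Implicit Types u v : R.

Definition nilp u := exists k, u ^+ k = 0.

Lemma nilpM u v : nilp u -> nilp (u * v).
Proof. by move=> [k hk]; exists k; rewrite exprMn hk mul0r. Qed.

Lemma nilpD u v : nilp u -> nilp v -> nilp (u + v).
Proof.
move=> [k hk] [l hl]; exists (k + l)%N; rewrite exprDn big1 // => i _.
have [h|h] := leqP l i.
  by rewrite -(subnK h) exprD hl mulr0 mulr0 mul0rn.
have h' : (k <= k + l - i)%N by lia.
by rewrite -(subnK h') exprD hk mulr0 mul0r mul0rn.
Qed.

Lemma nilpN u : nilp u -> nilp (- u).
Proof. by rewrite -mulrN1; apply: nilpM. Qed.

Lemma nilp_fix u v : nilp u -> v = u * v -> v = 0.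
Proof.
move=> [k hk] h; have : v = u ^+ k * v.
  elim: k {hk} => [|k IH]; first by rewrite mul1r.
  by rewrite exprS -mulrA -IH.
by rewrite hk mul0r.
Qed.

End Nilpotent.

Record localA (K : fieldType) m (A : calg K m) (N : {vspace car A}) := LocalA {
  loc1 : 1 \notin N;
  locD : (1 + N = fullv)%VS;
  locI : (N * N <= N)%VS;
  locm : exists k, (N ^+ k = 0)%VS }.

Section BuildLocal.
Variables (K : fieldType) (m : nat) (A : calg K m).
Implicit Types (u v : car A).

Lemma prodv_lineP q w : w \in (<[q]> * fullv)%VS -> exists v, w = q * v.
Proof.
apply: (@prodv_ind _ _ _ _ _ (fun w => exists v, w = q * v)).
- by exists 0; rewrite mulr0.
- by move=> ? ? [a ->] [b ->]; exists (a + b); rewrite mulrDr.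
- by move=> k ? [a ->]; exists (k *: a); rewrite scalerAr.
- by move=> ? v /vlineP [k ->] _; exists (k *: v); rewrite -scalerAl scalerAr.
Qed.

(** By [nilp_fix], multiplying [q] by a nilpotent makes the ideal of [q] strictly smaller unless
    [q = 0]. So each factor costs one dimension, and a product of more than [m] nilpotents
    vanishes. *)
Lemma nil_product (l : seq (car A)) : (forall u, u \in l -> nilp u) ->
  \prod_(u <- l) u = 0 \/ (\dim (<[\prod_(u <- l) u : car A]> * fullv)%VS + size l <= m)%N.
Proof.
elim: l => [|n l IH] hl; first by right; rewrite addn0 (leq_trans (dimvS (subvf _))) // dimvf /dim /= mul1n.
have hn : nilp n by apply: hl; rewrite mem_head.
have {}IH := IH (fun u h => hl u (mem_behead (s := n :: l) h)).
rewrite big_cons; set q := \prod_(u <- l) u in IH *.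
have [|nq] := eqVneq (n * q) 0; first by left.
right; case: IH => [q0|IH]; first by rewrite q0 mulr0 eqxx in nq.
rewrite /= addnS; apply: leq_trans IH; rewrite -addSn leq_add2r.
have sub : (<[n * q]> * fullv <= <[q]> * fullv)%VS.
  apply/prodvP => u v /vlineP [k ->] _; rewrite -scalerAl memvZ //.
  have -> : n * q * v = q * (n * v) by ring.
  by rewrite memv_mul ?memv_line ?memvf.
rewrite ltnNge; apply/negP => le.
have /eqP E : (<[n * q]> * fullv == <[q]> * fullv)%VS by rewrite eqEdim sub.
have : q \in (<[n * q]> * fullv)%VS by rewrite E -{1}[q]mulr1 memv_mul ?memv_line ?memvf.
move=> /prodv_lineP [v hv].
have q0 : q = 0 by apply: (@nilp_fix _ (n * v)); [exact: nilpM | rewrite {1}hv mulrAC].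
by rewrite q0 mulr0 eqxx in nq.
Qed.

Lemma nil_expv (N : {vspace car A}) : (forall u, u \in N -> nilp u) -> (N ^+ m.+1 = 0)%VS.
Proof.
move=> hN.
have H k : forall w, w \in (N ^+ k)%VS -> forall l : seq (car A), (k + size l = m.+1)%N ->
    (forall u, u \in l -> u \in N) -> w * \prod_(u <- l) u = 0.
  elim: k => [|k IH] w.
    rewrite expv0 => /vlineP [c ->] l sl hl; rewrite -scalerAl mul1r.
    have [->|h] := @nil_product l (fun u h => hN u (hl u h)); first by rewrite scaler0.
    by move: sl h; rewrite add0n => ->; lia.
  rewrite expvSl; move: w; apply: prodv_ind.
  - by move=> l _ _; rewrite mul0r.
  - by move=> u v hu hv l sl hl; rewrite mulrDl hu // hv // addr0.
  - by move=> c u hu l sl hl; rewrite -scalerAl hu // scaler0.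
  move=> u v uN vN l sl hl; rewrite -(IH _ vN (u :: l)) /= ?big_cons.
  - by rewrite mulrA [v * u]mulrC.
  - by rewrite -sl addnS.
  by move=> x; rewrite inE => /orP [/eqP ->|/hl].
apply/eqP; rewrite -subv0; apply/subvP => w hw; rewrite memv0; apply/eqP.
by have := H _ w hw [::]; rewrite big_nil mulr1; apply => //; rewrite addn0.
Qed.

End BuildLocal.

(** * From commuting matrices to local algebras *)

Section ToAlgebra.
Variable K : closedFieldType.

(** The maximal ideal is the span of the nilpotents [b_i - c_i] for a basis [b]. It consists of
    nilpotents by commutativity, and it contains all of them because a nonzero scalar is not
    nilpotent. *)
Lemma build_local m (A : calg K m) :
  (forall u : car A, exists c : K, nilp (u - c *: 1)) -> exists N, @localA K m A N.
Proof.
move=> h.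
pose b := vbasis {: car A}.
have /fin_all_exists [c hc] : forall i : 'I_(\dim {: car A}), exists c : K, nilp (b`_i - c *: 1).
  by move=> i; apply: h.
pose s := [seq b`_(i : 'I_(\dim {: car A})) - c i *: 1 | i <- enum 'I_(\dim {: car A})].
have hN u : u \in <<s>>%VS -> nilp u.
  have : forall x, x \in s -> nilp x by move=> x /mapP [i _ ->].
  elim: s u => [|x s IH] u hs; first by rewrite span_nil memv0 => /eqP ->; exists 1%N; rewrite expr1.
  rewrite span_cons => /memv_addP [y /vlineP [k ->] [z zs ->]]; apply: nilpD.
    by rewrite -mulr_algl mulrC; apply: nilpM; apply: hs; rewrite mem_head.
  by apply: IH => // t ts; apply: hs; rewrite inE ts orbT.
have n1 : ~ nilp (1 : car A) by move=> [k]; rewrite expr1n => /eqP; rewrite oner_eq0.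
have dec u : exists a n, n \in <<s>>%VS /\ u = a *: 1 + n.
  exists (\sum_i coord b i u * c i), (\sum_i coord b i u *: (b`_i - c i *: 1)); split.
    apply: memv_suml => i _; apply: memvZ; apply: memv_span; apply/mapP; exists i => //.
    by rewrite mem_enum.
  rewrite {1}(coord_vbasis (memvf u)) scaler_suml -big_split /=; apply: eq_bigr => i _.
  by rewrite scalerBr scalerA addrC subrK.
have nil_in u : nilp u -> u \in <<s>>%VS.
  move=> nu; have [a [n [ns e]]] := dec u.
  have na : nilp (a *: (1 : car A)).
    have -> : a *: 1 = u - n by rewrite e addrK.
    by apply: nilpD => //; apply: nilpN; apply: hN.
  have [a0|a0] := eqVneq a 0; first by rewrite e a0 scale0r add0r.
  case: n1; have -> : (1 : car A) = a *: 1 * (a^-1 *: 1) by rewrite -scalerAl mul1r scalerA divff // scale1r.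
  exact: nilpM.
exists <<s>>%VS; split.
- by apply/negP => /hN.
- apply/eqP; rewrite eqEsubv subvf /=; apply/subvP => u _.
  have [a [n [ns ->]]] := dec u; rewrite memv_add // memvZ // memv_line //.
- by apply/prodvP => u v /hN nu _; apply: nil_in; apply: nilpM.
by exists m.+1; apply: nil_expv.
Qed.

(** The power is written with [iter] because square matrices form a ring only in positive size. *)
Lemma good_nonscalar J m (X : J -> 'M[K]_m) r f j0 :
  (forall k, (k < m)%N -> CM K k) -> (forall i j, X i *m X j = X j *m X i) ->
  (forall l, exists2 v : 'rV_m, v != 0 & v *m iter m (mulmx (X j0 - l%:M)) 1%:M != 0) ->
  good m (matfam X r f).
Proof.
case: m X r f => [|n] X r f IH cX h; first by apply: CM0.
have [|U [V [full rUV rU rV st]]] := @split_nonlocal _ _ (X j0).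
  move=> l; have [v _] := h l; apply: contraNneq => nil.
  have E k : iter k (mulmx (X j0 - l%:M)) 1%:M = (X j0 - l%:M) ^+ k.
    by elim: k => [|k IHk] //=; rewrite IHk exprS.
  by rewrite E nil mulmx0.
by apply: (good_split r f IH cX _ _ full rUV rU rV) => j; have [? ?] := st (X j) (cX _ _).
Qed.

(** Equivalently, no nonzero ideal lies in the kernels of both functionals; this is what bounds the
    socle. *)
Definition cogen m (A : calg K m) (f : bool -> 'cV[K]_m) :=
  forall u : car A, u != 0 -> exists b (v : car A), pr (f b) (u * v) != 0.

(** If the vectors [r X^w] do not span, or if both functionals kill a nonzero invariant subspace,
    the size drops. Otherwise [r] is a cyclic vector: a matrix of the commutant is determined by its
    value at [r], and this transports the product of matrices to ['rV_m]. *)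
Lemma CM_of_local m : (forall k, (k < m)%N -> CM K k) ->
  (forall (A : calg K m) (N : {vspace car A}) f, localA N -> @cogen m A f -> goodA A) -> CM K m.
Proof.
move=> IH hA; case: (posnP m) => [->|m0]; first exact: CM0.
move=> J X r f cX.
have cW w j : mword X w *m X j = X j *m mword X w by apply: mword_comm => i.
have cWW w w' : mword X w *m mword X w' = mword X w' *m mword X w.
  by apply: mword_comm => i; rewrite -cW.
case: (classic (exists U : 'M_m, [/\ (r <= U)%MS, (forall j, U *m X j <= U)%MS & (\rank U < m)%N])).
  by move=> [U [rU sU lt]]; apply: (good_leq (ltnW lt)); apply: good_restrict => //; apply: IH.
move=> ncyc.
case: (classic (exists U : 'M_m, [/\ (forall b, U *m f b = 0), (forall j, U *m X j <= U)%MS & (0 < \rank U)%N])).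
  move=> [U [fU sU lt]]; apply: (good_leq (leq_subr (\rank U) m)); apply: good_corestrict => //; apply: IH.
  by have := rank_leq_row U; lia.
move=> ncoc.
pose Mat (ws : seq (seq J)) : 'M_(size ws, m) := \matrix_(i < size ws) (r *m mword X (nth [::] ws i)).
(* A list of words of maximal rank exists because the rank is at most [m]; its vectors span the
   cyclic module of [r]. *)
have [ws wsmax] : exists ws, forall ws', (\rank (Mat ws') <= \rank (Mat ws))%N.
  apply: NNPP => nex.
  have H k : exists ws, (k <= \rank (Mat ws))%N.
    elim: k => [|k [ws hk]]; first by exists [::].
    apply: NNPP => nex'; apply: nex; exists ws => ws'; rewrite leqNgt; apply/negP => lt.
    by apply: nex'; exists ws'; apply: leq_ltn_trans lt.
  by have [ws] := H m.+1; have := rank_leq_col (Mat ws); lia.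
pose P := Mat ws.
have inP w : (r *m mword X w <= P)%MS.
  have := wsmax (w :: ws); have s1 : (P <= Mat (w :: ws))%MS.
    apply/row_subP => i; apply: submx_trans (row_sub (lift ord0 i) _).
    by rewrite !rowK.
  have s2 : (r *m mword X w <= Mat (w :: ws))%MS.
    by apply: submx_trans (row_sub ord0 _); rewrite rowK.
  move=> le; apply: submx_trans s2 _.
  by have := mxrank_leqif_eq s1; case=> _; rewrite eqn_leq le mxrankS //= => /esym /andP [].
have st j : (P *m X j <= P)%MS.
  apply/row_subP => i; rewrite row_mul rowK -mulmxA.
  have -> : mword X (nth [::] ws i) *m X j = mword X (rcons (nth [::] ws i) j).
    by rewrite -cats1 mword_cat /= mulmx1.
  exact: inP.
have full : row_full P.
  apply/negPn/negP => nf; apply: ncyc; exists <<P>>%MS; split.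
  - by rewrite genmxE; have := inP [::]; rewrite mulmx1.
  - by move=> j; rewrite (eqmxMr _ (genmxE P)) genmxE.
  by rewrite genmxE ltn_neqAle nf rank_leq_col.
(* The combination of words with [r *m M v = v]; by [uniq2] below it is the only element of the
   commutant with this value at [r]. *)
pose M (v : 'rV_m) := \sum_k (v *m pinvmx P) 0 k *: mword X (nth [::] ws k).
have rM v : r *m M v = v.
  rewrite -[RHS](mulmxKpV (submx_full v full)) [RHS]mulmx_sum_row /M mulmx_sumr; apply: eq_bigr => k _.
  by rewrite rowK -scalemxAr.
have MX v j : M v *m X j = X j *m M v.
  by rewrite mulmx_suml mulmx_sumr; apply: eq_bigr => k _; rewrite -scalemxAl -scalemxAr cW.
have MW v w : M v *m mword X w = mword X w *m M v by rewrite mword_comm.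
have MM u v : M u *m M v = M v *m M u.
  by rewrite [in LHS]/M [in RHS]/M mulmx_suml mulmx_sumr; apply: eq_bigr => k _; rewrite -scalemxAl -scalemxAr MW.
have uniq Z : (forall j, X j *m Z = Z *m X j) -> r *m Z = 0 -> Z = 0.
  move=> cZ rZ; have PZ : P *m Z = 0.
    apply/row_matrixP => i; rewrite row_mul rowK -mulmxA mword_comm // mulmxA rZ mul0mx row0 //.
  have /row_fullP [B BP] := full.
  by rewrite -[Z]mul1mx -BP -mulmxA PZ mulmx0.
have uniq2 Z Z' : (forall j, X j *m Z = Z *m X j) -> (forall j, X j *m Z' = Z' *m X j) ->
    r *m Z = r *m Z' -> Z = Z'.
  move=> cZ cZ' e; apply/eqP; rewrite -subr_eq0; apply/eqP; apply: uniq => [j|].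
    by rewrite mulmxBr mulmxBl cZ cZ'.
  by rewrite mulmxBr e subrr.
have r0 : r != 0.
  apply: contraL m0 => /eqP r0; have P0 : P = 0 by apply/row_matrixP => i; rewrite rowK r0 mul0mx row0.
  by move: full; rewrite /row_full P0 mxrank0 eq_sym -leqn0 leqNgt.
have MXj j : M (r *m X j) = X j by apply: uniq2 => [i|i|]; rewrite ?MX // ?cX // rM.
have MD u v : M (u + v) = M u + M v.
  by rewrite /M -big_split /=; apply: eq_bigr => k _; rewrite mulmxDl mxE scalerDl.
have MZ a u : M (a *: u) = a *: M u.
  by rewrite /M scaler_sumr; apply: eq_bigr => k _; rewrite -scalemxAl mxE scalerA.
pose mu (u v : 'rV_m) := u *m M v.
have muC : commutative mu by move=> u v; rewrite /mu -{1}(rM u) -{2}(rM v) -!mulmxA MM.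
have muA : associative mu.
  move=> u v w; rewrite /mu -mulmxA; congr (_ *m _); apply: uniq2 => [j|j|].
  - by rewrite MX.
  - by rewrite mulmxA -MX -!mulmxA MX.
  by rewrite rM mulmxA rM.
have mu1 : left_id r mu by move=> u; apply: rM.
have muDl : left_distributive mu +%R by move=> u v w; rewrite /mu mulmxDl.
have muZ k u v : k *: mu u v = mu (k *: u) v by rewrite /mu scalemxAl.
pose A := Calg muA muC mu1 muDl muZ r0.
pose x j : car A := r *m X j.
have lx j : lmx (x j) = X j.
  by apply/row_matrixP => i; rewrite !rowE mul_lmx -[LHS]/(mu _ _) /mu MXj.
have prodx w : \prod_(j <- w) x j = r *m mword X w :> car A.
  rewrite -[LHS]mul1r -mword_lmx; congr (_ *m _); elim: w => //= j w ->; by rewrite lx.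
apply: (good_ext (Phi := algfam x f)).
  by move=> b w; rewrite /algfam prodx.
(* If some generator is not a scalar plus a nilpotent, its matrix has two eigenvalues. Otherwise
   every element of [A] is a scalar plus a nilpotent, and [A] is local. *)
case: (classic (forall j, exists c : K, nilp (x j - c *: 1))) => [hx|]; last first.
  move=> /not_all_ex_not [j hj]; apply: (good_ext (Phi := matfam X r f)).
    by move=> b w; rewrite /algfam prodx.
  apply: (@good_nonscalar _ _ _ _ _ j) => // l; exists r => //; apply/eqP => e; apply: hj.
  exists l; exists m; rewrite -e.
  have : forall k, (x j - l *: 1 : car A) ^+ k = r *m iter k (mulmx (X j - l%:M)) 1%:M.
    elim=> [|k IHk]; first by rewrite mulmx1.
    rewrite exprSr IHk /= -mul_lmx; have -> : lmx (x j - l *: 1 : car A) = X j - l%:M.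
      apply/row_matrixP => i; rewrite !rowE mul_lmx mulrBr -mul_lmx lx mulmxBr; congr (_ - _).
      by rewrite -scalerAr mulr1 mul_mx_scalar.
    rewrite -mulmxA; congr (_ *m _); elim: k {IHk} => [|k IHk] /=; first by rewrite mul1mx mulmx1.
    by rewrite -mulmxA IHk.
  by move=> ->.
have sN u v : (exists c : K, nilp (u - c *: 1 : car A)) -> (exists c : K, nilp (v - c *: 1 : car A)) ->
    exists c : K, nilp (u + v - c *: 1 : car A).
  move=> [c hc] [c' hc']; exists (c + c').
  by rewrite scalerDl opprD addrACA; apply: nilpD.
have sM u v : (exists c : K, nilp (u - c *: 1 : car A)) -> (exists c : K, nilp (v - c *: 1 : car A)) ->
    exists c : K, nilp (u * v - c *: 1 : car A).
  move=> [c hc] [c' hc']; exists (c * c').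
  have -> : u * v - (c * c') *: 1 = (u - c *: 1) * v + (v - c' *: 1) * (c *: 1) :> car A.
    have -> : (c * c') *: 1 = (c *: 1) * (c' *: 1) :> car A by rewrite -scalerAl mul1r scalerA.
    by ring.
  by apply: nilpD; apply: nilpM.
have sW w : exists c : K, nilp ((r *m mword X w : car A) - c *: 1).
  rewrite -prodx; elim: w => [|j w IHw]; last by rewrite big_cons; apply: sM.
  by rewrite big_nil; exists 1, 1%N; rewrite scale1r subrr.
have [|N lN] := @build_local _ A.
  move=> u; have -> : u = \sum_k (u *m pinvmx P) 0 k *: (r *m mword X (nth [::] ws k) : car A) :> car A.
    by rewrite -{1}(rM u) mulmx_sumr; apply: eq_bigr => k _; rewrite -scalemxAr.
  apply: (big_ind (fun u : car A => exists c : K, nilp (u - c *: 1))) => //.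
    by exists 0, 1%N; rewrite scale0r subr0.
  move=> k _; rewrite -mulr_algl; apply: sM => //.
  by exists ((u *m pinvmx P) 0 k), 1%N; rewrite subrr.
apply: (hA A N f lN) => u u0.
apply: NNPP => nex; apply: ncoc.
have z b v : pr (f b) ((u : car A) * v) = 0.
  by apply: NNPP => h; apply: nex; exists b, v; apply/eqP.
(* The ideal of [u] would be an invariant subspace killed by both functionals, which was excluded by
   [ncoc]. *)
exists (lmx u : 'M_m); split.
- move=> b; apply/row_matrixP => i; rewrite row_mul rowE (mul_lmx (delta_mx 0 i : car A)) mulrC row0.
  by apply/matrixP => a c; rewrite !ord1 [RHS]mxE; exact: z.
- move=> j; apply/row_subP => i; by rewrite row_mul rowE -lx (mul_lmx (delta_mx 0 i : car A)) mul_lmx mulrAC -mul_lmx submxMl.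
rewrite lt0n mxrank_eq0; apply: contraNneq u0 => h.
by rewrite -[u]mul1r -mul_lmx h mulmx0.
Qed.

End ToAlgebra.

(** * Local algebras *)

Section Annihilator.
Variables (K : fieldType) (m : nat) (A : calg K m).
Implicit Types (u v w : car A) (U V W : {vspace car A}).

Definition ann W : {vspace car A} := (\bigcap_(i < \dim W) lker (amulr (vbasis W)`_i))%VS.

Lemma annP u W : reflect (forall w, w \in W -> u * w = 0) (u \in ann W).
Proof.
apply: (iffP idP) => [|h]; rewrite memvE.
  move/subv_bigcapP => h w wW; rewrite (coord_vbasis wW) mulr_sumr big1 // => i _.
  have := h i isT; rewrite -memvE memv_ker lfunE /= => /eqP e.
  by rewrite -scalerAr e scaler0.
apply/subv_bigcapP => i _; rewrite -memvE memv_ker lfunE /= h //.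
by rewrite vbasis_mem // mem_nth // size_tuple.
Qed.

Fact pr_is_linear (l : 'cV[K]_m) : linear (pr l : car A -> K^o).
Proof. by move=> a u v; rewrite prD prZ. Qed.

Definition kpr (l : 'cV[K]_m) : {vspace car A} :=
  lker (linfun (HB.pack_for {linear car A -> K^o} (pr l : car A -> K^o)
     (GRing.isLinear.Build K (car A) K^o *:%R (pr l : car A -> K^o) (pr_is_linear l)))).

Lemma kprE l u : (u \in kpr l) = (pr l u == 0).
Proof. by rewrite /kpr memv_ker lfunE. Qed.

Lemma line_ann a u : (u \in ann <[a]>) = (u * a == 0).
Proof.
apply/annP/eqP => [|h w /vlineP [k ->]]; first by apply; apply: memv_line.
by rewrite -scalerAr h scaler0.
Qed.

End Annihilator.

Section Local.
Variables (K : closedFieldType) (m : nat) (A : calg K m) (N : {vspace car A}).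
Hypothesis lN : localA N.
Implicit Types (u v w : car A) (U V W : {vspace car A}).

Lemma loc_dec u : exists c n, n \in N /\ u = c *: 1 + n.
Proof.
have : u \in (1 + N)%VS by rewrite (locD lN) memvf.
by move/memv_addP => [x /vlineP [c ->] [n nN ->]]; exists c, n.
Qed.

Lemma NpS k : (N ^+ k.+2 <= N ^+ k.+1)%VS.
Proof.
elim: k => [|k IH]; first by rewrite expv2 expv1 (locI lN).
by rewrite expvSl (expvSl _ k.+1); apply: prodvS.
Qed.

Lemma Np_le i j : (0 < i)%N -> (i <= j)%N -> (N ^+ j <= N ^+ i)%VS.
Proof.
case: i => // i _; elim: j => // j IH; rewrite leq_eqVlt => /orP [/eqP -> //|lt].
by case: j IH lt => // j IH lt; apply: subv_trans (NpS j) (IH lt).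
Qed.

Lemma NpN k u : (0 < k)%N -> u \in (N ^+ k)%VS -> u \in N.
Proof. by move=> k0 h; have := Np_le (isT : 0 < 1)%N k0; rewrite expv1 => /subvP; apply. Qed.

Lemma NpM i j u v : u \in (N ^+ i)%VS -> v \in (N ^+ j)%VS -> u * v \in (N ^+ (i + j))%VS.
Proof. by rewrite expvD; apply: memv_mul. Qed.

Lemma N1M i u v : u \in N -> v \in (N ^+ i)%VS -> u * v \in (N ^+ i.+1)%VS.
Proof. by rewrite expvSl; apply: memv_mul. Qed.

Lemma NM1 i u v : u \in (N ^+ i)%VS -> v \in N -> u * v \in (N ^+ i.+1)%VS.
Proof. by rewrite mulrC => ? ?; apply: N1M. Qed.

Lemma NN u v : u \in N -> v \in N -> u * v \in (N ^+ 2)%VS.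
Proof. by rewrite expv2; apply: memv_mul. Qed.

Lemma Np_ideal k u v : (0 < k)%N -> u \in (N ^+ k)%VS -> u * v \in (N ^+ k)%VS.
Proof.
move=> k0 uN; have [c [n [nN ->]]] := loc_dec v.
rewrite mulrDr -scalerAr mulr1 memvD ?memvZ //.
by have /subvP := Np_le k0 (leqnSn k); apply; apply: NM1.
Qed.

Lemma loc_nil u : u \in N -> nilp u.
Proof.
move=> uN; have [k hk] := locm lN; exists k; apply/eqP; rewrite -memv0 -hk.
by elim: k {hk} => [|k IH]; rewrite ?expr0 ?expv0 ?memv_line // exprS; apply: N1M.
Qed.

(** Iterating the inclusion gives [V <= U + N^k V] for all [k], and [N] is nilpotent. *)
Lemma nakayama U V : (forall u v, u \in U -> u * v \in U) -> (V <= U + N * V)%VS -> (V <= U)%VS.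
Proof.
move=> iU h.
have H k : (V <= U + N ^+ k * V)%VS.
  elim: k => [|k IH]; first by rewrite expv0 prod1v addvSr.
  apply: subv_trans h _; rewrite subv_add addvSl /= expvSl -prodvA.
  apply/prodvP => n v nN /(subvP IH) /memv_addP [a aU [b bV ->]].
  by rewrite mulrDr memv_add ?memv_mul // mulrC iU.
have [k hk] := locm lN.
by have := H k; rewrite hk prod0v addv0.
Qed.

(** Writing both factors of a product modulo a power of [N] gives the product modulo the next power;
    the powers of [N] end at 0. *)
Lemma gen_full U : (N <= U + N ^+ 2)%VS -> agenv U = fullv.
Proof.
move=> h; apply/eqP; rewrite eqEsubv subvf /=.
have H k : (N <= agenv U + N ^+ k.+1)%VS.
  elim: k => [|k IH]; first by rewrite expv1 addvSr.
  apply: subv_trans h _; rewrite subv_add (subv_trans (sub_agenv U) (addvSl _ _)) /= expv2.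
  apply/prodvP => a b aN bN.
  have /memv_addP [x xU [s sN ea]] := subvP IH a aN; have /memv_addP [y yU [r rN eb]] := subvP IH b bN.
  have xN : x \in N by rewrite -(addrK s x) -ea memvB // (NpN (k := k.+1)).
  have e : a * b = x * y + (x * r + s * b).
    by rewrite ea eb; ring.
  rewrite e memv_add //; first by rewrite -agenvM memv_mul.
  by rewrite memvD //; [apply: N1M | apply: NM1].
have [k hk] := locm lN.
have NU : (N <= agenv U)%VS.
  by have := H k; rewrite expvSl hk prodv0 addv0.
by rewrite -(locD lN) subv_add sub1_agenv.
Qed.

Lemma Np_lt k : (0 < k)%N -> (N ^+ k != 0)%VS -> (\dim (N ^+ k.+1) < \dim (N ^+ k))%N.
Proof.
move=> k0 nz; rewrite ltn_neqAle dimvS ?Np_le // andbT; apply: contra nz => /eqP e.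
have E : (N ^+ k.+1 = N ^+ k)%VS by apply/eqP; rewrite eqEdim Np_le //= e.
rewrite -subv0; apply: (@nakayama 0%VS); last by rewrite add0v -expvSl E.
by move=> u v; rewrite !memv0 => /eqP ->; rewrite mul0r.
Qed.

Definition soc : {vspace car A} := ann N.

Lemma soc_sub : (N != 0)%VS -> (soc <= N)%VS.
Proof.
move=> N0; apply/subvP => s /annP sN; have [c [n [nN e]]] := loc_dec s.
have [c0|c0] := eqVneq c 0; first by rewrite e c0 scale0r add0r.
case/negP: N0; rewrite -subv0; apply/subvP => w wN; rewrite memv0; apply/eqP.
apply: (@nilp_fix _ (- c^-1 *: n)); first by apply: loc_nil; apply: memvZ.
have := sN w wN; rewrite e mulrDl -scalerAl mul1r => /eqP; rewrite addr_eq0 => /eqP h.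
by rewrite -scalerAl scaleNr -scalerN -h scalerA mulVf // scale1r.
Qed.

(** The last nonzero [N^j W] is killed by [N]. *)
Lemma soc_meets W : (forall u v, u \in W -> u * v \in W) -> (W != 0)%VS ->
  exists s, [/\ s \in W, s \in soc & s != 0].
Proof.
move=> iW W0; have [k hk] := locm lN.
have ex : exists j, (N ^+ j * W == 0)%VS by exists k; rewrite hk prod0v.
have := ex_minnP ex; case=> -[|j] /eqP hj mn; first by rewrite expv0 prod1v in hj; rewrite hj eqxx in W0.
have nz : (N ^+ j * W != 0)%VS.
  by apply/negP => h; have := mn j h; rewrite ltnn.
exists (vpick (N ^+ j * W)); split; last by rewrite vpick0.
  have : (N ^+ j * W <= W)%VS by apply/prodvP => a b _ bW; rewrite mulrC iW.
  by move/subvP; apply; apply: memv_pick.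
by apply/annP => w wN; apply/eqP; rewrite -memv0 -hj expvSl -prodvA mulrC memv_mul ?memv_pick.
Qed.

Lemma soc_scal s u : s \in soc -> exists c, s * u = c *: s.
Proof.
move=> /annP sN; have [c [n [nN ->]]] := loc_dec u.
by exists c; rewrite mulrDr (sN n nN) addr0 -scalerAr mulr1.
Qed.

Lemma dim_kpr U l : (\dim U <= (\dim (U :&: kpr A l)).+1)%N.
Proof.
rewrite /kpr; set g := linfun _; rewrite -(limg_ker_dim g U) -addn1 leq_add2l.
by apply: leq_trans (dimvS (subvf _)) _; rewrite dimvf.
Qed.

(** On the socle [A] acts by scalars, so a socle vector killed by both functionals spans an ideal
    killed by both. Hence the two functionals separate the socle. *)
Lemma cogen_soc f : cogen A f -> (\dim soc <= 2)%N.
Proof.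
move=> cf; have h1 := dim_kpr soc (f true); have h2 := dim_kpr (soc :&: kpr A (f true))%VS (f false).
suff h : (soc :&: kpr A (f true) :&: kpr A (f false) = 0)%VS by move: h1 h2; rewrite h dimv0; lia.
apply/eqP; rewrite -subv0; apply/subvP => s.
rewrite !memv_cap !kprE => /andP [/andP [sS /eqP s1] /eqP s2]; rewrite memv0.
apply/negPn/negP => s0; have [b [v]] := cf s s0; have [c ->] := soc_scal v sS.
by rewrite prZ; case: b; rewrite ?s1 ?s2 mulr0 eqxx.
Qed.

Lemma soc_neq0 : (soc != 0)%VS.
Proof.
have /soc_meets : forall u v, u \in {: car A}%VS -> u * v \in {: car A}%VS by move=> u v _; apply: memvf.
case.
  by apply/negP => /eqP h; have := memvf (1 : car A); rewrite h memv0 oner_eq0.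
by move=> s [_ sS s0]; apply: contraNneq s0 => h; move: sS; rewrite h memv0.
Qed.

(** The Gorenstein case: the form [pr phi (u * v)] is nondegenerate, since its radical is an ideal
    in the kernel of [phi] and a nonzero ideal meets the socle. *)
Lemma gor_rep (phi l : 'cV[K]_m) : (forall s, s \in soc -> pr phi s = 0 -> s = 0) ->
  exists y : car A, forall u : car A, pr l u = pr phi (y * u).
Proof.
move=> h; pose G : 'M[K]_m := \matrix_(i, j) pr phi ((delta_mx 0 i : car A) * (delta_mx 0 j : car A)).
have GE (y : car A) j : ((y : 'rV_m) *m G) 0 j = pr phi (y * (delta_mx 0 j : car A)).
  rewrite [in RHS](row_sum_delta y) mulr_suml pr_sum mxE; apply: eq_bigr => i _.
  by rewrite mxE -scalerAl prZ.
have GE2 (y u : car A) : (forall j, pr phi (y * (delta_mx 0 j : car A)) = pr l (delta_mx 0 j)) ->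
    pr l u = pr phi (y * u).
  move=> e; rewrite [in LHS](row_sum_delta u) [in RHS](row_sum_delta u) mulr_sumr !pr_sum.
  by apply: eq_bigr => j _; rewrite -scalerAr !prZ e.
have GU : G \in unitmx.
  rewrite -row_free_unit; apply: inj_row_free => y yG.
  have z (u : car A) : pr phi ((y : car A) * u) = 0.
    rewrite [u](row_sum_delta u) mulr_sumr pr_sum big1 // => j _.
    by rewrite -scalerAr prZ -GE yG mxE mulr0.
  apply/eqP/negPn/negP => y0.
  have [||s [sW sS s0]] := @soc_meets (<[y : car A]> * fullv)%VS.
  - by move=> u v /prodv_lineP [w ->]; rewrite -mulrA memv_mul ?memv_line ?memvf.
  - apply: contraNneq y0 => h0; by have := memv_mul (memv_line (y : car A)) (memvf (1 : car A)); rewrite mulr1 h0 memv0.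
  case/eqP: s0; apply: h => //; by have [w ->] := prodv_lineP sW.
exists (l^T *m invmx G : 'rV_m) => u; apply: GE2 => j.
by rewrite -GE mulmxKV // !mxE /pr -rowE !mxE.
Qed.

End Local.

Section GoodLocal.
Variables (K : closedFieldType) (m : nat) (A : calg K m) (N : {vspace car A}).
Hypothesis lN : localA N.
Hypothesis K0 : [pchar K] =i pred0.
Hypothesis IH : forall k, (k < m)%N -> CM K k.
Implicit Types (u v w : car A) (U V W : {vspace car A}).

Lemma loc_m1 : (N != 0)%VS -> (1 < m)%N.
Proof.
move=> N0; have : (\dim (1 + N) <= m)%N.
  by apply: leq_trans (dimvS (subvf _)) _; rewrite dimvf /dim /= mul1n.
rewrite dimv_disjoint_sum ?dimv1 ?ltnS; last first.
  apply/eqP; rewrite -subv0; apply/subvP => x; rewrite memv_cap => /andP [/vlineP [c ->] cN].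
  rewrite memv0 scaler_eq0 oner_eq0 orbF; apply: contraT => c0.
  case/negP: (loc1 lN); by have := memvZ c^-1 cN; rewrite scalerA mulVf // scale1r.
by apply: leq_trans; rewrite ltnS lt0n dimv_eq0.
Qed.

Lemma goodA_lE1 U y p l : (N <= <[y]> + U + N ^+ 2)%VS -> (N != 0)%VS ->
  (forall u, u \in U -> p * u = 0) -> (forall u v, u \in U -> pr l (u * v) = 0) ->
  pr l p != 0 -> goodA A.
Proof. by move=> /(gen_full lN) g /loc_m1 m1; apply: (goodA_E1 K0 IH g m1). Qed.

Lemma goodA_lsq y p : (N <= <[y]> + (N :&: ann <[p]>) + N ^+ 2)%VS -> p * p != 0 -> (N != 0)%VS -> goodA A.
Proof.
move=> /(gen_full lN) g pp /loc_m1 m1; apply: (goodA_sq K0 IH g m1) pp => u.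
by rewrite memv_cap => /andP [_]; rewrite line_ann mulrC => /eqP.
Qed.

(** Every [v] in [N] is a multiple of [p] plus an element that kills [p], so [p] itself can be the
    moving generator in [goodA_lsq]. *)
Lemma goodA_self p : p \in N -> (forall v, v \in N -> p * v \in <[p * p]>%VS) -> p * p != 0 -> goodA A.
Proof.
move=> pN h pp; apply: (@goodA_lsq p p) => //; last first.
  by apply: contraNneq pp => N0; move: pN; rewrite N0 memv0 => /eqP ->; rewrite mul0r.
apply: subv_trans (addvSl _ _); apply/subvP => v vN.
have /vlineP [c e] := h v vN.
rewrite -(subrK (c *: p) v) addrC memv_add ?memvZ ?memv_line // memv_cap line_ann.
by rewrite memvB ?memvZ // mulrBl -scalerAl [v * p]mulrC e subrr eqxx.
Qed.

(** The difference [u - w] kills [p]; as [w] lies in [N^2], the corrected elements still generate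
    together with [y]. *)
Lemma goodA_corr U y p : (N <= <[y]> + U + N ^+ 2)%VS -> (U <= N)%VS ->
  (forall u, u \in U -> exists2 w, w \in (N ^+ 2)%VS & p * u = p * w) -> p * p != 0 -> (N != 0)%VS ->
  goodA A.
Proof.
move=> g UN h pp N0; apply: (goodA_lsq (y := y)) pp N0; apply: subv_trans g _.
rewrite !subv_add (subv_trans (addvSl _ _) (addvSl _ _)) addvSr /= andbT.
apply/subvP => u uU; have [w wN e] := h u uU.
rewrite -(subrK w u) memv_add // (subvP (addvSr _ _)) // memv_cap line_ann.
have wN1 : w \in N by apply: (NpN lN (k := 2)).
by apply/andP; split; [apply: memvB => //; exact: (subvP UN) | rewrite mulrC mulrBr e subrr].
Qed.

Lemma goodA_m1 : (N = 0)%VS -> goodA A.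
Proof.
move=> N0 J x f; have dc u : exists c : K, u = c *: 1.
  by have [c [n]] := loc_dec lN u; rewrite N0 memv0 => -[/eqP -> ->]; exists c; rewrite addr0.
have hc j : exists c : K, x j == c *: 1 by have [c ->] := dc (x j); exists c.
pose c j := xchoose (hc j).
have cE j : x j = c j *: 1 by apply/eqP; exact: (xchooseP (hc j)).
have m0 : (0 < m)%N.
  have : (\dim <[1 : car A]> <= m)%N by apply: leq_trans (dimvS (subvf _)) _; rewrite dimvf /dim /= mul1n.
  by rewrite dim_vline oner_eq0.
apply: (good_leq m0); apply: zcl_sub; exists (fun _ b => pr (f b) (1 : car A)), (fun _ => c) => b w.
rewrite big_ord1 /algfam /= mulrC -prZ; congr pr.
elim: w => [|j w IHw]; first by rewrite !big_nil scale1r.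
by rewrite !big_cons IHw cE -scalerAl mul1r scalerA.
Qed.

(** Here [p = s] kills all of [N], and a functional that is 1 at [s] and 0 on [N^2] cuts out a
    hyperplane [U] of [N], with [U A] in its kernel too. *)
Lemma goodA_soc0 s : s \in soc N -> s \notin (N ^+ 2)%VS -> goodA A.
Proof.
move=> sS sN2; have [N0|N0] := eqVneq N 0%VS; first exact: goodA_m1.
have sN := subvP (soc_sub lN N0) s sS.
have [l [l1 l2]] := pr_sep sN2.
apply: (@goodA_lE1 (N :&: kpr A l)%VS s s l) => //.
- apply: subv_trans (addvSl _ _); apply/subvP => v vN.
  rewrite -(subrK (pr l v *: s) v) addrC memv_add ?memvZ ?memv_line // memv_cap kprE.
  by rewrite memvB ?memvZ //= prD prN prZ l1 mulr1 subrr.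
- by move=> u; rewrite memv_cap => /andP [uN _]; move/annP: sS; apply.
- move=> u v; rewrite memv_cap kprE => /andP [uN /eqP u0].
  have [c [n [nN ->]]] := loc_dec lN v.
  by rewrite mulrDr -scalerAr mulr1 prD prZ u0 mulr0 add0r l2 // NN.
by rewrite l1 oner_neq0.
Qed.

(** With a single generator nothing has to commute with [E]: a rank one matrix of nonzero trace will
    do. *)
Lemma goodA_e1 y : (N <= <[y]> + N ^+ 2)%VS -> goodA A.
Proof.
move=> h; have [N0|N0] := eqVneq N 0%VS; first exact: goodA_m1.
have [l [l1 _]] : exists l : 'cV[K]_m, pr l (1 : car A) = 1 /\ forall v, v \in (0%VS : {vspace car A}) -> pr l v = 0.
  by apply: pr_sep; rewrite memv0 oner_eq0.
apply: (@goodA_lE1 0%VS y 1 l) => //; rewrite ?addv0 ?l1 ?oner_neq0 //.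
- by move=> u; rewrite memv0 => /eqP ->; rewrite mulr0.
by move=> u v; rewrite memv0 => /eqP ->; rewrite mul0r pr0.
Qed.

Lemma powers_free v k : v ^+ k.+1 = 0 -> v ^+ k != 0 ->
  v ^+ k \notin (\sum_(i < k) <[v ^+ i]>)%VS.
Proof.
move=> v0 vk; apply/negP => /memv_sumP [w_ hw e].
have /fin_all_exists [c hc] : forall i : 'I_k, exists c : K, w_ i = c *: v ^+ i.
  by move=> i; have /vlineP [c ->] := hw i isT; exists c.
have z : forall i : nat, forall ik : (i < k)%N, c (Ordinal ik) = 0.
  elim/ltn_ind => i IHi ik.
  have := congr1 (fun x => v ^+ (k - i) * x) e.
  rewrite -exprD mulr_sumr (_ : (k - i + k)%N = (k.+1 + (k - i).-1)%N); last by lia.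
  rewrite exprD v0 mul0r (bigD1 (Ordinal ik)) //= big1 => [|j ji].
    rewrite addr0 hc -scalerAr -exprD subnK ?(ltnW ik) // => /esym /eqP.
    by rewrite scaler_eq0 (negbTE vk) orbF => /eqP.
  have [lt|ge] := ltnP j i.
    by rewrite hc [j](_ : j = Ordinal (ltn_ord j)) ?IHi ?scale0r ?mulr0 //; apply: val_inj.
  rewrite hc -scalerAr -exprD; have -> : (k - i + j = k.+1 + (j - i).-1)%N.
    have ne : nat_of_ord j != i by apply: contra ji => /eqP ej; apply/eqP/val_inj.
    by move: ge ne; lia.
  by rewrite exprD v0 mul0r scaler0.
case/eqP: vk; rewrite e big1 // => i _.
by rewrite hc [i](_ : i = Ordinal (ltn_ord i)) ?z ?scale0r //; apply: val_inj.
Qed.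

(* The commutant of [v] contains the projection onto [K[v]] along a complement. *)
Lemma goodA_e2 y v k : (N <= <[y]> + <[v]> + N ^+ 2)%VS -> v ^+ k.+1 = 0 -> v ^+ k != 0 ->
  (k.+1 < m)%N -> goodA A.
Proof.
move=> g v0 vk km.
have [l [l1 l2]] := pr_sep (powers_free v0 vk).
have lv i : pr l (v ^+ i) = (i == k)%:R.
  have [lt|gt|->] := ltngtP i k; last by [].
    apply: l2; apply: (subvP (sumv_sup (Ordinal lt) _ _)) => //; exact: memv_line.
  by rewrite -(subnK gt) exprD v0 mulr0 pr0.
(* As [l] picks the coefficient of [v^k], the map [u |-> \sum_i pr l (u v^(k-i)) v^i] is the
   identity on [K[v]] and commutes with [v]. It is a projection of rank [k + 1], so
   [tr E = tr (E E) = k + 1], and [m (k + 1) <> (k + 1)^2] since [k + 1 < m]. *)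
pose E : 'M[K]_m := \sum_(i < k.+1) lmx (v ^+ (k - i)) *m l *m (v ^+ i : 'rV_m).
have vE (u : car A) : (u : 'rV_m) *m E = \sum_(i < k.+1) pr l (u * v ^+ (k - i)) *: v ^+ i.
  rewrite /E mulmx_sumr; apply: eq_bigr => i _.
  by rewrite !mulmxA mul_lmx [X in X *m _]mx11_scalar mul_scalar_mx.
have trl (z w : car A) : \tr (lmx z *m l *m (w : 'rV_m)) = pr l (w * z).
  by rewrite mxtrace_mulC mulmxA mul_lmx [X in \tr X]mx11_scalar mxtrace_scalar.
apply: (@goodA_E _ _ A <[v]>%VS y E IH); first exact: gen_full g.
  move=> _ u /vlineP [c ->]; rewrite -scalerAr -scalemxAl !vE -scalerAr; congr (_ *: _).
  rewrite mulr_suml big_ord_recl [RHS]big_ord_recr /= subn0 subnn.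
  rewrite -[u * v * _]mulrA -exprS v0 mulr0 pr0 scale0r add0r -scalerAl -exprSr v0 scaler0 addr0.
  apply: eq_bigr => i _; rewrite /bump /= add1n -scalerAl -exprSr -mulrA -exprS.
  by rewrite subnSK.
have tE : \tr E = k.+1%:R.
  rewrite /E linear_sum /= (eq_bigr (fun _ => 1)) ?sumr_const ?card_ord // => i _.
  by rewrite trl -exprD lv subnKC ?eqxx // -ltnS.
have tEE : \tr (E *m E) = k.+1%:R.
  rewrite {1}/E mulmx_suml linear_sum /= (eq_bigr (fun _ => 1)) ?sumr_const ?card_ord // => i _.
  rewrite -(mulmxA _ _ E) vE mulmx_sumr linear_sum /= (bigD1 i) //= big1 => [|j ji].
    rewrite addr0 -scalemxAr mxtraceZ trl -!exprD !lv.
    by rewrite !subnKC ?eqxx ?mulr1 // -ltnS.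
  rewrite -scalemxAr mxtraceZ -exprD lv; case: eqP => [e|]; last by rewrite mul0r.
  by case/negP: ji; apply/eqP/val_inj => /=; have := ltn_ord i; have := ltn_ord j; lia.
rewrite tE tEE expr2 -subr_eq0 -mulrBl mulf_neq0 ?natK_neq0 //.
by rewrite -natrB 1?ltnW // ((pcharf0P K).1 K0) subn_eq0 -ltnNge.
Qed.

End GoodLocal.

Section Dimensions.
Variables (K : closedFieldType) (m : nat) (A : calg K m) (N : {vspace car A}).
Hypothesis lN : localA N.
Hypothesis K0 : [pchar K] =i pred0.
Hypothesis IH : forall k, (k < m)%N -> CM K k.
Implicit Types (u v w : car A) (U V W : {vspace car A}).

Lemma dimN : (\dim N).+1 = m.
Proof.
have : \dim (1 + N) = m by rewrite (locD lN) dimvf /dim /= mul1n.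
rewrite dimv_disjoint_sum ?dimv1 //; apply/eqP; rewrite -subv0; apply/subvP => x.
rewrite memv_cap => /andP [/vlineP [c ->] cN]; rewrite memv0 scaler_eq0 oner_eq0 orbF.
apply: contraT => c0; case/negP: (loc1 lN).
by have := memvZ c^-1 cN; rewrite scalerA mulVf // scale1r.
Qed.

Lemma dim_Np k : (N ^+ k.+2 != 0)%VS -> (\dim (N ^+ k.+2) + k <= \dim (N ^+ 2))%N.
Proof.
elim: k => [|k IHk] h; first by rewrite addn0.
have h' : (N ^+ k.+2 != 0)%VS by apply: contraNneq h => h0; rewrite -subv0 -h0 NpS.
by have := Np_lt lN (ltn0Sn _) h'; have := IHk h'; lia.
Qed.

(** At most two generators [y] and [v]. That [v] generates a subalgebra smaller than [A], as
    [goodA_e2] demands, follows from the strict descent of the powers of [N]. *)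
Lemma goodA_e_le2 : (\dim N <= (\dim (N ^+ 2)).+2)%N -> goodA A.
Proof.
move=> he; have N2 : (N ^+ 2 <= N)%VS by rewrite -{2}(expv1 N) NpS.
pose C := (N :\: N ^+ 2)%VS.
have NC : (N <= C + N ^+ 2)%VS by rewrite addv_diff addvSl.
have dC : (\dim C + \dim (N ^+ 2) = \dim N)%N.
  by rewrite addnC -(dimv_cap_compl N (N ^+ 2)%VS) (capv_idPr N2).
have CN : (C <= N)%VS by apply: diffvSl.
have [y [v [gC hv vN]]] : exists y v, [/\ (C <= <[y]> + <[v]>)%VS, (v != 0 -> \dim C = 2%N) & v \in N].
  have sp := span_basis (vbasisP C).
  case: (vbasis C) sp => s /= /eqP; case: s => [|y [|v [|? ?]]] /=.
  - by move=> _ <-; exists 0, 0; rewrite eqxx mem0v; split=> //; rewrite span_nil sub0v.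
  - by move=> _ <-; exists y, 0; rewrite eqxx mem0v; split=> //; rewrite span_seq1 addvSl.
  - move=> e sp; exists y, v; split=> //; first by rewrite -{1}sp span_cons span_seq1.
    by apply: (subvP CN); rewrite -sp memv_span // !inE eqxx orbT.
  by move=> e _; exfalso; move: dC he; rewrite -e; lia.
have g : (N <= <[y]> + <[v]> + N ^+ 2)%VS by apply: subv_trans NC _; apply: addvS.
have [v0|v0] := eqVneq v 0.
  by apply: (goodA_e1 lN K0 IH (y := y)); rewrite v0 addv0 in g.
have [k [vk0 vk]] : exists k, v ^+ k.+1 = 0 /\ v ^+ k != 0.
  have ex : exists k, v ^+ k == 0 by have [k hk] := loc_nil lN vN; exists k; apply/eqP.
  have := ex_minnP ex; case=> [[|k]] /eqP hk mn; first by move: hk; rewrite expr0 => /eqP; rewrite oner_eq0.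
  by exists k; split=> //; apply/negP => /mn; rewrite ltnn.
apply: (goodA_e2 lN K0 IH g vk0 vk).
have := dimN; have := hv v0; case: k vk0 vk => [|[|k]] vk0 vk; try by move: dC; lia.
have : (N ^+ k.+2 != 0)%VS.
  apply: contraNneq vk => h; rewrite -memv0 -h.
  elim: (k.+2) => [|j IHj]; first by rewrite expr0 expv0 memv_line.
  by rewrite exprS N1M.
move=> nz; have := dim_Np nz; have : (0 < \dim (N ^+ k.+2))%N by rewrite lt0n dimv_eq0.
by move: dC; lia.
Qed.

(** If some [y] in [N] that kills [N^2] has [y y <> 0], then [y N] lies in the socle, the line of
    [y y], and [goodA_self] applies. Otherwise let [y] represent, through [gor_rep], a functional
    that is 1 at [x] and 0 on [N^2]: it kills [N^2] too, and polarizing the vanishing squares gives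
    [x y = 0], against [pr phi (y * x) = 1]. *)
Lemma goodA_T1 (x : car A) : \dim (soc N) = 1%N -> (soc N <= N ^+ 2)%VS -> x \in N -> x \notin (N ^+ 2)%VS ->
  (forall n, n \in (N ^+ 2)%VS -> x * n = 0) -> goodA A.
Proof.
move=> dS SN2 xN xN2 xz.
have [s [sS s0 Ss]] : exists s, [/\ s \in soc N, s != 0 & forall u, u \in soc N -> exists c, u = c *: s].
  have nz : (soc N != 0)%VS by rewrite -dimv_eq0 dS.
  exists (vpick (soc N)); split; rewrite ?memv_pick ?vpick0 // => u uS.
  have /eqP e : (<[vpick (soc N)]> == soc N)%VS.
    by rewrite eqEdim -memvE memv_pick dS dim_vline vpick0 nz.
  by apply/vlineP; rewrite e.
have [phi [phis _]] : exists l : 'cV[K]_m, pr l s = 1 /\ forall v, v \in (0%VS : {vspace car A}) -> pr l v = 0.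
  by apply: pr_sep; rewrite memv0.
have [|N20] := eqVneq (N ^+ 2)%VS 0%VS.
  by move=> h; case/eqP: s0; apply/eqP; rewrite -memv0 -h (subvP SN2).
case: (classic (exists y, [/\ y \in N, (forall n, n \in (N ^+ 2)%VS -> y * n = 0) & y * y != 0])).
  move=> [y [yN yz yy]]; apply: (goodA_self lN K0 IH yN _ yy).
  have yS v : v \in N -> y * v \in soc N.
    by move=> vN; apply/annP => w wN; rewrite -mulrA yz // NN.
  move=> v vN; have [c ->] := Ss _ (yS v vN); have [c' e] := Ss _ (yS y yN).
  have c'0 : c' != 0.
    by apply: contraNneq yy => h; rewrite e h scale0r.
  apply/vlineP; exists (c / c'); rewrite e scalerA mulfVK //.
move=> nex.
have sq y : y \in N -> (forall n, n \in (N ^+ 2)%VS -> y * n = 0) -> y * y = 0.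
  by move=> yN yz; apply/eqP/negPn/negP => yy; apply: nex; exists y.
have [l [l1 l2]] := pr_sep xN2.
have [|y hy] := @gor_rep _ _ _ _ lN phi l.
  by move=> u uS; have [c ->] := Ss u uS; rewrite prZ phis mulr1 => ->; rewrite scale0r.
have yz n : n \in (N ^+ 2)%VS -> y * n = 0.
  move=> nN; apply/eqP/negPn/negP => yn0.
  have [||w [wW wS w0]] := @soc_meets _ _ _ _ lN (<[y * n]> * fullv)%VS.
  - by move=> u v /prodv_lineP [w ->]; rewrite -mulrA memv_mul ?memv_line ?memvf.
  - by apply: contraNneq yn0 => h; have := memv_mul (memv_line (y * n)) (memvf (1 : car A)); rewrite mulr1 h memv0.
  have [v ev] := prodv_lineP wW; have [c ec] := Ss _ wS.
  have : pr phi w = 0 by rewrite ev -mulrA -hy l2 // Np_ideal.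
  rewrite ec prZ phis mulr1 => c0; move: w0; by rewrite ec c0 scale0r eqxx.
have yN : y \in N.
  have [c [n [nN e]]] := loc_dec lN y; have [c0|c0] := eqVneq c 0; first by rewrite e c0 scale0r add0r.
  case/eqP: N20; apply/eqP; rewrite -subv0; apply/subvP => u uN; rewrite memv0; apply/eqP.
  apply: (@nilp_fix _ (- c^-1 *: n)); first by apply: (loc_nil lN); apply: memvZ.
  have := yz u uN; rewrite e mulrDl -scalerAl mul1r => /eqP; rewrite addr_eq0 => /eqP h.
  by rewrite -scalerAl scaleNr -scalerN -h scalerA mulVf // scale1r.
have xy0 : x * y *+ 2 = 0.
  have e : (x + y) * (x + y) = 0.
    by apply: sq => [|n nN]; [exact: memvD | rewrite mulrDl xz // yz // addr0].
  by move: e; rewrite mulrDl !mulrDr (sq x) // (sq y) // addr0 add0r [y * x]mulrC mulr2n.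
have := hy x; rewrite l1 => /eqP; rewrite mulrC; have -> : x * y = 0.
  apply/eqP; move/eqP: xy0; rewrite -scaler_nat scaler_eq0.
  by rewrite ((pcharf0P K).1 K0).
by rewrite pr0 oner_eq0.
Qed.

End Dimensions.

(** * Deformations of the multiplication *)

Section Deformation.
Variables (K : closedFieldType) (m : nat) (A : calg K m).
Implicit Types (u v w : car A).

(** The exact condition for [u * v + G u v] to be an associative commutative product with the same
    unit; unlike for a Hochschild cocycle, the last clause contains the terms quadratic in [G]. *)
Definition cocycle (G : 'rV[K]_m -> 'rV[K]_m -> 'rV[K]_m) :=
  [/\ commutative G, left_distributive G +%R, (forall k u v, k *: G u v = G (k *: u) v),
      (forall v, G (1 : car A) v = 0)
    & forall u v w, G (u * v) w + (G u v : car A) * w + G (G u v) w =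
                    G u (v * w) + u * (G v w : car A) + G u (G v w)].

Lemma mk_calg G : cocycle G -> {At : calg K m | cone At = cone A &
  forall u v, cmul At u v = cmul A u v + G u v}.
Proof.
case=> GC GD GZ G1 GA; pose mu (u v : 'rV[K]_m) := cmul A u v + G u v.
have GDr u v w : G u (v + w) = G u v + G u w by rewrite GC GD !(GC u).
have muA : associative mu.
  move=> u v w; rewrite /mu.
  have -> : cmul A u (cmul A v w + G v w) = (u : car A) * (v : car A) * (w : car A) + (u : car A) * (G v w : car A).
    by rewrite -mulrA -mulrDr.
  have -> : cmul A (cmul A u v + G u v) w = (u : car A) * (v : car A) * (w : car A) + (G u v : car A) * (w : car A).
    by rewrite -mulrDl.
  rewrite GDr GD -!addrA; congr (_ + _); rewrite addrCA [RHS]addrCA !addrA.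
  exact/esym/GA.
have muC : commutative mu by move=> u v; rewrite /mu cmulC GC.
have mu1 : left_id (cone A) mu by move=> u; rewrite /mu cmul1 -[cone A]/(1 : car A) G1 addr0.
have muD : left_distributive mu +%R by move=> u v w; rewrite /mu cmulDl GD addrACA.
have muZ k u v : k *: mu u v = mu (k *: u) v by rewrite /mu scalerDr cmulZ GZ.
by exists (Calg muA muC mu1 muD muZ (cone0 A)).
Qed.

Lemma goodA_family (B C : 'rV[K]_m -> 'rV[K]_m -> 'rV[K]_m) :
  (forall t, cocycle (fun u v => t *: B u v + t ^+ 2 *: C u v)) ->
  gen (fun t => forall At : calg K m, cone At = cone A ->
    (forall u v, cmul At u v = cmul A u v + (t *: B u v + t ^+ 2 *: C u v)) -> goodA At) -> goodA A.
Proof.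
move=> hc hg; pose At t := s2val (mk_calg (hc t)).
apply: (@goodA_deform K m A At B C) => [t|t u v|].
- exact: (s2valP (mk_calg (hc t))).
- by rewrite (s2valP' (mk_calg (hc t))) addrA.
by apply: gen_mono hg => t; apply; [exact: (s2valP (mk_calg (hc t))) | exact: (s2valP' (mk_calg (hc t)))].
Qed.

(** [G] respects the powers of [N] in the same way as the product does, so the powers for the new
    product lie in the old ones and [N] stays nilpotent. *)
Lemma deform_local (N : {vspace car A}) G (At : calg K m) : localA N -> cone At = cone A ->
  (forall u v, cmul At u v = cmul A u v + G u v) ->
  (forall j u v, (0 < j)%N -> u \in N -> v \in (N ^+ j)%VS -> (G u v : car A) \in (N ^+ j.+1)%VS) ->
  @localA K m At N /\ forall j u, (0 < j)%N -> u \in ((N : {vspace car At}) ^+ j)%VS -> (u : car A) \in (N ^+ j)%VS.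
Proof.
move=> lN h1 hm hG.
have sub j : (((N : {vspace car At}) ^+ j.+1)%VS <= (((N ^+ j.+1)%VS : {vspace car A}) : {vspace car At}))%VS.
  elim: j => [|j IHj]; first by rewrite !expv1.
  rewrite expvSl; apply/prodvP => u v uN vN.
  have vN' := subvP IHj v vN; rewrite -[u * v]/(cmul At u v) hm.
  apply: (@memvD _ _ ((N ^+ j.+2)%VS : {vspace car A})); last by apply: hG.
  exact: (@N1M _ _ _ _ j.+1).
split; last by case=> // j u _; exact: (subvP (sub j)).
split.
- by rewrite -[1]/(cone At) h1; exact: (loc1 lN).
- by have := locD lN; rewrite -[(1 : car A)]/(cone A) -h1.
- by rewrite -expv2; apply: subv_trans (sub 1%N) _; exact: (NpS lN 0).
have [k hk] := locm lN; exists k.+1; apply/eqP; rewrite -subv0.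
by apply: subv_trans (sub k) _; rewrite expvSl hk prodv0.
Qed.

End Deformation.

Section SocleDeformation.
Variables (K : closedFieldType) (m : nat) (A : calg K m) (N : {vspace car A}).
Hypothesis lN : localA N.
Implicit Types (u v w : car A) (U V W : {vspace car A}).

(** [e] is the residue character of [A]. A functional that vanishes at 1 and on [N^2] is a
    derivation over [e]; deformations below are built from such functionals. *)
Lemma loc_char : exists e : 'cV[K]_m, [/\ pr e (1 : car A) = 1, forall u, u \in N -> pr e u = 0,
  forall s u, s \in soc N -> s * u = pr e u *: s
  & forall l, pr l (1 : car A) = 0 -> (forall n, n \in (N ^+ 2)%VS -> pr l n = 0) ->
    forall u v, pr l (u * v) = pr e u * pr l v + pr e v * pr l u].
Proof.
have [e [e1 e0]] := pr_sep (loc1 lN); exists e; split=> //.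
  move=> s u /annP sN; have [c [n [nN ->]]] := loc_dec lN u.
  by rewrite mulrDr (sN n nN) addr0 -scalerAr mulr1 prD prZ e1 e0 // mulr1 addr0.
move=> l l1 l2 u v; have [a [n [nN ->]]] := loc_dec lN u; have [b [n' [nN' ->]]] := loc_dec lN v.
rewrite !mulrDl !mulrDr -!scalerAl -!scalerAr !mul1r !mulr1 !prD !prZ l1 e1 !e0 //.
by rewrite (l2 _ (NN nN nN')); ring.
Qed.

(** A symmetric form that is a derivation over [e] in each argument gives, with values in the socle,
    a Hochschild cocycle. It vanishes on [s] and [s'], so the quadratic terms disappear and no
    higher correction is needed. *)
Lemma soc_cocycle (s s' : car A) (e : 'cV[K]_m) (g g' : 'rV[K]_m -> 'rV[K]_m -> K) :
  (forall u, s * u = pr e u *: s) -> (forall u, s' * u = pr e u *: s') ->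
  (forall h, h = g \/ h = g' -> [/\ commutative h, forall k u v w, h (k *: u + v) w = k * h u w + h v w,
     forall v, h (1 : car A) v = 0, forall v, h s v = 0 /\ h s' v = 0
     & forall u v w, h (u * v) w = pr e u * h v w + pr e v * h u w]) ->
  cocycle A (fun u v => g u v *: s + g' u v *: s').
Proof.
move=> sE sE' hg.
have [gC gL g1 gs gM] := hg g (or_introl erefl).
have [gC' gL' g1' gs' gM'] := hg g' (or_intror erefl).
have g0 v : g 0 v = 0 by have := gL (-1) 0 0 v; rewrite scaler0 addr0 mulN1r addNr.
have g0' v : g' 0 v = 0 by have := gL' (-1) 0 0 v; rewrite scaler0 addr0 mulN1r addNr.
split.
- by move=> u v; rewrite gC gC'.
- move=> u v w; have := gL 1 u v w; have := gL' 1 u v w; rewrite !scale1r !mul1r => -> ->.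
  by rewrite !scalerDl addrACA.
- move=> k u v; have := gL k u 0 v; have := gL' k u 0 v; rewrite !addr0 g0 g0' !addr0 => -> ->.
  by rewrite scalerDr !scalerA.
- by move=> v; rewrite g1 g1' !scale0r addr0.
move=> u v w.
have gG (h : 'rV[K]_m -> 'rV[K]_m -> K) a b c : h = g \/ h = g' -> h (a *: s + b *: s') c = 0.
  move=> e0; have [_ hL _ hs _] := hg h e0; have h0 : h 0 c = 0.
    by have := hL (-1) 0 0 c; rewrite scaler0 addr0 mulN1r addNr.
  have := hL b s' 0 c; rewrite addr0 h0 addr0 (hs c).2 mulr0 => e1.
  by rewrite hL (hs c).1 e1 mulr0 addr0.
rewrite !gG ?(gC u (_ + _)) ?(gC' u (_ + _)) ?gG; try tauto.
rewrite !scale0r !addr0 !gM !gM' (gC u (v * w)) (gC' u (v * w)) !gM !gM'.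
rewrite mulrDl mulrDr -!scalerAl -!scalerAr ![u * _]mulrC !sE !sE' !scalerA.
rewrite addrACA [RHS]addrACA -!scalerDl; rewrite ?(gC v u) ?(gC w u) ?(gC w v) ?(gC' v u) ?(gC' w u) ?(gC' w v).
by congr (_ *: _ + _ *: _); ring.
Qed.

End SocleDeformation.

Section LT2.
Variables (K : closedFieldType) (m : nat) (A : calg K m) (N : {vspace car A}).
Hypothesis lN : localA N.
Hypothesis K0 : [pchar K] =i pred0.
Hypothesis IH : forall k, (k < m)%N -> CM K k.
Implicit Types (u v w : car A) (U V W : {vspace car A}).

(* The products of [x] with [L] are deformed into multiples of [s + t *: s'], in such a
   way that [x - z] multiplies [N] into the line of its own square. *)
Lemma goodA_T2 (x s s' : car A) (ka xi : 'cV[K]_m) (L Y : {vspace car A}) :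
  s \in soc N -> s' \in soc N -> (soc N <= N ^+ 2)%VS -> x \in L ->
  (forall n, n \in (N ^+ 2)%VS -> x * n = 0) -> (N <= L + Y + N ^+ 2)%VS -> (L <= N)%VS -> (Y <= N)%VS ->
  (forall v, v \in L -> x * v = pr ka v *: s) ->
  (forall l, l = ka \/ l = xi -> pr l (1 : car A) = 0 /\ forall n, n \in (Y + N ^+ 2)%VS -> pr l n = 0) ->
  pr xi x = 1 ->
  gen (fun t => s + t *: s' != 0 /\ exists z, [/\ z \in (N ^+ 2)%VS, forall n, n \in (N ^+ 2)%VS -> z * n = 0,
     forall v, v \in L -> z * v = 0 & forall v, v \in Y -> (x - z) * v \in <[s + t *: s']>%VS]) ->
  goodA A.
Proof.
move=> sS sS' SN2 xL xz gN LN YN xka hl xix hgen.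
have [e [e1 e0 es eM]] := loc_char lN.
have l1 l : l = ka \/ l = xi -> pr l (1 : car A) = 0 by move=> h; case: (hl l h).
have l2 l : l = ka \/ l = xi -> forall n, n \in (N ^+ 2)%VS -> pr l n = 0.
  by move=> h n nN; case: (hl l h) => _; apply; apply: (subvP (addvSr _ _)).
have lY l : l = ka \/ l = xi -> forall n, n \in Y -> pr l n = 0.
  by move=> h n nN; case: (hl l h) => _; apply; apply: (subvP (addvSl _ _)).
pose kx := pr ka x.
(* [B] and [C] are chosen so that for [v] in [L] the new product of [x] and [v] is
   [(ka v + t xi v) (s + t s')]. In particular the new square of [x] is [(kx + t) (s + t s')],
   nonzero for [t <> - kx]. *)
pose B (u v : 'rV[K]_m) : 'rV[K]_m := (pr xi u * pr xi v) *: s +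
   (pr xi u * pr ka v + pr ka u * pr xi v - kx * pr xi u * pr xi v) *: s'.
pose C (u v : 'rV[K]_m) : 'rV[K]_m := (pr xi u * pr xi v) *: s'.
pose g t (u v : 'rV[K]_m) := t * (pr xi u * pr xi v).
pose g' t (u v : 'rV[K]_m) := t * (pr xi u * pr ka v + pr ka u * pr xi v - kx * pr xi u * pr xi v)
   + t ^+ 2 * (pr xi u * pr xi v).
have BC t u v : t *: B u v + t ^+ 2 *: C u v = g t u v *: s + g' t u v *: s'.
  by rewrite /B /C /g /g' scalerDr !scalerA -addrA -scalerDl.
have sN2 := subvP SN2 s sS; have sN2' := subvP SN2 s' sS'.
have cc t : cocycle A (fun u v => g t u v *: s + g' t u v *: s').
  apply: (@soc_cocycle _ _ A s s' e) => [u|u|h hh]; try exact: es.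
  have kM := eM ka (l1 ka (or_introl erefl)) (l2 ka (or_introl erefl)).
  have xM := eM xi (l1 xi (or_intror erefl)) (l2 xi (or_intror erefl)).
  have z0 n : n \in (N ^+ 2)%VS -> pr xi n = 0 /\ pr ka n = 0.
    by move=> nN; split; apply: l2 => //; [right|left].
  have x1 : pr xi (1 : car A) = 0 /\ pr ka (1 : car A) = 0 by split; apply: l1; [right|left].
  have [xs ks] := z0 s sN2; have [xs' ks'] := z0 s' sN2'; have [x11 k11] := x1.
  have hk : forall k u v w, h (k *: u + v) w = k * h u w + h v w.
    by move=> k u v w; case: hh => ->; rewrite /g /g' !prD !prZ; ring.
  have hz v : h s v = 0 /\ h s' v = 0.
    by split; case: hh => ->; rewrite /g /g' ?xs ?ks ?xs' ?ks'; ring.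
  split=> // [u v|v|u v w]; case: hh => ->; rewrite /g /g' ?kM ?xM ?x11 ?k11; ring.
apply: (@goodA_family K m A B C) => [t|].
  have [c1 c2 c3 c4 c5] := cc t.
  split=> [u v|u v w|k u v|v|u v w]; cbv beta; rewrite !BC; [exact: c1|exact: c2|exact: c3|exact: c4|exact: c5].
apply: (gen_mono _ (gen_and hgen (gen_neC (- kx)))) => t [[st0 [z [zN zn zL zY]]] tk] At h1 hm.
have hm' u v : cmul At u v = cmul A u v + (g t u v *: s + g' t u v *: s') by rewrite hm BC.
have GN2 u n : n \in (N ^+ 2)%VS -> g t u n *: s + g' t u n *: s' = 0.
  move=> nN; have [xn kn] : pr xi n = 0 /\ pr ka n = 0 by split; apply: l2 => //; [right|left].
  by rewrite /g /g' xn kn !mulr0 !(addr0, subr0, mulr0) !scale0r addr0.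
have [lNt subNt] : @localA K m At N /\ forall j u, (0 < j)%N -> u \in ((N : {vspace car At}) ^+ j)%VS -> (u : car A) \in (N ^+ j)%VS.
  apply: (deform_local lN h1 hm') => j u v j0 uN vN.
  case: j j0 vN => [//|[|j]] _ vN; first by apply: (subvP SN2); rewrite memvD ?memvZ.
  by rewrite GN2 ?mem0v //; apply: (subvP (Np_le lN (isT : 0 < 2)%N _)) vN.
pose P : car A := x - z.
have zN1 : z \in N by apply: (NpN lN (k := 2)).
have xN := subvP LN x xL.
have PG v : g t P v *: s + g' t P v *: s' = (t * pr xi v) *: (s + t *: s') + (t * pr ka v) *: s'.
  have [xz0 kz0] : pr xi z = 0 /\ pr ka z = 0 by split; apply: l2 => //; [right|left].
  have -> : (t * pr xi v) *: (s + t *: s') + (t * pr ka v) *: s' =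
      (t * pr xi v) *: s + (t * pr xi v * t + t * pr ka v) *: s'.
    by rewrite scalerDr scalerA -addrA -scalerDl.
  rewrite /g /g' /P !prD !prN xz0 kz0 !subr0 xix -/kx.
  by congr (_ *: _ + _ *: _); ring.
have Pv v : v \in N -> cmul At P v \in <[s + t *: s' : car A]>%VS.
  move=> vN; rewrite hm' PG.
  have /memv_addP [ly /memv_addP [l lL [y yY ->]] [n nN ->]] := subvP gN v vN.
  rewrite -[cmul A P _]/(P * (l + y + n)) !mulrDr !prD.
  have -> : P * n = 0 by rewrite /P mulrBl xz // zn // subr0.
  have -> : P * l = pr ka l *: s by rewrite /P mulrBl zL // subr0 xka.
  rewrite (lY xi (or_intror erefl) y yY) (lY ka (or_introl erefl) y yY).
  rewrite (l2 xi (or_intror erefl) n nN) (l2 ka (or_introl erefl) n nN) !addr0.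
  have -> : pr ka l *: s + P * y + ((t * pr xi l) *: (s + t *: s') + (t * pr ka l) *: s')
     = P * y + ((t * pr xi l) *: (s + t *: s') + pr ka l *: (s + t *: s')).
    have -> : pr ka l *: (s + t *: s') = pr ka l *: s + (t * pr ka l) *: s'.
      by rewrite scalerDr scalerA [pr ka l * t]mulrC.
    by rewrite -!addrA addrCA; congr (_ + _); rewrite addrCA.
  by rewrite memvD ?zY // -scalerDl memvZ // memv_line.
have PP : cmul At P P = (kx + t) *: (s + t *: s').
  rewrite hm' PG -[cmul A P P]/(P * P).
  have [xz0 kz0] : pr xi z = 0 /\ pr ka z = 0 by split; apply: l2 => //; [right|left].
  have -> : P * P = kx *: s.
    rewrite {2}/P mulrBr; have -> : P * z = 0 by rewrite /P mulrBl xz // zn // subrr.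
    by rewrite subr0 /P mulrBl zL // subr0 xka.
  rewrite /P !prD !prN xz0 kz0 !subr0 xix mulr1 -/kx scalerDl [kx *: (_ + _)]scalerDr scalerA mulrC.
  by rewrite -!addrA; congr (_ + _); rewrite addrC.
have kt0 : kx + t != 0 by rewrite addrC addr_eq0.
have PPt : (P : car At) * (P : car At) = (kx + t) *: (s + t *: s') := PP.
apply: (@goodA_self K m At N lNt K0 IH P).
- by rewrite memvB.
- move=> v vN; rewrite PPt.
  have /vlineP [c ec] := Pv v vN; apply/vlineP; exists (c / (kx + t)).
  by rewrite -[LHS]/(cmul At P v) ec scalerA mulfVK.
by rewrite PPt scaler_eq0 negb_or kt0.
Qed.

End LT2.

Section Coordinates.
Variables (K : fieldType) (m : nat) (A : calg K m).
Implicit Types (u v w : car A) (U V W : {vspace car A}).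

Lemma lin_pr (g : car A -> K) : (forall a u v, g (a *: u + v) = a * g u + g v) ->
  exists l, forall u : car A, pr l u = g u.
Proof.
move=> gl; exists (\col_j g (delta_mx 0 j)) => u.
have g0 : g 0 = 0 by have := gl (-1) 0 0; rewrite scaler0 addr0 mulN1r addNr.
have gD x y : g (x + y) = g x + g y by have := gl 1 x y; rewrite scale1r mul1r.
have gZ a x : g (a *: x) = a * g x by have := gl a x 0; rewrite addr0 g0 addr0.
rewrite {2}[u](row_sum_delta u) (big_morph g gD g0) /pr mxE; apply: eq_bigr => j _.
by rewrite gZ mxE.
Qed.

Lemma quot_coord U W h : (U <= W)%VS -> \dim W = (\dim U + h)%N ->
  exists (l : 'I_h -> 'cV[K]_m) (e : 'I_h -> car A),
  [/\ forall i u, u \in U -> pr (l i) u = 0, forall i, e i \in W,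
      forall i j, pr (l i) (e j) = (i == j)%:R
    & forall w, w \in W -> exists2 u, u \in U & w = \sum_i pr (l i) w *: e i + u].
Proof.
move=> UW dW; pose C := (W :\: U)%VS.
have dC : \dim C = h.
  by have := dimv_cap_compl W U; rewrite (capv_idPr UW) dW => /eqP; rewrite eqn_add2l => /eqP.
have CU : (C :&: U = 0)%VS by exact: capv_diff.
have CUW : (C + U = W)%VS by rewrite addv_diff; apply/addv_idPl.
have UC : (U :&: C = 0)%VS by rewrite capvC.
pose b := vbasis C.
have bC i : b`_i \in C.
  have [lt|ge] := ltnP i (size b); first by rewrite vbasis_mem // mem_nth.
  by rewrite nth_default // mem0v.
rewrite -dC.
have /fin_all_exists [l hl] : forall i : 'I_(\dim C), exists l, forall u : car A, pr l u = coord b i (daddv_pi C U u).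
  by move=> i; apply: lin_pr => a u v; rewrite linearP /= linearP.
exists l, (fun i => b`_i); split.
- move=> i u uU; rewrite hl; have := daddv_pi_add CU (subvP (addvSr C U) u uU).
  rewrite [X in _ + X]daddv_pi_id // => h'; have -> : daddv_pi C U u = 0.
    by rewrite -(addrK u (daddv_pi C U u)) h' subrr.
  by rewrite linear0.
- by move=> i; apply: (subvP (diffvSl W U)); apply: bC.
- move=> i j; by rewrite hl (daddv_pi_id CU (bC j)) coord_free ?(basis_free (vbasisP C)) // eq_sym.
move=> w wW; rewrite -CUW in wW; exists (daddv_pi U C w); first exact: memv_pi.
rewrite -{1}(daddv_pi_add CU wW); congr (_ + _).
rewrite [LHS](coord_vbasis (memv_pi C U w)); apply: eq_bigr => i _; by rewrite hl.
Qed.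

End Coordinates.

(** * Multiplying N onto N^2 by one element *)

Section Net.
Variables (K : closedFieldType) (m : nat) (A : calg K m) (N : {vspace car A}).
Hypothesis lN : localA N.
Hypothesis K0 : [pchar K] =i pred0.
Implicit Types (u v w x y z : car A) (U V W : {vspace car A}).

Lemma two_neq0 : (2%:R : K) != 0. Proof. by rewrite ((pcharf0P K).1 K0). Qed.

Lemma double0 (c : K) : c + c = 0 -> c = 0.
Proof. by rewrite -mulr2n -mulr_natl => /eqP; rewrite mulf_eq0 (negbTE two_neq0) => /eqP. Qed.

(** Polarization: the square of [N] is spanned by squares. *)
Lemma N2_ind (P : car A -> Prop) : P 0 -> (forall u v, P u -> P v -> P (u + v)) ->
  (forall k u, P u -> P (k *: u)) -> (forall u, u \in N -> P (u * u)) -> forall w, w \in (N ^+ 2)%VS -> P w.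
Proof.
move=> P0 PD PZ Psq w; rewrite expv2; apply: prodv_ind => // u v uN vN.
have -> : u * v = 2%:R^-1 *: ((u + v) * (u + v) + (-1) *: (u * u) + (-1) *: (v * v)).
  rewrite !scaleN1r (_ : _ + _ + _ = 2%:R *: (u * v)).
    by rewrite scalerA mulVf ?two_neq0 // scale1r.
  by rewrite scaler_nat mulr2n; ring.
by apply/PZ/PD; [apply: (PD _ _ (Psq _ _) (PZ _ _ (Psq _ _))) => //; apply: memvD | apply/PZ/Psq].
Qed.

Lemma N3N2 : (N ^+ 3 <= N ^+ 2)%VS. Proof. exact: (NpS lN 1). Qed.

(** [D] is the determinant on [N^2/N^3]. If [D (a x) (a y)] vanished for all [a], polarizing in [a]
    would make every square proportional to one fixed square modulo [N^3], while squares span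
    [N^2]. *)
Lemma net2 : \dim (N ^+ 2) = (\dim (N ^+ 3) + 2)%N ->
  exists2 a, a \in N & (N ^+ 2 <= <[a]> * N + N ^+ 3)%VS.
Proof.
move=> /(quot_coord N3N2) [l [e [l3 eN le lw]]].
pose D u v := pr (l 0) u * pr (l 1) v - pr (l 1) u * pr (l 0) v.
have sp a x y : a \in N -> x \in N -> y \in N -> D (a * x) (a * y) != 0 ->
    (N ^+ 2 <= <[a]> * N + N ^+ 3)%VS.
  move=> aN xN yN D0; apply/subvP => w wN.
  pose al := D w (a * y) / D (a * x) (a * y); pose be := D (a * x) w / D (a * x) (a * y).
  have inW z : z \in N -> a * z \in (<[a]> * N + N ^+ 3)%VS.
    by move=> zN; apply: (subvP (addvSl _ _)); rewrite memv_mul ?memv_line.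
  pose w' := w - al *: (a * x) - be *: (a * y).
  have w'N : w' \in (N ^+ 2)%VS by rewrite !memvB ?memvZ ?NN.
  have c0 i : pr (l i) w' = 0.
    have [->|->] : i = 0 \/ i = 1 by case: i => -[|[|//]] p; [left|right]; apply: val_inj.
      by rewrite /w' !prD !prN !prZ /al /be /D; field; exact: D0.
    by rewrite /w' !prD !prN !prZ /al /be /D; field; exact: D0.
  have [u uN ew] := lw w' w'N.
  have -> : w = u + (al *: (a * x) + be *: (a * y)).
    move: ew; rewrite big1 => [|i _]; last by rewrite c0 scale0r.
    by rewrite add0r => <-; rewrite /w' [_ + be *: _]addrC addrA !subrK.
  by rewrite !memvD ?memvZ ?inW // (subvP (addvSr _ _)).
apply: NNPP => nex.
have D0 a x y : a \in N -> x \in N -> y \in N -> D (a * x) (a * y) = 0.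
  by move=> aN xN yN; apply/eqP/negPn/negP => h; apply: nex; exists a => //; apply: (sp a x y).
have Dpol u a x y : u \in N -> a \in N -> x \in N -> y \in N -> D (u * x) (a * y) + D (a * x) (u * y) = 0.
  move=> uN aN xN yN.
  have -> : D (u * x) (a * y) + D (a * x) (u * y) =
      D ((u + a) * x) ((u + a) * y) - D (u * x) (u * y) - D (a * x) (a * y).
    by rewrite /D !mulrDl !prD; ring.
  by rewrite !D0 ?memvD // !subr0.
have [a [aN a0]] : exists a, a \in N /\ exists i, pr (l i) (a * a) != 0.
  apply: NNPP => nsq; have : forall w, w \in (N ^+ 2)%VS -> pr (l 0) w = 0.
    apply: N2_ind => [|u v hu hv|k u hu|u uN]; rewrite ?pr0 ?prD ?prZ ?hu ?hv ?addr0 ?mulr0 //.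
    by apply/eqP/negPn/negP => h; apply: nsq; exists u; split=> //; exists 0.
  by move=> /(_ _ (eN 0)); rewrite le => /eqP; rewrite oner_eq0.
have Da w : w \in (N ^+ 2)%VS -> D w (a * a) = 0.
  move: w; apply: (@N2_ind (fun w => D w (a * a) = 0)) => [|u v hu hv|k u hu|u uN].
  - by rewrite /D !pr0 !mul0r subrr.
  - by rewrite -[RHS](addr0 0) -{1}hu -hv /D !prD; ring.
  - by rewrite -[RHS](mulr0 k) -hu /D !prZ; ring.
  (* with a u = c a^2 mod N^3, the element k := u - c a satisfies a k = 0 *)
  have [i ai] := a0; pose c := pr (l i) (a * u) / pr (l i) (a * a).
  have ak j : pr (l j) (a * u) = c * pr (l j) (a * a).
    have := D0 a a u aN aN uN; rewrite /D /c.
    have [ei|ei] : i = 0 \/ i = 1 by case: i {ai c} => -[|[|//]] p; [left|right]; apply: val_inj.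
      move: ai; rewrite ei => ai e0.
      have [->|->] : j = 0 \/ j = 1 by case: j => -[|[|//]] p; [left|right]; apply: val_inj.
        by field.
      apply: (mulfI ai); move/eqP: e0; rewrite subr_eq0 => /eqP ->.
      by field.
    move: ai; rewrite ei => ai e0.
    have [->|->] : j = 0 \/ j = 1 by case: j => -[|[|//]] p; [left|right]; apply: val_inj.
      apply: (mulfI ai); move/eqP: e0; rewrite subr_eq0 => /eqP <-.
      by field.
    by field.
  pose k := u - c *: a.
  have kN : k \in N by rewrite memvB ?memvZ.
  have ak0 j : pr (l j) (a * k) = 0 by rewrite mulrBr -scalerAr prD prN prZ ak subrr.
  have ku : u = k + c *: a by rewrite subrK.
  clearbody k; have := Dpol k a k a kN aN kN aN.
  rewrite {2}/D [k * a]mulrC !ak0 !mul0r subrr addr0.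
  have -> : u * u = k * k + c *: (a * k) + (c *: (a * k) + (c * c) *: (a * a)).
    by rewrite ku mulrDl !mulrDr -!scalerAl -!scalerAr scalerA [k * a]mulrC.
  rewrite /D !prD !prZ !ak0 => h; rewrite -[RHS]h; ring.
have [i ai] := a0; case/eqP: ai.
have := Da (e 0) (eN 0); have := Da (e 1) (eN 1).
rewrite /D !le !mul1r !mul0r /= subr0 sub0r => /eqP; rewrite oppr_eq0 => /eqP e1 e2.
by have [->|->] : i = 0 \/ i = 1 by case: i => -[|[|//]] p; [left|right]; apply: val_inj.
Qed.

End Net.

Section Net3.
Variables (K : closedFieldType) (m : nat) (A : calg K m) (N : {vspace car A}).
Hypothesis lN : localA N.
Hypothesis K0 : [pchar K] =i pred0.
Implicit Types (u v w x y z : car A) (U V W : {vspace car A}).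

Lemma ord3 (P : 'I_3 -> Prop) : P 0 -> P 1 -> P 2 -> forall i, P i.
Proof.
move=> h0 h1 h2 [[|[|[|//]]] p]; [move: h0|move: h1|move: h2]; congr (P _); exact: val_inj.
Qed.

Definition det3 (p q r : 'I_3 -> K) := p 0 * (q 1 * r 2 - q 2 * r 1)
  - p 1 * (q 0 * r 2 - q 2 * r 0) + p 2 * (q 0 * r 1 - q 1 * r 0).

(** Cramer's rule with the nonzero minor in positions [i], [j]; each identity to be checked is
    trivial or, up to sign, the vanishing of the determinant. *)
Lemma det3_span (p q u : 'I_3 -> K) i j : p i * q j - p j * q i != 0 -> det3 u p q = 0 ->
  exists al be, forall k, u k = al * p k + be * q k.
Proof.
move=> M0 D0; set M := _ - _ in M0.
exists ((u i * q j - u j * q i) / M), ((p i * u j - p j * u i) / M) => k.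
suff e : M * u k = (u i * q j - u j * q i) * p k + (p i * u j - p j * u i) * q k.
  by apply: (mulfI M0); rewrite e; field.
have h : M * u k - ((u i * q j - u j * q i) * p k + (p i * u j - p j * u i) * q k) = 0 \/
   M * u k - ((u i * q j - u j * q i) * p k + (p i * u j - p j * u i) * q k) = det3 u p q \/
   M * u k - ((u i * q j - u j * q i) * p k + (p i * u j - p j * u i) * q k) = - det3 u p q.
  rewrite /M /det3; elim/ord3: i {M M0}; elim/ord3: j; elim/ord3: k;
    first [by left; ring | by right; left; ring | by right; right; ring].
rewrite D0 oppr0 in h; apply/eqP; rewrite -subr_eq0; apply/eqP; tauto.
Qed.

(* If no [a] maps [N/N^2] onto the three-dimensional [N^2/N^3], the multiplication factors
   through a quotient of dimension two: polarize [det (a x, a y, a z) = 0]. *)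
Lemma net3 (Cc : {vspace car A}) : \dim (N ^+ 2) = (\dim (N ^+ 3) + 3)%N ->
  (forall c, c \in N -> (forall v, v \in N -> c * v \in (N ^+ 3)%VS) -> c \in Cc) ->
  (exists2 a, a \in N & (N ^+ 2 <= <[a]> * N + N ^+ 3)%VS) \/
  exists a b, [/\ a \in N, b \in N, (N <= <[a]> + <[b]> + Cc)%VS
     & forall k, k \in N -> exists2 c, c \in Cc & k - c \in (<[a]> + <[b]>)%VS].
Proof.
move=> /(quot_coord (N3N2 lN)) [l [e [l3 eN le lw]]] hC.
pose L u i := pr (l i) u.
have LD u v i : L (u + v) i = L u i + L v i by rewrite /L prD.
have LZ c u i : L (c *: u) i = c * L u i by rewrite /L prZ.
pose D u v w := det3 (L u) (L v) (L w).
have L0 w : w \in (N ^+ 2)%VS -> (forall i, L w i = 0) -> w \in (N ^+ 3)%VS.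
  move=> wN h; have [u uN ->] := lw w wN; rewrite big1 ?add0r // => i _.
  by rewrite -/(L w i) h scale0r.
have inA a x y z : a \in N -> x \in N -> y \in N -> z \in N -> D (a * x) (a * y) (a * z) != 0 ->
    (N ^+ 2 <= <[a]> * N + N ^+ 3)%VS.
  move=> aN xN yN zN d0; apply/subvP => w wN.
  pose d := D (a * x) (a * y) (a * z).
  pose c1 := D w (a * y) (a * z) / d; pose c2 := D (a * x) w (a * z) / d; pose c3 := D (a * x) (a * y) w / d.
  pose w' := w - (c1 *: (a * x) + c2 *: (a * y) + c3 *: (a * z)).
  have inW t : t \in N -> a * t \in (<[a]> * N + N ^+ 3)%VS.
    by move=> tN; apply: (subvP (addvSl _ _)); rewrite memv_mul ?memv_line.
  have w'N : w' \in (N ^+ 3)%VS.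
    apply: L0; first by rewrite memvB // !memvD ?memvZ ?NN.
    move=> i; rewrite /w' /L prD prN !prD !prZ -!/(L _ _).
    have : D (a * x) (a * y) (a * z) != 0 by []; rewrite /c1 /c2 /c3 /d /D /det3.
    by elim/ord3: i => ?; field.
  rewrite -(subrK (c1 *: (a * x) + c2 *: (a * y) + c3 *: (a * z)) w) -/w'.
  apply: memvD; first exact: (subvP (addvSr _ _)).
  by rewrite !memvD ?memvZ ?inW.
case: (classic (exists2 a, a \in N & (N ^+ 2 <= <[a]> * N + N ^+ 3)%VS)); first by left.
move=> nex; right.
have D0 a x y z : a \in N -> x \in N -> y \in N -> z \in N -> D (a * x) (a * y) (a * z) = 0.
  by move=> aN xN yN zN; apply/eqP/negPn/negP => h; apply: nex; exists a => //; apply: (inA a x y z).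
(* Full polarization of [D0] in the repeated left factor. *)
have polD a b c x y z : a \in N -> b \in N -> c \in N -> x \in N -> y \in N -> z \in N ->
    D (a * x) (b * y) (c * z) + D (a * x) (c * y) (b * z) + D (b * x) (a * y) (c * z)
  + D (b * x) (c * y) (a * z) + D (c * x) (a * y) (b * z) + D (c * x) (b * y) (a * z) = 0.
  move=> aN bN cN xN yN zN.
  have -> : D (a * x) (b * y) (c * z) + D (a * x) (c * y) (b * z) + D (b * x) (a * y) (c * z)
    + D (b * x) (c * y) (a * z) + D (c * x) (a * y) (b * z) + D (c * x) (b * y) (a * z) =
     D ((a + b + c) * x) ((a + b + c) * y) ((a + b + c) * z)
     - D ((a + b) * x) ((a + b) * y) ((a + b) * z) - D ((a + c) * x) ((a + c) * y) ((a + c) * z)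
     - D ((b + c) * x) ((b + c) * y) ((b + c) * z)
     + D (a * x) (a * y) (a * z) + D (b * x) (b * y) (b * z) + D (c * x) (c * y) (c * z).
    by rewrite /D /det3 !mulrDl !LD; ring.
  by rewrite !D0 ?memvD // !subr0 !addr0.
pose M u v i j := L u i * L v j - L u j * L v i.
(* If [a a] and [a b] were always dependent modulo [N^3], all squares would be proportional to a
   single one, as in [net2]. *)
have [a [b [aN bN [i [j Mab]]]]] : exists a b, [/\ a \in N, b \in N & exists i j, M (a * a) (a * b) i j != 0].
  apply: NNPP => nab.
  have M0 a y i j : a \in N -> y \in N -> M (a * a) (a * y) i j = 0.
    by move=> aN yN; apply/eqP/negPn/negP => h; apply: nab; exists a, y; split=> //; exists i, j.
  have [a [aN [i ai]]] : exists a, a \in N /\ exists i, L (a * a) i != 0.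
    apply: NNPP => nsq; have h : forall w, w \in (N ^+ 2)%VS -> L w 0 = 0.
      apply: (N2_ind K0) => [|u v hu hv|k u hu|u uN]; rewrite ?LD ?LZ ?hu ?hv ?addr0 ?mulr0 //.
        by rewrite /L pr0.
      by apply/eqP/negPn/negP => h; apply: nsq; exists u; split=> //; exists 0.
    by have := h _ (eN 0); rewrite /L le => /eqP; rewrite oner_eq0.
  have Ma w s t : w \in (N ^+ 2)%VS -> M w (a * a) s t = 0.
    move: w; apply: (N2_ind K0) => [|u v hu hv|k u hu|u uN].
    - by rewrite /M /L !pr0 !mul0r subrr.
    - by rewrite -[RHS](addr0 0) -{1}hu -hv /M !LD; ring.
    - by rewrite -[RHS](mulr0 k) -hu /M !LZ; ring.
    pose c := L (a * u) i / L (a * a) i; pose k := u - c *: a.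
    have kN : k \in N by rewrite memvB ?memvZ.
    have ak0 j : L (a * k) j = 0.
      rewrite /k mulrBr -scalerAr /L prD prN prZ -!/(L _ _) /c.
      have /eqP := M0 a u i j aN uN; rewrite /M subr_eq0 => /eqP h.
      by apply: (mulfI ai); rewrite mulr0 mulrBr h; field.
    have ku : u = k + c *: a by rewrite subrK.
    clearbody k; have h : M (k * k) (a * a) s t = 0.
      have := M0 (a + k) k s t (memvD aN kN) kN.
      rewrite !mulrDl !mulrDr [k * a]mulrC /M !LD !ak0 !add0r !addr0 => h.
      rewrite -[RHS](oppr0) -h; ring.
    rewrite -[RHS]h ku mulrDl !mulrDr -!scalerAl -!scalerAr scalerA [k * a]mulrC /M !LD !LZ !ak0; ring.
  case/eqP: ai; have := Ma (e 0) 0 1 (eN 0); have := Ma (e 0) 0 2 (eN 0); have := Ma (e 1) 1 0 (eN 1).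
  rewrite /M /L !le !mul1r !mul0r !subr0 => e1 e2 e3.
  by elim/ord3: i.
have sp u : u \in (N ^+ 2)%VS -> D u (a * a) (a * b) = 0 ->
   exists al be, forall k, L u k = al * L (a * a) k + be * L (a * b) k.
  by move=> uN; apply: det3_span Mab.
(* The kernel of multiplication by [a] from [N] to [N^2/N^3]; by [decK] it is complemented by [a]
   and [b]. *)
pose Ka k := k \in N /\ forall i, L (a * k) i = 0.
have decK u : u \in N -> exists al be k, Ka k /\ u = al *: a + be *: b + k.
  move=> uN; have [|al [be h]] := sp (a * u) (NN aN uN).
    by rewrite -[RHS](D0 a u a b aN uN aN bN).
  exists al, be, (u - (al *: a + be *: b)); split; last by rewrite addrC subrK.
  split; first by rewrite memvB // memvD ?memvZ.
  move=> t; rewrite mulrBr mulrDr -!scalerAr /L prD prN prD !prZ -!/(L _ _) h; ring.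
have kV k u : Ka k -> u \in N -> exists al be, forall t, L (u * k) t = al * L (a * a) t + be * L (a * b) t.
  move=> [kN ak] uN; apply: sp; first exact: NN.
  have := polD a a u k a b aN aN uN kN aN bN.
  rewrite /D /det3 !ak => h; apply: (double0 K0); rewrite -[RHS]h; ring.
(* Otherwise [a a] and [a b] alone would span [N^2/N^3], by [decK] and [kV], against dimension
   three. *)
have Dab : D (a * a) (a * b) (b * b) != 0.
  apply/negP => /eqP d0.
  have [|al [be hbb]] := sp (b * b) (NN bN bN); first by rewrite -[RHS]d0 /D /det3; ring.
  have all w : w \in (N ^+ 2)%VS -> D w (a * a) (a * b) = 0.
    move: w; apply: (N2_ind K0) => [|u v hu hv|k u hu|u uN].
    - by rewrite /D /det3 /L !pr0; ring.
    - by rewrite -[RHS](addr0 0) -{1}hu -hv /D /det3 !LD; ring.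
    - by rewrite -[RHS](mulr0 k) -hu /D /det3 !LZ; ring.
    have [p [q [k [kk ->]]]] := decK u uN.
    have [kN ak] := kk; have [p1 [q1 h1]] := kV k b kk bN; have [p2 [q2 h2]] := kV k k kk kN.
    rewrite !mulrDl !mulrDr -!scalerAl -!scalerAr !scalerA ![k * a]mulrC ![k * b]mulrC ![b * a]mulrC.
    rewrite /D /det3 !LD !LZ !ak !h1 !h2 !hbb; ring.
  case/eqP: Mab; have := all (e 0) (eN 0); have := all (e 1) (eN 1); have := all (e 2) (eN 2).
  have Le s t : L (e s) t = (t == s)%:R := le t s.
  rewrite /D /det3 /M !Le !mul1r !mul0r !(subr0, sub0r, addr0, add0r) => e2 e1 e0.
  have E s t : L (a * a) s * L (a * b) t - L (a * a) t * L (a * b) s = 0.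
    have e1' : L (a * a) 0 * L (a * b) 2 - L (a * a) 2 * L (a * b) 0 = 0 by apply/eqP; rewrite -oppr_eq0 e1.
    elim/ord3: s; elim/ord3: t => //; rewrite ?subrr //; apply/eqP; rewrite -oppr_eq0 opprB; exact/eqP.
  exact: E.
(* Now [a a], [a b], [b b] is a basis of [N^2/N^3], and suitable polarized identities isolate one
   coordinate at a time: [Ka] multiplies [b], and then itself, into [N^3]. *)
have bk k t : Ka k -> L (b * k) t = 0.
  move=> kk; have [kN ak] := kk; have [al [be h]] := kV k b kk bN.
  have h1 : D (a * a) (b * k) (b * b) = 0.
    have := polD b b a a k b bN bN aN aN kN bN; rewrite [b * a]mulrC /D /det3 !ak => h1.
    by apply: (double0 K0); rewrite -[RHS]h1; ring.
  have h2 : D (b * a) (b * k) (b * b) = 0 by apply: D0.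
  have be0 : be = 0.
    apply: (mulIf Dab); rewrite mul0r -[RHS]h1 /D /det3 !h; ring.
  have al0 : al = 0.
    apply: (mulIf Dab); rewrite mul0r -[RHS]oppr0 -[in RHS]h2 [b * a]mulrC /D /det3 !h be0; ring.
  by rewrite h al0 be0; ring.
have kk' k k' t : Ka k -> Ka k' -> L (k * k') t = 0.
  move=> kk kk'; have [kN ak] := kk; have [kN' ak'] := kk'; have [al [be h]] := kV k' k kk' kN.
  have h1 : D (a * a) (k * k') (b * b) = 0.
    have := polD a b k a k' b aN bN kN aN kN' bN.
    have bk1 s : L (b * k') s = 0 by apply: bk.
    by rewrite [b * a]mulrC [k * a]mulrC /D /det3 !ak !ak' !bk1 => h1; rewrite -[RHS]h1; ring.
  have h2 : D (b * a) (k * k') (b * b) = 0.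
    have := polD b b k a k' b bN bN kN aN kN' bN.
    have bk1 s : L (b * k') s = 0 by apply: bk.
    rewrite [k * a]mulrC /D /det3 !ak !bk1 => h1'.
    by apply: (double0 K0); rewrite -[RHS]h1'; ring.
  have be0 : be = 0.
    apply: (mulIf Dab); rewrite mul0r -[RHS]h1 /D /det3 !h; ring.
  have al0 : al = 0.
    apply: (mulIf Dab); rewrite mul0r -[RHS]oppr0 -[in RHS]h2 [b * a]mulrC /D /det3 !h be0; ring.
  by rewrite h al0 be0; ring.
have KC k : Ka k -> k \in Cc.
  move=> kk; have [kN ak] := kk; apply: hC => // v vN; apply: L0; first exact: NN.
  move=> t; have [p [q [k' [kk1 ->]]]] := decK v vN.
  rewrite !mulrDr -!scalerAr !LD !LZ [k * a]mulrC [k * b]mulrC ak bk // kk' //; ring.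
have dec u : u \in N -> exists2 c, c \in Cc & u - c \in (<[a]> + <[b]>)%VS.
  move=> uN; have [p [q [k [kk ->]]]] := decK u uN; exists k; first exact: KC.
  by rewrite addrK memv_add ?memvZ ?memv_line.
exists a, b; split=> //; apply/subvP => u uN; have [c cC h] := dec u uN.
by rewrite -(subrK c u) memv_add.
Qed.

End Net3.

(** * Socle of dimension two: pencils of quadratic forms *)

Section Pencil.
Variables (K : closedFieldType) (m : nat) (A : calg K m) (N : {vspace car A}).
Hypothesis lN : localA N.
Hypothesis K0 : [pchar K] =i pred0.
Hypothesis IH : forall k, (k < m)%N -> CM K k.
Implicit Types (u v w x y z s : car A) (U V W X Y : {vspace car A}).

Lemma pr_ext (l : 'cV[K]_m) X W : (forall u, u \in (X :&: W)%VS -> pr l u = 0) ->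
  exists l', (forall u, u \in X -> pr l' u = pr l u) /\ (forall u, u \in W -> pr l' u = 0).
Proof.
move=> h; pose C := (X :\: W)%VS.
have CW : (C :&: W = 0)%VS by exact: capv_diff.
have XCW : (X <= C + W)%VS by rewrite addv_diff addvSl.
have [l' hl] : exists l', forall u : car A, pr l' u = pr l (daddv_pi C W u).
  by apply: lin_pr => a u v; rewrite linearP /= prD prZ.
exists l'; split=> u uX; rewrite hl.
  have e := daddv_pi_add CW (subvP XCW u uX).
  have cX : daddv_pi C W u \in X by apply: (subvP (diffvSl X W)); exact: memv_pi.
  rewrite -[in RHS]e prD [X in _ = _ + X]h ?addr0 // memv_cap memv_pi andbT.
  have -> : daddv_pi W C u = u - daddv_pi C W u by rewrite -[X in X - _]e addrAC subrr add0r.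
  exact: memvB.
have := daddv_pi_add CW (subvP (addvSr C W) u uX).
have WC : (W :&: C = 0)%VS by rewrite capvC.
rewrite [X in _ + X](daddv_pi_id WC uX) => e; have -> : daddv_pi C W u = 0.
  by rewrite -(addrK u (daddv_pi C W u)) e subrr.
exact: pr0.
Qed.

(** If [H] is invertible, an eigenvalue [l] of [G H^-1] gives the singular member [G - l H]. *)
Lemma det_pencil q (G H : 'M[K]_q) : (0 < q)%N -> exists a b (v : 'rV[K]_q),
  [/\ (a != 0) || (b != 0), v != 0 & v *m (a *: G + b *: H) = 0].
Proof.
case: q G H => // q G H _.
have sing (F : 'M[K]_q.+1) : F \notin unitmx -> exists2 v : 'rV_q.+1, v != 0 & v *m F = 0.
  rewrite -row_free_unit -kermx_eq0 => /rowV0Pn [v /sub_kermxP vF v0]; by exists v.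
have [Hu|/sing [v v0 vH]] := boolP (H \in unitmx); last first.
  by exists 0, 1, v; rewrite oner_neq0 orbT scale0r scale1r add0r.
have [l rl] : exists l, root (char_poly (G *m invmx H)) l.
  by apply/closed_rootP; rewrite size_char_poly.
have /eigenvalueP [v ev v0] : eigenvalue (G *m invmx H) l by rewrite eigenvalue_root_char.
exists 1, (- l), v; rewrite oner_neq0; split=> //.
rewrite scale1r mulmxDr -scalemxAr scaleNr; apply/eqP; rewrite subr_eq0; apply/eqP.
by rewrite scalemxAl -ev -!mulmxA mulVmx // mulmx1.
Qed.

Lemma soc_basis : \dim (soc N) = 2%N -> exists s1 s2 (l1 l2 : 'cV[K]_m),
  [/\ s1 \in soc N, s2 \in soc N & forall u, u \in soc N -> u = pr l1 u *: s1 + pr l2 u *: s2] /\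
  [/\ pr l1 s1 = 1, pr l1 s2 = 0, pr l2 s1 = 0 & pr l2 s2 = 1].
Proof.
move=> dS; have [l [e [_ eS le lw]]] := @quot_coord _ _ A 0%VS (soc N) 2 (sub0v _) (etrans dS (esym (congr1 (addn^~ 2%N) (dimv0 _)))).
exists (e 0), (e 1), (l 0), (l 1); rewrite !le; split=> //; split=> // u uS.
have [w] := lw u uS; rewrite memv0 => /eqP -> {1}->; rewrite addr0 2!big_ord_recl big_ord0 addr0.
by have -> : lift ord0 ord0 = 1 :> 'I_2 by apply: val_inj.
Qed.

(** The two socle coordinates of [u * v] are quadratic forms on [X] modulo [N^2]. A singular member
    of their pencil has a radical vector [x], and [x X] lies in the line of the socle on which that
    combination of coordinates vanishes. *)
Lemma pencil_soc X : \dim (soc N) = 2%N -> ~~ (X <= N ^+ 2)%VS ->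
  (forall u n, u \in X -> n \in (N ^+ 2)%VS -> u * n = 0) ->
  (forall u v, u \in X -> v \in X -> u * v \in soc N) ->
  exists x s s' ka (l l' : 'cV[K]_m), [/\ x \in X, x \notin (N ^+ 2)%VS, s \in soc N, s' \in soc N
    & forall v, v \in X -> x * v = pr ka v *: s] /\
    [/\ pr l s = 1, pr l s' = 0, pr l' s = 0, pr l' s' = 1 &
    forall u, u \in soc N -> u = pr l u *: s + pr l' u *: s'].
Proof.
move=> dS nX XN2 XX; have [s1 [s2 [l1 [l2 [[S1 S2 Se] [l11 l12 l21 l22]]]]]] := soc_basis dS.
pose C := (X :\: N ^+ 2)%VS; pose b := vbasis C.
have dC : (0 < \dim C)%N.
  rewrite lt0n dimv_eq0; apply: contra nX => /eqP C0.
  have := addv_diff X (N ^+ 2)%VS; rewrite -/C C0 add0v => ->; exact: addvSl.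
have bX i : b`_i \in X.
  have [lt|ge] := ltnP i (size b); last by rewrite nth_default // mem0v.
  by apply: (subvP (diffvSl X (N ^+ 2)%VS)); rewrite vbasis_mem // mem_nth.
have bC i : b`_i \in C.
  have [lt|ge] := ltnP i (size b); last by rewrite nth_default // mem0v.
  by rewrite vbasis_mem // mem_nth.
pose G (l : 'cV[K]_m) : 'M[K]_(\dim C) := \matrix_(i, j) pr l (b`_i * b`_j).
have [c1 [c2 [v [c0 v0 vG]]]] := det_pencil (G l1) (G l2) dC.
pose x := \sum_(i < \dim C) v 0 i *: b`_i.
have xC : x \in C by apply: memv_suml => i _; rewrite memvZ.
have xX : x \in X by apply: memv_suml => i _; rewrite memvZ.
have xn : x \notin (N ^+ 2)%VS.
  apply/negP => xN2; have : x \in (C :&: N ^+ 2)%VS by rewrite memv_cap xC.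
  rewrite capv_diff memv0 => /eqP x0; case/eqP: v0; apply/rowP => i; rewrite mxE.
  by rewrite -(coord_sum_free (fun i => v 0 i) i (basis_free (vbasisP C))) -/b -/x x0 linear0.
have xz u : u \in X -> c1 * pr l1 (x * u) + c2 * pr l2 (x * u) = 0.
  move=> uX; have : u \in (C + N ^+ 2)%VS by rewrite addv_diff (subvP (addvSl _ _)).
  case/memv_addP => c cC [n nN ->]; rewrite mulrDr (XN2 x n xX nN) addr0.
  have bz (j : 'I_(\dim C)) : c1 * pr l1 (x * b`_j) + c2 * pr l2 (x * b`_j) = 0.
    have := congr1 (fun M : 'M_(1, \dim C) => M 0 j) vG; rewrite [X in _ = X]mxE => e.
    rewrite -[RHS]e mxE /x mulr_suml !pr_sum !mulr_sumr -big_split /=; apply: eq_bigr => i _.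
    by rewrite !mxE -scalerAl !prZ mulrDr !(mulrCA (v 0 i)).
  rewrite (coord_vbasis cC) mulr_sumr !pr_sum !mulr_sumr -big_split /= big1 // => j _.
  by rewrite -scalerAr !prZ !(mulrCA _ (coord _ _ _)) -mulrDr bz mulr0.
pose s := c2 *: s1 - c1 *: s2.
have sS : s \in soc N by rewrite memvB ?memvZ.
have [c20|c20] := eqVneq c2 0.
  have c10 : c1 != 0 by move: c0; rewrite c20 eqxx orbF.
  have [ka hk] : exists ka, forall u : car A, pr ka u = - c1^-1 * pr l2 (x * u).
    by apply: lin_pr => a u w; rewrite mulrDr -scalerAr prD prZ mulrDr mulrCA.
  exists x, s, s1, ka, (- c1^-1 *: l2), l1; split; first split=> //.
    move=> u uX; rewrite hk {1}(Se _ (XX _ _ xX uX)).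
    have := xz u uX; rewrite c20 mul0r addr0 => /eqP; rewrite mulf_eq0 (negbTE c10) => /eqP ->.
    rewrite /s c20 !scale0r !add0r scalerN scalerA -scaleNr; congr (_ *: _); by field.
  have prl (l : 'cV[K]_m) c u0 : pr (c *: l) u0 = c * pr l u0 by rewrite /pr -scalemxAr mxE.
  rewrite !prl /s c20 scale0r add0r !prN !prZ l11 l12 l21 l22; split; try ring; first by field.
  move=> u uS; rewrite prl {1}(Se u uS) addrC; congr (_ + _).
  by rewrite scalerN scalerA -scaleNr; congr (_ *: _); field.
have [ka hk] : exists ka, forall u : car A, pr ka u = c2^-1 * pr l1 (x * u).
  by apply: lin_pr => a u w; rewrite mulrDr -scalerAr prD prZ mulrDr mulrCA.
have prl (l : 'cV[K]_m) c u0 : pr (c *: l) u0 = c * pr l u0 by rewrite /pr -scalemxAr mxE.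
have prl2 (l l' : 'cV[K]_m) u0 : pr (l + l') u0 = pr l u0 + pr l' u0 by rewrite /pr mulmxDr mxE.
exists x, s, s2, ka, (c2^-1 *: l1), (l2 + (c1 / c2) *: l1); split; first split=> //.
  move=> u uX; rewrite hk {1}(Se _ (XX _ _ xX uX)).
  have e : pr l2 (x * u) = - (c1 / c2) * pr l1 (x * u).
    by apply: (mulfI c20); move/eqP: (xz u uX); rewrite addrC addr_eq0 => /eqP ->; field.
  rewrite e /s scalerBr !scalerA -scaleNr; congr (_ *: _ + _ *: _); field; exact: c20.
rewrite !prl2 !prl /s !prD !prN !prZ l11 l12 l21 l22; split; try ring; try (field; exact: c20).
move=> u uS; rewrite prl2 !prl {1}(Se u uS) scalerBr !scalerA -addrA -[- _]scaleNr -scalerDl.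
by congr (_ *: _ + _ *: _); field; exact: c20.
Qed.

(** [goodA_T2] for [L = X]: [pencil_soc] supplies [x], and the functionals [ka], [xi] are chosen to
    vanish at 1, on [Y] and on [N^2]. *)
Lemma goodA_T2X X Y : \dim (soc N) = 2%N -> (soc N <= N ^+ 2)%VS -> (X <= N)%VS -> ~~ (X <= N ^+ 2)%VS ->
  (Y <= N)%VS -> (N <= X + Y + N ^+ 2)%VS -> (X :&: (Y + N ^+ 2) <= N ^+ 2)%VS ->
  (forall u n, u \in X -> n \in (N ^+ 2)%VS -> u * n = 0) ->
  (forall u v, u \in X -> v \in X -> u * v \in soc N) ->
  (forall x s s' l l', x \in X -> s \in soc N -> s' \in soc N ->
    [/\ pr l s = 1, pr l s' = 0, pr l' s = 0, pr l' s' = 1 & forall u, u \in soc N -> u = pr l u *: s + pr l' u *: s'] ->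
    gen (fun t => exists z, [/\ z \in (N ^+ 2)%VS, forall n, n \in (N ^+ 2)%VS -> z * n = 0,
     forall v, v \in X -> z * v = 0 & forall v, v \in Y -> (x - z) * v \in <[s + t *: s']>%VS])) ->
  goodA A.
Proof.
move=> dS SN2 XN nX YN gN XY XN2 XX H.
have [x [s [s' [ka [l [l' [[xX xn sS sS' xka] hl]]]]]]] := pencil_soc dS nX XN2 XX.
pose W := (1 + (Y + N ^+ 2))%VS.
have XW : (X :&: W <= N ^+ 2)%VS.
  apply/subvP => u; rewrite memv_cap => /andP [uX /memv_addP [c c1 [w wY e]]].
  have YN2 : (Y + N ^+ 2 <= N)%VS by rewrite subv_add YN; apply: subv_trans (NpS lN 0) _; rewrite expv1.
  have cN : c \in N by rewrite -(addrK w c) -e; apply: memvB; [exact: (subvP XN) | exact: (subvP YN2)].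
  have c0 : c = 0.
    move/vlineP: c1 cN => [k ->] kN; have [->|k0] := eqVneq k 0; first by rewrite scale0r.
    by case/negP: (loc1 lN); have := memvZ k^-1 kN; rewrite scalerA mulVf // scale1r.
  by apply: (subvP XY); rewrite memv_cap uX e c0 add0r.
have s0 : s != 0.
  by case: hl => [h _ _ _ _]; apply: contra_eq_neq h => ->; rewrite pr0 eq_sym oner_neq0.
have kaN2 n : n \in (N ^+ 2)%VS -> n \in X -> pr ka n = 0.
  move=> nN nX'; have := xka n nX'; rewrite XN2 // => /esym /eqP.
  by rewrite scaler_eq0 (negbTE s0) orbF => /eqP.
have [ka' [ka1 ka2]] : exists l', (forall u, u \in X -> pr l' u = pr ka u) /\ (forall u, u \in W -> pr l' u = 0).
  by apply: pr_ext => u uXW; apply: kaN2; [exact: (subvP XW) | move: uXW; rewrite memv_cap => /andP []].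
have xW : x \notin W by apply: contra xn => xW; apply: (subvP XW); rewrite memv_cap xX.
have [xi [xi1 xi2]] := pr_sep xW.
apply: (@goodA_T2 _ _ _ _ lN K0 IH x s s' ka' xi X Y) => //.
- by move=> n; apply: XN2.
- by move=> v vX; rewrite ka1 // xka.
- have in1 : (1 : car A) \in W by apply: (subvP (addvSl _ _)); exact: memv_line.
  have in2 n : n \in (Y + N ^+ 2)%VS -> n \in W by apply: (subvP (addvSr _ _)).
  by move=> ll [->|->]; split=> [|n /in2]; [exact: ka2 | exact: ka2 | exact: xi2 | exact: xi2].
apply: gen_mono (H x s s' l l' xX sS sS' hl) => t hz; split=> //.
apply/eqP => h; case: hl => [h1 h2 _ _ _]; move: (pr0 l).
by rewrite -h prD prZ h1 h2 mulr0 addr0 => /eqP; rewrite oner_eq0.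
Qed.

End Pencil.

Section CubicRank1.
Variables (K : closedFieldType) (m : nat) (A : calg K m) (N : {vspace car A}).
Hypothesis lN : localA N.
Hypothesis K0 : [pchar K] =i pred0.
Hypothesis IH : forall k, (k < m)%N -> CM K k.
Implicit Types (u v w x y z s : car A) (U V W X Y : {vspace car A}).

Lemma line_mulP q U w : w \in (<[q]> * U)%VS -> exists2 v, v \in U & w = q * v.
Proof.
move: w; apply: (@prodv_ind _ _ A <[q]>%VS U (fun w => exists2 v, v \in U & w = q * v)).
- by exists 0; rewrite ?mem0v ?mulr0.
- by move=> u v [u' hu ->] [v' hv ->]; exists (u' + v'); rewrite ?memvD ?mulrDr.
- by move=> k u [u' hu ->]; exists (k *: u'); rewrite ?memvZ ?scalerAr.
- by move=> u v /vlineP [k ->] hv; exists (k *: v); rewrite ?memvZ // -scalerAr -scalerAl.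
Qed.

Lemma mem_line_mul q U v : v \in U -> q * v \in (<[q]> * U)%VS.
Proof. by move=> h; rewrite memv_mul // memv_line. Qed.

Lemma dim_line_mul a U : (\dim (U :&: ann <[a]>) + \dim (<[a]> * U) = \dim U)%N.
Proof.
rewrite prodvC -(limg_ker_dim (amulr a) U) limg_amulr; congr (\dim _ + _)%N.
by apply/vspaceP => u; rewrite !memv_cap memv_ker lfunE /= line_ann.
Qed.

Lemma ideal_line_mul q k u v : u \in (<[q]> * N ^+ k.+1)%VS -> u * v \in (<[q]> * N ^+ k.+1)%VS.
Proof. by case/line_mulP => w hw ->; rewrite -mulrA mem_line_mul // (Np_ideal lN). Qed.

(** Polarization in characteristic zero: [6 u v^2 = (v + u)^3 - (v - u)^3 - 2 u^3], and the squares
    span [N^2]. *)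
Lemma N3_ind (P : car A -> Prop) : P 0 -> (forall u v, P u -> P v -> P (u + v)) ->
  (forall k u, P u -> P (k *: u)) -> (forall u, u \in N -> P (u * u * u)) -> forall w, w \in (N ^+ 3)%VS -> P w.
Proof.
move=> P0 PD PZ Pc; have PB u v : P u -> P v -> P (u - v) by move=> hu hv; rewrite -scaleN1r; apply: PD => //; exact: PZ.
have three : (3%:R : K) != 0 by exact: natK_neq0.
have P2 u v : u \in N -> v \in N -> P (u * (v * v)).
  move=> uN vN; have -> : u * (v * v) = (6%:R^-1 : K) *: ((v + u) * (v + u) * (v + u) - (v - u) * (v - u) * (v - u)
     - (u * u * u + u * u * u)).
    apply: (scalerI (natK_neq0 K0 5)); rewrite scalerA mulfV ?(natK_neq0 K0 5) // scale1r scaler_nat; ring.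
  by apply: (PZ); apply: (PB); [apply: (PB) | apply: (PD)]; apply: (Pc) => //; [exact: memvD | exact: memvB].
move=> w; rewrite expvSl; move: w; apply: prodv_ind => // u v uN.
move: v; apply: (@N2_ind _ _ _ _ K0 (fun v => P (u * v))) => [|v w|k v|v vN].
- by rewrite mulr0.
- by rewrite mulrDr; exact: PD.
- by rewrite -scalerAr; exact: PZ.
- exact: P2.
Qed.

(** A cube [a^3] spans [N^3] modulo [N^4]. With [p = a^2], every [v] in [N] is a multiple of [a]
    plus some [u] with [p u] in [N^4], and [N^4 <= p N^2] allows the correction of [u]. If
    [p p = a^4] were 0, then [N^4 = N^5], hence [N^4 = 0]. *)
Lemma goodA_h3_1 : (N ^+ 4 != 0)%VS -> \dim (N ^+ 3) = (\dim (N ^+ 4)).+1 -> goodA A.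
Proof.
move=> N40 d3; have N43 : (N ^+ 4 <= N ^+ 3)%VS := NpS lN 2.
have [a aN a3] : exists2 a, a \in N & a * a * a \notin (N ^+ 4)%VS.
  apply: NNPP => h; have /dimvS : (N ^+ 3 <= N ^+ 4)%VS.
    apply/subvP; apply: (@N3_ind (fun w => w \in (N ^+ 4)%VS)); rewrite ?mem0v //.
    - by move=> u v; exact: memvD.
    - by move=> k u; exact: memvZ.
    by move=> u uN; apply: NNPP => h'; apply: h; exists u => //; apply/negP.
  by rewrite d3 ltnn.
have a2N : a * a \in (N ^+ 2)%VS := NN aN aN.
have a3N : a * a * a \in (N ^+ 3)%VS := NM1 a2N aN.
have g3 : (N ^+ 3 <= <[a * a * a]> + N ^+ 4)%VS.
  suff /eqP <- : (<[a * a * a]> + N ^+ 4 == N ^+ 3)%VS by exact: subvv.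
  rewrite eqEdim subv_add -memvE a3N N43 /= d3.
  rewrite dimv_disjoint_sum ?dim_vline; last first.
    apply/eqP; rewrite -subv0; apply/subvP => u; rewrite memv_cap => /andP [/vlineP [k ->] hk].
    have [->|k0] := eqVneq k 0; first by rewrite scale0r mem0v.
    by case/negP: a3; have := memvZ k^-1 hk; rewrite scalerA mulVf // scale1r.
  by rewrite (_ : _ != 0) //; apply: contraNneq a3 => ->; rewrite mem0v.
have N4 : (N ^+ 4 <= <[a * a]> * N ^+ 2)%VS.
  apply: (nakayama lN); first by move=> u v; exact: ideal_line_mul.
  have {1}-> : (N ^+ 4 = N * N ^+ 3)%VS by exact: expvSl.
  apply: subv_trans (prodvSr _ g3) _; rewrite prodvDr addvS //.
  rewrite prodvC; apply/subvP => w /line_mulP [v vN ->].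
  by rewrite -(mulrA (a * a) a v); apply: (@mem_line_mul (a * a) (N ^+ 2)%VS (a * v)); apply: NN.
have p2 : a * a * (a * a) != 0.
  apply/negP => /eqP h; case/negP: N40; rewrite -subv0; apply: (nakayama lN) => [u v|].
    by rewrite !memv0 => /eqP ->; rewrite mul0r.
  rewrite add0v.
  have g2 : (N ^+ 4 <= N * N ^+ 4)%VS.
    apply: (subv_trans N4); apply/subvP => w /line_mulP [v vN2 ->].
    have : v \in (N ^+ 2)%VS := vN2; move: v {vN2}.
    apply: (@N2_ind _ _ _ _ K0 (fun v => a * a * v \in (N * N ^+ 4)%VS)) => [|v w'|k v|v vN].
    - by rewrite mulr0 mem0v.
    - by rewrite mulrDr; exact: memvD.
    - by rewrite -scalerAr; exact: memvZ.
    have : a * v * v \in (N ^+ 3)%VS := NM1 (NN aN vN) vN.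
    move/(subvP g3)/memv_addP => [c /vlineP [k ->] [n nN e]].
    have -> : a * a * (v * v) = a * (a * v * v) by ring.
    rewrite e mulrDr -scalerAr (_ : a * (a * a * a) = a * a * (a * a)); last by ring.
    by rewrite h scaler0 add0r memv_mul.
  exact: g2.
pose U := (N :&: (amulr (a * a) @^-1: (N ^+ 4)))%VS.
have inU u : (u \in U) = (u \in N) && (u * (a * a) \in (N ^+ 4)%VS) by rewrite memv_cap -memv_preim lfunE.
apply: (@goodA_corr _ _ _ _ lN K0 IH U a (a * a)) => //.
- apply: subv_trans (addvSl _ _); apply/subvP => v vN.
  have : v * (a * a) \in (N ^+ 3)%VS by apply: N1M.
  move/(subvP g3)/memv_addP => [c /vlineP [k ->] [n nN e]].
  rewrite -(subrK (k *: a) v) addrC; apply: memv_add; first by rewrite memvZ ?memv_line.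
  rewrite inU memvB ?memvZ // mulrBl e -scalerAl mulrA [_ + n]addrC addrK //.
- exact: capvSl.
- move=> u; rewrite inU => /andP [uN /(subvP N4) /line_mulP [w wN e]].
  by exists w => //; rewrite -e mulrC.
- by apply: contraNneq N40 => ->; rewrite expvSl prod0v.
Qed.

End CubicRank1.

Lemma chain_lt3 (p q r : nat) : (0 < p)%N -> (p < q)%N -> (q < r)%N -> (r <= 2)%N -> False.
Proof. lia. Qed.

Lemma quad_coef (R : nzRingType) (c0 c1 c2 : R) :
  c0%:P + c1 *: 'X - c2 *: 'X^2 = 0 -> [/\ c0 = 0, c1 = 0 & c2 = 0].
Proof.
move=> g0; have h i := congr1 (fun p : {poly R} => p`_i) g0.
move: (h 0) (h 1) (h 2); rewrite !coefB !coefD !coefC !coefZ !coefX !coefXn ?coef0 /=.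
rewrite !mulr0 !mulr1 !subr0 !addr0 !add0r => -> -> /eqP; rewrite oppr_eq0 => /eqP -> //.
Qed.

Section LineDim.
Variables (K : fieldType) (vT : vectType K).
Implicit Types (v : vT) (U W : {vspace vT}).

Lemma dim_line_add v U : v \notin U -> \dim (<[v]> + U) = (\dim U).+1.
Proof.
move=> vU; have v0 : v != 0 by apply: contraNneq vU => ->; exact: mem0v.
rewrite dimv_disjoint_sum ?dim_vline ?v0 //; apply/eqP; rewrite -subv0; apply/subvP => u.
rewrite memv_cap => /andP [/vlineP [k ->] hk]; have [->|k0] := eqVneq k 0; first by rewrite scale0r mem0v.
by case/negP: vU; have := memvZ k^-1 hk; rewrite scalerA mulVf // scale1r.
Qed.

Lemma dim_line_le v U : (\dim (<[v]> + U) <= (\dim U).+1)%N.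
Proof.
have [vU|vU] := boolP (v \in U); last by rewrite dim_line_add.
by rewrite (addv_idPr _) -?memvE.
Qed.

Lemma dim_lt_ex U W : (\dim U < \dim W)%N -> exists2 v, v \in W & v \notin U.
Proof.
move=> h; apply: NNPP => hn; have /dimvS : (W <= U)%VS.
  by apply/subvP => u uW; apply: NNPP => uU; apply: hn; exists u => //; apply/negP.
by rewrite leqNgt h.
Qed.

Lemma eq_sub_dim U W : (U <= W)%VS -> (\dim W <= \dim U)%N -> (W <= U)%VS.
Proof. by move=> h1 h2; have /eqP -> : (U == W)%VS by rewrite eqEdim h1. Qed.

End LineDim.

(** * Two-dimensional N^2/N^3 and N^3/N^4 *)

Section RankTwo.
Variables (K : closedFieldType) (m : nat) (A : calg K m) (N : {vspace car A}).
Hypothesis lN : localA N.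
Hypothesis K0 : [pchar K] =i pred0.
Hypothesis IH : forall k, (k < m)%N -> CM K k.
Implicit Types (u v w x y z s : car A) (U V W X Y : {vspace car A}).

Section Multiplier.
Variable a : car A.
Hypothesis aN : a \in N.
Hypothesis aN2 : (N ^+ 2 <= <[a]> * N)%VS.

Lemma mult_pow k : (N ^+ k.+2 <= <[a]> * N ^+ k.+1)%VS.
Proof.
elim: k => [|k IHk] //; rewrite expvSl; apply: subv_trans (prodvSr _ IHk) _.
by rewrite prodvA (prodvC N) -prodvA -expvSl.
Qed.

Lemma mult_pow_eq k : (<[a]> * N ^+ k.+1 = N ^+ k.+2)%VS.
Proof. by apply: subv_anti; rewrite mult_pow andbT [X in (_ <= X)%VS]expvSl prodvSl // -memvE. Qed.

(** As [N^2 <= a N], this kernel annihilates all of [N^2]; it will be the [X] of [goodA_T2X]. *)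
Definition mker := (N :&: ann <[a]>)%VS.

Lemma mkerP u : (u \in mker) = (u \in N) && (u * a == 0).
Proof. by rewrite memv_cap line_ann. Qed.

Lemma mker_N2 u n : u \in mker -> n \in (N ^+ 2)%VS -> u * n = 0.
Proof.
rewrite mkerP => /andP [_ /eqP ua] /(subvP aN2) /line_mulP [v _ ->].
by rewrite mulrA ua mul0r.
Qed.

Lemma dim_mker k : (\dim (N ^+ k.+1 :&: ann <[a]>) + \dim (N ^+ k.+2) = \dim (N ^+ k.+1))%N.
Proof. by rewrite -mult_pow_eq dim_line_mul. Qed.

Lemma mker_capE k : (0 < k)%N -> (mker :&: N ^+ k = N ^+ k :&: ann <[a]>)%VS.
Proof.
move=> k0; have h : (N ^+ k <= N)%VS by apply/subvP => u; exact: (NpN lN).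
by rewrite /mker -capvA [(ann _ :&: _)%VS]capvC capvA (capv_idPr h).
Qed.

Lemma mker_mul u v : u \in mker -> v \in N -> u * v \in (N ^+ 2 :&: ann <[a]>)%VS.
Proof.
move=> h vN; move: (h); rewrite mkerP => /andP [uN /eqP ua].
by rewrite memv_cap line_ann (NN uN vN) /= mulrAC ua mul0r.
Qed.

(** Generators in [mker] disappear after one multiplication by [a], so only [a^(k+2)] and
    [a^(k+1) b] survive in each degree. *)
Lemma mult_gen b : (N <= <[a]> + (<[b]> + (mker + N ^+ 2)))%VS -> forall k,
  (N ^+ k.+2 <= <[a ^+ k.+2]> + (<[a ^+ k.+1 * b]> + N ^+ k.+3))%VS.
Proof.
move=> g; elim=> [|k IHk].
  apply: subv_trans aN2 _; apply/subvP => w /line_mulP [v /(subvP g) /memv_addP [c /vlineP [k ->]]].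
  move=> [v1 /memv_addP [d /vlineP [k' ->] [v2 /memv_addP [x]]]].
  rewrite mkerP => /andP [_ /eqP xa] [n nN ->] -> -> ->; rewrite !mulrDr -!scalerAr [a * x]mulrC xa add0r.
  rewrite -expr2 expr1. apply: memv_add; first by rewrite memvZ ?memv_line.
  by apply: memv_add; [rewrite memvZ ?memv_line | exact: (N1M aN nN)].
apply: subv_trans (mult_pow _) _; apply/subvP => w /line_mulP [v /(subvP IHk) /memv_addP [c /vlineP [j ->]]].
move=> [v1 /memv_addP [d /vlineP [j' ->] [n nN ->]] -> ->]; rewrite !mulrDr -!scalerAr (mulrA a (a ^+ k.+1) b) -!exprS.
apply: memv_add; first by rewrite memvZ ?memv_line.
by apply: memv_add; [rewrite memvZ ?memv_line | exact: (N1M aN nN)].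
Qed.

Hypothesis SE : soc N = (N ^+ 2 :&: ann <[a]>)%VS.

Lemma socP u : (u \in soc N) = (u \in (N ^+ 2)%VS) && (u * a == 0).
Proof. by rewrite SE memv_cap line_ann. Qed.

Lemma socN s v : s \in soc N -> v \in N -> s * v = 0.
Proof. by move=> /annP h /h. Qed.

(* [a ^+ k] cannot be reached from [b] and [mker]: so it is separated from the ideal
   they generate. *)
Lemma goodA_nilmult b k : (\dim (N ^+ 4) + 2 = \dim (N ^+ 3))%N -> b \in N -> (3 <= k)%N ->
  a ^+ k.+1 != 0 -> a ^+ k.+2 = 0 -> a ^+ 3 * b = 0 ->
  (N <= <[a]> + (<[b]> + (mker + N ^+ 2)))%VS ->
  (forall z, z \in (N ^+ 2)%VS -> a * z \in soc N -> b * z = 0) -> goodA A.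
Proof.
move=> d3 bN k3 ak ak1 a3b g hM.
have ab2 : a ^+ 2 * b \notin (N ^+ 4)%VS.
  apply/negP => h; have /dimvS : (N ^+ 3 <= <[a ^+ 3]> + N ^+ 4)%VS.
    apply: subv_trans (mult_gen g 1) _; apply: addvS => //; rewrite subv_add subvv andbT -memvE //.
  by rewrite leqNgt -d3 addn2 ltnS dim_line_le.
have apow j : a ^+ j.+1 \in (N ^+ j.+1)%VS.
  by elim: j => [|j IHj]; [rewrite expr1 expv1 | rewrite exprS; exact: N1M].
have ab_s : a ^+ 2 * b \in soc N.
  have h : a ^+ 2 * b \in (N ^+ 3)%VS := NM1 (apow 1%N) bN.
  by rewrite socP (subvP (NpS lN 1) _ h) /= mulrAC -exprSr a3b.
have abb : b * (a * b) = 0 by apply: hM; [exact: NN | rewrite mulrA -expr2].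
pose U := (<[b]> + mker)%VS.
have XA : (mker * fullv <= mker)%VS.
  apply/prodvP => u v uX _; have [c [n [nN ->]]] := loc_dec lN v.
  rewrite mulrDr -scalerAr mulr1 memvD ?memvZ //.
  have := mker_mul uX nN; rewrite memv_cap mkerP line_ann => /andP [h ->]; rewrite andbT.
  exact: (NpN lN _ h).
(* Multiply a hypothetical expression by [a]: only multiples of [a b] and [a^2 b] remain. A second
   multiplication removes the first, so [a^2 b] would be a multiple of [a^(k+1)], in [N^4]. *)
have pU : a ^+ k \notin (U * fullv)%VS.
  apply/negP; rewrite prodvDl => /memv_addP [w /line_mulP [u _ ->] [x /(subvP XA) xX e]].
  have [c [n [nN eu]]] := loc_dec lN u.
  case/memv_addP: (subvP g n nN) => d /vlineP [al ->] [n1 /memv_addP [d' /vlineP [be ->] [n2 /memv_addP [x' xX' [n3 nN3 ->]] ->]] en].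
  have xa : x * a = 0 by move: xX; rewrite mkerP => /andP [_ /eqP].
  have xa' : x' * a = 0 by move: xX'; rewrite mkerP => /andP [_ /eqP].
  have [n4 nN4 en3] := line_mulP (subvP aN2 _ nN3).
  have e1 : a ^+ k.+1 = c *: (a * b) + al *: (a ^+ 2 * b).
    rewrite exprSr e mulrDl xa addr0 eu en en3 !(mulrDl, mulrDr) -!(scalerAr, scalerAl) mulr1.
    have -> : b * b * a = 0 by rewrite -abb; ring.
    have -> : b * x' * a = 0 by rewrite -mulrA xa' mulr0.
    have -> : b * (a * n4) * a = 0 by rewrite -(socN ab_s nN4); ring.
    rewrite scaler0 !addr0; congr (_ *: _ + _ *: _); first by rewrite mulrC.
    by ring.
  have c0 : c = 0.
    apply/eqP; have := ak1; rewrite exprS e1 mulrDr -!scalerAr [a * (a * b)]mulrA -expr2 [a * (_ * b)]mulrA -exprS a3b scaler0 addr0.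
    move/eqP; rewrite scaler_eq0 => /orP [|/eqP h] //.
    by case/negP: ab2; rewrite h mem0v.
  move: e1; rewrite c0 scale0r add0r => e1.
  have al0 : al != 0 by apply: contraNneq ak => h; rewrite e1 h scale0r.
  case/negP: ab2; rewrite -[_ * b](scalerK al0) -e1 memvZ //.
  by apply: (subvP (Np_le lN _ _)) (apow k).
have [l [l1 l2]] := pr_sep pU.
apply: (@goodA_lE1 _ _ _ _ lN K0 IH U a (a ^+ k) l).
- by apply: subv_trans g _; rewrite -!addvA.
- by apply: contraNneq ak => h; move: aN; rewrite h memv0 => /eqP ->; rewrite expr0n.
- move=> u /memv_addP [w /vlineP [c ->] [x]]; rewrite mkerP => /andP [_ /eqP xa] ->.
  rewrite mulrDr -scalerAr -(subnKC k3) exprD mulrAC a3b mul0r scaler0 add0r.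
  by rewrite -exprD subnKC // -(prednK (ltnW (ltnW k3))) exprSr -mulrA [a * x]mulrC xa mulr0.
- by move=> u v uU; apply: l2; rewrite memv_mul ?memvf.
by rewrite l1 oner_neq0.
Qed.

End Multiplier.

(** When the socle has dimension two, it is [N^2 :&: ann a] and lies in [N^3 = a N^2]. On the
    elements that [a] sends to the socle, multiplication by a further generator [b] is compared with
    multiplication by [a]: if it is a scalar multiple, [goodA_nilmult] applies, otherwise
    [goodA_T2X]. *)
Lemma goodA_h2_2 : (N ^+ 4 != 0)%VS -> \dim (N ^+ 2) = (\dim (N ^+ 3) + 2)%N ->
  (\dim (N ^+ 4) + 2 = \dim (N ^+ 3))%N -> (\dim (N ^+ 4) <= 2)%N -> (\dim (N ^+ 2) + 3 <= \dim N)%N ->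
  (\dim (soc N) <= 2)%N -> (soc N <= N ^+ 2)%VS -> goodA A.
Proof.
move=> N40 d2 d3 d4 dN dS SN2.
have [a aN aN2'] := net2 lN K0 d2.
have aN2 : (N ^+ 2 <= <[a]> * N)%VS.
  apply: (nakayama lN) => [u v h|]; first by rewrite -[N]expv1 ideal_line_mul // expv1.
  by rewrite -expvSl.
have dX := dim_mker aN aN2 0; rewrite expv1 -/(mker a) in dX.
have dX2 : \dim (N ^+ 2 :&: ann <[a]>) = 2%N.
  by apply/eqP; rewrite -(eqn_add2r (\dim (N ^+ 3))) (dim_mker aN aN2 1) d2 addnC.
have dX3 : \dim (N ^+ 3 :&: ann <[a]>) = 2%N.
  by apply/eqP; rewrite -(eqn_add2r (\dim (N ^+ 4))) (dim_mker aN aN2 2) -d3 addnC.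
have XnN2 : ~~ (mker a <= N ^+ 2)%VS.
  apply/negP => h; have := dimvS h; move: dX2; rewrite -mker_capE // (capv_idPl h) => e _.
  by move: dN; rewrite -dX e addnC leq_add2r.
have X2 := @mker_N2 a aN2.
have N0 : (N != 0)%VS by apply: contraNneq N40 => ->; rewrite expvSl prod0v.
have [dS1|dS1] := eqVneq (\dim (soc N)) 1%N.
  case/subvPn: XnN2 => x xX xN2; apply: (@goodA_T1 _ _ _ _ lN K0 IH x) => //.
    by move: xX; rewrite mkerP => /andP [].
  by move=> n; exact: X2.
have {dS1}dS : \dim (soc N) = 2%N.
  by move: dS dS1 (soc_neq0 lN); rewrite -dimv_eq0; case: (\dim _) => [|[|[|]]].
have SX2 : (soc N <= N ^+ 2 :&: ann <[a]>)%VS.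
  by rewrite subv_cap SN2; apply/subvP => u /annP h; rewrite line_ann h.
have SE : soc N = (N ^+ 2 :&: ann <[a]>)%VS by apply/eqP; rewrite eqEdim SX2 dX2 dS.
have SN3 : (soc N <= N ^+ 3)%VS.
  rewrite SE; apply: subv_trans (capvSl _ (ann <[a]>)); apply: eq_sub_dim; last by rewrite dX2 dX3.
  exact: capvS (NpS lN 1) (subvv _).
have zs s : s \in soc N -> exists2 z, z \in (N ^+ 2)%VS & s = a * z.
  by move=> /(subvP SN3) /(subvP (mult_pow aN2 1)) /line_mulP [z zN ->]; exists z.
have XS u v : u \in mker a -> v \in N -> u * v \in soc N by rewrite SE; exact: mker_mul.
have SN s v : s \in soc N -> v \in N -> s * v = 0 := @socN s v.
pose W := (<[a]> + (mker a + N ^+ 2))%VS.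
have aX : a \notin (mker a + N ^+ 2)%VS.
  apply/negP => /memv_addP [x xX [n nN ea]].
  have /dimvS : (N ^+ 2 <= N ^+ 3)%VS.
    apply: subv_trans aN2 _; apply/subvP => w /line_mulP [v vN ->]; rewrite ea mulrDl.
    by rewrite memvD ?(NM1 nN vN) // (subvP SN3) // XS.
  by rewrite d2 addn2 ltnNge leqnSn.
have dXN : (\dim (mker a + N ^+ 2) + 2 = \dim N)%N.
  by have := dimv_sum_cap (mker a) (N ^+ 2); rewrite mker_capE // dX2 => ->; rewrite dX.
have XN : (mker a <= N)%VS by exact: capvSl.
have N2N : (N ^+ 2 <= N)%VS by have := NpS lN 0; rewrite expv1.
have WN : (W <= N)%VS by rewrite !subv_add -memvE aN XN.
have [b bN bW] : exists2 b, b \in N & b \notin W.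
  by apply: dim_lt_ex; rewrite dim_line_add // -dXN addn2.
have gW : (N <= <[b]> + W)%VS.
  apply: eq_sub_dim; first by rewrite subv_add -memvE bN.
  by rewrite !dim_line_add // -dXN addn2.
have bzS z c : z \in (N ^+ 2)%VS -> c \in N -> a * z \in soc N -> c * z \in soc N.
  move=> zN cN h; rewrite SE memv_cap line_ann (subvP (NpS lN 1) _ (N1M cN zN)) /=.
  by rewrite -mulrA mulrC [z * a]mulrC SN.
have [[be hM]|nsc] := classic (exists be, forall z, z \in (N ^+ 2)%VS -> a * z \in soc N -> b * z = be *: (a * z)).
  (* Now [b1] kills every [z] in [N^2] with [a z] in the socle, in particular the power of [a] just
     below the top one. *)
  pose b1 := b - be *: a.
  have b1N : b1 \in N by rewrite memvB ?memvZ.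
  have hM1 z : z \in (N ^+ 2)%VS -> a * z \in soc N -> b1 * z = 0.
    by move=> zN h; rewrite mulrBl hM // -scalerAl subrr.
  have g1 : (N <= <[a]> + (<[b1]> + (mker a + N ^+ 2)))%VS.
    apply: subv_trans gW _; rewrite subv_add /W subv_add addvSl -memvE /=; apply/andP; split; last first.
      by apply: subv_trans (addvSr _ _); exact: addvSr.
    rewrite -(subrK (be *: a) b) addrC; apply: memv_add; first by rewrite memvZ ?memv_line.
    by apply: (subvP (addvSl _ _)); exact: memv_line.
  have G := mult_gen aN aN2 g1.
  have apow j : a ^+ j.+1 \in (N ^+ j.+1)%VS.
    by elim: j => [|j IHj]; [rewrite expr1 expv1 | rewrite exprS; exact: N1M].
  have top j : (N ^+ j.+4 = 0)%VS -> (N ^+ j.+3 != 0)%VS -> a ^+ j.+2 * b1 = 0 /\ (N ^+ j.+3 = <[a ^+ j.+3]>)%VS.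
    move=> z nz; have aS : a * a ^+ j.+2 \in soc N.
      rewrite -exprS; apply/annP => v vN; have := NM1 (apow j.+2) vN; rewrite z memv0 => /eqP //.
    have h0 : a ^+ j.+2 * b1 = 0.
      by rewrite mulrC hM1 //; apply: (subvP (Np_le lN _ _)) (apow j.+1).
    split=> //; apply: subv_anti; rewrite -memvE apow andbT; apply: subv_trans (G j.+1) _.
    by rewrite h0 z addv0 subv_add subvv -memvE mem0v.
  have [N50|N50] := eqVneq (N ^+ 5)%VS 0%VS.
    have [h0 e4] := top 1%N N50 N40.
    apply: (@goodA_nilmult a aN aN2 SE b1 3) => //.
    - by apply: contraNneq N40; rewrite e4 => ->; rewrite -subv0 -memvE mem0v.
    - by apply/eqP; rewrite -memv0 -N50 apow.
  have d5 : (0 < \dim (N ^+ 5) < \dim (N ^+ 4))%N by rewrite lt0n dimv_eq0 N50 (Np_lt lN).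
  have N60 : (N ^+ 6 = 0)%VS.
    apply/eqP; apply/negPn/negP => h; have := Np_lt lN (isT : (0 < 5)%N) N50.
    have h6 : (0 < \dim (N ^+ 6))%N by rewrite lt0n dimv_eq0 h.
    case/andP: d5 => _ h5 h'.
    exact: chain_lt3 h6 h' h5 d4.
  have [h0 e5] := top 2%N N60 N50.
  have a50 : a ^+ 5 != 0.
    by apply: contraNneq N50; rewrite e5 => ->; rewrite -subv0 -memvE mem0v.
  have a60 : a ^+ 6 = 0 by apply/eqP; rewrite -memv0 -N60 apow.
  have a4n : a ^+ 4 \notin (N ^+ 5)%VS.
    by rewrite e5; apply/negP => /vlineP [k e]; case/eqP: a50; rewrite exprSr e -scalerAl -exprSr a60 scaler0.
  have N4e : (N ^+ 4 <= <[a ^+ 4]> + N ^+ 5)%VS.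
    apply: eq_sub_dim; first by rewrite subv_add -memvE apow (NpS lN 3).
    rewrite dim_line_add //; apply: leq_trans d4 _; case/andP: d5 => h _; exact: h.
  have : a ^+ 3 * b1 \in (N ^+ 4)%VS by exact: NM1 (apow 2%N) b1N.
  move/(subvP N4e)/memv_addP => [u /vlineP [c ->] [n]]; rewrite e5 => /vlineP [c' ->] e.
  have c0 : c = 0.
    have : a * (a ^+ 3 * b1) = 0 by rewrite mulrA -exprS.
    rewrite e mulrDr -!scalerAr -!exprS a60 scaler0 addr0 => /eqP.
    by rewrite scaler_eq0 (negbTE a50) orbF => /eqP.
  move: e; rewrite c0 scale0r add0r => e.
  (* If [N^5 <> 0], the product [a^3 b1] need not vanish but is [c' a^5]; subtracting [c' a^2] from
     [b1] removes it. *)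
  apply: (@goodA_nilmult a aN aN2 SE (b1 - c' *: a ^+ 2) 4) => //.
  - by rewrite memvB ?memvZ // (subvP N2N) ?apow.
  - by rewrite mulrBr e -scalerAr -exprD subrr.
  - apply: subv_trans g1 _; rewrite subv_add addvSl /= subv_add; apply/andP; split; last first.
      by apply: subv_trans (addvSr _ _); exact: addvSr.
    rewrite -memvE -[X in X \in _](subrK (c' *: a ^+ 2)); apply: (subvP (addvSr _ _)); apply: memv_add; first exact: memv_line.
    by apply: (subvP (addvSr _ _)); rewrite memvZ ?(apow 1%N).
  - by move=> z zN h; rewrite mulrBl hM1 // -scalerAl expr2 -mulrA (mulrC a (a * z)) (SN _ _ h aN) scaler0 subrr.
pose Y := (<[a]> + <[b]>)%VS.
have YN : (Y <= N)%VS by rewrite subv_add -!memvE aN bN.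
apply: (@goodA_T2X _ _ _ _ lN K0 IH (mker a) Y) => //.
- apply: subv_trans gW _; rewrite /W /Y !subv_add; apply/and4P; split.
  + by apply: subv_trans (addvSl _ _); apply: subv_trans (addvSr _ _); exact: addvSr.
  + by apply: subv_trans (addvSl _ _); apply: subv_trans (addvSr _ _); exact: addvSl.
  + by apply: subv_trans (addvSl _ _); exact: addvSl.
  + exact: addvSr.
- apply/subvP => u; rewrite memv_cap => /andP [uX /memv_addP [y /memv_addP [c /vlineP [al ->] [d /vlineP [be ->] ->]] [n nN e]]].
  have be0 : be = 0.
    apply/eqP/negPn/negP => h; case/negP: bW; rewrite -[X in X \in _](scalerK h) memvZ //.
    have -> : be *: b = - al *: a + (u - n) by rewrite e scaleNr; ring.
    by apply: memv_add; [rewrite memvZ ?memv_line | apply: memv_add => //; rewrite memvN].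
  have al0 : al = 0.
    apply/eqP/negPn/negP => h; case/negP: aX; rewrite -[X in X \in _](scalerK h) memvZ //.
    have -> : al *: a = u - n by rewrite e be0 scale0r; ring.
    by apply: memv_add; rewrite ?memvN.
  by rewrite e al0 be0 !scale0r !add0r.
- by move=> u v uX vX; apply: XS => //; apply: (subvP XN).
move=> x s s' l l' xX sS sS' [l1 l2 l3 l4 le].
have [z zN ez] := zs s sS; have [z' zN' ez'] := zs s' sS'.
have bz : b * z \in soc N by apply: bzS; rewrite -?ez.
have bz' : b * z' \in soc N by apply: bzS; rewrite -?ez'.
(* The correction will be [c (z + t z')], whose product with [a] is in the line of [s + t s'] for
   every [c]. The product with [b] leaves one linear equation for [c], with coefficient [g.[t]]; and
   [g = 0] would make [b] a scalar multiple of [a] in the sense of [nsc]. *)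
pose g := (pr l' (b * z))%:P + (pr l' (b * z') - pr l (b * z)) *: 'X - pr l (b * z') *: 'X^2.
have [g0|g0] := eqVneq g 0.
  case: nsc; exists (pr l (b * z)) => w wN awS.
  have [c0 /eqP c1 c2] := @quad_coef K _ _ _ g0; move: c1; rewrite subr_eq0 => /eqP c1.
  pose k := pr l (a * w); pose k' := pr l' (a * w).
  have eaw : a * w = k *: s + k' *: s' by exact: le.
  pose w0 := w - k *: z - k' *: z'.
  have w0S : w0 \in soc N.
    rewrite SE memv_cap line_ann; rewrite !memvB ?memvZ //= !mulrBl -!scalerAl !(mulrC _ a) -ez -ez' eaw.
    by apply/eqP; ring.
  have ebw : b * w = k *: (b * z) + k' *: (b * z').
    have : b * w0 = 0 by rewrite mulrC SN.
    by rewrite /w0 !mulrBr -!scalerAr => /eqP; rewrite -addrA -opprD subr_eq0 => /eqP.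
  have e1 : b * z = pr l (b * z) *: s by rewrite {1}(le _ bz) c0 scale0r addr0.
  have e2 : b * z' = pr l (b * z) *: s' by rewrite {1}(le _ bz') c1 c2 scale0r add0r.
  move: (pr l (b * z)) e1 e2 => be e1 e2.
  by rewrite ebw eaw e2 e1 scalerDr !scalerA [k * _]mulrC [k' * _]mulrC.
apply: gen_mono (gen_ne g0) => t gt.
have gE : g.[t] = pr l' (b * z) + t * (pr l' (b * z') - pr l (b * z)) - t ^+ 2 * pr l (b * z').
  by rewrite /g !(hornerD, hornerN, hornerZ, hornerC, hornerX, hornerXn); ring.
pose c := (pr l' (x * b) - t * pr l (x * b)) / g.[t].
have cE : c * g.[t] = pr l' (x * b) - t * pr l (x * b) by rewrite /c divfK.
pose zt := c *: (z + t *: z').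
have ztN : zt \in (N ^+ 2)%VS by rewrite memvZ ?memvD ?memvZ.
have zta : zt * a = c *: (s + t *: s').
  by rewrite /zt -scalerAl mulrDl -scalerAl !(mulrC _ a) -ez -ez'.
have ztS : c *: (s + t *: s') \in soc N by rewrite memvZ ?memvD ?memvZ.
exists zt; split=> //.
- by move=> n /(subvP aN2) /line_mulP [v vN ->]; rewrite mulrA zta SN.
- by move=> v vX; rewrite mulrC X2.
move=> v /memv_addP [v1 /vlineP [k ->] [v2 /vlineP [k' ->] ->]].
have xa : x * a = 0 by move: xX; rewrite mkerP => /andP [_ /eqP].
rewrite mulrDr -!scalerAr memvD // memvZ // mulrBl.
  by rewrite xa zta sub0r memvN memvZ ?memv_line.
have xbS : x * b \in soc N by exact: XS.
have ztb : zt * b = c *: (b * z + t *: (b * z')).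
  by rewrite /zt -scalerAl mulrDl -scalerAl !(mulrC _ b).
have : x * b - zt * b = pr l (x * b - zt * b) *: (s + t *: s').
  have hS : x * b - zt * b \in soc N.
    by rewrite ztb memvB ?memvZ ?memvD ?memvZ.
  rewrite {1}(le _ hS) scalerDr scalerA; congr (_ + _ *: _).
  rewrite ztb !prD !prN !prZ !prD !prZ.
  have := cE; rewrite gE => e; apply/eqP; rewrite -subr_eq0; apply/eqP.
  transitivity (pr l' (x * b) - t * pr l (x * b) - c * (pr l' (b * z) + t * (pr l' (b * z') - pr l (b * z)) - t ^+ 2 * pr l (b * z'))); first by ring.
  by rewrite e subrr.
by move=> ->; rewrite memvZ ?memv_line.
Qed.

End RankTwo.

Lemma fun_choice (A B : Type) (R : A -> B -> Prop) :
  (forall x, exists y, R x y) -> exists f, forall x, R x (f x).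
Proof.
by move=> h; exists (fun x => proj1_sig (constructive_indefinite_description _ (h x))) => x; case: (constructive_indefinite_description _ _).
Qed.

(** * Lifting along a surjective differential *)

Section Hensel.
Variable K : closedFieldType.

(** [Fh] is the same expression evaluated at points with polynomial coordinates, where congruences
    modulo powers of the variable make sense. *)
Lemma pf_cong (I : Type) (F : (I -> K) -> K) : polyfun F ->
  exists2 Fh : (I -> {poly K}) -> {poly K}, forall P t, (Fh P).[t] = F (fun i => (P i).[t])
  & forall P Q k, (forall i, exists q, P i = Q i + 'X^k * q) -> exists q, Fh P = Fh Q + 'X^k * q.
Proof.
elim=> {F}.
- move=> c; exists (fun _ => c%:P) => [P t|P Q k _]; first by rewrite hornerC.
  by exists 0; rewrite mulr0 addr0.
- by move=> i; exists (fun P => P i).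
- move=> F G _ [Fh h1 h2] _ [Gh g1 g2]; exists (fun P => Fh P + Gh P) => [P t|P Q k h].
    by rewrite hornerD h1 g1.
  by have [q ->] := h2 _ _ _ h; have [q' ->] := g2 _ _ _ h; exists (q + q'); ring.
- move=> F G _ [Fh h1 h2] _ [Gh g1 g2]; exists (fun P => Fh P * Gh P) => [P t|P Q k h].
    by rewrite hornerM h1 g1.
  have [q ->] := h2 _ _ _ h; have [q' ->] := g2 _ _ _ h.
  by exists (q * Gh Q + Fh Q * q' + 'X^k * q * q'); ring.
- by move=> F G _ [Fh h1 h2] FG; exists Fh => // P t; rewrite h1 FG.
Qed.

(** An equation of [S] takes on [T] a polynomial value divisible by every power of the variable,
    hence 0. *)
Lemma zcl_adic (I : Type) (S : (I -> K) -> Prop) (T : I -> {poly K}) :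
  (forall k, exists2 P : I -> {poly K}, forall t, zcl S (fun i => (P i).[t])
     & forall i, exists q, P i = T i + 'X^k * q) -> forall t, zcl S (fun i => (T i).[t]).
Proof.
move=> h t F pF FS; have [Fh h1 h2] := pf_cong pF; rewrite -h1.
suff -> : Fh T = 0 by rewrite horner0.
have [P PS PT] := h (size (Fh T)); have [q e] := h2 _ _ _ PT.
have P0 : Fh P = 0 by apply: poly_eq0 => s; rewrite h1; apply: PS.
have eT : Fh T = 'X^(size (Fh T)) * (- q).
  by rewrite mulrN; apply/eqP; rewrite -subr_eq0 opprK -e P0.
apply/eqP/negPn/negP => T0; have q0 : - q != 0 by apply: contraNneq T0 => h0; rewrite eT h0 mulr0.
have := congr1 (fun p : {poly K} => size p) eT; rewrite mulrC size_mulXn //.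
by move/eqP; rewrite -[X in X == _]addn0 eqn_add2l eq_sym size_poly_eq0 (negbTE q0).
Qed.

(* [F] is a polynomial function and [D] its differential at [x0]. *)
Inductive pfder (I : Type) (x0 : I -> K) : ((I -> K) -> K) -> ((I -> K) -> K) -> Prop :=
| pd_const c : pfder x0 (fun _ => c) (fun _ => 0)
| pd_coord i : pfder x0 (fun x => x i) (fun v => v i)
| pd_add F D G E : pfder x0 F D -> pfder x0 G E -> pfder x0 (fun x => F x + G x) (fun v => D v + E v)
| pd_mul F D G E : pfder x0 F D -> pfder x0 G E ->
    pfder x0 (fun x => F x * G x) (fun v => D v * G x0 + F x0 * E v).

Lemma pd_sum (I : Type) (x0 : I -> K) (T : Type) (s : seq T) F D :
  (forall j, pfder x0 (F j) (D j)) ->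
  exists2 F', F' =1 (fun x => \sum_(j <- s) F j x) & exists2 D', D' =1 (fun v => \sum_(j <- s) D j v) & pfder x0 F' D'.
Proof.
move=> h; elim: s => [|j s [F' hF [D' hD hp]]].
  exists (fun _ => 0) => [x|]; first by rewrite big_nil.
  by exists (fun _ => 0) => [x|]; [rewrite big_nil | exact: pd_const].
exists (fun x => F j x + F' x) => [x|]; first by rewrite big_cons hF.
exists (fun x => D j x + D' x) => [x|]; first by rewrite big_cons hD.
exact: pd_add.
Qed.

(** Taylor expansion: a change of the path in order [k + 1] changes the value by the differential at
    the starting point, up to order [k + 2]. *)
Lemma pfder_path (I : Type) (x0 : I -> K) F D : pfder x0 F D ->
  forall (x : I -> {poly K}) (v : I -> K) k, (forall i, (x i).[0] = x0 i) ->
  exists p r : {poly K}, [/\ forall t, F (fun i => (x i).[t]) = p.[t], p.[0] = F x0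
   & forall t, F (fun i => (x i + 'X^(k.+1) * (v i)%:P).[t]) = (p + 'X^(k.+1) * (D v)%:P + 'X^(k.+2) * r).[t]].
Proof.
move=> h x v k hx; elim: h => {F D}.
- by move=> c; exists c%:P, 0; rewrite polyC0 !mulr0 !addr0 !hornerC; split=> // t; rewrite hornerC.
- by move=> i; exists (x i), 0; split=> // t; rewrite mulr0 addr0.
- move=> F D G E _ [p [r [h1 h2 h3]]] _ [q [s [g1 g2 g3]]]; exists (p + q), (r + s); split=> [t||t].
  + by rewrite h1 g1 hornerD.
  + by rewrite hornerD h2 g2.
  by rewrite h3 g3 -hornerD polyCD; congr _.[t]; ring.
move=> F D G E _ [p [r [h1 h2 h3]]] _ [q [s [g1 g2 g3]]].
have cst (u : {poly K}) : exists u', u = (u.[0])%:P + 'X * u'.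
  have : root (u - (u.[0])%:P) 0 by rewrite /root !hornerE subrr.
  by case/factor_theorem => u' e; exists u'; rewrite mulrC -[X in u' * X]subr0 -e addrC subrK.
have [p' ep] := cst p; have [q' eq] := cst q; rewrite h2 in ep; rewrite g2 in eq.
exists (p * q), (p * s + q * r + 'X^k * ((D v)%:P + 'X * r) * ((E v)%:P + 'X * s) + (D v)%:P * q' + p' * (E v)%:P).
split=> [t||t]; first by rewrite h1 g1 hornerM.
  by rewrite hornerM h2 g2.
rewrite h3 g3 -hornerM polyCD !polyCM; congr _.[t].
have -> : ((G x0)%:P : {poly K}) = q - 'X * q' by rewrite [q]eq addrK.
have -> : ((F x0)%:P : {poly K}) = p - 'X * p' by rewrite [p]ep addrK.
by rewrite !exprS; ring.
Qed.

(* A polynomial map is dominant onto the affine space cut out by linear equations as soon as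
   its differential at one point is onto. *)
Lemma zcl_dominant (I J : Type) (x0 : I -> K) (Psi D : (I -> K) -> J -> K) (E : J -> J -> Prop) (Z : J -> Prop)
   (Sol := fun C : J -> K => (forall i j, E i j -> C i = C j) /\ forall i, Z i -> C i = 0) S :
  (forall j, exists2 F, F =1 Psi^~ j & exists2 G, G =1 D^~ j & pfder x0 F G) ->
  (forall x, Sol (Psi x)) -> (forall x, zcl S (Psi x)) ->
  (forall C, Sol C -> exists v, forall j, D v j = C j) -> forall C, Sol C -> zcl S C.
Proof.
move=> pP PSol PS Dsurj C CSol.
have PE x y : x =1 y -> forall j, Psi x j = Psi y j.
  move=> e j; have [F eF [G _ h]] := pP j; rewrite -!eF.
  by elim: h => {F G eF} // F G F' G' _ h1 _ h2; rewrite h1 h2.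
(* The segment from [Psi x0] to [C]. It is lifted near its beginning only, and to finite order,
   which is all that [zcl_adic] needs. *)
pose T j : {poly K} := (Psi x0 j)%:P + 'X * (C j - Psi x0 j)%:P.
have T1 : C =1 fun j => (T j).[1] by move=> j; rewrite /T hornerD hornerM hornerX !hornerC mul1r addrC subrK.
suff h k : exists x : I -> {poly K}, (forall i, (x i).[0] = x0 i) /\
    forall j, exists p q : {poly K}, (forall t, Psi (fun i => (x i).[t]) j = p.[t]) /\ p = T j + 'X^(k.+1) * q.
  apply: zcl_ext (fsym T1) _; apply: zcl_adic => k; have [x [_ hx]] := h k.
  have ch j : exists p : {poly K}, (forall t, Psi (fun i => (x i).[t]) j = p.[t]) /\ exists q, p = T j + 'X^k * q.
    by have [p [q [h1 h2]]] := hx j; exists p; split=> //; exists ('X * q); rewrite h2 exprSr mulrA.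
  have [P hP] := fun_choice ch.
  exists P => [t|j]; last by case: (hP j).
  by apply: zcl_ext (PS (fun i => (x i).[t])) => j; case: (hP j).
elim: k => [|k [x [hx0 hx]]].
  exists (fun i => (x0 i)%:P); split=> [i|j]; first by rewrite hornerC.
  exists (Psi x0 j)%:P, (- (C j - Psi x0 j)%:P); rewrite expr1 /T mulrN addrK; split=> // t.
  by rewrite hornerC; apply: PE => i; rewrite hornerC.
have ch j : exists pq : {poly K} * {poly K},
    (forall t, Psi (fun i => (x i).[t]) j = pq.1.[t]) /\ pq.1 = T j + 'X^(k.+1) * pq.2.
  by have [p [q h]] := hx j; exists (p, q).
have [pq hpq] := fun_choice ch.
pose p j := (pq j).1; pose q j := (pq j).2.
have hp j t : Psi (fun i => (x i).[t]) j = (p j).[t] by case: (hpq j).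
have hq j : p j = T j + 'X^(k.+1) * q j by case: (hpq j).
clearbody p q => {pq hpq}.
have Xk0 : ('X^(k.+1) : {poly K}) != 0 by rewrite -size_poly_eq0 size_polyXn.
have TSol t : Sol (fun j => (T j).[t]).
  by case: CSol (PSol x0) => [c1 c2] [d1 d2]; split=> [i j e|i z]; rewrite /T !hornerE;
     [rewrite (c1 _ _ e) (d1 _ _ e) | rewrite (c2 _ z) (d2 _ z) subr0 mulr0 addr0].
have qSol : Sol (fun j => - (q j).[0]).
  have pe i j : (forall t, (p i - T i).[t] = (p j - T j).[t]) -> q i = q j.
    move=> h; apply: (mulfI Xk0); apply/eqP; rewrite -subr_eq0; apply/eqP; apply: poly_eq0 => t.
    by move: (h t); rewrite !hq [T i + _]addrC [T j + _]addrC !addrK hornerD hornerN => ->; rewrite subrr.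
  split=> [i j e|i z].
    rewrite (pe i j) // => t; rewrite !hornerD !hornerN -!hp.
    by have [c1 _] := PSol (fun i => (x i).[t]); have [d1 _] := TSol t; rewrite (c1 _ _ e) (d1 _ _ e).
  suff -> : q i = 0 by rewrite horner0 oppr0.
  apply: (mulfI Xk0); rewrite mulr0; apply: poly_eq0 => t.
  have -> : 'X^(k.+1) * q i = p i - T i by rewrite hq [T i + _]addrC addrK.
  rewrite hornerD hornerN -hp.
  by have [_ c1] := PSol (fun i => (x i).[t]); have [_ d1] := TSol t; rewrite (c1 _ z) (d1 _ z) subrr.
(* The leading coefficient of the error satisfies the same linear equations, so it is in the image
   of the differential and one more order can be corrected. *)
have [v hv] := Dsurj _ qSol.
exists (fun i => x i + 'X^(k.+1) * (v i)%:P); split=> [i|j].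
  by rewrite hornerD hornerM hornerXn expr0n /= mul0r addr0.
have [F eF [G eG h]] := pP j; have [p1 [r [h1 h2 h3]]] := pfder_path h v k hx0.
have ep : p1 = p j.
  apply/eqP; rewrite -subr_eq0; apply/eqP; apply: poly_eq0 => t.
  by rewrite hornerD hornerN -h1 eF hp subrr.
have [q' [a ea eq]] : exists q', exists2 a, a = (q j).[0] & q j = a%:P + 'X * q'.
  have : root (q j - ((q j).[0])%:P) 0 by rewrite /root !hornerE subrr.
  by case/factor_theorem => u' e; exists u', (q j).[0] => //; rewrite mulrC -[X in u' * X]subr0 -e addrC subrK.
exists (p1 + 'X^(k.+1) * (G v)%:P + 'X^(k.+2) * r), (r + q'); split=> [t|].
  by rewrite -eF h3.
rewrite ep hq eG hv -ea eq polyCN !exprS; ring.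
Qed.

End Hensel.

(** * Separating the cubic part from the rest *)

Section Peel.
Variable K : closedFieldType.

Lemma prod_const_seq (R : comNzRingType) (I : Type) (w : seq I) (t : R) : \prod_(i <- w) t = t ^+ size w.
Proof. by elim: w => [|i w h]; rewrite ?big_nil ?expr0 // big_cons h exprS. Qed.

Definition quadf e (c : K) (l : 'I_e -> K) (q : 'I_e -> 'I_e -> K) (w : seq 'I_e) : K :=
  match w with [::] => c | [:: i] => l i | [:: i; j] => q i j | _ => 0 end.

(** The pair lives on a module with basis 1, the [e] letters and [s] quadrics, of size [1 + e + s];
    its multiplication matrices commute because the [Q k] are symmetric. *)
Lemma good_quad e s (c : bool -> K) (l : bool -> 'I_e -> K) (Q : 'I_s -> 'I_e -> 'I_e -> K) (g : bool -> 'I_s -> K) :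
  (forall k i j, Q k i j = Q k j i) -> CM K (1 + (e + s)) ->
  good (1 + (e + s)) (fun i : bool * seq 'I_e =>
    quadf (c i.1) (l i.1) (fun x y => \sum_k g i.1 k * Q k x y) i.2).
Proof.
move=> Qs cm.
pose M i : 'M[K]_(e, s) := \matrix_(j, k) Q k j i.
pose X i : 'M[K]_(1 + (e + s)) := block_mx 0 (row_mx (delta_mx 0 i) 0) 0 (block_mx 0 (M i) 0 0).
have XE (a : 'M[K]_1) (u : 'rV_e) (v : 'rV_s) i :
    row_mx a (row_mx u v) *m X i = row_mx 0 (row_mx (a *m delta_mx 0 i) (u *m M i)).
  by rewrite /X mul_row_block !mulmx0 mul_mx_row mul_row_block !mulmx0 !addr0 add_row_mx !add0r addr0.
have XC i j : X i *m X j = X j *m X i.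
  apply/row_matrixP => k; rewrite !rowE !mulmxA; move: (delta_mx 0 k : 'rV_(1 + (e + s))) => z.
  rewrite -[z]hsubmxK -[rsubmx z]hsubmxK !XE !mul0mx; congr (row_mx _ (row_mx _ _)).
  rewrite -!mulmxA; congr (_ *m _); apply/rowP => k'; rewrite !mxE (bigD1 i) //= big1 ?addr0; last first.
    by move=> x xi; rewrite !mxE (negbTE xi) andbF mul0r.
  rewrite (bigD1 j) //= big1 ?addr0; last by move=> x xi; rewrite !mxE (negbTE xi) andbF mul0r.
  by rewrite !mxE !eqxx Qs.
pose f b : 'cV[K]_(1 + (e + s)) := col_mx (c b)%:M (col_mx (\col_i l b i) (\col_k g b k)).
apply: (good_ext _ (cm _ X (row_mx 1%:M 0) f XC)) => b w.
rewrite /matfam /f /=.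
have r0 : (row_mx 1%:M 0 : 'rV[K]_(1 + (e + s))) = row_mx 1%:M (row_mx 0 0) by rewrite row_mx0.
case: w => [|i [|j [|k w]]] /=; rewrite ?mulmxA r0 ?mulmx1 ?XE ?mul1mx ?mul0mx.
- by rewrite !mul_row_col !mul0mx !addr0 mul1mx !mxE eqxx mulr1n.
- rewrite !mul_row_col !mul0mx add0r addr0 !mxE (bigD1 i) //= big1 ?addr0.
    by rewrite !mxE !eqxx mul1r.
  by move=> x xi; rewrite !mxE (negbTE xi) andbF mul0r.
- rewrite !mul_row_col !mul0mx !add0r !mxE; apply: eq_bigr => k _; rewrite !mxE mulrC; congr (_ * _).
  rewrite (bigD1 i) //= big1 ?addr0; first by rewrite !mxE !eqxx mul1r.
  by move=> x xi; rewrite !mxE (negbTE xi) andbF mul0r.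
have -> : row_mx 0 (row_mx 0 0) = 0 :> 'rV[K]_(1 + (e + s)) by rewrite !row_mx0.
by rewrite !mul0mx mxE.
Qed.

(* The points of the cubic part are contracted to the origin; the poles of order at most
   two are absorbed by the quadratic part. *)
Lemma good_peel e h s (Phi C : bool * seq 'I_e -> K) (sel : bool -> 'I_s) :
  (forall b w, size w = 3%N -> Phi (b, w) = C (b, w)) ->
  (forall b w, (3 < size w)%N -> Phi (b, w) = 0) ->
  (forall b i j, Phi (b, [:: i; j]) = Phi (b, [:: j; i])) -> injective sel ->
  CM K (1 + (e + s)) -> good h C -> good (h + (1 + (e + s))) Phi.
Proof.
move=> Phi3 Phi4 PhiC si cm gC.
pose G (Psi : bool * seq 'I_e -> K) (i : bool * seq 'I_e) : K :=
  if size i.2 == 3%N then Psi i else if (size i.2 < 3)%N then Phi i else 0.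
have : good (h + (1 + (e + s))) (G C).
  apply: (zcl_map (S := @zsum K 'I_e h)) gC => [i|Psi [c [y hPsi]]].
    by rewrite /G; case: (size i.2 == 3%N); [exact: pf_coord | exact: pf_const].
  (* Contract the points to [t y] and divide the weights by [t^3]: degree 3 is kept, higher degrees
     tend to 0, and the poles in lower degrees are cancelled by [R]. *)
  pose P (i : bool * seq 'I_e) : {poly K} := if (size i.2 < 3)%N then (Phi i)%:P else 'X^(size i.2 - 3) * (Psi i)%:P.
  apply: (good_ext (Phi := fun i => (P i).[0])) => [b w|].
    rewrite /P /G /=; case: ltngtP => hw; rewrite ?hornerC //.
      by rewrite hornerM hornerXn expr0n subn_eq0 leqNgt hw mul0r.
    by rewrite hw subnn expr0 mul1r hornerC.
  apply: good_lim; apply: gen_mono (gen_neC 0) => t t0.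
  pose R b w := Phi (b, w) - t ^- 3 * t ^+ (size w) * Psi (b, w).
  have gR : good (1 + (e + s)) (fun i : bool * seq 'I_e => if (size i.2 < 3)%N then R i.1 i.2 else 0).
    (* Through [sel] each of the two functionals gets a quadric of its own. *)
    have := @good_quad e s (fun b => R b [::]) (fun b i => R b [:: i])
      (fun k i j => \sum_(b | sel b == k) R b [:: i; j]) (fun b k => (sel b == k)%:R).
    move=> h1; have {h1}h1 := h1 _ cm; apply: (good_ext _ (h1 _)) => [b w|k i j].
      case: w => [|i [|j [|k w]]] //=; rewrite (bigD1 (sel b)) //= eqxx mul1r [X in _ + X]big1 ?addr0.
        by rewrite (bigD1 b) //= big1 ?addr0 // => b' /andP [/eqP /si ->]; rewrite eqxx.
      by move=> k kb; rewrite eq_sym (negbTE kb) mul0r.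
    apply: eq_bigr => b _; rewrite /R PhiC !hPsi /=; congr (_ - _ * _); apply: eq_bigr => a _.
    by rewrite !big_cons big_nil !mulr1 [y a i * _]mulrC.
  have gP : good h (fun i : bool * seq 'I_e => t ^- 3 * t ^+ (size i.2) * Psi i).
    apply: zcl_sub; exists (fun a b => t ^- 3 * c a b), (fun a i => t * y a i) => b w /=.
    rewrite hPsi mulr_sumr; apply: eq_bigr => a _; rewrite big_split /= prod_const_seq.
    by rewrite -!mulrA; congr (_ * _); rewrite mulrCA.
  apply: (good_ext _ (good_add gP gR)) => b w; rewrite /P /=.
  case: ltnP => hw; first by rewrite hornerC /R addrC subrK.
  rewrite addr0 hornerM hornerXn hornerC; congr (_ * _).
  by rewrite -[in LHS](subnK hw) exprD mulrCA mulVf ?mulr1 // expf_neq0.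
apply: good_ext => b w; rewrite /G /=; case: ltngtP => // hw; first by rewrite Phi4.
by rewrite Phi3.
Qed.

End Peel.

(** * Limits of sums of powers *)

Section Cubics.
Variable K : closedFieldType.
Hypothesis K0 : [pchar K] =i pred0.

Lemma sum_delta (I : finType) (F : I -> K) k : \sum_l F l * (l == k)%:R = F k.
Proof.
rewrite (bigD1 k) //= eqxx mulr1 big1 ?addr0 // => l /negbTE ->.
by rewrite mulr0.
Qed.

(** Use the points [t y_l] and [- t y_l] with opposite weights, and likewise for
    [S = \sum_l x_l y_l]. Even degrees cancel by symmetry, degree one because of [S], and with
    weights of order [t^-3] only the cubic part survives at [t = 0]. This costs [2 e + 2] points. *)
Lemma polyX_path e (x : 'I_e -> K) (y : 'I_e -> 'I_e -> K) :
  let H w := \sum_l x l * \prod_(i <- w) y l i - \prod_(i <- w) (\sum_l x l * y l i) in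
  good (e + e + (1 + 1)) (fun i : bool * seq 'I_e => if size i.2 == 3%N then H i.2 else 0).
Proof.
move=> H; pose P (i : bool * seq 'I_e) : {poly K} :=
  if odd (size i.2) && (1 < size i.2)%N then 'X^(size i.2 - 3) * (H i.2)%:P else 0.
have two : (2%:R : K) != 0 by exact: natK_neq0.
apply: (good_ext (Phi := fun i => (P i).[0])) => [b w|].
  rewrite /P /=; case: ifP => [/andP [ow w1]|]; last first.
    by rewrite horner0; case: eqP => // ->.
  rewrite hornerM hornerXn hornerC expr0n subn_eq0; case: (size w) ow w1 => [|[|[|[|n]]]] // _ _.
    by rewrite mul1r.
  by rewrite mul0r.
apply: good_lim; apply: gen_mono (gen_neC 0) => t t0.
pose pt n (a : 'I_n -> K) (z : 'I_n -> 'I_e -> K) (i : bool * seq 'I_e) := \sum_l a l * \prod_(j <- i.2) z l j.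
have zpt n a z : good n (@pt n a z) by apply: zcl_sub; exists (fun l _ => a l), z.
pose k : K := t ^- 3 / 2%:R; pose S i := \sum_l x l * y l i.
have h := good_add (good_add (zpt e (fun l => k * x l) (fun l i => t * y l i)) (zpt e (fun l => - k * x l) (fun l i => - t * y l i)))
  (good_add (zpt 1%N (fun _ => - k) (fun _ i => t * S i)) (zpt 1%N (fun _ => k) (fun _ i => - t * S i))).
apply: good_ext h => b w; rewrite /pt /= !big_ord1.
have e1 (c : K) (z : 'I_e -> K) : \prod_(j <- w) (c * z j) = c ^+ size w * \prod_(j <- w) z j.
  by rewrite big_split /= prod_const_seq.
have e2 (c d : K) : \sum_(l < e) c * x l * \prod_(j <- w) (d * y l j) = c * d ^+ size w * \sum_(l < e) x l * \prod_(j <- w) y l j.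
  by rewrite mulr_sumr; apply: eq_bigr => l _; rewrite e1; ring.
rewrite !e1 !e2 exprNn; set X := \sum_(l < e) _; set Y := \prod_(j <- w) _.
transitivity (k * t ^+ size w * (1 - (-1) ^+ size w) * (X - Y)); first by ring.
rewrite /P /= -signr_odd; case ow: (odd (size w)) => /=; last by rewrite expr0 subrr mulr0 mul0r horner0.
case: ltnP => w1.
  rewrite hornerM hornerXn hornerC -/X -/Y /k expr1 opprK.
  have w3 : (3 <= size w)%N by case: (size w) ow w1 => [|[|[|n]]].
  rewrite -(subnK w3) exprD (_ : (1 + 1 : K) = 2%:R) //; congr (_ * _).
  rewrite addnK; move: (t ^+ 3) (expf_neq0 3 t0) => z z0; field.
  by rewrite two z0.
have : size w = 1%N by case: (size w) ow w1 => [|[|n]].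
rewrite horner0 /X /Y; case: w {e1 e2 X Y ow w1} => [|i [|j w]] //= _.
by rewrite big_cons big_nil mulr1 /S -sumrB big1 ?mulr0 // => l _; rewrite big_cons big_nil mulr1 subrr.
Qed.

(* Every cubic is a limit of sums of [e.+1] cubes [w_l y_l ^ 3] with [\sum_l w_l y_l = 0]:
   the differential of the parametrization at [w_l = 1], [y_l = x_l] is onto. *)
Lemma good_cubic e (c : 'I_e -> 'I_e -> 'I_e -> K) :
  (forall i j k, c i j k = c j i k) -> (forall i j k, c i j k = c i k j) ->
  (forall C : 'I_e -> 'I_e -> 'I_e -> K, (forall i j k, C i j k = C j i k) -> (forall i j k, C i j k = C i k j) ->
     exists s : 'I_e -> K, forall i j k, i != j -> i != k -> j != k -> s i + s j + s k = - C i j k) ->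
  good (e + e + (1 + 1)) (fun i : bool * seq 'I_e => if i.2 is [:: i; j; k] then c i j k else 0).
Proof.
move=> cs1 cs2 hs.
have three : (3%:R : K) != 0 by exact: natK_neq0.
have two : (2%:R : K) != 0 by exact: natK_neq0.
pose I := ('I_e + 'I_e * 'I_e)%type; pose J := (bool * seq 'I_e)%type.
pose x0 (i : I) : K := match i with inl _ => 1 | inr p => (p.1 == p.2)%:R end.
pose S (x : I -> K) i := \sum_l x (inl l) * x (inr (l, i)).
pose Psi (x : I -> K) (i : J) := if size i.2 == 3%N then
  \sum_l x (inl l) * \prod_(j <- i.2) x (inr (l, j)) - \prod_(j <- i.2) S x j else 0.
(* At [x0] the vector [S] has all coordinates 1, so its cube varies by [dS i + dS j + dS k]. Nothing
   else contributes to the coefficients with three distinct indices, whence the hypothesis on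
   [s]. *)
pose dS (v : I -> K) i := v (inl i) + \sum_l v (inr (l, i)).
pose D (v : I -> K) (i : J) : K := if i.2 is [:: i; j; k] then
   (v (inl k) * (k == i)%:R + v (inr (k, i))) * (k == j)%:R + (k == i)%:R * v (inr (k, j)) + (j == i)%:R * v (inr (j, k))
   - (dS v i + dS v j + dS v k) else 0.
apply: (zcl_dominant (x0 := x0) (Psi := Psi) (D := D) (E := fun i j => perm_eq i.2 j.2) (Z := fun i => size i.2 != 3%N)).
- case=> b w; have [w3|w3] := eqVneq (size w) 3%N; last first.
    exists (fun _ => 0) => [x|]; first by rewrite /Psi /= (negbTE w3).
    exists (fun _ => 0) => [x|]; last exact: pd_const.
    by rewrite /D /=; case: w w3 => [|i [|j [|k [|]]]].
  case: w w3 => [|i [|j [|k [|]]]] // _.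
  have [F1 hF1 [D1 hD1 p1]] := pd_sum (index_enum 'I_e) (fun l => pd_mul (pd_mul (pd_mul (pd_coord x0 (inl l : I)) (pd_coord x0 (inr (l, i) : I))) (pd_coord x0 (inr (l, j) : I))) (pd_coord x0 (inr (l, k) : I))).
  have pS i0 := pd_sum (index_enum 'I_e) (fun l => pd_mul (pd_coord x0 (inl l : I)) (pd_coord x0 (inr (l, i0) : I))).
  have S0 i0 : S x0 i0 = 1 by rewrite /S /x0 /= sum_delta.
  have dS0 i0 v : \sum_l (v (inl l) * x0 (inr (l, i0)) + x0 (inl l) * v (inr (l, i0))) = dS v i0.
    by rewrite big_split /= sum_delta /dS; congr (_ + _); apply: eq_bigr => l _; rewrite mul1r.
  have [F2 hF2 [D2 hD2 p2]] := pS i; have [F3 hF3 [D3 hD3 p3]] := pS j; have [F4 hF4 [D4 hD4 p4]] := pS k.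
  have pp := pd_add p1 (pd_mul (pd_const x0 (-1)) (pd_mul (pd_mul p2 p3) p4)).
  eexists; last (eexists; last exact: pp).
    move=> x; rewrite /Psi /= !big_cons big_nil mulr1 hF1 hF2 hF3 hF4 mulN1r mulrA; congr (_ - _).
    by apply: eq_bigr => l _; rewrite !big_cons big_nil mulr1 !mulrA.
  move=> v; rewrite /D /= hD1 hD2 hD3 hD4 hF2 hF3 hF4 -!/(S x0 _) !S0 !dS0 mul0r add0r mulN1r !mulr1 !mul1r.
  congr (_ - _); rewrite big_split /= sum_delta; congr (_ + _).
    by rewrite /x0 /= !mul1r.
  rewrite -[RHS]mulrC -(sum_delta (fun l => v (inr (l, k)) * (l == i)%:R)); apply: eq_bigr => l _.
  by rewrite mul1r; ring.
- move=> x; split=> [[b w] [b' w'] /= h|[b w] /= /negbTE h]; last by rewrite /Psi /= h.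
  rewrite /Psi /= (perm_size h); case: ifP => // _; congr (_ - _); last exact: perm_big.
  by apply: eq_bigr => l _; congr (_ * _); exact: perm_big.
- by move=> x; apply: (good_ext _ (polyX_path (fun l => x (inl l)) (fun l i => x (inr (l, i))))).
- move=> C [CE CZ]; pose c' b i j k := C (b, [:: i; j; k]).
  have bb b i j k : c' b i j k = c' true i j k by apply: CE; exact: perm_refl.
  have s1 i j k : c' true i j k = c' true j i k.
    by apply: CE; rewrite /= -(cat1s i) -(cat1s j [:: i; k]) /= (perm_catCA [:: i] [:: j] [:: k]).
  have s2 i j k : c' true i j k = c' true i k j.
    by apply: CE; rewrite /= perm_cons -(cat1s j) -(cat1s k) perm_catC.
  have [s hsC] := hs (c' true) s1 s2.
  (* [up] matches the coefficients with exactly two equal indices and [ud] those with three; the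
     weights are then adjusted so that [dS v = s]. *)
  pose up i j := c' true i i j + 2%:R * s i + s j.
  pose u i := \sum_(l | l != i) up l i.
  pose ud i := (c' true i i i + 2%:R * s i + u i) / 2%:R.
  pose v (i : I) := match i with inl i => s i - u i - ud i | inr p => if p.1 == p.2 then ud p.1 else up p.1 p.2 end.
  have dSv i : dS v i = s i.
    rewrite /dS (bigD1 i) //= eqxx (eq_bigr (fun l => up l i)); last by move=> l /negbTE ->.
    by rewrite -/(u i); ring.
  exists v => [[b w]]; rewrite /D /=; have [w3|w3] := eqVneq (size w) 3%N; last first.
    rewrite CZ //=; by case: w w3 => [|i [|j [|k [|]]]].
  case: w w3 => [|i [|j [|k [|]]]] // _; rewrite !dSv -[RHS]/(c' b i j k) bb /=.
  have bt : (true%:R : K) = 1 by []. have bf : (false%:R : K) = 0 by [].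
  have [<-|ki] := eqVneq k i.
    have [<-|kj] := eqVneq k j; last by rewrite ?bt ?bf s2 /up; ring.
    by rewrite ?bt ?bf ?eqxx !mulr1 !mul1r /ud; field.
  have [<-|kj] := eqVneq k j.
    rewrite (negbTE ki) ?bt ?bf (s1 i k k) (s2 k i k) /up; ring.
  have [e1|ji] := eqVneq j i; first by rewrite ?bt ?bf e1 /up; ring.
  by rewrite !mulr0 !mul0r !addr0 sub0r hsC ?opprK // eq_sym.
split=> [[b w] [b' w'] /= h|[b w] /= h]; last by case: w h => [|i [|j [|k [|]]]].
have e0 := perm_size h; case: w w' h e0 => [|i [|j [|k [|l w]]]] [|i' [|j' [|k' [|l' w']]]] //= h _.
have cs i1 i2 i3 j1 j2 j3 : perm_eq [:: i1; i2; i3] [:: j1; j2; j3] -> c i1 i2 i3 = c j1 j2 j3.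
  move=> hp; have : j1 \in [:: i1; i2; i3] by rewrite (perm_mem hp) mem_head.
  have two' x1 x2 y1 y2 : perm_eq [:: x1; x2] [:: y1; y2] -> c j1 x1 x2 = c j1 y1 y2.
    move=> hq; have : y1 \in [:: x1; x2] by rewrite (perm_mem hq) mem_head.
    rewrite !inE => /orP [/eqP e1|/eqP e1].
      by move: hq; rewrite e1 perm_cons => /(perm_small_eq (isT : (size [:: _] <= 1)%N)) [->].
    move: hq; rewrite e1 (perm_catC [:: x1] [:: x2] : perm_eql _ _) /= perm_cons => /(perm_small_eq (isT : (size [:: _] <= 1)%N)) [->].
    exact: cs2.
  rewrite !inE => /or3P [/eqP e1|/eqP e1|/eqP e1].
  - by move: hp; rewrite -e1 perm_cons => /two'.
  - by move: hp; rewrite -e1 (perm_catCA [:: i1] [:: j1] [:: i3] : perm_eql _ _) /= perm_cons => /two' <-; rewrite cs1.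
  move: hp; rewrite -e1 (perm_catC [:: i1; i2] [:: j1] : perm_eql _ _) /= perm_cons => /two' <-.
  by rewrite cs2 cs1.
exact: cs.
Qed.

Lemma good_cubic34 e (c : 'I_e -> 'I_e -> 'I_e -> K) : (e = 3 \/ e = 4)%N ->
  (forall i j k, c i j k = c j i k) -> (forall i j k, c i j k = c i k j) ->
  good (e + e + (1 + 1)) (fun i : bool * seq 'I_e => if i.2 is [:: i; j; k] then c i j k else 0).
Proof.
have three : (3%:R : K) != 0 by exact: natK_neq0.
move=> e34 cs1 cs2; apply: good_cubic => // C s1 s2.
case: e34 C s1 s2 {c cs1 cs2} => -> C s1 s2.
  exists (fun i => if i == 0 then - C 0 1 2 else 0) => i j k.
  have P (R : 'I_3 -> Prop) : R 0 -> R 1 -> R 2 -> forall i, R i := @ord3 R.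
  move: i j k; do 3 apply: (P) => //=; rewrite ?addr0 ?add0r => *; congr (- _); rewrite ?(s1 1 0) ?(s1 2 0) ?(s1 2 1) ?(s2 0 2 1) ?(s2 1 2 0) ?(s2 2 1 0) ?(s1 1 0) ?(s2 0 2 1) //.
(* Four triples and four unknowns: with [s_i = T + C_jkl] the sum over a triple contains every [C]
   but its own, and [3 T] is minus the sum of all four. From five variables on there are more
   triples than unknowns. *)
pose T : K := - (C 0 1 2 + C 0 1 3 + C 0 2 3 + C 1 2 3) / 3%:R.
have P (R : 'I_4 -> Prop) : R 0 -> R 1 -> R 2 -> R 3 -> forall i, R i.
  move=> h0 h1 h2 h3 [[|[|[|[|i]]]] hi] //; [move: h0 | move: h1 | move: h2 | move: h3];
  by congr R; apply: val_inj.
exists (fun i => if i == 0 then T + C 1 2 3 else if i == 1 then T + C 0 2 3 else if i == 2 then T + C 0 1 3 else T + C 0 1 2).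
have srt i j k : C i j k = C j i k /\ C i j k = C i k j by [].
move=> i j k; move: i j k; do 3 apply: (P) => //=; move=> *.
all: rewrite ?(s1 1 0) ?(s1 2 0) ?(s1 3 0) ?(s1 2 1) ?(s1 3 1) ?(s1 3 2) ?(s2 0 2 1) ?(s2 0 3 1) ?(s2 0 3 2) ?(s2 1 2 0) ?(s2 1 3 0) ?(s2 1 3 2) ?(s2 2 3 0) ?(s2 2 3 1) ?(s1 1 0) ?(s1 2 0) ?(s1 2 1) ?(s2 0 2 1) ?(s2 0 3 1) ?(s2 0 3 2) ?(s2 1 3 2) /T; by field.
Qed.

(* Four cubes [y_l ^ 3] and squares [d_l y_l ^ 2] of the same ternary linear forms approximate any
   cubic and quadric: the differential at [x, y, z, x + y + z] and [d = (1, 0, 0, 0)] is onto. *)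
Lemma good_cubic_quadric (Phi : bool * seq 'I_3 -> K) :
  (forall b w, (3 < size w)%N -> Phi (b, w) = 0) -> (forall w, (2 < size w)%N -> Phi (true, w) = 0) ->
  (forall b w w', perm_eq w w' -> Phi (b, w) = Phi (b, w')) ->
  CM K (1 + (3 + 1)) -> good (3 + 1 + (1 + (3 + 1))) Phi.
Proof.
move=> P4 P2 Ps cm.
have three : (3%:R : K) != 0 by exact: natK_neq0.
have two : (2%:R : K) != 0 by exact: natK_neq0.
pose I := ('I_3 + unit + (('I_3 + unit) * 'I_3))%type; pose J := (bool * seq 'I_3)%type.
pose x0 (i : I) : K := match i with inl (inl l) => (l == 0)%:R | inl (inr _) => 0
  | inr (inl l, i) => (l == i)%:R | inr (inr _, i) => 1 end.
pose lo b : nat := if b then 2 else 3.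
pose Psi (x : I -> K) (i : J) : K := if size i.2 == lo i.1 then
   (if i.1 then \sum_l x (inl (inl l)) * \prod_(j <- i.2) x (inr (inl l, j)) + x (inl (inr tt)) * \prod_(j <- i.2) x (inr (inr tt, j))
    else \sum_l \prod_(j <- i.2) x (inr (inl l, j)) + \prod_(j <- i.2) x (inr (inr tt, j))) else 0.
pose C0 (i : J) : K := if size i.2 == lo i.1 then Phi i else 0.
pose D (v : I -> K) (i : J) : K := match i with
  | (false, [:: i; j; k]) => v (inr (inl k, i)) * (k == j)%:R + (k == i)%:R * v (inr (inl k, j)) + (j == i)%:R * v (inr (inl j, k))
      + (v (inr (inr tt, i)) + v (inr (inr tt, j)) + v (inr (inr tt, k)))
  | (true, [:: i; j]) => v (inl (inl j)) * (j == i)%:R + (j == 0)%:R * v (inr (inl j, i)) + (i == 0)%:R * v (inr (inl i, j)) + v (inl (inr tt))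
  | _ => 0 end.
pose G (Psi : J -> K) (i : J) : K := if size i.2 == lo i.1 then Psi i else if (size i.2 < lo i.1)%N then Phi i else 0.
suff gG : good (3 + 1 + (1 + (3 + 1))) (G C0).
  apply: good_ext gG => b w; rewrite /G /C0 /=; case: ltngtP => //; by rewrite /lo; case: b => h; [rewrite P2 | rewrite P4].
pose Im (Psi' : J -> K) := exists x, Psi' =1 Psi x.
have gC0 : zcl Im C0.
  apply: (zcl_dominant (x0 := x0) (Psi := Psi) (D := D) (E := fun i j => i.1 = j.1 /\ perm_eq i.2 j.2) (Z := fun i => size i.2 != lo i.1)).
  - case=> b w; have [w3|w3] := eqVneq (size w) (lo b); last first.
      exists (fun _ => 0) => [x|]; first by rewrite /Psi /= (negbTE w3).
      exists (fun _ => 0) => [x|]; last exact: pd_const.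
      by rewrite /D /=; case: b w w3 => [] [|i [|j [|k [|]]]].
    case: b w w3 => [] [|i [|j [|k [|]]]] // _.
      have [F1 hF1 [D1 hD1 p1]] := pd_sum (index_enum 'I_3) (fun l => pd_mul (pd_mul (pd_coord x0 (inl (inl l) : I)) (pd_coord x0 (inr (inl l, i) : I))) (pd_coord x0 (inr (inl l, j) : I))).
      have pp := pd_add p1 (pd_mul (pd_mul (pd_coord x0 (inl (inr tt) : I)) (pd_coord x0 (inr (inr tt, i) : I))) (pd_coord x0 (inr (inr tt, j) : I))).
      eexists; last (eexists; last exact: pp).
        move=> x; rewrite /Psi /= !big_cons big_nil mulr1 hF1 mulrA; congr (_ + _).
        by apply: eq_bigr => l _; rewrite !big_cons big_nil mulr1 !mulrA.
      move=> v; rewrite /D /= hD1 !mul0r !addr0 !mulr1; congr (_ + _).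
      rewrite big_split /= sum_delta; congr (_ + _).
      rewrite -[RHS]mulrC -(sum_delta (fun l => v (inr (inl l, j)) * (l == 0)%:R)); apply: eq_bigr => l _.
      by ring.
    have [F1 hF1 [D1 hD1 p1]] := pd_sum (index_enum 'I_3) (fun l => pd_mul (pd_mul (pd_coord x0 (inr (inl l, i) : I)) (pd_coord x0 (inr (inl l, j) : I))) (pd_coord x0 (inr (inl l, k) : I))).
    have pp := pd_add p1 (pd_mul (pd_mul (pd_coord x0 (inr (inr tt, i) : I)) (pd_coord x0 (inr (inr tt, j) : I))) (pd_coord x0 (inr (inr tt, k) : I))).
    eexists; last (eexists; last exact: pp).
      move=> x; rewrite /Psi /= !big_cons big_nil mulr1 hF1 mulrA; congr (_ + _).
      by apply: eq_bigr => l _; rewrite !big_cons big_nil mulr1 !mulrA.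
    move=> v; rewrite /D /= hD1 !mulr1 !mul1r; congr (_ + _).
    rewrite big_split /= sum_delta; congr (_ + _).
    rewrite -[RHS]mulrC -(sum_delta (fun l => v (inr (inl l, k)) * (l == i)%:R)); apply: eq_bigr => l _.
    by ring.
  - move=> x; split=> [[b w] [b' w'] /= [<- h]|[b w] /= /negbTE h]; last by rewrite /Psi /= h.
    rewrite /Psi /= (perm_size h); case: ifP => // _; case: b; congr (_ + _).
    + by apply: eq_bigr => l _; congr (_ * _); exact: perm_big.
    + by congr (_ * _); exact: perm_big.
    + by apply: eq_bigr => l _; exact: perm_big.
    + exact: perm_big.
  - by move=> x; apply: zcl_sub; exists x.
  - move=> C [CE CZ]; pose c i j k := C (false, [:: i; j; k]); pose q i j := C (true, [:: i; j]).
    have cs1 i j k : c i j k = c j i k.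
      by apply: CE; split=> //=; rewrite (perm_catCA [:: i] [:: j] [:: k]).
    have cs2 i j k : c i j k = c i k j.
      by apply: CE; split=> //=; rewrite perm_cons (perm_catC [:: j] [:: k]).
    have qs i j : q i j = q j i by apply: CE; split=> //=; rewrite (perm_catC [:: i] [:: j]).
    (* [tau] is the variation of the fourth form. The coefficients [q 0 1], [q 0 2] force
       [2 tau 0 + tau 1 = k1] and [2 tau 0 + tau 2 = k2], and the squarefree cubic coefficient
       forces [tau 0 + tau 1 + tau 2 = c 0 1 2]; [t0] is the resulting value of [tau 0]. *)
    pose k1 := c 0 0 1 - q 0 1 + q 1 2; pose k2 := c 0 0 2 - q 0 2 + q 1 2.
    pose t0 := (k1 + k2 - c 0 1 2) / 3%:R.
    pose tau (i : 'I_3) := if i == 0 then t0 else if i == 1 then k1 - 2%:R * t0 else k2 - 2%:R * t0.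
    pose up (i j : 'I_3) := if i == j then c i i i / 3%:R - tau i else c i i j - 2%:R * tau i - tau j.
    pose v (i : I) : K := match i with inl (inl l) => q l l - q 1 2 - 2%:R * (l == 0)%:R * up l l | inl (inr _) => q 1 2
      | inr (inl l, i) => up l i | inr (inr _, i) => tau i end.
    exists v => [[b w]]; have [w3|w3] := eqVneq (size w) (lo b); last first.
      by rewrite CZ //=; case: b w w3 => [] [|i [|j [|k [|]]]].
    have P (R : 'I_3 -> Prop) : R 0 -> R 1 -> R 2 -> forall i, R i := @ord3 R.
    case: b w w3 => [] [|i [|j [|k [|]]]] // _.
      rewrite -[RHS]/(q i j); move: i j; do 2 apply: (P) => //=; rewrite /up /tau /t0 /k1 /k2 /= ?(qs 1 0) ?(qs 2 0) ?(qs 2 1); by field.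
    have up3 i0 : up i0 i0 + up i0 i0 + up i0 i0 + (tau i0 + tau i0 + tau i0) = c i0 i0 i0 by rewrite /up eqxx; field.
    have up2 i0 j0 : i0 != j0 -> up i0 j0 + (tau i0 + tau i0 + tau j0) = c i0 i0 j0 by move=> /negbTE h; rewrite /up h; ring.
    have bt : (true%:R : K) = 1 by []. have bf : (false%:R : K) = 0 by [].
    rewrite -[RHS]/(c i j k) /=; have [<-|ki] := eqVneq k i.
      have [<-|kj] := eqVneq k j; first by rewrite ?bt ?bf ?eqxx -up3; ring.
      rewrite cs2 -(up2 _ _ kj) ?bt ?bf; ring.
    have [<-|kj] := eqVneq k j.
      rewrite (negbTE ki) (cs1 i k k) (cs2 k i k) -(up2 _ _ ki) ?bt ?bf; ring.
    have [e1|ji] := eqVneq j i.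
      rewrite e1 -up2 1?eq_sym // ?bt ?bf; ring.
    rewrite ?bt ?bf !mulr0 !mul0r !addr0 add0r; move: ki kj ji.
    have tt : tau 0 + tau 1 + tau 2 = c 0 1 2 by rewrite /tau /= /t0; field.
    move: i j k; do 3 apply: (P) => //= ; move=> _ _ _; rewrite ?(cs1 1 0) ?(cs1 2 0) ?(cs1 2 1) ?(cs2 0 2 1) ?(cs2 1 2 0) ?(cs1 1 0) ?(cs2 0 2 1) -tt; ring.
  split=> [[b w] [b' w'] /= [<- h]|[b w] /= /negbTE h]; last by rewrite /C0 /= h.
  by rewrite /C0 /= (perm_size h) (Ps b w w' h).
apply: (zcl_map (S := Im)) gC0 => [i|Psi' [x hx]].
  by rewrite /G; case: (size i.2 == lo i.1); [exact: pf_coord | exact: pf_const].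
pose H (i : J) : K := if i.1 then \sum_l x (inl (inl l)) * \prod_(j <- i.2) x (inr (inl l, j)) + x (inl (inr tt)) * \prod_(j <- i.2) x (inr (inr tt, j))
    else \sum_l \prod_(j <- i.2) x (inr (inl l, j)) + \prod_(j <- i.2) x (inr (inr tt, j)).
pose Pt (i : J) : {poly K} := if (size i.2 < lo i.1)%N then (Phi i)%:P else 'X^(size i.2 - lo i.1) * (H i)%:P.
apply: (good_ext (Phi := fun i => (Pt i).[0])) => [b w|].
  rewrite /Pt /G /=; case: ltngtP => hw; rewrite ?hornerC //.
    by rewrite hornerM hornerXn expr0n subn_eq0 leqNgt hw mul0r.
  by rewrite hw subnn expr0 mul1r hornerC hx /Psi /= hw eqxx.
apply: good_lim; apply: gen_mono (gen_neC 0) => t tn0.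
have gP : good (3 + 1) (fun i : J => t ^- lo i.1 * t ^+ (size i.2) * H i).
  pose pt n (a : 'I_n -> bool -> K) (z : 'I_n -> 'I_3 -> K) (i : J) := \sum_l a l i.1 * \prod_(j <- i.2) z l j.
  have zpt n a z : good n (@pt n a z) by apply: zcl_sub; exists a, z.
  have h := good_add (zpt 3 (fun l b => t ^- lo b * (if b then x (inl (inl l)) else 1)) (fun l i => t * x (inr (inl l, i))))
    (zpt 1%N (fun _ b => t ^- lo b * (if b then x (inl (inr tt)) else 1)) (fun _ i => t * x (inr (inr tt, i)))).
  apply: good_ext h => b w; rewrite /pt /= big_ord1.
  have e1 (z : 'I_3 -> K) : \prod_(j <- w) (t * z j) = t ^+ size w * \prod_(j <- w) z j.
    by rewrite big_split /= prod_const_seq.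
  under eq_bigr => l _ do rewrite e1.
  rewrite e1 /H /=; case: b; rewrite mulrDr mulr_sumr; congr (_ + _); try (by apply: eq_bigr => l _; ring); ring.
pose R b w := Phi (b, w) - t ^- lo b * t ^+ (size w) * H (b, w).
(* What remains has degree at most two for one functional and at most one for the other, so one
   quadric suffices and the length is [1 + 3 + 1]. *)
have gR : good (1 + (3 + 1)) (fun i : J => if (size i.2 < lo i.1)%N then R i.1 i.2 else 0).
  have := @good_quad K 3 1 (fun b => R b [::]) (fun b i => R b [:: i]) (fun _ i j => R false [:: i; j]) (fun b _ => if b then 0 else 1).
  move=> h1; have {h1}h1 := h1 _ cm; apply: (good_ext _ (h1 _)) => [b w|k i j].
    by case: b w => [] [|i [|j [|k w]]] //=; rewrite big_ord1 ?mul0r ?mul1r.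
  have pij : perm_eq [:: i; j] [:: j; i] by rewrite (perm_catC [:: i] [:: j]).
  rewrite /R (Ps _ _ _ pij) /H /=; congr (_ - _ * (_ + _)); last by apply: perm_big.
  by apply: eq_bigr => l _; apply: perm_big.
apply: (good_ext _ (good_add gP gR)) => b w; rewrite /Pt /=.
case: ltnP => hw; first by rewrite hornerC /R addrC subrK.
rewrite addr0 hornerM hornerXn hornerC; congr (_ * _).
by rewrite -[in LHS](subnK hw) exprD mulrCA mulVf ?mulr1 // expf_neq0.
Qed.

End Cubics.

(** * Pairings defined by socle functionals *)

Section Duality.
Variables (K : closedFieldType) (m : nat) (A : calg K m).
Implicit Types (u v w x y z : car A) (U V W : {vspace car A}).

Definition mtab (l : 'cV[K]_m) : 'M[K]_m := \matrix_(i, k) pr l ((delta_mx 0 i : car A) * (delta_mx 0 k : car A)).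

Lemma mtabE l u v : ((u : 'rV_m) *m mtab l *m (v : 'rV_m)^T) 0 0 = pr l (u * v).
Proof.
have eu : u = \sum_i u 0 i *: (delta_mx 0 i : car A) by exact: row_sum_delta.
have ev : v = \sum_i v 0 i *: (delta_mx 0 i : car A) by exact: row_sum_delta.
rewrite [in RHS]eu [in RHS]ev mulr_suml pr_sum !mxE.
under eq_bigr => k _ do rewrite !mxE mulr_suml.
rewrite exchange_big /=; apply: eq_bigr => i _; rewrite mulr_sumr pr_sum; apply: eq_bigr => k _.
by rewrite -scalerAl -scalerAr !prZ !mxE; ring.
Qed.

(** The version of [gor_rep] for two functionals: an element that pairs to zero under both generates
    an ideal without socle, so it is 0. *)
Lemma lev_rep (N : {vspace car A}) (phi psi l : 'cV[K]_m) : localA N ->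
  (forall s, s \in soc N -> pr phi s = 0 -> pr psi s = 0 -> s = 0) ->
  exists y y', forall u, pr l u = pr phi (y * u) + pr psi (y' * u).
Proof.
move=> lN hs; pose M := col_mx (mtab phi) (mtab psi).
have lM : (l^T <= M)%MS.
  rewrite submxE; apply/eqP/rowP => j; rewrite [RHS]mxE; pose u : car A := (col j (cokermx M))^T.
  have u0 : M *m (u : 'rV_m)^T = 0 by rewrite trmxK colE mulmxA mulmx_coker mul0mx.
  have : u = 0.
    apply: NNPP => /eqP un0.
    have idl v w : v \in (<[u]> * fullv)%VS -> v * w \in (<[u]> * fullv)%VS.
      by case/line_mulP => z _ ->; rewrite -mulrA mem_line_mul ?memvf.
    have W0 : (<[u]> * fullv)%VS != 0%VS.
      apply: contraNneq un0 => h; have := mem_line_mul u (memvf (1 : car A)).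
      by rewrite mulr1 h memv0.
    have [s [sU sS s0]] := soc_meets lN idl W0.
    case/line_mulP: sU => v _ es; case/eqP: s0; move: u0; rewrite mul_col_mx -(col_mx0 K m m 1).
    case/eq_col_mx => h1 h2; apply: hs => //; rewrite es mulrC -mtabE -mulmxA ?h1 ?h2 mulmx0 mxE //.
  move=> uz; have -> : (l^T *m cokermx M) 0 j = pr l u.
    by rewrite /pr !mxE; apply: eq_bigr => i _; rewrite !mxE mulrC.
  by rewrite uz pr0.
case/submxP: lM => D eD; exists (lsubmx D : 'rV_m), (rsubmx D : 'rV_m) => u.
rewrite -!mtabE -[D]hsubmxK mul_row_col in eD *.
have -> : pr l u = (l^T *m (u : 'rV_m)^T) 0 0 by rewrite -trmx_mul [RHS]mxE.
by rewrite eD mulmxDl mxE !row_mxKl !row_mxKr.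
Qed.

Lemma pair_surj U W (phi l : 'cV[K]_m) :
  (forall v, v \in W -> (forall z, z \in U -> pr phi (z * v) = 0) -> v = 0) ->
  exists2 z, z \in U & forall v, v \in W -> pr phi (z * v) = pr l v.
Proof.
move=> nd; pose M : 'M[K]_(\dim U, \dim W) := \matrix_(i, j) pr phi ((vbasis U)`_i * (vbasis W)`_j).
pose lr : 'rV[K]_(\dim W) := \row_j pr l (vbasis W)`_j.
have MU z j : z \in U -> \sum_i coord (vbasis U) i z * M i j = pr phi (z * (vbasis W)`_j).
  move=> zU; rewrite [in RHS](coord_vbasis zU) mulr_suml pr_sum; apply: eq_bigr => i _.
  by rewrite -scalerAl prZ mxE.
have bU i : (vbasis U)`_i \in U.
  have [lt|ge] := ltnP i (size (vbasis U)); last by rewrite nth_default ?mem0v.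
  by rewrite vbasis_mem ?mem_nth.
have bW i : (vbasis W)`_i \in W.
  have [lt|ge] := ltnP i (size (vbasis W)); last by rewrite nth_default ?mem0v.
  by rewrite vbasis_mem ?mem_nth.
have lM : (lr <= M)%MS.
  rewrite submxE; apply/eqP/rowP => j; rewrite [RHS]mxE.
  pose v : car A := \sum_k (cokermx M) k j *: (vbasis W)`_k.
  have vW : v \in W by apply: memv_suml => k _; rewrite memvZ.
  have v0 : v = 0.
    apply: nd => // z zU; rewrite (coord_vbasis zU) mulr_suml pr_sum big1 // => i _.
    rewrite -scalerAl prZ; apply/eqP; rewrite mulf_eq0; apply/orP; right; apply/eqP.
    have := congr1 (fun X : 'M_(_, _) => X i j) (mulmx_coker M); rewrite [X in _ = X]mxE => e.
    rewrite -[RHS]e mxE /v mulr_sumr pr_sum; apply: eq_bigr => k _.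
    by rewrite -scalerAr prZ !mxE mulrC.
  have -> : (lr *m cokermx M) 0 j = pr l v.
    by rewrite mxE /v pr_sum; apply: eq_bigr => k _; rewrite prZ mxE mulrC.
  by rewrite v0 pr0.
case/submxP: lM => D eD; exists (\sum_i D 0 i *: (vbasis U)`_i).
  by apply: memv_suml => i _; rewrite memvZ.
move=> v vW; rewrite (coord_vbasis vW) mulr_sumr !pr_sum; apply: eq_bigr => k _.
rewrite -scalerAr !prZ; congr (_ * _); rewrite mulr_suml pr_sum.
have := congr1 (fun X : 'rV_(_) => X 0 k) eD; rewrite !mxE => ->; apply: eq_bigr => i _.
by rewrite -scalerAl prZ mxE.
Qed.

(** An element of [U] that pairs to zero with representatives of a basis of [W] modulo [W0] lies in
    [U0], and each of these conditions lowers the dimension by at most one. *)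
Lemma pair_dim U U0 W W0 (phi : 'cV[K]_m) : (W0 <= W)%VS ->
  (forall u w, u \in U -> w \in W0 -> pr phi (u * w) = 0) ->
  (forall u, u \in U -> (forall w, w \in W -> pr phi (u * w) = 0) -> u \in U0) ->
  (\dim U + \dim W0 <= \dim U0 + \dim W)%N.
Proof.
move=> W0W h1 h2.
have [h eh] : exists h, \dim W = (\dim W0 + h)%N by exists (\dim W - \dim W0)%N; rewrite subnKC // dimvS.
have [l [e [l0 eW le lW]]] := quot_coord W0W eh.
have e1 : forall u, (forall i, pr phi (u * e i) = 0) -> u \in U -> u \in U0.
  move=> u hu uU; apply: h2 => // w wW; have [w0 hw0 ->] := lW w wW.
  rewrite mulrDr prD (h1 u w0 uU hw0) addr0 mulr_sumr pr_sum big1 // => i _.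
  by rewrite -scalerAr prZ hu mulr0.
rewrite eh addnCA [X in (X <= _)%N]addnC leq_add2l; clear h1 h2 lW le l0 eh eW l.
elim: h e U e1 => [|h IHh] e U e1.
  by rewrite addn0; apply: dimvS; apply/subvP => u; apply: e1 => -[].
have [l hl] : exists l, forall u : car A, pr l u = pr phi (u * e ord0).
  by apply: lin_pr => a u v; rewrite mulrDl -scalerAl prD prZ.
apply: leq_trans (dim_kpr U l) _; rewrite addnS ltnS.
apply: (IHh (fun i => e (lift ord0 i))) => u hu; rewrite memv_cap kprE hl => /andP [uU /eqP u0].
by apply: e1 => // i; case: (unliftP ord0 i) => [j ->|->].
Qed.

End Duality.

Section CubicLocal.
Variables (K : closedFieldType) (m : nat) (A : calg K m) (N : {vspace car A}).
Hypothesis lN : localA N.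
Hypothesis K0 : [pchar K] =i pred0.
Hypothesis IH : forall k, (k < m)%N -> CM K k.
Implicit Types (u v w x y z s : car A) (U V W X Y : {vspace car A}).

Lemma letters_peval e (y : 'I_e -> car A) : (N <= (\sum_i <[y i]>) + N ^+ 2)%VS ->
  forall u, exists l, u = peval y l.
Proof.
move=> g u; apply: (@agenv_peval _ _ _ (\sum_i <[y i]>)%VS); last by rewrite (gen_full lN g) memvf.
move=> {}u /memv_sumP [v hv ->]; have h i : exists k, v i = k *: y i by apply/vlineP; exact: hv.
have [k hk] := fun_choice h; exists [seq (k i, [:: i]) | i <- index_enum 'I_e].
by rewrite /peval big_map; apply: eq_bigr => i _; rewrite big_seq1 hk.
Qed.

Lemma goodA_letters e (y : 'I_e -> car A) : (N <= (\sum_i <[y i]>) + N ^+ 2)%VS ->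
  (forall f, good m (algfam y f)) -> goodA A.
Proof. by move=> g; apply: goodA_gen; exact: letters_peval. Qed.

(** By [lev_rep] every pair of functionals arises from [phi] and [psi] by multiplication and mixing,
    which [good_mix] allows. *)
Lemma goodA_letters2 e (y : 'I_e -> car A) (phi psi : 'cV[K]_m) : (N <= (\sum_i <[y i]>) + N ^+ 2)%VS ->
  (forall s, s \in soc N -> pr phi s = 0 -> pr psi s = 0 -> s = 0) ->
  good m (algfam y (fun b => if b then psi else phi)) -> goodA A.
Proof.
move=> g hs h; apply: (goodA_letters g) => f.
have hb b : exists l : seq (K * (bool * seq 'I_e)), forall u : car A,
    pr (f b) u = \sum_(x <- l) x.1 * pr (if x.2.1 then psi else phi) (\prod_(i <- x.2.2) y i * u).
  have [z [z' e1]] := lev_rep (f b) lN hs; have [l1 h1] := letters_peval g z; have [l2 h2] := letters_peval g z'.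
  exists ([seq (x.1, (false, x.2)) | x : K * seq 'I_e <- l1] ++ [seq (x.1, (true, x.2)) | x : K * seq 'I_e <- l2]) => u.
  rewrite e1 big_cat !big_map /= h1 h2 /peval !mulr_suml !pr_sum.
  by congr (_ + _); apply: eq_bigr => x _; rewrite -scalerAl prZ.
have [u hu] := fun_choice hb; apply: (good_ext _ (good_mix u h)) => b w.
by rewrite /algfam /= hu; apply: eq_bigr => x _; rewrite big_cat.
Qed.

Lemma word_Np e (y : 'I_e -> car A) (w : seq 'I_e) : (forall i, y i \in N) -> w != [::] -> \prod_(i <- w) y i \in (N ^+ size w)%VS.
Proof.
move=> yN; case: w => // i w _; elim: w i => [|j w IHw] i; first by rewrite big_seq1 /= expv1.
by rewrite big_cons; apply: N1M.
Qed.

Hypothesis N4 : (N ^+ 4 = 0)%VS.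

Lemma word4 e (y : 'I_e -> car A) (w : seq 'I_e) : (forall i, y i \in N) -> (3 < size w)%N -> \prod_(i <- w) y i = 0.
Proof.
move=> yN w4; have w0 : w != [::] by case: w w4.
apply/eqP; rewrite -memv0 -N4; apply: (subvP (Np_le lN _ w4)) => //; exact: word_Np.
Qed.

(** The cubic values of every functional factor through commuting matrices of size [h < m], so by
    induction they cost [h] points; [good_peel] treats the rest, with one quadric for each of the
    two functionals. *)
Lemma goodA_peel e h (y : 'I_e -> car A) (X : 'I_e -> 'M[K]_h) (r : 'rV[K]_h) :
  (forall i, y i \in N) -> (N <= (\sum_i <[y i]>) + N ^+ 2)%VS ->
  (forall i j, X i *m X j = X j *m X i) ->
  (forall l : 'cV[K]_m, exists g : 'cV[K]_h, forall i j k, pr l (y i * y j * y k) = (r *m X i *m X j *m X k *m g) 0 0) ->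
  (h < m)%N -> (1 + (e + 2) < m)%N -> (h + (1 + (e + 2)) <= m)%N -> goodA A.
Proof.
move=> yN g XC hX hm em hem; apply: (goodA_letters g) => f.
have hb b : exists gb : 'cV[K]_h, forall i j k, pr (f b) (y i * y j * y k) = (r *m X i *m X j *m X k *m gb) 0 0 by exact: hX.
have [gb hg] := fun_choice hb.
apply: (good_leq hem); apply: (good_peel (C := matfam X r gb) (sel := fun b : bool => if b then (1 : 'I_2) else 0)).
- move=> b; case=> [|i [|j [|k [|]]]] // _.
  by rewrite /algfam /matfam /= !big_cons big_nil mulr1 mulrA hg mulmx1 !mulmxA.
- by move=> b w w4; rewrite /algfam /= word4 ?pr0.
- by move=> b i j; rewrite /algfam /= !big_cons !big_nil !mulr1 mulrC.
- by case=> [] [].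
- exact: IH.
exact: IH.
Qed.

End CubicLocal.

(** * Algebras with N^4 = 0 *)

Section CubicCases.
Variables (K : closedFieldType) (m : nat) (A : calg K m) (N : {vspace car A}).
Hypothesis lN : localA N.
Hypothesis K0 : [pchar K] =i pred0.
Hypothesis IH : forall k, (k < m)%N -> CM K k.
Hypothesis SN2 : (soc N <= N ^+ 2)%VS.
Implicit Types (u v w x y z s : car A) (U V W X Y : {vspace car A}).

Definition nker := (N :&: ann (N ^+ 2))%VS.

Lemma nkerP u : reflect (u \in N /\ forall n, n \in (N ^+ 2)%VS -> u * n = 0) (u \in nker).
Proof. by rewrite memv_cap; apply: (iffP andP) => -[h1 /annP h2]. Qed.

Lemma vsum_basis U : (\sum_(i < \dim U) <[(vbasis U)`_i]> = U)%VS.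
Proof.
apply: subv_anti; apply/andP; split.
  by apply/subv_sumP => i _; rewrite -memvE vbasis_mem // mem_nth // size_tuple.
apply/subvP => u uU; rewrite (coord_vbasis uU); apply: memv_suml => i _.
by rewrite memvZ //; apply: (subvP (sumv_sup i (isT : xpredT i) (subvv _))); exact: memv_line.
Qed.

Hypothesis N4 : (N ^+ 4 = 0)%VS.

Lemma N2_nker : (N ^+ 2 <= nker)%VS.
Proof.
apply/subvP => u hu; apply/nkerP; split; first exact: (NpN lN (isT : (0 < 2)%N) hu).
by move=> n hn; have := NpM hu hn; rewrite N4 memv0 => /eqP.
Qed.

Lemma N3_soc : (N ^+ 3 <= soc N)%VS.
Proof. by apply/subvP => u hu; apply/annP => n hn; have := NM1 hu hn; rewrite N4 memv0 => /eqP. Qed.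

Lemma nker_mul u v : u \in nker -> v \in N -> u * v \in soc N.
Proof.
by move=> /nkerP [uN h] vN; apply/annP => n nN; rewrite -mulrA; apply: h; exact: NN.
Qed.

Lemma N2_mul z v : z \in (N ^+ 2)%VS -> v \in N -> z * v \in soc N.
Proof. by move=> zN vN; apply: (subvP N3_soc); exact: NM1. Qed.

(* The generic combination of the two socle functionals is nondegenerate modulo [nker]. *)
Lemma goodA_nd : \dim (soc N) = 2%N -> ~~ (nker <= N ^+ 2)%VS ->
  (forall s s' l l', s \in soc N -> s' \in soc N ->
    [/\ pr l s = 1, pr l s' = 0, pr l' s = 0, pr l' s' = 1 & forall u, u \in soc N -> u = pr l u *: s + pr l' u *: s'] ->
    gen (fun t => forall v, v \in N -> (forall z, z \in (N ^+ 2)%VS -> pr l' (z * v) - t * pr l (z * v) = 0) -> v \in nker)) ->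
  goodA A.
Proof.
move=> dS nX nd; have XN : (nker <= N)%VS by exact: capvSl.
have XN2 u n : u \in nker -> n \in (N ^+ 2)%VS -> u * n = 0 by move=> /nkerP [_]; exact.
pose Y := (N :\: nker)%VS.
have YN : (Y <= N)%VS by exact: diffvSl.
have YX : (Y :&: nker = 0)%VS by exact: capv_diff.
apply: (@goodA_T2X _ _ _ _ lN K0 IH nker Y) => //.
- apply: subv_trans (addvSl _ _); rewrite addvC addv_diff; exact: addvSl.
- apply/subvP => u; rewrite memv_cap => /andP [uX /memv_addP [y yY [n nN e]]].
  have : y \in (Y :&: nker)%VS.
    by rewrite memv_cap yY -(addrK n y) -e memvB // (subvP N2_nker).
  by rewrite YX memv0 => /eqP y0; rewrite e y0 add0r.
- by move=> u v uX vX; apply: nker_mul => //; exact: (subvP XN).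
move=> x s s' l l' xX sS sS' hl; case: (hl) => l1 l2 l3 l4 le.
apply: gen_mono (nd s s' l l' sS sS' hl) => t ht.
have chiE u : pr (l' - t *: l) u = pr l' u - t * pr l u by rewrite /pr mulmxBr -scalemxAr !mxE.
have [f hf] : exists f, forall u : car A, pr f u = pr (l' - t *: l) (x * u).
  by apply: lin_pr => a u v; rewrite mulrDr -scalerAr prD prZ.
(* On the socle [l' - t l] vanishes exactly on the line of [s + t s']. By nondegeneracy any
   functional on [Y] is a product with some [z] in [N^2]; this one makes [l' - t l] vanish on
   [(x - z) Y]. *)
have [z zN hz] : exists2 z, z \in (N ^+ 2)%VS & forall v, v \in Y -> pr (l' - t *: l) (z * v) = pr f v.
  apply: pair_surj => v vY h; apply/eqP; rewrite -memv0 -YX memv_cap vY; apply: ht; first exact: (subvP YN).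
  by move=> z zN; rewrite -chiE; exact: h.
exists z; split=> // [n nN|v vX|v vY].
- by have := NpM zN nN; rewrite N4 memv0 => /eqP.
- by rewrite mulrC XN2.
have vN := subvP YN v vY.
have hS : (x - z) * v \in soc N by rewrite mulrBl; apply: memvB; [exact: nker_mul | exact: N2_mul].
have : pr (l' - t *: l) ((x - z) * v) = 0 by rewrite mulrBl prD prN hz // hf subrr.
rewrite chiE => /eqP; rewrite subr_eq0 => /eqP e.
by rewrite [X in X \in _](le _ hS) e [t * _]mulrC -scalerA -scalerDr memvZ ?memv_line.
Qed.

(** For general [t] the functional [l' - t l] does not vanish on the line [N^3], which contains all
    products of [N^2] with [N]. *)
Lemma goodA_nd_h3_1 w : \dim (soc N) = 2%N -> ~~ (nker <= N ^+ 2)%VS -> (N ^+ 3 = <[w]>)%VS -> w != 0 -> goodA A.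
Proof.
move=> dS nX N3 w0; apply: goodA_nd => // s s' l l' sS sS' [l1 l2 l3 l4 le].
have wS : w \in soc N by apply: (subvP N3_soc); rewrite N3 memv_line.
pose g : {poly K} := (pr l' w)%:P - (pr l w)%:P * 'X.
have g0 : g != 0.
  apply: contra_neq w0 => h; have := congr1 (fun p : {poly K} => p`_0) h; have := congr1 (fun p : {poly K} => p`_1) h.
  rewrite /g !coefB !coefC !coefCM !coefX ?coef0 /= mulr0 subr0 mulr1 sub0r => /eqP.
  by rewrite oppr_eq0 => /eqP e1 e2; rewrite (le _ wS) e1 e2 !scale0r addr0.
apply: gen_mono (gen_ne g0) => t gt v vN h; apply/nkerP; split=> // z zN.
have : z * v \in (N ^+ 3)%VS := NM1 zN vN; rewrite N3 => /vlineP [k e].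
have := h z zN; rewrite e !prZ mulrCA -mulrBr => /eqP; rewrite mulf_eq0 => /orP [/eqP k0|].
  by rewrite mulrC e k0 scale0r.
by move: gt; rewrite /g hornerD hornerN hornerM !hornerC hornerX [_ * t]mulrC => /negbTE ->.
Qed.

(** Comparing dimensions in the pairings given by [phi] leaves only the Hilbert function (1, 3, 4,
    1), with [m = 9]. On words in three generators [phi] is a cubic and [psi], which kills [N^3], a
    quadric, both with lower terms. *)
Lemma goodA_cubic_quadric w : \dim (soc N) = 2%N -> (nker <= N ^+ 2)%VS -> (N ^+ 3 = <[w]>)%VS -> w != 0 ->
  (m <= 10)%N -> (\dim (N ^+ 2) + 3 <= \dim N)%N -> goodA A.
Proof.
move=> dS LN N3 w0 m10 e3.
have wS : w \in soc N by apply: (subvP N3_soc); rewrite N3 memv_line.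
have LE : nker = (N ^+ 2)%VS by apply: subv_anti; rewrite LN N2_nker.
have N2N : (N ^+ 2 <= N)%VS by have := NpS lN 0; rewrite expv1.
have wn : w \notin (0 : {vspace car A})%VS by rewrite memv0.
have [phi [p1 _]] := pr_sep wn.
have wph u : u \in (N ^+ 3)%VS -> pr phi u = 0 -> u = 0.
  by rewrite N3 => /vlineP [k ->]; rewrite prZ p1 mulr1 => ->; rewrite scale0r.
have d1 : (\dim (N ^+ 2) + \dim (N ^+ 2) <= \dim (soc N) + \dim N)%N.
  apply: (@pair_dim _ _ A (N ^+ 2) (soc N) N (N ^+ 2) phi) => // [u v hu hv|u hu h].
    by have := NpM hu hv; rewrite N4 memv0 => /eqP ->; rewrite pr0.
  by apply/annP => n nN; apply: wph; [exact: NM1 | exact: h].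
have d2 : (\dim N + \dim (soc N) <= \dim (N ^+ 2) + \dim (N ^+ 2))%N.
  apply: (@pair_dim _ _ A N (N ^+ 2) (N ^+ 2) (soc N) phi) => // [u v hu /annP hv|u hu h].
    by rewrite mulrC hv // pr0.
  by rewrite -LE; apply/nkerP; split=> // n nN; apply: wph; [exact: N1M | exact: h].
have F (a b mm : nat) : (a + a <= 2 + b)%N -> (b + 2 <= a + a)%N -> b.+1 = mm -> (mm <= 10)%N -> (a + 3 <= b)%N -> b = (a + 3)%N /\ mm = 9%N.
  by clear; lia.
rewrite dS in d1 d2; have [dN m9] := F _ _ _ d1 d2 (dimN lN) m10 e3.
pose C := (N :\: N ^+ 2)%VS.
have dC : \dim C = 3%N.
  by apply/eqP; rewrite -(eqn_add2l (\dim (N ^+ 2))) -{1}(capv_idPr N2N) dimv_cap_compl dN.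
have gC : (N <= C + N ^+ 2)%VS by rewrite addv_diff; exact: addvSl.
have CN : (C <= N)%VS by exact: diffvSl.
pose y (i : 'I_3) : car A := (vbasis C)`_i.
have yN i : y i \in N.
  by apply: (subvP CN); rewrite vbasis_mem // mem_nth // size_tuple dC.
have [x [xS xw]] : exists x, x \in soc N /\ x \notin (N ^+ 3)%VS.
  have [x xS xN] : exists2 x, x \in soc N & x \notin (N ^+ 3)%VS by apply: dim_lt_ex; rewrite dS N3 dim_vline w0.
  by exists x.
have [psi [q1 q2]] := pr_sep xw.
have sE : (soc N <= <[x]> + N ^+ 3)%VS.
  apply: eq_sub_dim; first by rewrite subv_add -memvE xS N3_soc.
  by rewrite dim_line_add // dS N3 dim_vline w0.
apply: (@goodA_letters2 _ _ _ _ lN _ y phi psi).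
- apply: subv_trans gC _; apply: addvS => //; apply/subvP => u uC; rewrite (coord_vbasis uC); apply: memv_suml => i _.
  by rewrite memvZ //; apply: (subvP (sumv_sup (cast_ord dC i) (isT : xpredT _) (subvv _))); exact: memv_line.
- move=> s /(subvP sE) /memv_addP [u /vlineP [k ->] [v vN ->]]; rewrite !prD !prZ => h1.
  rewrite q1 (q2 _ vN) addr0 mulr1 => k0; move: h1; rewrite k0 mul0r add0r scale0r add0r; exact: wph.
have cm : CM K (1 + (3 + 1)) by apply: IH; rewrite m9.
have h9 := good_cubic_quadric K0 (Phi := algfam y (fun b => if b then psi else phi)) _ _ _ cm.
apply: (@good_leq _ _ (3 + 1 + (1 + (3 + 1)))); first by rewrite m9.
apply: h9 => [b u hu|u hu|b u u' pu].
- by rewrite /algfam /= (word4 lN N4 yN hu) pr0.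
- rewrite /algfam /= q2 //; apply: (subvP (Np_le lN _ hu)) => //; apply: word_Np => //; by case: u hu.
by rewrite /algfam /= (perm_big _ pu).
Qed.

(** Unless [goodA_T1] applies, the pairing by [phi] forces the Hilbert function (1, e, e, 1) with
    [m = 2 e + 2], so [e] is 3 or 4. The generators are then corrected until the dual functional is
    a pure cubic form, for which [good_cubic34] has exactly enough points. *)
Lemma goodA_gor3 : \dim (soc N) = 1%N -> (N ^+ 3 != 0)%VS -> (m <= 10)%N -> (\dim (N ^+ 2) + 3 <= \dim N)%N -> goodA A.
Proof.
move=> dS N30 m10 e3.
have N2N : (N ^+ 2 <= N)%VS by have := NpS lN 0; rewrite expv1.
have [|/subvPn [x xL xN2]] := boolP (nker <= N ^+ 2)%VS; last first.
  by case/nkerP: xL => xN h; apply: (@goodA_T1 _ _ _ _ lN K0 IH x).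
move=> LN; have LE : nker = (N ^+ 2)%VS by apply: subv_anti; rewrite LN N2_nker.
have SE : soc N = (N ^+ 3)%VS.
  by apply/eqP; rewrite eq_sym eqEdim N3_soc dS lt0n dimv_eq0.
have [w wS w0] : exists2 w, w \in soc N & w != 0.
  by exists (vpick (soc N)); rewrite ?memv_pick // vpick0 -dimv_eq0 dS.
have SW : soc N = <[w]>%VS by apply/eqP; rewrite eq_sym eqEdim -memvE wS dS dim_vline w0.
have wn : w \notin (0 : {vspace car A})%VS by rewrite memv0.
have [phi [p1 _]] := pr_sep wn.
have wph u : u \in soc N -> pr phi u = 0 -> u = 0.
  by rewrite SW => /vlineP [k ->]; rewrite prZ p1 mulr1 => ->; rewrite scale0r.
have d1 : (\dim (N ^+ 2) + \dim (N ^+ 2) <= \dim (soc N) + \dim N)%N.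
  apply: (@pair_dim _ _ A (N ^+ 2) (soc N) N (N ^+ 2) phi) => // [u v hu hv|u hu h].
    by have := NpM hu hv; rewrite N4 memv0 => /eqP ->; rewrite pr0.
  by apply/annP => n nN; apply: wph; [rewrite SE; exact: NM1 | exact: h].
have d2 : (\dim N + \dim (soc N) <= \dim (N ^+ 2) + \dim (N ^+ 2))%N.
  apply: (@pair_dim _ _ A N (N ^+ 2) (N ^+ 2) (soc N) phi) => // [u v hu /annP hv|u hu h].
    by rewrite mulrC hv // pr0.
  by rewrite -LE; apply/nkerP; split=> // n nN; apply: wph; [rewrite SE; exact: N1M | exact: h].
pose C := (N :\: N ^+ 2)%VS; pose e := \dim C.
have dC : (\dim (N ^+ 2) + e = \dim N)%N by rewrite -{1}(capv_idPr N2N) dimv_cap_compl.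
have F (a b c mm : nat) : (a + a <= 1 + b)%N -> (b + 1 <= a + a)%N -> b.+1 = mm -> (mm <= 10)%N -> (a + 3 <= b)%N -> (a + c = b)%N ->
  (c = 3 \/ c = 4)%N /\ mm = (c + c + (1 + 1))%N by clear; lia.
rewrite dS in d1 d2; have [e34 me] := F _ _ _ _ d1 d2 (dimN lN) m10 e3 dC.
have gC : (N <= C + N ^+ 2)%VS by rewrite addv_diff; exact: addvSl.
have CN : (C <= N)%VS by exact: diffvSl.
have CN2 : (C :&: N ^+ 2 = 0)%VS by exact: capv_diff.
pose y0 (i : 'I_e) : car A := (vbasis C)`_i.
have y0C i : y0 i \in C by rewrite vbasis_mem // mem_nth // size_tuple.
have one_N u : (1 + N ^+ 2)%VS = (1 + N ^+ 2)%VS -> u \in (C :&: (1 + N ^+ 2))%VS -> u = 0.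
  move=> _; rewrite memv_cap => /andP [uC /memv_addP [c /vlineP [k ->] [n nN ec]]].
  have k0 : k = 0.
    apply/eqP/negPn/negP => k0; case/negP: (loc1 lN); rewrite -(scalerK k0 1) memvZ //.
    by rewrite -(addrK n (k *: 1)) -ec; apply: memvB; [exact: (subvP CN) | exact: (subvP N2N)].
  by apply/eqP; rewrite -memv0 -CN2 memv_cap uC ec k0 scale0r add0r.
(* With [n i] representing [- 1/2 pr phi (y0 i * _)] on [C], the generators [y0 i + n i] satisfy
   [pr phi (y i * y j) = 0]: each of the two cross terms removes one half. *)
have hn i : exists2 n, n \in (N ^+ 2)%VS & forall v, v \in C -> pr phi (n * v) = - 2%:R^-1 * pr phi (y0 i * v).
  have [f hf] : exists f, forall u : car A, pr f u = - 2%:R^-1 * pr phi (y0 i * u).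
    by apply: lin_pr => a u v; rewrite mulrDr -scalerAr prD prZ mulrDr mulrCA.
  have [n nN h] : exists2 n, n \in (N ^+ 2)%VS & forall v, v \in C -> pr phi (n * v) = pr f v.
    apply: pair_surj => v vC h; apply/eqP; rewrite -memv0 -CN2 memv_cap vC -LE.
    apply/nkerP; split; first exact: (subvP CN).
    by move=> n nN; rewrite mulrC; apply: wph; [apply: N2_mul => //; exact: (subvP CN) | exact: h].
  by exists n => // v vC; rewrite h // hf.
have hn' i : exists n, n \in (N ^+ 2)%VS /\ forall v, v \in C -> pr phi (n * v) = - 2%:R^-1 * pr phi (y0 i * v).
  by have [x h1 h2] := hn i; exists x.
have [n hnn] := fun_choice hn'.
pose y i := y0 i + n i.
have yN i : y i \in N by apply: memvD; [exact: (subvP CN) | apply: (subvP N2N); case: (hnn i)].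
have y2 i j : pr phi (y i * y j) = 0.
  rewrite /y mulrDl !mulrDr !prD (hnn i).2 // [y0 i * n j]mulrC (hnn j).2 // [y0 j * y0 i]mulrC.
  have -> : n i * n j = 0 by have := NpM (hnn i).1 (hnn j).1; rewrite N4 memv0 => /eqP.
  by rewrite pr0; field; exact: two_neq0.
pose W := (1 + \sum_i <[y i]>)%VS.
(* [phi'] agrees with [phi] on [N^2] and vanishes at 1 and at the generators, so only its cubic
   values are nonzero. *)
have [phi' [f1 f2]] : exists l', (forall u, u \in (N ^+ 2)%VS -> pr l' u = pr phi u) /\ (forall u, u \in W -> pr l' u = 0).
  apply: pr_ext => u; rewrite memv_cap => /andP [uN /memv_addP [c /vlineP [k ->] [v /memv_sumP [z hz ->] eu]]].
  have ch i : exists a, z i = a *: y i by apply/vlineP; exact: hz.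
  have [a ha] := fun_choice ch.
  have eu' : u = k *: 1 + \sum_i a i *: y0 i + \sum_i a i *: n i.
    by rewrite eu -addrA -big_split; congr (_ + _); apply: eq_bigr => i _ /=; rewrite ha -scalerDr.
  have z0 : \sum_i a i *: y0 i = 0.
    apply: one_N => //; rewrite memv_cap memv_suml => [/=|i _]; last by rewrite memvZ.
    have -> : \sum_i a i *: y0 i = - k *: 1 + (u - \sum_i a i *: n i) by rewrite eu' scaleNr; ring.
    apply: memv_add; first by rewrite memvZ ?memv_line.
    by rewrite memvB // memv_suml // => i _; rewrite memvZ // (hnn i).1.
  have a0 i : a i = 0 by rewrite -(coord_sum_free a i (basis_free (vbasisP C))) -/e z0 linear0.
  have k0 : k = 0.
    apply/eqP/negPn/negP => k0; case/negP: (loc1 lN); rewrite -(scalerK k0 1) memvZ //.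
    move: eu'; rewrite z0 addr0 big1 ?addr0 => [<-|i _]; [exact: (subvP N2N) | by rewrite a0 scale0r].
  by rewrite eu' k0 scale0r z0 !add0r big1 ?pr0 // => i _; rewrite a0 scale0r.
apply: (@goodA_letters2 _ _ _ _ lN _ y phi' phi').
- apply: subv_trans gC _; rewrite -{1}(vsum_basis C) subv_add addvSr andbT; apply/subv_sumP => i _.
  rewrite -memvE -[X in X \in _](addrK (n i)); apply: memv_add; last by rewrite memvN (hnn i).1.
  by apply: (subvP (sumv_sup i (isT : xpredT i) (subvv _))); exact: memv_line.
- by move=> s sS h _; apply: wph => //; rewrite -f1 // (subvP SN2).
apply: (@good_leq _ _ (e + e + (1 + 1))); first by rewrite me.
apply: (good_ext _ (@good_cubic34 K K0 e (fun i j k => pr phi (y i * y j * y k)) e34 _ _)).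
- move=> b; case=> [|i [|j [|k [|l w']]]] /=; rewrite /algfam /= if_same ?big_cons ?big_nil.
  + by rewrite f2 // (subvP (addvSl _ _)) ?memv_line.
  + rewrite mulr1 f2 //; apply: (subvP (addvSr _ _)); apply: (subvP (sumv_sup i (isT : xpredT i) (subvv _))); exact: memv_line.
  + by rewrite mulr1 f1 ?y2 //; exact: NN.
  + by rewrite mulr1 mulrA f1 // (subvP SN2) // SE; apply: NM1 => //; exact: NN.
  have := word4 lN N4 yN (isT : (3 < size [:: i, j, k, l & w'])%N); rewrite !big_cons => ->; by rewrite pr0.
- by move=> i j k; rewrite [y i * y j]mulrC.
by move=> i j k; rewrite mulrAC.
Qed.

End CubicCases.

Lemma quad_neq0 (K : closedFieldType) (x y u : K) : ~ [/\ x = 0, y = 0 & u = 0] ->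
  exists t, x * t ^+ 2 + y * t + u != 0.
Proof.
move=> h; have q0 : u%:P + y *: 'X - (- x) *: 'X^2 != 0 :> {poly K}.
  by apply/eqP => /quad_coef [e1 e2 /eqP]; rewrite oppr_eq0 => /eqP e3; apply: h.
have [t ht] := poly_neq0_ex q0; exists t; apply: contraNneq ht => e.
rewrite !(hornerD, hornerN, hornerZ, hornerC, hornerX, hornerXn) -e; apply/eqP; ring.
Qed.

Section Dependence.
Variables (K : fieldType) (m : nat) (A : calg K m).
Implicit Types (u v w x y z s : car A) (U V W X Y : {vspace car A}).

Lemma dep_mod U W h (f : 'I_h.+1 -> car A) : (U <= W)%VS -> \dim W = (\dim U + h)%N -> (forall i, f i \in W) ->
  exists c : 'I_h.+1 -> K, (exists i, c i != 0) /\ \sum_i c i *: f i \in U.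
Proof.
move=> UW dW fW; have [l [e [l0 eW le lW]]] := quot_coord UW dW.
pose M : 'M[K]_(h.+1, h) := \matrix_(i, j) pr (l j) (f i).
have : kermx M != 0.
  by rewrite -mxrank_eq0 mxrank_ker subn_eq0 -ltnNge; apply: leq_ltn_trans (rank_leq_col M) _.
case/rowV0Pn => v /sub_kermxP vM v0; exists (fun i => v 0 i); split.
  apply: NNPP => hn; case/eqP: v0; apply/rowP => i; rewrite mxE.
  by apply/eqP/negPn/negP => h0; apply: hn; exists i.
have [u uU ->] := lW (\sum_i v 0 i *: f i) (memv_suml _ (fun i _ => memvZ _ (fW i))).
rewrite big1 ?add0r // => j _; suff -> : pr (l j) (\sum_i v 0 i *: f i) = 0 by rewrite scale0r.
have := congr1 (fun X : 'rV_h => X 0 j) vM; rewrite !mxE => h0; rewrite -[RHS]h0 pr_sum.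
by apply: eq_bigr => i _; rewrite prZ mxE.
Qed.

End Dependence.

(** * N^4 = 0 and N^3 equal to a socle of dimension two *)

Section LevelTwo.
Variables (K : closedFieldType) (m : nat) (A : calg K m) (N : {vspace car A}).
Hypothesis lN : localA N.
Hypothesis K0 : [pchar K] =i pred0.
Hypothesis IH : forall k, (k < m)%N -> CM K k.
Hypothesis SN2 : (soc N <= N ^+ 2)%VS.
Hypothesis N4 : (N ^+ 4 = 0)%VS.
Hypothesis dS : \dim (soc N) = 2%N.
Hypothesis SN3 : (soc N <= N ^+ 3)%VS.
Hypothesis e3 : (\dim (N ^+ 2) + 3 <= \dim N)%N.
Implicit Types (u v w x y z s : car A) (U V W X Y : {vspace car A}).

Lemma N3E : (N ^+ 3 = soc N)%VS.
Proof. by apply: subv_anti; rewrite SN3 N3_soc. Qed.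

(* A pencil of binary cubics consisting of cubes of linear forms is constant. *)
Lemma goodA_binary a b : a \in N -> b \in N -> (N <= <[a]> + <[b]> + nker N)%VS -> goodA A.
Proof.
move=> aN bN g; have LN : ~~ (nker N <= N ^+ 2)%VS.
  apply/negP => h; have : (N <= <[a]> + (<[b]> + N ^+ 2))%VS by apply: subv_trans g _; rewrite -addvA; do 2 apply: addvS => //.
  move/dimvS; rewrite leqNgt => /negP; apply; apply: leq_ltn_trans (dim_line_le _ _) _.
  by apply: leq_trans e3; rewrite addn3 !ltnS dim_line_le.
apply: (@goodA_nd _ _ _ _ lN K0 IH SN2 N4 dS LN) => s s' l l' sS sS' [l1 l2 l3 l4 le].
pose p (i : 'I_4) : car A := nth 0 [:: a * a * a; a * a * b; a * b * b; b * b * b] i.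
pose al i := pr l (p i); pose be i := pr l' (p i).
have n3 x y z : x \in N -> y \in N -> z \in N -> x * y * z \in (N ^+ 3)%VS by move=> *; apply: NM1 => //; exact: NN.
have pN (x : car A) : x \in N -> exists al be n, [/\ x = al *: a + be *: b + n, n \in N & forall k, k \in (N ^+ 2)%VS -> n * k = 0].
  move=> /(subvP g) /memv_addP [y /memv_addP [? /vlineP [k1 ->] [? /vlineP [k2 ->] ->]] [n /nkerP [n1 n2] ->]].
  by exists k1, k2, n.
pose c (i : 'I_4) t := be i - t * al i.
have gb (i j k n : 'I_4) : (forall t, c i t * c j t = c k t * c n t) \/ gen (fun t => c i t * c j t - c k t * c n t != 0).
  have [h|/not_all_ex_not [t ht]] := classic (forall t, c i t * c j t = c k t * c n t); [by left | right].
  pose q i0 : {poly K} := (be i0)%:P - (al i0)%:P * 'X.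
  have qE i0 t' : (q i0).[t'] = c i0 t' by rewrite /q /c hornerD hornerN hornerM !hornerC hornerX [t' * _]mulrC.
  have : (q i * q j - q k * q n).[t] != 0 by rewrite hornerD hornerN !hornerM !qE subr_eq0; apply/eqP.
  by move/gen_bad; apply: gen_mono => t'; rewrite hornerD hornerN !hornerM !qE.
(* On words in [a] and [b] the functional [l' - t l] is a binary cubic with coefficients [c i t]; it
   is nondegenerate as soon as one minor of its catalecticant is nonzero. *)
have nd t : [\/ c 0 t * c 2 t - c 1 t * c 1 t != 0, c 0 t * c 3 t - c 1 t * c 2 t != 0 | c 1 t * c 3 t - c 2 t * c 2 t != 0] ->
    forall v, v \in N -> (forall z, z \in (N ^+ 2)%VS -> pr l' (z * v) - t * pr l (z * v) = 0) -> v \in nker N.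
  move=> hc v vN h; have [x [y [n [ev nN hn]]]] := pN v vN.
  have E z i j : z \in (N ^+ 2)%VS -> z * a = p i -> z * b = p j -> x * c i t + y * c j t = 0.
    move=> zN ei ej; rewrite -[RHS](h z zN) ev !mulrDr -!scalerAr ei ej [z * n]mulrC (hn _ zN) addr0 !prD !prZ.
    by rewrite /c /al /be; ring.
  have E1 : x * c 0 t + y * c 1 t = 0 by apply: (E (a * a)) => //; rewrite ?NN.
  have E2 : x * c 1 t + y * c 2 t = 0 by apply: (E (a * b)); rewrite ?NN // /p /=; ring.
  have E3 : x * c 2 t + y * c 3 t = 0 by apply: (E (b * b)); rewrite ?NN // /p /=; ring.
  have [x0 y0] : x = 0 /\ y = 0.
    case: hc => h0; split; apply: (mulIf h0); rewrite mul0r.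
    + transitivity ((x * c 0 t + y * c 1 t) * c 2 t - (x * c 1 t + y * c 2 t) * c 1 t); first by ring. by rewrite E1 E2; ring.
    + transitivity ((x * c 1 t + y * c 2 t) * c 0 t - (x * c 0 t + y * c 1 t) * c 1 t); first by ring. by rewrite E1 E2; ring.
    + transitivity ((x * c 0 t + y * c 1 t) * c 3 t - (x * c 2 t + y * c 3 t) * c 1 t); first by ring. by rewrite E1 E3; ring.
    + transitivity ((x * c 2 t + y * c 3 t) * c 0 t - (x * c 0 t + y * c 1 t) * c 2 t); first by ring. by rewrite E1 E3; ring.
    + transitivity ((x * c 1 t + y * c 2 t) * c 3 t - (x * c 2 t + y * c 3 t) * c 2 t); first by ring. by rewrite E2 E3; ring.
    transitivity ((x * c 2 t + y * c 3 t) * c 1 t - (x * c 1 t + y * c 2 t) * c 2 t); first by ring. by rewrite E2 E3; ring.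
  by apply/nkerP; rewrite ev x0 y0 !scale0r !add0r.
have [M1|M1] := gb 0 2 1 1; last by apply: gen_mono M1 => t ht; apply: nd; exact: Or31.
have [M2|M2] := gb 0 3 1 2; last by apply: gen_mono M2 => t ht; apply: nd; exact: Or32.
have [M3|M3] := gb 1 3 2 2; last by apply: gen_mono M3 => t ht; apply: nd; exact: Or33.
have two : (2%:R : K) != 0 by exact: natK_neq0.
(* The minors now vanish identically in [t]; the values at 0, 1 and -1 give the three coefficients
   of each relation. *)
have co i j k n : (forall t, c i t * c j t = c k t * c n t) ->
   [/\ be i * be j = be k * be n, al i * be j + al j * be i = al k * be n + al n * be k & al i * al j = al k * al n].
  move=> h; have e0 : be i * be j = be k * be n by have := h 0; rewrite /c !mul0r !subr0.
  have h1 := h 1; have h2 := h (-1); rewrite /c in h1 h2; split=> //; apply: (mulfI two).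
    transitivity ((be i - -1 * al i) * (be j - -1 * al j) - (be i - 1 * al i) * (be j - 1 * al j)); first by ring.
    by rewrite h1 h2; ring.
  transitivity ((be i - -1 * al i) * (be j - -1 * al j) + (be i - 1 * al i) * (be j - 1 * al j) - 2%:R * (be i * be j)); first by ring.
  by rewrite h1 h2 e0; ring.
have {M1}[b1 ab1 a1] := co _ _ _ _ M1; have {M2}[b2 ab2 a2] := co _ _ _ _ M2; have {M3}[b3 ab3 a3] := co _ _ _ _ M3.
have sq (x : K) : x ^+ 2 = 0 -> x = 0 by move/eqP; rewrite expf_eq0 => /eqP.
have D01 : al 0 * be 1 - al 1 * be 0 = 0.
  apply: sq; transitivity (al 0 * al 0 * (be 1 * be 1) - al 0 * be 0 * (al 1 * be 1 + al 1 * be 1) + (al 1 * al 1) * (be 0 * be 0)); first by ring.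
  by rewrite -b1 -ab1 -a1; ring.
have D23 : al 2 * be 3 - al 3 * be 2 = 0.
  apply: sq; transitivity (al 3 * al 3 * (be 2 * be 2) - al 3 * be 3 * (al 2 * be 2 + al 2 * be 2) + (al 2 * al 2) * (be 3 * be 3)); first by ring.
  by rewrite -b3 -ab3 -a3; ring.
have D02 : al 0 * be 2 - al 2 * be 0 = 0.
  apply: sq; transitivity ((al 0 * be 2 + al 2 * be 0) ^+ 2 - 4%:R * (al 0 * al 2) * (be 0 * be 2)); first by ring.
  by rewrite ab1 a1 b1; ring.
have D13 : al 1 * be 3 - al 3 * be 1 = 0.
  apply: sq; transitivity ((al 1 * be 3 + al 3 * be 1) ^+ 2 - 4%:R * (al 1 * al 3) * (be 1 * be 3)); first by ring.
  by rewrite ab3 a3 b3; ring.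
have D12 : al 1 * be 2 - al 2 * be 1 = 0.
  have e0 : al 0 * (al 1 * be 2 - al 2 * be 1) = 0.
    transitivity (al 1 * (al 0 * be 2 - al 2 * be 0) - al 2 * (al 0 * be 1 - al 1 * be 0)); first by ring.
    by rewrite D01 D02 !mulr0 subrr.
  have e1 : be 0 * (al 1 * be 2 - al 2 * be 1) = 0.
    transitivity (be 1 * (al 0 * be 2 - al 2 * be 0) - be 2 * (al 0 * be 1 - al 1 * be 0)); first by ring.
    by rewrite D01 D02 !mulr0 subrr.
  have [a00|a00] := eqVneq (al 0) 0; last by apply: (mulfI a00); rewrite e0 mulr0.
  have [b00|b00] := eqVneq (be 0) 0; last by apply: (mulfI b00); rewrite e1 mulr0.
  have -> : al 1 = 0 by apply: sq; rewrite expr2 -a1 a00 mul0r.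
  have -> : be 1 = 0 by apply: sq; rewrite expr2 -b1 b00 mul0r.
  by rewrite mul0r mulr0 subrr.
have D03 : al 0 * be 3 - al 3 * be 0 = 0.
  apply: sq; transitivity ((al 0 * be 3 + al 3 * be 0) ^+ 2 - 4%:R * (al 0 * al 3) * (be 0 * be 3)); first by ring.
  rewrite ab2 a2 b2; transitivity ((al 1 * be 2 - al 2 * be 1) ^+ 2); first by ring.
  by rewrite D12 expr0n.
(* The vectors [al] and [be] are proportional, so a nonzero combination of the two socle coordinates
   vanishes on all cubes, hence on [N^3]. As [N^3] is the socle, this is absurd. *)
have [[f1 f2] [hf fp]] : exists f : K * K, (f.1 != 0 \/ f.2 != 0) /\ forall i, f.1 * al i + f.2 * be i = 0.
  have P (R : 'I_4 -> Prop) : R 0 -> R 1 -> R 2 -> R 3 -> forall i, R i.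
    move=> h0 h1 h2 h3 [[|[|[|[|i]]]] hi] //; [move: h0 | move: h1 | move: h2 | move: h3];
    by congr R; apply: val_inj.
  have DD i j : al i * be j - al j * be i = 0.
    move: i j; do 2 apply: (P); rewrite ?subrr //;
    by rewrite -[LHS]opprB ?D01 ?D02 ?D03 ?D12 ?D13 ?D23 oppr0.
  have [[j hj]|hn] := classic (exists j, al j != 0 \/ be j != 0).
    exists (be j, - al j); split=> /= [|i]; first by case: hj => h; [right; rewrite oppr_eq0 | left].
    by rewrite -(DD i j); ring.
  exists (1, 0); split=> /= [|i]; first by left; exact: oner_neq0.
  rewrite mul0r addr0 mul1r; apply/eqP/negPn/negP => h; apply: hn; exists i; by left.
pose chi u := f1 * pr l u + f2 * pr l' u.
have chiD u v : chi (u + v) = chi u + chi v by rewrite /chi !prD; ring.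
have chiZ k u : chi (k *: u) = k * chi u by rewrite /chi !prZ; ring.
have chi0 u : u \in (N ^+ 3)%VS -> chi u = 0.
  move: u; apply: (@N3_ind _ _ _ _ K0 (fun u => chi u = 0)).
  - by rewrite /chi !pr0 !mulr0 addr0.
  - by move=> u v hu hv; rewrite chiD hu hv addr0.
  - by move=> k u hu; rewrite chiZ hu mulr0.
  move=> u uN; have [x [y [n [eu nN hn]]]] := pN u uN; pose v := x *: a + y *: b.
  have vN : v \in N by rewrite memvD ?memvZ.
  have -> : u * u * u = v * v * v + n * (v * v + v * v + v * v + v * n + v * n + v * n + n * n) by rewrite eu -/v; ring.
  rewrite hn ?memvD ?NN // addr0.
  have -> : v * v * v = x ^+ 3 *: p 0 + (3%:R * x ^+ 2 * y) *: p 1 + (3%:R * x * y ^+ 2) *: p 2 + y ^+ 3 *: p 3.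
    have al_ex (k : K) : exists X : car A, forall u', k *: u' = X * u' by exists k%:A => u'; rewrite mulr_algl.
    have [X eX] := al_ex x; have [Z eY] := al_ex y.
    have -> : x ^+ 3 *: p 0 = x *: (x *: (x *: p 0)) by rewrite !scalerA; congr (_ *: _); ring.
    have -> : (3%:R * x ^+ 2 * y) *: p 1 = y *: (x *: (x *: (p 1 + p 1 + p 1))).
      by rewrite !scalerDr !scalerA -!scalerDl; congr (_ *: _); ring.
    have -> : (3%:R * x * y ^+ 2) *: p 2 = y *: (y *: (x *: (p 2 + p 2 + p 2))).
      by rewrite !scalerDr !scalerA -!scalerDl; congr (_ *: _); ring.
    have -> : y ^+ 3 *: p 3 = y *: (y *: (y *: p 3)) by rewrite !scalerA; congr (_ *: _); ring.
    by rewrite /v !eX !eY /p /=; ring.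
  rewrite !chiD !chiZ /chi -!/(al _) -!/(be _) !fp; ring.
have hs : chi s = 0 by apply: chi0; rewrite N3E.
have hs' : chi s' = 0 by apply: chi0; rewrite N3E.
move: hs hs'; rewrite /chi l1 l2 l3 l4 !mulr1 !mulr0 addr0 add0r => h1 h2.
by case: hf => /=; rewrite ?h1 ?h2 eqxx.
Qed.

Hypothesis m10 : (m <= 10)%N.

(** The kernel of a multiplier from [net2] annihilates [N^2] and has codimension two in [N] modulo
    [N^2]; so only two generators matter. *)
Lemma goodA_h3_2_h2_2 : \dim (N ^+ 2) = (\dim (N ^+ 3) + 2)%N -> goodA A.
Proof.
move=> d2; have [a aN aN2'] := net2 lN K0 d2.
have aN2 : (N ^+ 2 <= <[a]> * N)%VS.
  apply: (nakayama lN) => [u v h|]; first by rewrite -[N]expv1 ideal_line_mul // expv1.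
  by rewrite -expvSl.
have dX := dim_mker aN aN2 0; rewrite expv1 -/(mker N a) in dX.
have dX2 : (\dim (mker N a :&: N ^+ 2) = 2)%N.
  by apply/eqP; rewrite -(eqn_add2r (\dim (N ^+ 3))) (mker_capE lN) // (dim_mker aN aN2 1) d2 addnC.
have XL : (mker N a <= nker N)%VS.
  apply/subvP => u hu; apply/nkerP; split; first by move: hu; rewrite mkerP => /andP [].
  by move=> n; exact: (mker_N2 aN2).
have XN : (mker N a + N ^+ 2 <= N)%VS by rewrite subv_add capvSl /=; have := NpS lN 0; rewrite expv1.
have dXN : (\dim (mker N a + N ^+ 2) + 2 = \dim N)%N.
  by have := dimv_sum_cap (mker N a) (N ^+ 2); rewrite dX2 dX.
have [b bN bX] : exists2 b, b \in N & b \notin (mker N a + N ^+ 2)%VS by apply: dim_lt_ex; rewrite -dXN addn2.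
have [c cN cX] : exists2 c, c \in N & c \notin (<[b]> + (mker N a + N ^+ 2))%VS.
  by apply: dim_lt_ex; rewrite dim_line_add // -dXN addn2.
apply: (@goodA_binary c b) => //; apply: eq_sub_dim.
  by rewrite !subv_add -!memvE cN bN capvSl.
apply: (@leq_trans (\dim (<[c]> + (<[b]> + (mker N a + N ^+ 2))))).
  by rewrite !dim_line_add // -dXN addn2.
by apply: dimvS; rewrite -addvA; do 2 apply: addvS => //; rewrite subv_add XL N2_nker.
Qed.

(* Multiplication by [a] identifies [N^2] with [N] modulo [mker]; transporting the product
   along it makes a three-dimensional quotient of [N] an associative algebra. *)
Lemma goodA_h3_2_rep3 a : a \in N -> (N ^+ 2 <= <[a]> * N)%VS -> \dim (N ^+ 2) = (\dim (N ^+ 3) + 3)%N -> goodA A.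
Proof.
move=> aN aN2 d2.
have d3 : \dim (N ^+ 3) = 2%N by rewrite N3E.
have dX := dim_mker aN aN2 0; rewrite expv1 -/(mker N a) in dX.
have dX2 : (\dim (mker N a :&: N ^+ 2) = 3)%N.
  by apply/eqP; rewrite -(eqn_add2r (\dim (N ^+ 3))) (mker_capE lN) // (dim_mker aN aN2 1) d2 addnC.
have XN : (mker N a <= N)%VS by exact: capvSl.
have N2N : (N ^+ 2 <= N)%VS by have := NpS lN 0; rewrite expv1.
pose Wk := (mker N a + N ^+ 2)%VS.
have WN : (Wk <= N)%VS by rewrite subv_add XN.
have dW : \dim N = (\dim Wk + 3)%N.
  by have := dimv_sum_cap (mker N a) (N ^+ 2); rewrite dX2 dX => <-.
have [lc [y [lc0 yN lcy gN]]] := @quot_coord _ _ A Wk N 3 WN dW.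
have aaN : a * a \in (N ^+ 2)%VS by exact: NN.
pose vl (t : 'rV[K]_3) : car A := \sum_k t 0 k *: y k.
have vlD t t' : vl (t - t') = vl t - vl t'.
  by rewrite /vl -sumrB; apply: eq_bigr => k _; rewrite !mxE scalerBl.
have vlN t : vl t \in N by apply: memv_suml => k _; rewrite memvZ.
have N3a u : u \in (N ^+ 3)%VS -> a * u = 0 by move=> h; have := N1M aN h; rewrite N4 memv0 => /eqP.
have inj t : a * vl t \in (N ^+ 3)%VS -> t = 0.
  move=> /(subvP (mult_pow aN2 1)) /line_mulP [n nN e].
  have nN' : n \in N := subvP N2N n nN.
  have h : vl t \in Wk.
    rewrite -(subrK n (vl t)); apply: memv_add => //; rewrite mkerP memvB //=.
    by rewrite mulrC mulrBr e subrr.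
  apply/rowP => k; rewrite mxE -[RHS](lc0 k _ h) /vl pr_sum (bigD1 k) //= big1 ?addr0.
    by rewrite prZ lcy eqxx mulr1.
  by move=> j jk; rewrite prZ lcy eq_sym (negbTE jk) mulr0.
have crd w : w \in N -> exists t, w - vl t \in Wk.
  move=> wN; have [w0 hw0 ew] := gN w wN; exists (\row_k pr (lc k) w).
  have -> : vl (\row_k pr (lc k) w) = \sum_k pr (lc k) w *: y k by apply: eq_bigr => k _; rewrite mxE.
  by rewrite {1}ew [X in X - _]addrC addrK.
have exq (u v : car A) : u \in N -> v \in N -> exists t, u * v - a * vl t \in (N ^+ 3)%VS.
  move=> uN vN; have /(subvP aN2) /line_mulP [w wN e] := NN uN vN.
  have [t /memv_addP [x hx [n nN en]]] := crd w wN; exists t; rewrite e -mulrBr en; move: hx.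
  rewrite mkerP => /andP [_ /eqP xa].
  by rewrite mulrDr [a * x]mulrC xa add0r N1M.
pose S t u v := u * v - a * vl t \in (N ^+ 3)%VS.
have Suniq t t' u v : S t u v -> S t' u v -> t = t'.
  move=> h h'; apply/eqP; rewrite -subr_eq0; apply/eqP; apply: inj; rewrite vlD mulrBr.
  have -> : a * vl t - a * vl t' = (u * v - a * vl t') - (u * v - a * vl t) by ring.
  exact: memvB.
have exS (q : 'I_3 * 'I_3) : exists t, S t (y q.1) (y q.2) by exact: exq.
(* Structure constants: [y i * y j] is [a] times the vector [T0 (i, j)] modulo [N^3]. *)
have [T0 hT0] := fun_choice exS.
pose T j : 'M[K]_3 := \matrix_i T0 (i, j).
have TE t j : S (t *m T j) (vl t) (y j).
  rewrite /S mulmx_sum_row /vl mulr_suml.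
  have -> : \sum_k (\sum_i t 0 i *: row i (T j)) 0 k *: y k = \sum_i t 0 i *: vl (T0 (i, j)).
    rewrite /vl; under [RHS]eq_bigr do rewrite scaler_sumr; rewrite exchange_big /=; apply: eq_bigr => k _.
    rewrite summxE scaler_suml; apply: eq_bigr => i _; by rewrite rowK mxE scalerA.
  rewrite mulr_sumr -sumrB; apply: memv_suml => i _.
  by rewrite -scalerAl -scalerAr -scalerBr memvZ //; exact: (hT0 (i, j)).
have mS t u v z : S t u v -> z \in N -> a * (vl t * z) = u * v * z.
  move=> h zN; apply/eqP; rewrite -subr_eq0 -memv0 -N4.
  have -> : a * (vl t * z) - u * v * z = - ((u * v - a * vl t) * z) by ring.
  by rewrite memvN NM1.
have [r hr] := crd a aN.
have WkN z w : z \in N -> w \in Wk -> w * z \in (N ^+ 3)%VS.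
  move=> zN /memv_addP [x xX [n nN ->]]; rewrite mulrDl; apply: memvD; last exact: NM1.
  by rewrite N3E; apply: nker_mul => //; apply/nkerP; split; [exact: (subvP XN) | move=> n' hn'; exact: (mker_N2 aN2)].
have aWk w z : w \in Wk -> z \in N -> a * w * z = 0.
  by move=> wW zN; rewrite -mulrA N3a // WkN.
have vlE k : vl (delta_mx 0 k) = y k.
  rewrite /vl (bigD1 k) //= mxE !eqxx scale1r big1 ?addr0 // => j jk; by rewrite mxE (negbTE jk) andbF scale0r.
have rT i : r *m T i = delta_mx 0 i.
  apply: (Suniq _ _ (vl r) (y i)); first exact: TE.
  rewrite /S vlE -mulrBl -opprB mulNr memvN; exact: WkN.
have aavl (t : 'rV[K]_3) j : a * (vl t * y j) = a * a * vl (t *m T j).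
  by have := N3a _ (TE t j); rewrite mulrBr => /eqP; rewrite subr_eq0 => /eqP ->; rewrite mulrA.
(* Since [a] is [vl r] modulo [Wk], every cubic monomial is [a^2] times a vector obtained from [r]
   by the matrices, as [goodA_peel] requires. *)
have word i j k : y i * y j * y k = a * a * vl (r *m T i *m T j *m T k).
  rewrite -aavl rT; have := mS _ _ _ (y k) (TE (delta_mx 0 i) j) (yN k); rewrite vlE => <- //.
have [s1 [s2 [l1 [l2 [[s1S s2S le] [l11 l12 l21 l22]]]]]] := soc_basis dS.
(* The two socle coordinates of [a^2 y k]. These elements span [N^3], the whole socle, so the rank
   is 2 and the kernel of [Lm] is at most a line. *)
pose Lm : 'M[K]_(3, 2) := \matrix_(k, j) pr (if j == 0 then l1 else l2) (a * a * y k).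
have LmE (t : 'rV[K]_3) j : (t *m Lm) 0 j = pr (if j == 0 then l1 else l2) (a * a * vl t).
  by rewrite mxE /vl mulr_sumr pr_sum; apply: eq_bigr => k _; rewrite -scalerAr prZ mxE.
have rL : (2 <= \rank Lm)%N.
  rewrite leqNgt; apply/negP => h.
  have : kermx Lm^T != 0 by rewrite -mxrank_eq0 mxrank_ker subn_eq0 -ltnNge mxrank_tr.
  case/rowV0Pn => v /sub_kermxP vM v0.
  pose chi u := v 0 0 * pr l1 u + v 0 1 * pr l2 u.
  have chiY k : chi (a * a * y k) = 0.
    have := congr1 (fun X : 'rV_3 => X 0 k) vM; rewrite !mxE !big_ord_recl big_ord0 !mxE /= addr0 => e.
    by rewrite -[RHS]e /chi; congr (_ * _ + v 0 _ * _); apply: val_inj.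
  have chi0 u : u \in (N ^+ 3)%VS -> chi u = 0.
    move=> /(subvP (mult_pow aN2 1)) /line_mulP [n1 /(subvP aN2) /line_mulP [w wN ->] ->].
    have [w0 hw0 ->] := gN w wN; rewrite !mulrDr [a * w0]mulrC (_ : a * (w0 * a) = 0) ?addr0; last first.
      by rewrite -(aWk w0 a hw0 aN); ring.
    rewrite !mulr_sumr /chi !pr_sum !mulr_sumr -big_split /= big1 // => k _.
    rewrite -!scalerAr mulrA !prZ; transitivity (pr (lc k) w * chi (a * a * y k)); first by rewrite /chi; ring.
    by rewrite chiY mulr0.
  case/eqP: v0; apply/rowP => j; rewrite mxE.
  have h1 : v 0 0 = 0 by have := chi0 s1; rewrite /chi l11 l21 mulr1 mulr0 addr0; apply; rewrite N3E.
  have h2 : v 0 1 = 0 by have := chi0 s2; rewrite /chi l12 l22 mulr1 mulr0 add0r; apply; rewrite N3E.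
  by case: j => [[|[|j]] hj] //; [rewrite -[RHS]h1 | rewrite -[RHS]h2]; congr (v 0 _); apply: val_inj.
have TC i j : T i *m T j = T j *m T i.
  (* The rows of the commutator [Om] lie in the kernel of [Lm], so they are multiples of one vector.
     The elements [a * (vl (row p Om) * y q)] are antisymmetric in [p] and [q], because [B] is
     symmetric; with proportional rows this forces them to vanish. *)
  apply/eqP; rewrite -subr_eq0; set Om := (_ - _); apply/eqP.
  have OmE p : row p Om = delta_mx 0 p *m T i *m T j - delta_mx 0 p *m T j *m T i.
    by rewrite rowE /Om mulmxBr !mulmxA.
  have wd p i' j' : a * a * vl (delta_mx 0 p *m T i' *m T j') = y p * y i' * y j' by rewrite word rT.
  have OL : Om *m Lm = 0.
    apply/row_matrixP => p; apply/rowP => q; rewrite row_mul LmE OmE vlD mulrBr !wd row0 mxE.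
    by rewrite mulrAC subrr pr0.
  have [k0 hk0] : exists k0 : 'rV[K]_3, forall p, exists c, row p Om = c *: k0.
    exists (nz_row (kermx Lm)) => p; apply/sub_rVP.
    apply: (submx_trans (row_sub p Om)); apply: (submx_trans (_ : Om <= kermx Lm)%MS); first by apply/sub_kermxP.
    rewrite -(geq_leqif (mxrank_leqif_sup (nz_row_sub (kermx Lm)))) rank_rV nz_row_eq0 -mxrank_eq0 mxrank_ker.
    by case: (3 - \rank Lm)%N (leq_sub2l 3 rL) => [|[|]].
  have [c hc] := fun_choice hk0.
  pose B p i' q j' := vl (delta_mx 0 p *m T i') * (a * vl (delta_mx 0 q *m T j')).
  have BE p i' q j' : a * (vl (delta_mx 0 p *m T i' *m T j') * y q) = B p i' q j'.
    rewrite (mS _ _ _ (y q) (TE _ _) (yN q)) -mulrA /B; apply/eqP; rewrite -subr_eq0 -mulrBr -memv0 -N4 mulrC.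
    have hq := TE (delta_mx 0 q) j'; rewrite /S vlE in hq.
    by rewrite [y j' * y q]mulrC NM1.
  have Bs p i' q j' : B p i' q j' = B q j' p i' by rewrite /B; ring.
  have anti p q : a * (vl (row p Om) * y q) = - (a * (vl (row q Om) * y p)).
    rewrite !OmE !vlD !mulrBl !mulrBr !BE opprB [B p i q j]Bs [B p j q i]Bs //.
  have mz p q : a * (vl (row p Om) * y q) = 0.
    have [cp|cp] := eqVneq (c p) 0.
      by rewrite hc cp scale0r /vl big1 ?mul0r ?mulr0 // => k _; rewrite mxE scale0r.
    have vlZ k t : vl (k *: t) = k *: vl t by rewrite /vl scaler_sumr; apply: eq_bigr => k' _; rewrite mxE scalerA.
    have mp : a * (vl k0 * y p) = 0.
      have := anti p p; rewrite hc vlZ -scalerAl -scalerAr => h.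
      apply: (scalerI cp); rewrite scaler0; apply: (scalerI (two_neq0 K0)).
      by rewrite scaler0 (_ : 2%:R = 1 + 1 :> K) // scalerDl scale1r [X in X + _]h addrC subrr.
    by rewrite anti [in row q _]/Om -/Om hc vlZ -scalerAl -scalerAr mp scaler0 oppr0.
  apply/row_matrixP => p; rewrite row0; apply: inj; rewrite N3E; apply/annP => w wN.
  have [w0 hw0 ->] := gN w wN; rewrite mulrDr.
  have -> : a * vl (row p Om) * w0 = 0 by rewrite mulrAC aWk.
  rewrite addr0 mulr_sumr big1 // => q _; by rewrite -scalerAr -mulrA mz scaler0.
pose D := (mker N a :\: N ^+ 2)%VS; pose k := \dim D.
have dD : (k + 3 = \dim (mker N a))%N by rewrite -dX2 addnC dimv_cap_compl.
have dimD x : x \in D -> x \in mker N a by apply: (subvP (diffvSl _ _)).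
pose d (i : 'I_k) : car A := (vbasis D)`_i.
have dX' i : d i \in mker N a by apply: dimD; rewrite vbasis_mem // mem_nth // size_tuple.
have d0 i n : n \in (N ^+ 2)%VS -> d i * n = 0 by exact: (mker_N2 aN2).
pose Y (i : 'I_(3 + k)) := match split i with inl j => y j | inr j => d j end.
pose X (i : 'I_(3 + k)) := match split i with inl j => T j | inr j => 0 end.
have YN i : Y i \in N by rewrite /Y; case: (split i) => j //; exact: (subvP XN).
(* The [k] generators in [mker] act by 0 on the cubic part. The count is exact:
   [3 + (1 + (3 + k) + 2)] is [m]. *)
apply: (@goodA_peel _ _ _ _ lN IH N4 (3 + k) 3 Y X r) => //.
- apply/subvP => w wN; have [w0 hw0 ->] := gN w wN; apply: memvD.
    apply: (subvP (addvSl _ _)); apply: memv_suml => i _; rewrite memvZ //.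
    apply: (subvP (sumv_sup (lshift k i) (isT : xpredT _) (subvv _))).
    by rewrite /Y -[lshift k i]/(unsplit (inl i)) unsplitK memv_line.
  have XD : (mker N a <= D + N ^+ 2)%VS by rewrite addv_diff addvSl.
  apply: (subvP (_ : Wk <= _)%VS _ hw0); rewrite subv_add addvSr andbT; apply: (subv_trans XD); apply: addvS => //.
  rewrite -{1}(vsum_basis D); apply/subv_sumP => i _; rewrite -memvE.
  apply: (subvP (sumv_sup (rshift 3 i) (isT : xpredT _) (subvv _))).
  by rewrite /Y -[rshift 3 i]/(unsplit (inr i)) unsplitK memv_line.
- by move=> i j; rewrite /X; case: (split i) => i'; case: (split j) => j' //; rewrite ?mul0mx ?mulmx0.
- move=> l; exists (\col_q pr l (a * a * y q)) => i1 j1 k1; rewrite /Y /X.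
  case: (split i1) => i'; last by rewrite !mulmx0 !mul0mx mxE -mulrA d0 ?pr0 //; apply: NN; [exact: YN j1 | exact: YN k1].
  case: (split j1) => j'; last first.
    rewrite !mulmx0 !mul0mx mxE [y i' * _]mulrC -mulrA d0 ?pr0 //; apply: NN => //; exact: YN k1.
  case: (split k1) => k'; last by rewrite !mulmx0 !mul0mx mxE mulrC d0 ?pr0 //; exact: NN.
  rewrite word /vl mulr_sumr pr_sum mxE; apply: eq_bigr => q _; rewrite -scalerAr prZ; congr (_ * _); by rewrite mxE.
- have := dimN lN; have := dX; rewrite -dD d2 d3 => <- <-; clear; lia.
- have := dimN lN; have := dX; rewrite -dD d2 d3 => <- <-; clear; lia.
by have := dimN lN; have := dX; rewrite -dD d2 d3 => <- <-; clear; lia.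
Qed.

Lemma goodA_h3_2_h2_3 : \dim (N ^+ 2) = (\dim (N ^+ 3) + 3)%N -> goodA A.
Proof.
move=> d2; have [|[a aN aN2']|[a [b [aN bN g _]]]] := net3 lN K0 (Cc := nker N) d2.
- move=> c cN h; apply/nkerP; split=> // n; rewrite expvSl expv1 => hn.
  move: n hn; apply: prodv_ind => [|u v hu hv|k u hu|u v uN vN].
  + by rewrite mulr0.
  + by rewrite mulrDr hu hv addr0.
  + by rewrite -scalerAr hu scaler0.
  by have := NM1 (h u uN) vN; rewrite N4 memv0 -mulrA => /eqP.
- apply: (goodA_h3_2_rep3 aN) => //; apply: (nakayama lN) => [u v h|].
    by rewrite -[N]expv1 ideal_line_mul // expv1.
  by rewrite -expvSl.
exact: goodA_binary aN bN g.
Qed.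

End LevelTwo.

Section FourRows.
Variable K : fieldType.

Definition rw (p q s t : K) : 'rV[K]_4 := \row_i nth 0 [:: p; q; s; t] i.
Definition rows4 (r0 r1 r2 r3 : 'rV[K]_4) : 'M[K]_4 := \matrix_i nth 0 [:: r0; r1; r2; r3] i.

Lemma rw_rows p q s t r0 r1 r2 r3 : rw p q s t *m rows4 r0 r1 r2 r3 = p *: r0 + q *: r1 + s *: r2 + t *: r3.
Proof. by rewrite mulmx_sum_row !big_ord_recl big_ord0 addr0 !rowK !mxE /= !addrA. Qed.

Lemma rwZ k p q s t : k *: rw p q s t = rw (k * p) (k * q) (k * s) (k * t).
Proof. by apply/rowP => -[[|[|[|[|i]]]] hi] //; rewrite !mxE. Qed.

Lemma rwD p q s t p' q' s' t' : rw p q s t + rw p' q' s' t' = rw (p + p') (q + q') (s + s') (t + t').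
Proof. by apply/rowP => -[[|[|[|[|i]]]] hi] //; rewrite !mxE. Qed.

Lemma rwE p q s t (g : 'I_4 -> K) : (rw p q s t *m \col_i g i) 0 0 = p * g 0 + q * g 1 + s * g 2 + t * g 3.
Proof.
rewrite mxE !big_ord_recl big_ord0 addr0 !mxE /= !addrA.
by congr (_ * g _ + _ * g _ + _ * g _ + _ * g _); apply: val_inj.
Qed.

Lemma rows4_comm (X Y : 'M[K]_4) : (forall p q s t, rw p q s t *m X *m Y = rw p q s t *m Y *m X) -> X *m Y = Y *m X.
Proof.
move=> h; apply/row_matrixP => i; rewrite !rowE !mulmxA.
have -> : delta_mx 0 i = rw (i == 0)%:R (i == 1)%:R (i == 2)%:R (i == 3)%:R.
  by apply/rowP => -[[|[|[|[|j]]]] hj] //; rewrite !mxE eqxx /= eq_sym.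
exact: h.
Qed.

End FourRows.

(** * The Hilbert function (1, 3, 4, 2) *)

Section RankFour.
Variables (K : closedFieldType) (m : nat) (A : calg K m) (N : {vspace car A}).
Hypothesis lN : localA N.
Hypothesis K0 : [pchar K] =i pred0.
Hypothesis IH : forall k, (k < m)%N -> CM K k.
Hypothesis SN2 : (soc N <= N ^+ 2)%VS.
Hypothesis N4 : (N ^+ 4 = 0)%VS.
Hypothesis dS : \dim (soc N) = 2%N.
Hypothesis SN3 : (soc N <= N ^+ 3)%VS.
Hypothesis dN : \dim N = (\dim (N ^+ 2) + 3)%N.
Hypothesis dN2 : \dim (N ^+ 2) = (\dim (N ^+ 3) + 4)%N.
Implicit Types (u v w x y z s : car A) (U V W X Y : {vspace car A}).

Let N30 u v : u \in (N ^+ 3)%VS -> v \in N -> u * v = 0.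
Proof. by move=> h hv; have := NM1 h hv; rewrite N4 memv0 => /eqP. Qed.

Definition span3 a b c := [/\ a \in N, b \in N, c \in N & (N <= <[a]> + <[b]> + <[c]> + N ^+ 2)%VS].

(** The cubic values come from an algebra with basis [1, b, c, d] in which [a] is 1 and [Tb], [Tc]
    are the multiplications: geometrically, the coordinate ring of a scheme of length 4 in the
    plane. The entries of [g] are the values at [a^3], [a^2 b], [a^2 c] and at [d], and
    [4 + (1 + 3 + 2) = 10]. *)
Lemma goodA_rep4 a b c (d : car A) (r1 r2 r3 s1 s2 s3 : 'rV[K]_4) : span3 a b c ->
  let Tb := rows4 (rw 0 1 0 0) r1 r2 r3 in let Tc := rows4 (rw 0 0 1 0) s1 s2 s3 in
  (forall p q s t : K, rw p q s t *m Tb *m Tc = rw p q s t *m Tc *m Tb) ->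
  (forall l : 'cV[K]_m, let g : 'cV[K]_4 := \col_i nth 0 [:: pr l (a * a * a); pr l (a * a * b); pr l (a * a * c); pr l d] i in
    [/\ [/\ pr l (a * b * b) = (r1 *m g) 0 0, pr l (a * b * c) = (s1 *m g) 0 0 & pr l (a * c * c) = (s2 *m g) 0 0] &
        [/\ pr l (b * b * b) = (r1 *m Tb *m g) 0 0, pr l (b * b * c) = (r1 *m Tc *m g) 0 0,
            pr l (b * c * c) = (s1 *m Tc *m g) 0 0 & pr l (c * c * c) = (s2 *m Tc *m g) 0 0]]) -> goodA A.
Proof.
move=> [aN bN cN gN] Tb Tc hC hl.
have TC : Tb *m Tc = Tc *m Tb by exact: rows4_comm.
pose y (i : 'I_3) := nth 0 [:: a; b; c] i; pose X (i : 'I_3) : 'M[K]_4 := nth 0 [:: 1%:M; Tb; Tc] i.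
have P (R : 'I_3 -> Prop) : R 0 -> R 1 -> R 2 -> forall i, R i := @ord3 R.
have XC i j : X i *m X j = X j *m X i by move: i j; do 2 apply: (P); rewrite /X /= ?mul1mx ?mulmx1.
have ybig : (\sum_(i < 3) <[y i]> = <[a]> + <[b]> + <[c]>)%VS by rewrite !big_ord_recl big_ord0 addv0 addvA.
have d3 : \dim (N ^+ 3) = 2%N.
  have -> : (N ^+ 3 = soc N)%VS by apply: subv_anti; rewrite SN3 N3_soc.
  exact: dS.
have m10 : m = 10%N by rewrite -(dimN lN) dN dN2 d3.
apply: (@goodA_peel _ _ _ _ lN IH N4 3 4 y X (rw 1 0 0 0)) => //.
- by apply: (P); rewrite /y /=.
- by rewrite ybig.
- move=> l; have := hl l; set g := \col_i _; move=> [[h1 h2 h3] [h4 h5 h6 h7]]; exists g.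
  pose Q i j k := pr l (y i * y j * y k) = (rw 1 0 0 0 *m X i *m X j *m X k *m g) 0 0.
  have Q12 i j k : Q i j k -> Q j i k.
    by rewrite /Q [y j * y i]mulrC => ->; rewrite -![rw 1 0 0 0 *m X _ *m X _]mulmxA XC.
  have Q23 i j k : Q i j k -> Q i k j.
    by rewrite /Q [_ * y k * y j]mulrAC => ->; rewrite -![_ *m X _ *m X _]mulmxA XC.
  have rb : rw 1 0 0 0 *m Tb = rw 0 1 0 0 by rewrite rw_rows !scale0r !addr0 scale1r.
  have rc : rw 1 0 0 0 *m Tc = rw 0 0 1 0 by rewrite rw_rows !scale0r !addr0 scale1r.
  have bb : rw 0 1 0 0 *m Tb = r1 by rewrite rw_rows !scale0r !addr0 scale1r add0r.
  have bc : rw 0 1 0 0 *m Tc = s1 by rewrite rw_rows !scale0r !addr0 scale1r add0r.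
  have cc : rw 0 0 1 0 *m Tc = s2 by rewrite rw_rows !scale0r !addr0 scale1r !add0r.
  have g0 i : (rw (i == 0)%:R (i == 1)%:R (i == 2)%:R 0 *m g) 0 0 = if (i : 'I_3) == 0 then pr l (a * a * a) else if i == 1 then pr l (a * a * b) else pr l (a * a * c).
    by rewrite rwE; move: i; apply: (P); rewrite /= ?mul0r ?addr0 ?mul1r ?add0r.
  have Q000 : Q 0 0 0 by rewrite /Q /X /y /= !mulmx1 (g0 0).
  have Q001 : Q 0 0 1 by rewrite /Q /X /y /= !mulmx1 rb (g0 1).
  have Q002 : Q 0 0 2 by rewrite /Q /X /y /= !mulmx1 rc (g0 2).
  have Q011 : Q 0 1 1 by rewrite /Q /X /y /= !mulmx1 rb bb.
  have Q012 : Q 0 1 2 by rewrite /Q /X /y /= !mulmx1 rb bc.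
  have Q022 : Q 0 2 2 by rewrite /Q /X /y /= !mulmx1 rc cc.
  have Q111 : Q 1 1 1 by rewrite /Q /X /y /= rb bb.
  have Q112 : Q 1 1 2 by rewrite /Q /X /y /= rb bb.
  have Q122 : Q 1 2 2 by rewrite /Q /X /y /= rb bc.
  have Q222 : Q 2 2 2 by rewrite /Q /X /y /= rc cc.
  move=> i j k; rewrite -/(Q i j k); move: i j k; do 3 apply: (P);
    first [done | by apply: (Q12) | by apply: (Q23) | by apply: (Q12); apply: (Q23) | by apply: (Q23); apply: (Q12) | by apply: (Q12); apply: (Q23); apply: (Q12)].
- by rewrite m10.
- by rewrite m10.
by rewrite m10.
Qed.

Lemma span3_indep a b c (x y z : K) : span3 a b c -> x *: a + y *: b + z *: c \in (N ^+ 2)%VS -> [/\ x = 0, y = 0 & z = 0].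
Proof.
have aux a1 b1 c1 (k k1 k2 : K) : span3 a1 b1 c1 -> k *: a1 + (k1 *: b1 + k2 *: c1) \in (N ^+ 2)%VS -> k = 0.
  move=> [aN bN cN g] h; apply/eqP/negPn/negP => k0.
  have : (N <= <[b1]> + (<[c1]> + N ^+ 2))%VS.
    apply: subv_trans g _; rewrite -!addvA subv_add subvv andbT -memvE -[X in X \in _](scalerK k0) memvZ //.
    rewrite -(addrK (k1 *: b1 + k2 *: c1) (k *: a1)); apply: memvB; first by do 2 apply: (subvP (addvSr _ _)).
    apply: memv_add; first by rewrite memvZ ?memv_line.
    by apply: (subvP (addvSl _ _)); rewrite memvZ ?memv_line.
  move/dimvS; rewrite dN leqNgt => /negP; apply; rewrite addn3 ltnS.
  by apply: leq_trans (dim_line_le _ _) _; rewrite ltnS; exact: dim_line_le.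
move=> sp h; split.
- by apply: (aux a b c x y z sp); rewrite addrA.
- apply: (aux b a c y x z); last by rewrite addrCA addrA.
  by case: sp => aN bN cN g; split=> //; rewrite [(<[b]> + _)%VS]addvC.
apply: (aux c a b z x y); last by rewrite addrC.
by case: sp => aN bN cN g; split=> //; rewrite -(addvA <[c]>%VS) [(<[c]> + _)%VS]addvC.
Qed.

(** Two conics without common component, one of them [b c]. In the chart [a = 1] the basis is
    [1, b, c, b^2]; the other relation gives [c^2], and its multiples by [b] and [c] give [b^3] and
    [c^3]. *)
Lemma goodA_rep4_1 a b c (x y z p q : K) : span3 a b c -> b * c \in (N ^+ 3)%VS -> p != 0 -> q != 0 ->
  p *: (b * b) + q *: (c * c) - (x *: (a * a) + y *: (a * b) + z *: (a * c)) \in (N ^+ 3)%VS -> goodA A.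
Proof.
move=> sp bc p0 q0 rel; case: (sp) => aN bN cN _.
apply: (@goodA_rep4 a b c (a * b * b) (rw 0 0 0 1) 0 (rw 0 (x / p) 0 (y / p))
   0 (rw (x / q) (y / q) (z / q) (- (p / q))) 0 sp) => [p1 q1 s1 t1|l g].
  rewrite !rw_rows !scaler0 !addr0 !rwZ !rwD !rw_rows !scaler0 !addr0 !rwZ !rwD.
  by congr (rw _ _ _ _); field; rewrite ?p0 ?q0.
have rl v : v \in N -> p * pr l (b * b * v) + q * pr l (c * c * v) = x * pr l (a * a * v) + y * pr l (a * b * v) + z * pr l (a * c * v).
  move=> vN; have := N30 rel vN; rewrite mulrBl !mulrDl -!scalerAl => /eqP; rewrite subr_eq0 => /eqP /(congr1 (pr l)).
  by rewrite !prD !prZ.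
have bc0 v : v \in N -> b * c * v = 0 by exact: N30.
have ra := rl a aN; have rb := rl b bN; have rc := rl c cN.
have e1 : c * c * b = 0 by rewrite -(bc0 c cN); ring.
have e2 : b * b * c = 0 by rewrite -(bc0 b bN); ring.
have e3 : a * c * b = 0 by rewrite -(bc0 a aN); ring.
have e4 : a * b * c = 0 by rewrite -(bc0 a aN); ring.
have e5 : a * b * a = a * a * b by ring. have e6 : a * c * a = a * a * c by ring.
have e7 : b * b * a = a * b * b by ring. have e8 : c * c * a = a * c * c by ring.
rewrite e5 e6 e7 e8 in ra; rewrite e1 e3 pr0 !mulr0 !addr0 in rb; rewrite e2 e4 pr0 !mulr0 addr0 add0r in rc.
have gg : g = \col_i nth 0 [:: pr l (a * a * a); pr l (a * a * b); pr l (a * a * c); pr l (a * b * b)] i by [].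
rewrite !rw_rows !mul0mx !scaler0 !addr0 !scale0r !add0r !rwZ !rwD gg !rwE /= e4 e2 (_ : b * c * c = 0) ?bc0 //; split; split.
- by rewrite !mul0r !add0r mul1r.
- by rewrite pr0 mxE.
- by apply: (mulfI q0); rewrite -[LHS](addKr (p * pr l (a * b * b))) ra; field; rewrite ?q0.
- by rewrite mul1r; apply: (mulfI p0); rewrite rb; field; rewrite ?p0.
- by rewrite pr0 mul0mx mxE.
- by rewrite pr0 ?mul0mx mxE.
have E : pr l (a * c * c) = (x * pr l (a * a * a) + y * pr l (a * a * b) + z * pr l (a * a * c) - p * pr l (a * b * b)) / q.
  by apply: (mulfI q0); rewrite -[LHS](addKr (p * pr l (a * b * b))) ra; field; rewrite ?q0.
by apply: (mulfI q0); rewrite rc E; field; rewrite ?q0.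
Qed.

(** One conic is the double line [b^2] and the other involves [c^2], so that [1, b, c, b c] is a
    basis in the chart [a = 1]. *)
Lemma goodA_rep4_2 a b c (x y z k : K) : span3 a b c -> b * b \in (N ^+ 3)%VS ->
  c * c - (x *: (a * a) + y *: (a * b) + z *: (a * c) + k *: (b * c)) \in (N ^+ 3)%VS -> goodA A.
Proof.
move=> sp bb rel; case: (sp) => aN bN cN _.
apply: (@goodA_rep4 a b c (a * b * c) 0 (rw 0 0 0 1) 0
   (rw 0 0 0 1) (rw x y z k) (rw 0 x 0 z) sp) => [p1 q1 s1 t1|l g].
  rewrite !rw_rows !scaler0 !addr0 !rwZ !rwD !rw_rows !scaler0 !addr0 !rwZ !rwD.
  by congr (rw _ _ _ _); ring.
have rl v : v \in N -> pr l (c * c * v) = x * pr l (a * a * v) + y * pr l (a * b * v) + z * pr l (a * c * v) + k * pr l (b * c * v).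
  move=> vN; have := N30 rel vN; rewrite mulrBl !mulrDl -!scalerAl => /eqP; rewrite subr_eq0 => /eqP /(congr1 (pr l)).
  by rewrite !prD !prZ.
have bb0 v : v \in N -> b * b * v = 0 by exact: N30.
have ra := rl a aN; have rb := rl b bN; have rc := rl c cN.
have e1 : a * b * b = 0 by rewrite -(bb0 a aN); ring.
have e2 : b * c * b = 0 by rewrite -(bb0 c cN); ring.
have e5 : a * b * a = a * a * b by ring. have e6 : a * c * a = a * a * c by ring.
have e7 : b * c * a = a * b * c by ring. have e8 : c * c * a = a * c * c by ring.
have e9 : a * c * b = a * b * c by ring. have e10 : c * c * b = b * c * c by ring.
rewrite e5 e6 e7 e8 in ra; rewrite e1 e2 e9 e10 pr0 !mulr0 !addr0 in rb; rewrite rb ra in rc.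
have gg : g = \col_i nth 0 [:: pr l (a * a * a); pr l (a * a * b); pr l (a * a * c); pr l (a * b * c)] i by [].
rewrite !rw_rows ?mul0mx ?scaler0 ?addr0 ?scale0r ?add0r !rwZ ?rwD gg !rwE /= e1 (bb0 b bN) (bb0 c cN) rb rc ra !pr0; split; split.
all: by rewrite ?mul0mx ?mxE //; ring.
Qed.

(** The conics [c^2] and [c d] share the component [c]; the cubic relation for [d] cuts it down to a
    finite scheme, with basis [1, d, c, d^2] in the chart [a = 1]. *)
Lemma goodA_rep4_3 a c d (k1 k2 : K) : span3 a c d -> c * c \in (N ^+ 3)%VS -> c * d \in (N ^+ 3)%VS ->
  d * d * d = k1 *: (a * a * d) + k2 *: (a * d * d) -> goodA A.
Proof.
move=> sp cc cd rel; case: (sp) => aN cN dN' _.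
have sp' : span3 a d c by case: sp => h1 h2 h3 h4; split=> //; rewrite -(addvA <[a]>%VS) [(<[d]> + _)%VS]addvC addvA.
apply: (@goodA_rep4 a d c (a * d * d) (rw 0 0 0 1) 0 (rw 0 k1 0 k2) 0 0 0 sp') => [p1 q1 s1 t1|l g].
  rewrite !rw_rows !scaler0 !addr0 !rwZ !rwD !rw_rows !scaler0 !addr0 !rwZ ?rwD.
  by apply/rowP => -[[|[|[|[|j]]]] hj] //; rewrite !mxE /=; ring.
have cc0 v : v \in N -> c * c * v = 0 by exact: N30. have cd0 v : v \in N -> c * d * v = 0 by exact: N30.
have -> : a * d * c = 0 by rewrite -(cd0 a aN); ring.
have -> : a * c * c = 0 by rewrite -(cc0 a aN); ring.
have -> : d * d * c = 0 by rewrite -(cd0 d dN'); ring.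
have -> : d * c * c = 0 by rewrite -(cc0 d dN'); ring.
have gg : g = \col_i nth 0 [:: pr l (a * a * a); pr l (a * a * d); pr l (a * a * c); pr l (a * d * d)] i by [].
rewrite !rw_rows !mul0mx !scaler0 !addr0 !scale0r !add0r ?rwZ ?rwD gg ?rwE /= (cc0 c cN) rel !pr0 !prD !prZ; split; split.
all: by rewrite ?mul0mx ?mxE //; ring.
Qed.

Lemma span3_C12 a b c : span3 a b c -> span3 b a c.
Proof. by case=> aN bN cN g; split=> //; rewrite [(<[b]> + _)%VS]addvC. Qed.

Lemma span3_C23 a b c : span3 a b c -> span3 a c b.
Proof. by case=> h1 h2 h3 h4; split=> //; rewrite -(addvA <[a]>%VS) [(<[c]> + _)%VS]addvC addvA. Qed.

Lemma span3_sub a b c a' b' c' : span3 a b c -> a' \in N -> b' \in N -> c' \in N ->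
  (forall u, u \in [:: a; b; c] -> u \in (<[a']> + <[b']> + <[c']> + N ^+ 2)%VS) -> span3 a' b' c'.
Proof.
move=> [aN bN cN g] aN' bN' cN' h; split=> //; apply: subv_trans g _; rewrite !subv_add addvSr andbT -!memvE.
by rewrite !h ?inE ?eqxx ?orbT.
Qed.

Lemma mem_span3 a b c (x y z : K) : x *: a + y *: b + z *: c \in (<[a]> + <[b]> + <[c]> + N ^+ 2)%VS.
Proof.
apply: (subvP (addvSl _ _)); apply: memv_add; last by rewrite memvZ ?memv_line.
by apply: memv_add; rewrite memvZ ?memv_line.
Qed.

Lemma span3_shift a b c (y z : K) : span3 a b c -> span3 (a + y *: b + z *: c) b c.
Proof.
move=> sp; case: (sp) => aN bN cN g; apply: (span3_sub sp) => // [|u].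
  by rewrite !memvD ?memvZ.
rewrite !inE => /or3P [/eqP ->|/eqP ->|/eqP ->].
- have e : a = 1 *: (a + y *: b + z *: c) + (- y) *: b + (- z) *: c by rewrite scale1r !scaleNr; ring.
  rewrite [X in X \in _]e; exact: mem_span3.
- by have := mem_span3 (a + y *: b + z *: c) b c 0 1 0; rewrite !scale0r scale1r addr0 add0r.
by have := mem_span3 (a + y *: b + z *: c) b c 0 0 1; rewrite !scale0r scale1r !add0r.
Qed.

(** As [N^2/N^3] has dimension four, [c^2] is independent of [a^2], [a b], [b^2]. It kills [a] and
    [b], so it can be the [p] of [goodA_lE1]. *)
Lemma goodA_common1 a b c : span3 a b c -> c * a \in (N ^+ 3)%VS -> c * b \in (N ^+ 3)%VS -> goodA A.
Proof.
move=> sp ca cb; case: (sp) => aN bN cN g.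
pose J := (<[a * a]> + (<[a * b]> + (<[b * b]> + N ^+ 3)))%VS.
have N32 : (N ^+ 3 <= N ^+ 2)%VS := NpS lN 1.
have J2 : (J <= N ^+ 2)%VS by rewrite !subv_add -!memvE !NN.
have N3J : (N ^+ 3 <= J)%VS by do 3 apply: subv_trans (addvSr _ _); rewrite subvv.
have caJ := subvP N3J _ ca; have cbJ := subvP N3J _ cb.
have aaJ : a * a \in J by apply: (subvP (addvSl _ _)); exact: memv_line.
have abJ : a * b \in J by do 1 apply: (subvP (addvSr _ _)); apply: (subvP (addvSl _ _)); exact: memv_line.
have bbJ : b * b \in J by do 2 apply: (subvP (addvSr _ _)); apply: (subvP (addvSl _ _)); exact: memv_line.
have dec v : v \in N -> exists (x y z : K) n, n \in (N ^+ 2)%VS /\ v = x *: a + y *: b + z *: c + n.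
  move=> /(subvP g) /memv_addP [? /memv_addP [? /memv_addP [? /vlineP [x ->] [? /vlineP [y ->] ->]] [? /vlineP [z ->] ->]] [n nN ->]].
  by exists x, y, z, n.
have J3 u n : u \in N -> n \in (N ^+ 2)%VS -> u * n \in J by move=> uN nN; apply: (subvP N3J); exact: N1M.
have UJ (v : car A) : v \in N -> a * v \in J /\ b * v \in J.
  move=> /dec [x [y [z [n [nN ->]]]]]; rewrite !mulrDr -!scalerAr ![_ * c]mulrC [b * a]mulrC.
  by split; do ?[exact: J3 | apply: memvZ | apply: memvD].
have ccJ : c * c \notin J.
  apply/negP => h; have : (N ^+ 2 <= J)%VS.
    apply/subvP; apply: (@N2_ind _ _ _ _ K0 (fun w => w \in J)); rewrite ?mem0v //.
    - by move=> u v; exact: memvD.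
    - by move=> k u; exact: memvZ.
    move=> u uN; have [x [y [z [n [nN eu]]]]] := dec u uN.
    rewrite [X in X * _]eu !mulrDl -!scalerAl; have [h1 h2] := UJ u uN.
    have hcu : c * u \in J by rewrite eu !mulrDr -!scalerAr; do ?[exact: J3 | apply: memvZ | apply: memvD].
    by rewrite [n * u]mulrC; do ?[exact: J3 | apply: memvZ | apply: memvD].
  move/dimvS; rewrite dN2 leqNgt => /negP; apply; rewrite addn4 /J.
  apply: leq_ltn_trans (dim_line_le _ _) _; rewrite ltnS; apply: leq_ltn_trans (dim_line_le _ _) _; rewrite ltnS.
  by apply: leq_ltn_trans (dim_line_le _ _) _.
pose U := (<[a]> + <[b]>)%VS.
have UA : (U * fullv <= U + J)%VS.
  rewrite prodvDl subv_add; apply/andP; split; apply/subvP => w /line_mulP [v _ ->];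
    have [k [n [nN ->]]] := loc_dec lN v; have [h1 h2] := UJ n nN; rewrite mulrDr -scalerAr mulr1; apply: memv_add => //;
    rewrite memvZ //; [apply: (subvP (addvSl _ _)) | apply: (subvP (addvSr _ _))]; exact: memv_line.
have ccU : c * c \notin (U * fullv)%VS.
  apply/negP => /(subvP UA) /memv_addP [u /memv_addP [? /vlineP [x ->] [? /vlineP [y ->] ->]] [j jJ e]].
  have : x *: a + y *: b + 0 *: c \in (N ^+ 2)%VS.
    rewrite scale0r addr0 -(addrK j (_ + _)) -e memvB ?NN //; exact: (subvP J2).
  case/(span3_indep sp) => x0 y0 _; case/negP: ccJ; by rewrite e x0 y0 !scale0r !add0r.
have [l [l1 l2]] := pr_sep ccU.
apply: (@goodA_lE1 _ _ _ _ lN K0 IH U c (c * c) l).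
- by apply: subv_trans g _; rewrite [(_ + <[c]>)%VS]addvC.
- by apply: contraNneq ccJ => h; move: cN; rewrite h memv0 => /eqP ->; rewrite mul0r mem0v.
- move=> u /memv_addP [? /vlineP [x ->] [? /vlineP [y ->] ->]].
  have e1 : c * c * a = 0 by rewrite -(N30 ca cN); ring.
  have e2 : c * c * b = 0 by rewrite -(N30 cb cN); ring.
  by rewrite mulrDr -!scalerAr e1 e2 !scaler0 addr0.
- by move=> u v uU; apply: l2; rewrite memv_mul ?memvf.
by rewrite l1 oner_neq0.
Qed.

(** The three products [a^2 d], [a d^2], [d^3] are dependent in the two-dimensional [N^3]. Shifting
    [a] by a multiple of [d] makes the coefficient of [d^3] nonzero, as [goodA_rep4_3] needs. *)
Lemma goodA_common2 a c d : span3 a c d -> c * c \in (N ^+ 3)%VS -> c * d \in (N ^+ 3)%VS -> goodA A.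
Proof.
move=> sp cc cd; case: (sp) => aN cN dN' g.
have d3 : \dim (N ^+ 3) = 2%N.
  have -> : (N ^+ 3 = soc N)%VS by apply: subv_anti; rewrite SN3 N3_soc.
  exact: dS.
have n3 x y z : x \in N -> y \in N -> z \in N -> x * y * z \in (N ^+ 3)%VS by move=> *; apply: NM1 => //; exact: NN.
pose f (i : 'I_3) : car A := nth 0 [:: a * a * d; a * d * d; d * d * d] i.
have fN i : f i \in (N ^+ 3)%VS by move: i; apply: (@ord3); rewrite /f /=; exact: n3.
have [k [[i0 ki0]]] := @dep_mod _ _ A 0%VS (N ^+ 3)%VS 2 f (sub0v _) (etrans d3 (esym (congr1 (addn^~ 2%N) (dimv0 _)))) fN.
rewrite memv0 !big_ord_recl big_ord0 addr0 /f /= => /eqP.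
set k1 := k ord0; set k2 := k _; set k3 := k _ => rel.
have [t ht] : exists t, k1 * t ^+ 2 + k2 * t + k3 != 0.
  apply: quad_neq0 => -[h1 h2 h3]; case/eqP: ki0; move: i0; apply: (@ord3) => //.
    by rewrite -[RHS]h2 /k2; congr (k _); apply: val_inj.
  by rewrite -[RHS]h3 /k3; congr (k _); apply: val_inj.
set q := (_ + _) in ht.
pose a' := a - t *: d.
have sp' : span3 a' c d.
  by have := span3_shift 0 (- t) sp; rewrite scale0r addr0 scaleNr.
apply: (@goodA_rep4_3 a' c d (- (k1 / q)) (- ((k2 + 2%:R * t * k1) / q)) sp' cc cd).
have al_ex (x : K) : exists X : car A, forall u', x *: u' = X * u' by exists x%:A => u'; rewrite mulr_algl.
have rel' : k1 *: (a' * a' * d) + (k2 + 2%:R * t * k1) *: (a' * d * d) + q *: (d * d * d) = 0.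
  have [X1 e1] := al_ex k1; have [X2 e2] := al_ex k2; have [X3 e3] := al_ex k3; have [Z e4] := al_ex t.
  have q2 u : (k2 + 2%:R * t * k1) *: u = k2 *: u + t *: (k1 *: u) + t *: (k1 *: u).
    by rewrite !scalerA -!scalerDl; congr (_ *: _); ring.
  have q3 u : q *: u = t *: (t *: (k1 *: u)) + t *: (k2 *: u) + k3 *: u.
    by rewrite !scalerA -!scalerDl; congr (_ *: _); rewrite /q; ring.
  rewrite -[RHS]rel q2 q3 /a' !e4 !e1 !e2 !e3; ring.
apply: (scalerI ht); rewrite scalerDr !scalerA.
have -> : q * - (k1 / q) = - k1 by field.
have -> : q * - ((k2 + 2%:R * t * k1) / q) = - (k2 + 2%:R * t * k1) by field.
by apply/eqP; rewrite !scaleNr -opprD -addr_eq0 addrC rel'.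
Qed.

End RankFour.

Section RankFourCases.
Variables (K : closedFieldType) (m : nat) (A : calg K m) (N : {vspace car A}).
Hypothesis lN : localA N.
Hypothesis K0 : [pchar K] =i pred0.
Hypothesis IH : forall k, (k < m)%N -> CM K k.
Hypothesis SN2 : (soc N <= N ^+ 2)%VS.
Hypothesis N4 : (N ^+ 4 = 0)%VS.
Hypothesis dS : \dim (soc N) = 2%N.
Hypothesis SN3 : (soc N <= N ^+ 3)%VS.
Hypothesis dN : \dim N = (\dim (N ^+ 2) + 3)%N.
Hypothesis dN2 : \dim (N ^+ 2) = (\dim (N ^+ 3) + 4)%N.
Implicit Types (u v w x y z s : car A) (U V W X Y : {vspace car A}).

Let N30 u v : u \in (N ^+ 3)%VS -> v \in N -> u * v = 0.
Proof. by move=> h hv; have := NM1 h hv; rewrite N4 memv0 => /eqP. Qed.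

Lemma mem_eq U u w : u = w -> u \in U -> w \in U.
Proof. by move->. Qed.

Lemma sum3E (V : nmodType) (F : 'I_3 -> V) : \sum_i F i = F 0 + F 1 + F 2.
Proof. by rewrite !big_ord_recl big_ord0 addr0 addrA; congr (F _ + F _ + F _); apply: val_inj. Qed.

Lemma sum5E (V : nmodType) (F : 'I_5 -> V) : \sum_i F i = F 0 + F 1 + F 2 + F 3 + F 4.
Proof. by rewrite !big_ord_recl big_ord0 addr0 !addrA; congr (F _ + F _ + F _ + F _ + F _); apply: val_inj. Qed.

Lemma sum6E (V : nmodType) (F : 'I_6 -> V) : \sum_i F i = F 0 + F 1 + F 2 + F 3 + F 4 + F 5.
Proof. by rewrite !big_ord_recl big_ord0 addr0 !addrA; congr (F _ + F _ + F _ + F _ + F _ + F _); apply: val_inj. Qed.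

(** Over an algebraically closed field the form in [b], [c] is a product of two linear forms, which
    become new generators; whether they are distinct depends on the square root [z] of the
    discriminant. *)
Lemma binary_factor a b c (p q r : K) : span3 N a b c -> ~ [/\ p = 0, q = 0 & r = 0] ->
  p *: (b * b) + q *: (b * c) + r *: (c * c) \in (N ^+ 3)%VS ->
  exists a b c, span3 N a b c /\ (b * c \in (N ^+ 3)%VS \/ b * b \in (N ^+ 3)%VS).
Proof.
move=> sp nz rel; have scl k u : k != 0 -> k *: u \in (N ^+ 3)%VS -> u \in (N ^+ 3)%VS.
  by move=> k0 h; rewrite -[u](scalerK k0) memvZ.
have spb := span3_C12 sp; have spc := span3_C12 (span3_C23 sp).
have [p0|p0] := eqVneq p 0.
  have [q0|q0] := eqVneq q 0.
    exists a, c, b; split; first exact: span3_C23.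
    right; apply: (scl r); last by move: rel; rewrite p0 q0 !scale0r !add0r.
    by apply/eqP => r0; apply: nz.
  exists a, (b + 0 *: a + (r / q) *: c), c; split.
    by apply: span3_C12; exact: span3_shift.
  left; apply: (scl q) => //; move: rel; rewrite p0 !scale0r add0r addr0.
  apply: mem_eq; rewrite mulrDl -scalerAl scalerDr scalerA mulrCA divff // mulr1 //.
have two : (2%:R : K) != 0 by exact: natK_neq0.
have [z hz] : exists z : K, z ^+ 2 = q ^+ 2 - 4%:R * p * r.
  have [z] := @solve_monicpoly K 2 (fun i => if i == 0%N then q ^+ 2 - 4%:R * p * r else 0) isT.
  by rewrite !big_ord_recl big_ord0 /= mul0r !addr0 expr0 mulr1; exists z.
have al_ex (x : K) : exists X : car A, forall u', x *: u' = X * u' by exists x%:A => u'; rewrite mulr_algl.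
pose k1 := (q + z) / (2%:R * p); pose k2 := (q - z) / (2%:R * p).
have four : (4%:R : K) != 0 by exact: (natK_neq0 K0 3).
have e1 : p * (k1 + k2) = q by rewrite /k1 /k2; field; rewrite p0 two.
have e2 : p * (k1 * k2) = r.
  have -> : p * (k1 * k2) = (q ^+ 2 - z ^+ 2) / (4%:R * p) by rewrite /k1 /k2; field; rewrite ?p0 ?two ?four.
  by rewrite hz; field; rewrite ?p0 ?four.
have dk : k1 - k2 = z / p by rewrite /k1 /k2; field; rewrite p0 two.
have kz : z = 0 -> k1 = k2 by rewrite /k1 /k2 => ->; rewrite subr0 addr0.
clearbody k1 k2.
have prodE : (b + k1 *: c) * (b + k2 *: c) \in (N ^+ 3)%VS.
  apply: (scl p) => //; move: rel; rewrite -e1 -e2 -!scalerA scalerDl.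
  have [X1 h1] := al_ex k1; have [X2 h2] := al_ex k2; have [X h3] := al_ex p.
  by apply: mem_eq; rewrite !h3 !h1 !h2; ring.
have [z0|z0] := eqVneq z 0.
  exists a, (b + 0 *: a + k1 *: c), c; split; first by apply: span3_C12; exact: span3_shift.
  by right; rewrite scale0r addr0; move: prodE; rewrite -(kz z0).
exists a, (b + k1 *: c), (b + k2 *: c); split; last by left.
case: (sp) => aN bN cN _; apply: (span3_sub sp); rewrite ?memvD ?memvZ // => u.
have zk : k1 - k2 != 0.
  rewrite dk.
  by rewrite mulf_neq0 ?invr_eq0.
rewrite !inE => /or3P [/eqP ->|/eqP ->|/eqP ->].
- by have := mem_span3 N a (b + k1 *: c) (b + k2 *: c) 1 0 0; rewrite !scale0r scale1r !addr0.
- have := mem_span3 N a (b + k1 *: c) (b + k2 *: c) 0 (- k2 / (k1 - k2)) (k1 / (k1 - k2)).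
  apply: mem_eq; rewrite scale0r add0r !scalerDr !scalerA addrACA -!scalerDl.
  by rewrite -[RHS]scale1r -[RHS]addr0 -(scale0r c); congr (_ *: _ + _ *: _); field.
have := mem_span3 N a (b + k1 *: c) (b + k2 *: c) 0 (1 / (k1 - k2)) (- 1 / (k1 - k2)).
apply: mem_eq; rewrite scale0r add0r !scalerDr !scalerA addrACA -!scalerDl.
by rewrite -[RHS]scale1r -[RHS]add0r -(scale0r b); congr (_ *: _ + _ *: _); field.
Qed.

(** [(v0, v1, v2)] is a radical vector of the conic [w]. As [v0 <> 0], the substitution of
    [b - (v1/v0) a] and [c - (v2/v0) a] removes [a] from the relation, and [binary_factor]
    applies. *)
Lemma singular_relation a b c (w0 w1 w2 w3 w4 w5 v0 v1 v2 : K) : span3 N a b c ->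
  ~ [/\ [/\ w0 = 0, w1 = 0 & w2 = 0] & [/\ w3 = 0, w4 = 0 & w5 = 0]] -> v0 != 0 ->
  w0 *: (a * a) + w1 *: (a * b) + w2 *: (a * c) + w3 *: (b * b) + w4 *: (b * c) + w5 *: (c * c) \in (N ^+ 3)%VS ->
  2%:R * w0 * v0 + w1 * v1 + w2 * v2 = 0 -> w1 * v0 + 2%:R * w3 * v1 + w4 * v2 = 0 -> w2 * v0 + w4 * v1 + 2%:R * w5 * v2 = 0 ->
  exists a b c, span3 N a b c /\ (b * c \in (N ^+ 3)%VS \/ b * b \in (N ^+ 3)%VS).
Proof.
move=> sp nz v00 rel E0 E1 E2; pose x := v1 / v0; pose y := v2 / v0.
have two : (2%:R : K) != 0 by exact: natK_neq0.
have xv : x * v0 = v1 by rewrite divfK.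
have yv : y * v0 = v2 by rewrite divfK.
have f1 : w1 = - (2%:R * w3 * x + w4 * y).
  apply: (mulIf v00); transitivity (- (2%:R * w3 * (x * v0) + w4 * (y * v0))); last by ring.
  rewrite xv yv; apply/eqP; rewrite -addr_eq0 -E1; apply/eqP; ring.
have f2 : w2 = - (w4 * x + 2%:R * w5 * y).
  apply: (mulIf v00); transitivity (- (w4 * (x * v0) + 2%:R * w5 * (y * v0))); last by ring.
  rewrite xv yv; apply/eqP; rewrite -addr_eq0 -E2; apply/eqP; ring.
have f0 : w0 = - (w1 * x + w2 * y) / 2%:R.
  apply: (mulIf two); rewrite divfK //; apply: (mulIf v00).
  transitivity (- (w1 * (x * v0) + w2 * (y * v0))); last by ring.
  rewrite xv yv; apply/eqP; rewrite -addr_eq0 -E0; apply/eqP; ring.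
clearbody x y.
have sp' : span3 N a (b - x *: a) (c - y *: a).
  case: (sp) => aN bN cN _; apply: (span3_sub sp) => // [||u]; rewrite ?memvB ?memvZ //.
  rewrite !inE => /or3P [/eqP ->|/eqP ->|/eqP ->].
  - by have := mem_span3 N a (b - x *: a) (c - y *: a) 1 0 0; rewrite !scale0r scale1r !addr0.
  - have := mem_span3 N a (b - x *: a) (c - y *: a) x 1 0; rewrite scale0r scale1r addr0; apply: mem_eq; ring.
  have := mem_span3 N a (b - x *: a) (c - y *: a) y 0 1; rewrite scale0r scale1r addr0; apply: mem_eq; ring.
apply: (binary_factor (p := w3) (q := w4) (r := w5) sp').
  move=> [h3 h4 h5]; apply: nz; split=> //; have g1 : w1 = 0 by rewrite f1 h3 h4; ring.
  have g2 : w2 = 0 by rewrite f2 h4 h5; ring.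
  by split=> //; rewrite f0 g1 g2; field.
move: rel.
have al_ex (k : K) : exists X : car A, forall u', k *: u' = X * u' by exists k%:A => u'; rewrite mulr_algl.
have g1 u : w1 *: u = - (x *: (w3 *: u) + x *: (w3 *: u) + y *: (w4 *: u)).
  by rewrite f1 !scalerA -!scalerDl -scaleNr; congr (_ *: _); ring.
have g2 u : w2 *: u = - (x *: (w4 *: u) + y *: (w5 *: u) + y *: (w5 *: u)).
  by rewrite f2 !scalerA -!scalerDl -scaleNr; congr (_ *: _); ring.
have g0 u : w0 *: u = x *: (x *: (w3 *: u)) + x *: (y *: (w4 *: u)) + y *: (y *: (w5 *: u)).
  by rewrite f0 f1 f2 !scalerA -!scalerDl; congr (_ *: _); field.
have [X ex] := al_ex x; have [Y ey] := al_ex y; have [X3 e3] := al_ex w3; have [X4 e4] := al_ex w4; have [X5 e5] := al_ex w5.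
rewrite g0 g1 g2 !ex !ey !e3 !e4 !e5; apply: mem_eq; ring.
Qed.

(** Six quadratic monomials in a four-dimensional [N^2/N^3] satisfy a pencil of relations, that is,
    of conics. A singular member becomes [b c] or [b^2], and a second member decides among the
    normal forms above. *)
Lemma goodA_h3_2_h2_4 : goodA A.
Proof.
have N32 : (N ^+ 3 <= N ^+ 2)%VS := NpS lN 1.
have N2N : (N ^+ 2 <= N)%VS by have := NpS lN 0; rewrite expv1.
have [l [y [_ yN _ gN]]] := @quot_coord _ _ A _ _ 3 N2N dN.
have sp0 : span3 N (y 0) (y 1) (y 2).
  split=> //; apply/subvP => w /gN [u uN ->]; rewrite sum3E.
  by apply: memv_add => //; apply: memv_add; [apply: memv_add|]; rewrite memvZ // memv_line.
have P (R : 'I_3 -> Prop) : R 0 -> R 1 -> R 2 -> forall i, R i := @ord3 R.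
have [a [b [c [sp hbc]]]] : exists a b c, span3 N a b c /\ (b * c \in (N ^+ 3)%VS \/ b * b \in (N ^+ 3)%VS).
  move: (y 0) (y 1) (y 2) sp0 => a b c sp; case: (sp) => aN bN cN _.
  have [l' [e [l0 _ _ le]]] := @quot_coord _ _ A _ _ 4 N32 dN2.
  pose f (i : 'I_6) : car A := nth 0 [:: a * a; a * b; a * c; b * b; b * c; c * c] i.
  have fN i : f i \in (N ^+ 2)%VS by case: i => [[|[|[|[|[|[|]]]]]] hi] //; rewrite /f /=; exact: NN.
  pose M : 'M[K]_(6, 4) := \matrix_(i, j) pr (l' j) (f i).
  have relM (w : 'rV[K]_6) : w *m M = 0 -> \sum_i w 0 i *: f i \in (N ^+ 3)%VS.
    move=> wM; have hw : \sum_i w 0 i *: f i \in (N ^+ 2)%VS by apply: memv_suml => i _; rewrite memvZ.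
    have [u uN ->] := le _ hw.
    rewrite big1 ?add0r // => j _; rewrite pr_sum; have := congr1 (fun X : 'rV_4 => X 0 j) wM; rewrite !mxE => h.
    rewrite (_ : \sum_i _ = 0) ?scale0r // -[RHS]h; by apply: eq_bigr => i _; rewrite prZ mxE.
  have rk : (2 <= \rank (kermx M))%N by rewrite mxrank_ker; have := rank_leq_col M; case: (\rank M) => [|[|[|[|[|]]]]].
  pose g := nz_row (kermx M).
  have g0 : g != 0 by rewrite nz_row_eq0 -mxrank_eq0 -lt0n (ltnW rk).
  have : ~~ (kermx M <= g)%MS by apply/negP => /mxrankS; rewrite rank_rV g0 leqNgt rk.
  case/row_subPn => i0 hi0; pose h := row i0 (kermx M); rewrite -/h in hi0.
  have gM : g *m M = 0 by apply/sub_kermxP; exact: nz_row_sub.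
  have hM : h *m M = 0 by apply/sub_kermxP; exact: row_sub.
  (* The symmetric matrix of the conic, multiplied by 2. *)
  pose gm (w : 'rV[K]_6) : 'M[K]_3 := \matrix_(i, j) nth 0 (nth [::] [:: [:: 2%:R * w 0 0; w 0 1; w 0 2];
     [:: w 0 1; 2%:R * w 0 3; w 0 4]; [:: w 0 2; w 0 4; 2%:R * w 0 5]] i) j.
  have [al [be [v [ab v0 vG]]]] := det_pencil (gm g) (gm h) isT.
  pose w := al *: g + be *: h.
  have wM : w *m M = 0 by rewrite mulmxDl -!scalemxAl gM hM !scaler0 addr0.
  have gmw : v *m gm w = 0.
    rewrite -vG; congr (_ *m _); apply/matrixP => i j; rewrite !mxE.
    by move: i j; do 2 apply: (P); rewrite /= ?mxE; ring.
  have w0 : w != 0.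
    apply/eqP => hw; case/orP: ab => [al0|be0].
      have [be0|be0] := eqVneq be 0.
        by case/eqP: g0; apply: (scalerI al0); rewrite scaler0 -[RHS]hw /w be0 scale0r addr0.
      case/negP: hi0; apply/sub_rVP; exists (- (al / be)); apply: (scalerI be0); rewrite scalerA mulrN mulrCA divff // mulr1.
      by apply/eqP; rewrite scaleNr -addr_eq0 addrC -/w hw.
    case/negP: hi0; apply/sub_rVP; exists (- (al / be)); apply: (scalerI be0); rewrite scalerA mulrN mulrCA divff // mulr1.
    by apply/eqP; rewrite scaleNr -addr_eq0 addrC -/w hw.
  have rel : w 0 0 *: (a * a) + w 0 1 *: (a * b) + w 0 2 *: (a * c) + w 0 3 *: (b * b) + w 0 4 *: (b * c) + w 0 5 *: (c * c) \in (N ^+ 3)%VS.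
    by have := relM w wM; rewrite sum6E.
  have nz : ~ [/\ [/\ w 0 0 = 0, w 0 1 = 0 & w 0 2 = 0] & [/\ w 0 3 = 0, w 0 4 = 0 & w 0 5 = 0]].
    move=> [[h0 h1 h2] [h3 h4 h5]]; case/eqP: w0; apply/rowP => -[[|[|[|[|[|[|i]]]]]] hi] //; rewrite [RHS]mxE;
    [rewrite -[RHS]h0 | rewrite -[RHS]h1 | rewrite -[RHS]h2 | rewrite -[RHS]h3 | rewrite -[RHS]h4 | rewrite -[RHS]h5]; congr (w 0 _); exact: val_inj.
  have E j := congr1 (fun X : 'rV_3 => X 0 j) gmw.
  have eqs : [/\ 2%:R * w 0 0 * v 0 0 + w 0 1 * v 0 1 + w 0 2 * v 0 2 = 0, w 0 1 * v 0 0 + 2%:R * w 0 3 * v 0 1 + w 0 4 * v 0 2 = 0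
     & w 0 2 * v 0 0 + w 0 4 * v 0 1 + 2%:R * w 0 5 * v 0 2 = 0].
    by split; [have := E 0 | have := E 1 | have := E 2]; rewrite !mxE sum3E !mxE /= => h'; rewrite -[RHS]h'; ring.
  case: eqs => E0 E1 E2.
  have [h0|h0] := eqVneq (v 0 0) 0; last exact: (singular_relation sp nz h0 rel E0 E1 E2).
  have [h1|h1] := eqVneq (v 0 1) 0; last first.
    apply: (@singular_relation b a c (w 0 3) (w 0 1) (w 0 4) (w 0 0) (w 0 2) (w 0 5) (v 0 1) (v 0 0) (v 0 2) (span3_C12 sp)) => //.
    - by move=> [[? ? ?] [? ? ?]]; apply: nz.
    - by rewrite [b * a]mulrC; move: rel; apply: mem_eq; ring.
    - by rewrite -[RHS]E1; ring.
    - by rewrite -[RHS]E0; ring.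
    by rewrite -[RHS]E2; ring.
  have [h2|h2] := eqVneq (v 0 2) 0; last first.
    apply: (@singular_relation c a b (w 0 5) (w 0 2) (w 0 4) (w 0 0) (w 0 1) (w 0 3) (v 0 2) (v 0 0) (v 0 1) (span3_C12 (span3_C23 sp))) => //.
    - by move=> [[? ? ?] [? ? ?]]; apply: nz.
    - by rewrite [c * a]mulrC [c * b]mulrC; move: rel; apply: mem_eq; ring.
    - by rewrite -[RHS]E2; ring.
    - by rewrite -[RHS]E0; ring.
    by rewrite -[RHS]E1; ring.
  case/eqP: v0; apply/rowP => i; rewrite [RHS]mxE; move: i; apply: (P) => //.
have al_ex (k : K) : exists X : car A, forall u', k *: u' = X * u' by exists k%:A => u'; rewrite mulr_algl.
case: (sp) => aN bN cN _.
have dep5 (f : 'I_5 -> car A) : (forall i, f i \in (N ^+ 2)%VS) -> exists k : 'I_5 -> K,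
    (exists i, k i != 0) /\ k 0 *: f 0 + k 1 *: f 1 + k 2 *: f 2 + k 3 *: f 3 + k 4 *: f 4 \in (N ^+ 3)%VS.
  move=> fN; have [k [hk h]] := dep_mod N32 dN2 fN; exists k; split=> //.
  by move: h; rewrite sum5E.
have ex5 (k : 'I_5 -> K) : (exists i, k i != 0) -> ~ [/\ k 0 = 0, k 1 = 0, k 2 = 0, k 3 = 0 & k 4 = 0].
  move=> [i hi] [h0 h1 h2 h3 h4]; case/eqP: hi; case: i => [[|[|[|[|[|i]]]]] hi] //;
  [rewrite -[RHS]h0 | rewrite -[RHS]h1 | rewrite -[RHS]h2 | rewrite -[RHS]h3 | rewrite -[RHS]h4]; congr (k _); exact: val_inj.
case: hbc => hbc.
  have [k [/ex5 knz]] := dep5 (fun i => nth 0 [:: a * a; a * b; a * c; b * b; c * c] i) ltac:(by case=> [[|[|[|[|[|]]]]] hi] //=; exact: NN).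
  move=> /=; move: (k 0) (k 1) (k 2) (k 3) (k 4) knz => x y' z u v nz rel {k dep5 ex5}.
  (* The second conic also contains the line [c'], so the pencil has a common component. *)
  have common b' c' (x' z' : K) : span3 N a b' c' -> b' * c' \in (N ^+ 3)%VS -> ~ (x' = 0 /\ z' = 0) ->
      x' *: (a * c') + z' *: (c' * c') \in (N ^+ 3)%VS -> goodA A.
    move=> sp' h nz' rel'; have [x0|x0] := eqVneq x' 0.
      have z0 : z' != 0 by apply/eqP => z0; apply: nz'.
      apply: (goodA_common2 lN IH N4 dS SN3 dN dN2 (a:=a) (c:=c') (d:=b')); [exact: span3_C23 | | by rewrite mulrC].
      by rewrite -[c' * c'](scalerK z0) memvZ //; move: rel'; rewrite x0 scale0r add0r.
    have sp1 := span3_shift 0 (z' / x') sp'.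
    apply: (goodA_common1 lN K0 IH N4 dN dN2 sp1); last by rewrite mulrC.
    rewrite scale0r addr0 -[c' * _](scalerK x0) memvZ //; move: rel'; apply: mem_eq.
    by rewrite mulrDr -scalerAr scalerDr scalerA mulrCA divff // mulr1 [c' * a]mulrC.
  have [[x0 y0 u0]|h1] := classic [/\ x = 0, y' = 0 & u = 0].
    apply: (common b c z v) => //.
      by move=> [z0 v0]; apply: nz.
    by move: rel; rewrite x0 y0 u0 !scale0r !add0r addr0.
  have [[x0 z0 v0]|h2] := classic [/\ x = 0, z = 0 & v = 0].
    apply: (common c b y' u); [exact: span3_C23 | by rewrite mulrC | by move=> [y0 u0]; apply: nz|].
    by move: rel; rewrite x0 z0 v0 !scale0r !addr0 add0r.
  (* A shift of [a] makes the coefficients of both [b^2] and [c^2] nonzero; the term in [b c] that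
     it creates lies in [N^3]. *)
  have [s hs] := quad_neq0 h1; have [t ht] := quad_neq0 h2.
  have sp' := span3_shift (- s) (- t) sp; rewrite !scaleNr in sp'.
  apply: (goodA_rep4_1 lN IH N4 dS SN3 dN dN2 (x := - x) (y := - (y' + 2%:R * s * x)) (z := - (z + 2%:R * t * x)) sp' hbc hs ht).
  set A' := a - _ - _; set k := 2%:R * s * t * x + y' * t + z * s.
  suff h w : w = (x *: (a * a) + y' *: (a * b) + z *: (a * c) + u *: (b * b) + v *: (c * c)) - k *: (b * c) -> w \in (N ^+ 3)%VS.
    apply: h; rewrite !scaleNr.
    have q1 w : (x * s ^+ 2 + y' * s + u) *: w = s *: (s *: (x *: w)) + s *: (y' *: w) + u *: w.
      by rewrite !scalerA -!scalerDl; congr (_ *: _); ring.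
    have q2 w : (x * t ^+ 2 + z * t + v) *: w = t *: (t *: (x *: w)) + t *: (z *: w) + v *: w.
      by rewrite !scalerA -!scalerDl; congr (_ *: _); ring.
    have q3 w : (y' + 2%:R * s * x) *: w = y' *: w + s *: (x *: w) + s *: (x *: w).
      by rewrite !scalerA -!scalerDl; congr (_ *: _); ring.
    have q4 w : (z + 2%:R * t * x) *: w = z *: w + t *: (x *: w) + t *: (x *: w).
      by rewrite !scalerA -!scalerDl; congr (_ *: _); ring.
    have q5 w : k *: w = s *: (t *: (x *: w)) + s *: (t *: (x *: w)) + t *: (y' *: w) + s *: (z *: w).
      by rewrite !scalerA -!scalerDl; congr (_ *: _); rewrite /k; ring.
    rewrite q1 q2 q3 q4 q5 /A'.
    have [X ex] := al_ex x; have [Y ey] := al_ex y'; have [Z ez] := al_ex z; have [U eu] := al_ex u; have [V ev] := al_ex v.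
    have [S es] := al_ex s; have [T et] := al_ex t.
    by rewrite !es !et !ex !ey !ez !eu !ev; ring.
  by move=> ->; rewrite memvB ?memvZ.
have [k [/ex5 knz]] := dep5 (fun i => nth 0 [:: a * a; a * b; a * c; b * c; c * c] i) ltac:(by case=> [[|[|[|[|[|]]]]] hi] //=; exact: NN).
move=> /=; move: (k 0) (k 1) (k 2) (k 3) (k 4) knz => x y' z u v nz rel {k dep5 ex5}.
have [[x0 z0 v0]|h1] := classic [/\ x = 0, z = 0 & v = 0].
  have rel' : b * (y' *: a + u *: c) \in (N ^+ 3)%VS.
    move: rel; rewrite x0 z0 v0 !scale0r add0r !addr0; apply: mem_eq.
    by rewrite mulrDr -!scalerAr [b * a]mulrC.
  have [y0|y0] := eqVneq y' 0.
    have u0 : u != 0 by apply/eqP => u0; apply: nz.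
    apply: (goodA_common2 lN IH N4 dS SN3 dN dN2 (a:=a) (c:=b) (d:=c)) => //; rewrite -[b * c](scalerK u0) memvZ //.
    by move: rel'; rewrite y0 scale0r add0r scalerAr.
  have sp1 := span3_shift 0 (u / y') sp; rewrite scale0r addr0 in sp1.
  apply: (goodA_common2 lN IH N4 dS SN3 dN dN2 (a:=c) (c:=b) (d:=a + (u / y') *: c)) => //.
    by apply: span3_C12; apply: span3_C23; apply: span3_C12.
  rewrite -[b * _](scalerK y0) memvZ //; move: rel'; apply: mem_eq; rewrite [RHS]scalerAr; congr (_ * _).
  by rewrite scalerDr scalerA mulrCA divff // mulr1.
have [t ht] := quad_neq0 h1; set v' := (_ + v) in ht.
have sp' := span3_shift 0 (- t) sp; rewrite scale0r addr0 !scaleNr in sp'.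
apply: (goodA_rep4_2 lN IH N4 dS SN3 dN dN2 (x := - (x / v')) (y := - (y' / v')) (z := - ((z + 2%:R * t * x) / v')) (k := - ((u + y' * t) / v')) sp' hbc).
have dv k0 w : v' *: (- (k0 / v') *: w) = - (k0 *: w) by rewrite scalerA mulrN mulrCA divff // mulr1 scaleNr.
rewrite -[X in X \in _](scalerK ht) memvZ //; move: rel; apply: mem_eq.
rewrite scalerBr !scalerDr !dv.
have q1 w : v' *: w = t *: (t *: (x *: w)) + t *: (z *: w) + v *: w.
  by rewrite !scalerA -!scalerDl; congr (_ *: _); rewrite /v'; ring.
have q2 w : (z + 2%:R * t * x) *: w = z *: w + t *: (x *: w) + t *: (x *: w).
  by rewrite !scalerA -!scalerDl; congr (_ *: _); ring.
have q3 w : (u + y' * t) *: w = u *: w + t *: (y' *: w) by rewrite !scalerA -!scalerDl; congr (_ *: _); ring.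
rewrite q1 q2 q3; have [X ex] := al_ex x; have [Y ey] := al_ex y'; have [Z ez] := al_ex z; have [U eu] := al_ex u; have [V ev] := al_ex v.
have [T et] := al_ex t; rewrite !et !ex !ey !ez !eu !ev; ring.
Qed.

End RankFourCases.

(** * Growth of the Hilbert function and the end of the case N^4 = 0 *)

Section SmallPowers.
Variables (K : closedFieldType) (m : nat) (A : calg K m) (N : {vspace car A}).
Hypothesis lN : localA N.
Hypothesis K0 : [pchar K] =i pred0.
Hypothesis IH : forall k, (k < m)%N -> CM K k.
Hypothesis SN2 : (soc N <= N ^+ 2)%VS.
Hypothesis dS : (\dim (soc N) <= 2)%N.
Hypothesis e3 : (\dim (N ^+ 2) + 3 <= \dim N)%N.
Implicit Types (u v w x y z s : car A) (U V W X Y : {vspace car A}).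

Lemma dim_soc12 : \dim (soc N) = 1%N \/ \dim (soc N) = 2%N.
Proof. by move: dS (soc_neq0 lN); rewrite -dimv_eq0; case: (\dim _) => [|[|[|]]]; auto. Qed.

(** Every product of two elements of [N] is in the socle, so [goodA_T2X] applies with [X = N] and
    without correction. *)
Lemma goodA_N3_0 : (N ^+ 3 = 0)%VS -> goodA A.
Proof.
move=> N3; have N2N : (N ^+ 2 <= N)%VS by have := NpS lN 0; rewrite expv1.
have N30 u n : u \in N -> n \in (N ^+ 2)%VS -> u * n = 0.
  by move=> uN nN; have := N1M uN nN; rewrite N3 memv0 => /eqP.
have [x xN xN2] : exists2 x, x \in N & x \notin (N ^+ 2)%VS.
  by apply: dim_lt_ex; apply: leq_trans e3; rewrite addn3 !ltnS leqW // leqW.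
have [d1|d2] := dim_soc12.
  by apply: (@goodA_T1 _ _ _ _ lN K0 IH x) => // n; exact: N30.
apply: (@goodA_T2X _ _ _ _ lN K0 IH N 0%VS) => //.
- by apply/negP => /subvP h; case/negP: xN2; exact: h.
- exact: sub0v.
- by rewrite addv0 addvSl.
- by rewrite add0v capvSr.
- by move=> u v uN vN; apply/annP => n nN; rewrite mulrC (N30 _ _ nN (NN uN vN)).
move=> x0 s s' l l' _ _ _ _; apply: gen_all => t; exists 0; split; rewrite ?mem0v //.
- by move=> n _; rewrite mul0r.
- by move=> n _; rewrite mul0r.
by move=> v; rewrite memv0 => /eqP ->; rewrite mulr0 mem0v.
Qed.

(** A square [u^2] spans [N^2] modulo [N^3], and then [u^3] spans [N^3] modulo [N^4]. *)
Lemma h2_1 : \dim (N ^+ 2) = (\dim (N ^+ 3)).+1 -> (\dim (N ^+ 3) <= (\dim (N ^+ 4)).+1)%N.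
Proof.
move=> d2; have [u uN uu] : exists2 u, u \in N & u * u \notin (N ^+ 3)%VS.
  apply: NNPP => h; have /dimvS : (N ^+ 2 <= N ^+ 3)%VS.
    apply/subvP; apply: (@N2_ind _ _ _ _ K0 (fun w => w \in (N ^+ 3)%VS)); rewrite ?mem0v //.
    - by move=> u v; exact: memvD.
    - by move=> k u; exact: memvZ.
    by move=> u uN; apply: NNPP => h'; apply: h; exists u => //; apply/negP.
  by rewrite d2 ltnn.
have g2 : (N ^+ 2 <= <[u * u]> + N ^+ 3)%VS.
  by apply: eq_sub_dim; rewrite ?dim_line_add ?d2 // subv_add -memvE NN // NpS.
have g3 : (N ^+ 3 <= <[u * u * u]> + N ^+ 4)%VS.
  rewrite expvSl; apply: subv_trans (prodvSr _ g2) _; rewrite prodvDr subv_add -expvSl addvSr andbT prodvC.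
  apply/subvP => w /line_mulP [v vN ->]; have /(subvP g2) /memv_addP [? /vlineP [k ->] [n nN e]] := NN uN vN.
  rewrite -(mulrA u u v) e mulrDr -scalerAr; apply: memv_add; last exact: N1M.
  by rewrite memvZ // mulrA memv_line.
by apply: leq_trans (dimvS g3) _; exact: dim_line_le.
Qed.

(** A multiplier from [net2] maps [N^2/N^3] onto [N^3/N^4]. *)
Lemma h2_2 : \dim (N ^+ 2) = (\dim (N ^+ 3)).+2 -> (\dim (N ^+ 3) <= (\dim (N ^+ 4)).+2)%N.
Proof.
move=> d2; have [a aN aN2'] := net2 lN K0 (etrans d2 (esym (addn2 _))).
have aN2 : (N ^+ 2 <= <[a]> * N)%VS.
  apply: (nakayama lN) => [u v h|]; first by rewrite -[N]expv1 ideal_line_mul // expv1.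
  by rewrite -expvSl.
have [x xN xN3] : exists2 x, x \in (N ^+ 2)%VS & x \notin (N ^+ 3)%VS by apply: dim_lt_ex; rewrite d2.
have [y yN yx] : exists2 y, y \in (N ^+ 2)%VS & y \notin (<[x]> + N ^+ 3)%VS.
  by apply: dim_lt_ex; rewrite dim_line_add // d2.
have g : (N ^+ 2 <= <[y]> + (<[x]> + N ^+ 3))%VS.
  by apply: eq_sub_dim; rewrite ?dim_line_add ?d2 // !subv_add -!memvE yN xN NpS.
have g3 : (N ^+ 3 <= <[a * y]> + (<[a * x]> + N ^+ 4))%VS.
  apply: subv_trans (mult_pow aN2 1) _; apply/subvP => w /line_mulP [v /(subvP g) /memv_addP [? /vlineP [k ->] [? /memv_addP [? /vlineP [k' ->] [n nN ->]] ->]] ->].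
  rewrite !mulrDr -!scalerAr; apply: memv_add; first by rewrite memvZ ?memv_line.
  by apply: memv_add; [rewrite memvZ ?memv_line | exact: N1M].
apply: leq_trans (dimvS g3) _; apply: leq_trans (dim_line_le _ _) _; rewrite ltnS; exact: dim_line_le.
Qed.

(** [N^3] lies in the socle. If both have dimension two, [h2_1], [m <= 10] and the presence of three
    generators leave 4, 5 or 6 for the dimension of [N^2]. *)
Lemma goodA_N4_0 : (m <= 10)%N -> (N ^+ 3 != 0)%VS -> (N ^+ 4 = 0)%VS -> goodA A.
Proof.
move=> m10 N3 N4; have d3 : (0 < \dim (N ^+ 3))%N by rewrite lt0n dimv_eq0.
have [d1|d2] := dim_soc12; first exact: (goodA_gor3 lN K0 IH SN2 N4).
have h3 : (\dim (N ^+ 3) <= 2)%N by apply: leq_trans (dimvS (N3_soc N4)) _; rewrite d2.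
have [h31|h31] := eqVneq (\dim (N ^+ 3)) 1%N.
  have [w wN w0] : exists2 w, w \in (N ^+ 3)%VS & w != 0.
    by exists (vpick (N ^+ 3)%VS); rewrite ?memv_pick // vpick0.
  have N3w : (N ^+ 3 = <[w]>)%VS by apply/eqP; rewrite eq_sym eqEdim -memvE wN h31 dim_vline w0.
  have [LN|LN] := boolP (nker N <= N ^+ 2)%VS.
    exact: (goodA_cubic_quadric lN K0 IH SN2 N4 d2 LN N3w w0 m10 e3).
  exact: (goodA_nd_h3_1 lN K0 IH SN2 N4 d2 LN N3w).
have h32 : \dim (N ^+ 3) = 2%N by case: (\dim (N ^+ 3)) d3 h3 h31 => [|[|[|]]].
have SN3 : (soc N <= N ^+ 3)%VS.
  by apply: eq_sub_dim; [exact: N3_soc | rewrite d2 h32].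
have N20 : (N ^+ 2 != 0)%VS by apply: contraNneq N3 => h; rewrite -subv0 -h NpS.
have lt2 := Np_lt lN (isT : (0 < 2)%N) N20.
have h21 := h2_1; have dN := dimN lN; have d4 : \dim (N ^+ 4) = 0%N by rewrite N4 dimv0.
have [h|n1] := eqVneq (\dim (N ^+ 2)) 3%N; first by have := h21; rewrite h h32 d4 => /(_ erefl).
have [h|n2] := eqVneq (\dim (N ^+ 2)) 4%N; first by apply: (goodA_h3_2_h2_2 lN K0 IH SN2 N4 d2 SN3 e3); rewrite h h32.
have [h|n3] := eqVneq (\dim (N ^+ 2)) 5%N; first by apply: (goodA_h3_2_h2_3 lN K0 IH SN2 N4 d2 SN3 e3); rewrite h h32.
have F (a b mm : nat) : (2 < a)%N -> a != 3%N -> a != 4%N -> a != 5%N -> b.+1 = mm -> (mm <= 10)%N -> (a + 3 <= b)%N ->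
  a = 6%N /\ b = 9%N by clear; lia.
rewrite h32 in lt2; have [h b9] := F _ _ _ lt2 n1 n2 n3 dN m10 e3.
by apply: (goodA_h3_2_h2_4 lN K0 IH N4 d2 SN3); rewrite ?b9 ?h ?h32.
Qed.

End SmallPowers.

Section Conductor.
Variables (K : fieldType) (m : nat) (A : calg K m).
Implicit Types (u v w : car A) (U V W : {vspace car A}).

Definition transp U W := (\bigcap_(i < \dim U) (amulr (vbasis U)`_i @^-1: W))%VS.

Lemma transpP U W u : reflect (forall v, v \in U -> u * v \in W) (u \in transp U W).
Proof.
apply: (iffP idP) => h.
  move=> v vU; rewrite (coord_vbasis vU) mulr_sumr; apply: memv_suml => i _.
  rewrite -scalerAr memvZ //; move: h; rewrite /transp.
  by rewrite memvE => /subv_bigcapP /(_ i isT); rewrite -memvE -memv_preim lfunE.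
rewrite memvE; apply/subv_bigcapP => i _; rewrite -memvE -memv_preim lfunE /=; apply: h.
by rewrite vbasis_mem // mem_nth // size_tuple.
Qed.

End Conductor.

Section CoordinateSystem.
Variables (K : fieldType) (m : nat) (A : calg K m).
Implicit Types (u v w : car A).

Lemma al_ex (k : K) : exists X : car A, forall u, k *: u = X * u.
Proof. by exists (k *: 1) => u; rewrite -scalerAl mul1r. Qed.

Lemma coords (X : seq (car A)) : size X = m -> (fullv <= <<X>>)%VS ->
  exists l : nat -> 'cV[K]_m, (forall i j, (i < m)%N -> (j < m)%N -> pr (l i) X`_j = (i == j)%:R) /\
    forall u, u = \sum_(i < m) pr (l i) u *: X`_i.
Proof.
move=> sX XF; have fX : free (in_tuple X).
  have e : \dim (fullv : {vspace car A}) = size X by rewrite dimvf sX /dim /= mul1n.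
  by rewrite /free /= eqn_leq dim_span -e dimvS.
have lp (i : 'I_(size X)) : exists l, forall u : car A, pr l u = coord (in_tuple X) i u.
  by apply: lin_pr => k u v; rewrite linearP.
have [l hl] := fun_choice lp.
have eX u : u \in <<in_tuple X>>%VS by apply: (subvP XF); rewrite memvf.
exists (fun i => if insub i is Some j then l j else 0); split.
  move=> i j; rewrite -{1 2}sX => im jm; rewrite insubT hl.
  have := @coord_free _ _ _ (in_tuple X) (Ordinal jm) (Sub i im) fX.
  by rewrite /= eq_sym => ->.
move=> u; rewrite {1}(coord_span (eX u)).
have eB (F : nat -> car A) : \sum_(i < m) F i = \sum_(i < size X) F i by rewrite -!(big_mkord xpredT F) sX.
rewrite (eB (fun i => pr (if insub i is Some j then l j else 0) u *: X`_i)).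
by apply: eq_bigr => i _; rewrite valK hl.
Qed.

End CoordinateSystem.

(** * The Hilbert function (1, 3, 3, 2, 1) *)

Section Alpha.
Variables (K : closedFieldType) (m : nat) (A : calg K m) (N : {vspace car A}).
Hypothesis lN : localA N.
Hypothesis K0 : [pchar K] =i pred0.
Hypothesis IH : forall k, (k < m)%N -> CM K k.
Hypothesis dN : \dim N = 9%N.
Hypothesis dN2 : \dim (N ^+ 2) = 6%N.
Hypothesis dN3 : \dim (N ^+ 3) = 3%N.
Hypothesis dN4 : \dim (N ^+ 4) = 1%N.
Implicit Types (u v w x y z s : car A) (U V W X Y : {vspace car A}).

Definition vker := (N :&: ann (N ^+ 3))%VS.

Lemma vkerP u : reflect (u \in N /\ forall n, n \in (N ^+ 3)%VS -> u * n = 0) (u \in vker).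
Proof. by rewrite memv_cap; apply: (iffP andP) => -[h1 /annP h2]. Qed.

Lemma vkerN u : u \in vker -> u \in N.
Proof. by case/vkerP. Qed.

Lemma vker3 u n : u \in vker -> n \in (N ^+ 3)%VS -> u * n = 0.
Proof. by case/vkerP => _; apply. Qed.

Lemma N5 : (N ^+ 5 = 0)%VS.
Proof.
have h : (N ^+ 4 != 0)%VS by rewrite -dimv_eq0 dN4.
by have := Np_lt lN (isT : (0 < 4)%N) h; rewrite dN4 ltnS leqn0 dimv_eq0 => /eqP.
Qed.

Lemma N50 i j u v : (5 <= i + j)%N -> u \in (N ^+ i)%VS -> v \in (N ^+ j)%VS -> u * v = 0.
Proof.
move=> h ui vj; apply/eqP; rewrite -memv0 -N5; apply: (subvP (Np_le lN _ h)) => //; exact: NpM.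
Qed.

Lemma N2_vker : (N ^+ 2 <= vker)%VS.
Proof.
apply/subvP => z zN; apply/vkerP; split=> [|n nN]; first exact: (NpN lN (k := 2)).
exact: (N50 (isT : 5 <= 2 + 3)%N).
Qed.

Lemma vkerS u n : u \in vker -> n \in (N ^+ 2)%VS -> u * n \in soc N.
Proof. by move=> uV nN; apply/annP => w wN; rewrite -mulrA vker3 //; exact: NM1. Qed.

Hypothesis SN3 : (soc N <= N ^+ 3)%VS.
Hypothesis dS : \dim (soc N) = 2%N.
Hypothesis dV : \dim vker = 8%N.

Lemma N4_soc : (N ^+ 4 <= soc N)%VS.
Proof.
by apply/subvP => z zN; apply/annP => w wN; apply: (N50 (isT : 5 <= 4 + 1)%N) => //; rewrite expv1.
Qed.

Lemma socM s v : s \in soc N -> v \in N -> s * v = 0.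
Proof. by move=> /annP h /h. Qed.

Lemma ex_nvker : exists2 a, a \in N & a \notin vker.
Proof. by apply: dim_lt_ex; rewrite dN dV. Qed.

Lemma nvker_gen a : a \in N -> a \notin vker -> (N <= <[a]> + vker)%VS.
Proof.
move=> aN aV; apply: eq_sub_dim; last by rewrite dim_line_add // dV dN.
by rewrite subv_add -memvE aN capvSl.
Qed.

(** In the cube of [k a + v] with [v] in [vker], all terms but [a^3] are products of [v] with
    elements of [N^2], which lie in the socle. *)
Lemma nvker_N3 a : a \in N -> a \notin vker -> (N ^+ 3 <= <[a * a * a]> + soc N)%VS.
Proof.
move=> aN aV; have g := nvker_gen aN aV; apply/subvP; apply: (N3_ind K0).
- exact: mem0v.
- by move=> u v; exact: memvD.
- by move=> k u; exact: memvZ.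
move=> u /(subvP g) /memv_addP [? /vlineP [k ->] [v vV ->]].
have vN := vkerN vV; have [X eX] := al_ex A k.
have -> : (k *: a + v) * (k *: a + v) * (k *: a + v) =
  (k * k * k) *: (a * a * a) + (v * ((k * k * 3%:R) *: (a * a) + (k * 3%:R) *: (a * v) + v * v)).
  by rewrite -!scalerA !eX !scaler_nat; ring.
apply: memv_add; first by rewrite memvZ ?memv_line.
by apply: vkerS; rewrite // !memvD ?memvZ ?NN.
Qed.

Lemma a3_soc a : a \in N -> a \notin vker -> a * a * a \notin soc N.
Proof.
move=> aN aV; apply/negP => h; have := dimvS (subv_trans (nvker_N3 aN aV) _ : N ^+ 3 <= soc N)%VS.
by rewrite dS dN3 subv_add -memvE h subvv => /(_ isT).
Qed.

Lemma a3N a : a \in N -> a * a * a \in (N ^+ 3)%VS.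
Proof. by move=> aN; apply: NM1 => //; exact: NN. Qed.

Lemma a4_neq0 a : a \in N -> a \notin vker -> a * a * a * a != 0.
Proof.
move=> aN aV; apply: contraNneq (a3_soc aN aV) => h; apply/annP => w /(subvP (nvker_gen aN aV)).
case/memv_addP=> ? /vlineP [k ->] [v vV ->]; by rewrite mulrDr -scalerAr h scaler0 add0r mulrC (vker3 vV (a3N aN)).
Qed.

Lemma a4_N4 a : a \in N -> a \notin vker -> (N ^+ 4 <= <[a * a * a * a]>)%VS.
Proof.
move=> aN aV; apply: eq_sub_dim; last by rewrite dN4 dim_vline a4_neq0.
by rewrite -memvE; do 2 apply: NM1 => //; exact: NN.
Qed.

(** Subtracting a multiple of [a^2] from [c] brings [c' N] into the socle. Then [p = a^3] works with
    [U] spanned by [b] and [c']: both are in [vker], and [a^3] is outside the ideal they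
    generate. *)
Lemma goodA_alpha_net c : c \in N -> c \notin (N ^+ 2)%VS -> (forall v, v \in N -> c * v \in (N ^+ 3)%VS) -> goodA A.
Proof.
move=> cN cN2 cT; have [a aN aV] := ex_nvker.
have n3 : a * a * a \in (N ^+ 3)%VS by apply: NM1 => //; exact: NN.
have cV : c \in vker.
  apply/vkerP; split=> // n; move: n; apply: prodv_ind.
  - exact: mulr0.
  - by move=> u v h1 h2; rewrite mulrDr h1 h2 addr0.
  - by move=> k u h; rewrite -scalerAr h scaler0.
  - by move=> u v uN vN; rewrite mulrA; apply: (N50 (isT : 5 <= 3 + 2)%N) => //; exact: cT.
have [b bV bc] : exists2 b, b \in vker & b \notin (<[c]> + N ^+ 2)%VS.
  by apply: dim_lt_ex; rewrite dim_line_add // dN2 dV.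
have bN := vkerN bV; have aaN := NN aN aN.
have ca : c * a \in (<[a * a * a]> + soc N)%VS by apply: (subvP (nvker_N3 aN aV)); exact: cT.
case/memv_addP: ca => ? /vlineP [k ->] [s sS eca].
pose c' := c - k *: (a * a).
have c'V : c' \in vker by rewrite memvB ?memvZ // (subvP N2_vker).
have c'N2 : c' \notin (N ^+ 2)%VS.
  by apply: contra cN2 => h; rewrite -[c](subrK (k *: (a * a))) memvD ?memvZ.
have ec'a : c' * a = s by rewrite mulrBl -scalerAl eca addrC addKr.
have c'S v : v \in N -> c' * v \in soc N.
  have h v' : v' \in vker -> c' * v' \in soc N.
    move=> v'V; have v'N := vkerN v'V; have h3 : c' * v' \in (N ^+ 3)%VS.
      by rewrite mulrBl -scalerAl memvB ?memvZ ?cT //; apply: NM1.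
    apply/annP => w /(subvP (nvker_gen aN aV)) /memv_addP [? /vlineP [j ->] [w' w'V ->]].
    rewrite mulrDr -scalerAr mulrAC ec'a (socM sS v'N) scaler0 add0r mulrC; exact: vker3.
  move=> /(subvP (nvker_gen aN aV)) /memv_addP [? /vlineP [j ->] [w' w'V ->]].
  by rewrite mulrDr -scalerAr ec'a memvD ?memvZ ?h.
have c'0 n : n \in (N ^+ 2)%VS -> c' * n = 0.
  move: n; apply: prodv_ind.
  - exact: mulr0.
  - by move=> u v h1 h2; rewrite mulrDr h1 h2 addr0.
  - by move=> j u h; rewrite -scalerAr h scaler0.
  - by move=> u v uN vN; rewrite mulrA; apply: socM => //; exact: c'S.
have bc' : b \notin (<[c']> + N ^+ 2)%VS.
  apply: contra bc => /memv_addP [? /vlineP [j ->] [n nN ->]].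
  rewrite /c' scalerBr -addrA; apply: memv_add; first by rewrite memvZ ?memv_line.
  by rewrite addrC memvB // memvZ // memvZ.
have abc : a \notin (<[b]> + (<[c']> + N ^+ 2))%VS.
  by apply: contra aV; apply/subvP; rewrite !subv_add -!memvE bV c'V N2_vker.
have g : (N <= <[a]> + (<[b]> + (<[c']> + N ^+ 2)))%VS.
  apply: eq_sub_dim; last by rewrite !dim_line_add // dN2 dN.
  by rewrite !subv_add -!memvE aN bN (vkerN c'V) NpS.
have gN2 : (N ^+ 2 <= <[a * a]> + (<[a * b]> + (<[b * b]> + N ^+ 3)))%VS.
  apply/subvP; apply: (N2_ind K0).
  - exact: mem0v.
  - by move=> u v; exact: memvD.
  - by move=> j u; exact: memvZ.
  move=> u /(subvP g) /memv_addP [? /vlineP [k1 ->] [? /memv_addP [? /vlineP [k2 ->] [? /memv_addP [? /vlineP [k3 ->] [n nN ->]] ->]] eu]].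
    rewrite {}eu; have [X1 e1] := al_ex A k1; have [X2 e2] := al_ex A k2; have [X3 e3] := al_ex A k3.
  have -> : (k1 *: a + (k2 *: b + (k3 *: c' + n))) * (k1 *: a + (k2 *: b + (k3 *: c' + n))) =
     (k1 * k1) *: (a * a) + ((k1 * k2 * 2%:R) *: (a * b) + ((k2 * k2) *: (b * b) +
       ((n * (k1 *: a + k2 *: b + (k1 *: a + k2 *: b + n))) + (k3 * 2%:R) *: (c' * (k1 *: a + k2 *: b + n)) + (k3 * k3) *: (c' * c')))).
    by rewrite -!scalerA !e1 !e2 !e3 !scaler_nat; ring.
  have nN1 : n \in N := NpN lN (isT : (0 < 2)%N) nN.
  do 3 (apply: memv_add; first by rewrite memvZ ?memv_line).
  have sN : k1 *: a + k2 *: b + n \in N by rewrite !memvD ?memvZ.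
  apply: memvD; last by rewrite memvZ ?(subvP SN3) ?c'S ?(vkerN c'V).
  apply: memvD; first by apply: NM1 => //; rewrite !memvD ?memvZ.
  by rewrite memvZ ?(subvP SN3) ?c'S.
have ind al be : al *: (a * b) + be *: (b * b) \in (N ^+ 3)%VS -> al = 0 /\ be = 0.
  move=> h; have lt u W : (N ^+ 2 <= <[a * a]> + (<[u]> + N ^+ 3))%VS -> False.
    move/dimvS; rewrite leqNgt => /negP; apply; rewrite dN2; apply: leq_ltn_trans (dim_line_le _ _) _.
    by apply: (@leq_ltn_trans 5%N) => //; rewrite ltnS; apply: leq_trans (dim_line_le _ _) _; rewrite dN3.
  have [al0|al0] := eqVneq al 0; last first.
    exfalso; apply: (lt (b * b) 0%VS); apply: subv_trans gN2 _; apply: addvS => //.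
    rewrite subv_add subvv andbT -memvE -[a * b](scalerK al0) memvZ //.
    by rewrite -[al *: _](addrK (be *: (b * b))) addrC memv_add // memvN memvZ // memv_line.
  split=> //; have [//|be0] := eqVneq be 0.
  exfalso; apply: (lt (a * b) 0%VS); apply: subv_trans gN2 _; apply: addvS => //; apply: addvS => //.
  rewrite subv_add subvv andbT -memvE -[b * b](scalerK be0) memvZ //.
  by move: h; rewrite al0 scale0r add0r.
pose U := (<[b]> + <[c']>)%VS.
have pU : a * a * a \notin (U * fullv)%VS.
  apply/negP; rewrite prodvDl => /memv_addP [? /line_mulP [u _ ->] [? /line_mulP [v _ ->] e]].
  have [u0 [u1 [uN eu]]] := loc_dec lN u; have [v0 [v1 [vN ev]]] := loc_dec lN v.
  have e1 : u0 *: b + v0 *: c' + (b * u1 + c' * v1) = a * a * a.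
    by rewrite e eu ev !mulrDr -!scalerAr !mulr1 addrACA.
  have u00 : u0 = 0.
    apply/eqP; apply: contraNT bc' => h; rewrite -[b](scalerK h) memvZ //.
    have -> : u0 *: b = (- v0) *: c' + (a * a * a - (b * u1 + c' * v1)).
      by rewrite -e1 scaleNr; ring.
    apply: memv_add; first by rewrite memvZ ?memv_line.
    by apply: memvB; [exact: (subvP (NpS lN 1)) | rewrite memvD ?NN // (vkerN c'V)].
  move: e1; rewrite u00 scale0r add0r => e1.
  have v00 : v0 = 0.
    apply/eqP; apply: contraNT c'N2 => h; rewrite -[c'](scalerK h) memvZ //.
    have -> : v0 *: c' = a * a * a - (b * u1 + c' * v1) by rewrite -e1 addrK.
    by apply: memvB; [exact: (subvP (NpS lN 1)) | rewrite memvD ?NN // (vkerN c'V)].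
  move: e1; rewrite v00 scale0r add0r => e1.
  case/memv_addP: (subvP g _ uN) => ? /vlineP [k1 ->] [? /memv_addP [? /vlineP [k2 ->] [? /memv_addP [? /vlineP [k3 ->] [n nN ->]] ->]] eu1].
  have hS : k3 *: (c' * b) + b * n + c' * v1 \in soc N by rewrite !memvD ?memvZ ?c'S ?vkerS.
  have e2 : k1 *: (a * b) + k2 *: (b * b) = a * a * a - (k3 *: (c' * b) + b * n + c' * v1).
    rewrite -e1 eu1 !mulrDr -!scalerAr [b * a]mulrC [b * c']mulrC; ring.
  have [k10 k20] : k1 = 0 /\ k2 = 0 by apply: ind; rewrite e2 memvB // (subvP SN3).
  case/negP: (a3_soc aN aV); move: e2; rewrite k10 k20 !scale0r add0r => /esym/eqP; rewrite subr_eq0 => /eqP ->.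
  exact: hS.
have [l [l1 l2]] := pr_sep pU.
apply: (@goodA_lE1 _ _ _ _ lN K0 IH U a (a * a * a) l).
- by apply: subv_trans g _; rewrite -!addvA.
- by rewrite -dimv_eq0 dN.
- move=> u /memv_addP [? /vlineP [k1 ->] [? /vlineP [k2 ->] ->]].
  by rewrite mulrDr -!scalerAr (mulrC _ b) (mulrC _ c') (vker3 bV n3) (vker3 c'V n3) !scaler0 addr0.
- by move=> u v uU; apply: l2; rewrite memv_mul ?memvf.
by rewrite l1 oner_neq0.
Qed.

(** Adapted generators: [a] is a multiplier, [b] and [c] kill [N^3], and multiplication by [a^2]
    sends [c] to 0 and [b] to the direction of the socle other than [a^4]. *)
Definition frame a b c := [/\ a \in N, b \in vker, c \in vker & (N ^+ 2 <= <[a]> * N)%VS] /\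
  [/\ c \notin (N ^+ 2)%VS, a * a * c = 0 & a * a * b \notin <[a * a * a * a]>%VS].

Lemma mult_nvker a : (N ^+ 2 <= <[a]> * N)%VS -> a \notin vker.
Proof.
move=> aN2; apply/negP => /vkerP [_ h]; have : (N ^+ 4 <= 0)%VS.
  by apply/subvP => w /(subvP (mult_pow aN2 2)) /line_mulP [v vN ->]; rewrite h // mem0v.
by rewrite subv0 -dimv_eq0 dN4.
Qed.

(** [c] exists by counting: [a^2] has rank at most two on [vker], which it maps to the socle, and at
    least one on [N^2], so its kernel on [vker], of dimension eight, exceeds that on [N^2], of
    dimension six. *)
Lemma ex_frame a : a \in N -> (N ^+ 2 <= <[a]> * N)%VS -> exists b c, frame a b c.
Proof.
move=> aN aN2; have aV := mult_nvker aN2.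
have g := nvker_gen aN aV.
have [b bV b1] : exists2 b, b \in vker & a * a * b \notin <[a * a * a * a]>%VS.
  apply: NNPP => h; have : (N ^+ 3 <= <[a * a * a]> + <[a * a * a * a]>)%VS.
    apply/subvP => w /(subvP (mult_pow aN2 1)) /line_mulP [v /(subvP aN2) /line_mulP [u uN ->] ->].
    case/memv_addP: (subvP g u uN) => ? /vlineP [k ->] [u' u'V ->].
    rewrite mulrA mulrDr -scalerAr; apply: memv_add; first by rewrite memvZ ?memv_line.
    by apply: contraPT h => h'; apply; exists u'.
  move/dimvS; rewrite leqNgt dN3 => /negP; apply; apply: leq_ltn_trans (dim_line_le _ _) _.
  by rewrite dim_vline; case: (_ != 0).
have [c] : exists2 c, c \in (vker :&: ann <[a * a]>)%VS & c \notin (N ^+ 2 :&: ann <[a * a]>)%VS.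
  apply: dim_lt_ex; have h1 := dim_line_mul (a * a) vker; have h2 := dim_line_mul (a * a) (N ^+ 2)%VS.
  have h3 : (\dim (<[a * a]> * vker) <= 2)%N.
    rewrite -dS; apply/dimvS/subvP => w /line_mulP [v vV ->].
    by rewrite mulrC vkerS // NN.
  have h4 : (0 < \dim (<[a * a]> * N ^+ 2))%N.
    rewrite lt0n dimv_eq0; apply: contraNneq (a4_neq0 aN aV) => h.
    by rewrite -memv0 -h -mulrA mem_line_mul // NN.
  have F (p q r t : nat) : (p + q = 8 -> r + t = 6 -> q <= 2 -> 0 < t -> r < p)%N by clear; lia.
  by apply: F h3 h4; rewrite ?h1 ?h2.
rewrite memv_cap line_ann => /andP [cV ca]; rewrite memv_cap line_ann ca andbT => cN2.
have ca' : a * a * c = 0 by apply/eqP; rewrite mulrC.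
by exists b, c; split; split.
Qed.

Section Frame.
Variables a b c : car A.
Hypothesis abc : frame a b c.
Let aN : a \in N. Proof. by case: abc => -[]. Qed.
Let bV : b \in vker. Proof. by case: abc => -[]. Qed.
Let cV : c \in vker. Proof. by case: abc => -[]. Qed.
Let aN2 : (N ^+ 2 <= <[a]> * N)%VS. Proof. by case: abc => -[]. Qed.
Let cN2 : c \notin (N ^+ 2)%VS. Proof. by case: abc => _ []. Qed.
Let aac : a * a * c = 0. Proof. by case: abc => _ []. Qed.
Let aab : a * a * b \notin <[a * a * a * a]>%VS. Proof. by case: abc => _ []. Qed.
Let aV : a \notin vker. Proof. exact: mult_nvker. Qed.
Let bN : b \in N. Proof. exact: vkerN. Qed.
Let cN : c \in N. Proof. exact: vkerN. Qed.
Let a4S : a * a * a * a \in soc N.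
Proof. by apply: (subvP N4_soc); apply: NM1 => //; exact: a3N. Qed.
Let tS : a * a * b \in soc N. Proof. by rewrite mulrC vkerS // NN. Qed.

Lemma frame_gen : (N <= <[a]> + (<[b]> + (<[c]> + N ^+ 2)))%VS.
Proof.
have bc : b \notin (<[c]> + N ^+ 2)%VS.
  apply: contra aab => /memv_addP [? /vlineP [k ->] [n nN ->]].
  rewrite mulrDr -scalerAr aac scaler0 add0r; apply: (subvP (a4_N4 aN aV)).
  by apply: (@NpM _ _ _ N 2 2) => //; exact: NN.
have abc' : a \notin (<[b]> + (<[c]> + N ^+ 2))%VS.
  by apply: contra aV; apply/subvP; rewrite !subv_add -!memvE bV cV N2_vker.
apply: eq_sub_dim; last by rewrite !dim_line_add // dN2 dN.
by rewrite !subv_add -!memvE aN bN cN NpS.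
Qed.

Lemma frame_N2 : (N ^+ 2 <= <[a * a]> + (<[a * b]> + (<[a * c]> + N ^+ 3)))%VS.
Proof.
apply/subvP => w /(subvP aN2) /line_mulP [u /(subvP frame_gen) + ->].
case/memv_addP=> ? /vlineP [k1 ->] [? /memv_addP [? /vlineP [k2 ->] [? /memv_addP [? /vlineP [k3 ->] [n nN ->]] ->]] ->].
rewrite !mulrDr -!scalerAr; do 3 (apply: memv_add; first by rewrite memvZ ?memv_line).
exact: N1M.
Qed.

Lemma frame_N3 : (N ^+ 3 <= <[a * a * a]> + (<[a * a * a * a]> + <[a * a * b]>))%VS.
Proof.
apply/subvP => w /(subvP (mult_pow aN2 1)) /line_mulP [u /(subvP frame_N2) + ->].
case/memv_addP=> ? /vlineP [k1 ->] [? /memv_addP [? /vlineP [k2 ->] [? /memv_addP [? /vlineP [k3 ->] [n nN ->]] ->]] ->].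
rewrite !mulrDr -!scalerAr !mulrA aac scaler0 add0r; apply: memv_add; first by rewrite memvZ ?memv_line.
rewrite addrC; apply: memv_add; last by rewrite memvZ ?memv_line.
by apply: (subvP (a4_N4 aN aV)); exact: N1M.
Qed.

Lemma frame_span : (N ^+ 2 <= <[a * a]> + (<[a * b]> + (<[a * c]> +
  (<[a * a * a]> + (<[a * a * a * a]> + <[a * a * b]>)))))%VS.
Proof. by apply: subv_trans frame_N2 _; do 3 apply: addvS => //; exact: frame_N3. Qed.

Lemma frame_soc : (soc N <= <[a * a * b]> + <[a * a * a * a]>)%VS.
Proof.
apply: eq_sub_dim; first by rewrite subv_add -!memvE tS a4S.
by rewrite dim_line_add // dim_vline a4_neq0 // dS.
Qed.

Definition fvec i : car A := nth 0 [:: 1; a; b; c; a * a; a * b; a * c; a * a * a; a * a * a * a; a * a * b] i.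

Lemma frame_coords : exists l : nat -> 'cV[K]_m,
  (forall i j, (i < 10)%N -> (j < 10)%N -> pr (l i) (fvec j) = (i == j)%:R) /\
  forall u, exists2 n, n \in (N ^+ 2)%VS & u = pr (l 0%N) u *: 1 + (pr (l 1%N) u *: a + (pr (l 2%N) u *: b + (pr (l 3%N) u *: c + n))).
Proof.
have m10 : m = 10%N by rewrite -(dimN lN) dN.
have [||l [h1 h2]] := @coords _ _ A [:: 1; a; b; c; a * a; a * b; a * c; a * a * a; a * a * a * a; a * a * b]; first exact: esym m10.
  rewrite -(locD lN) !span_cons span_nil addv0; apply: addvS => //; apply: subv_trans frame_gen _.
  by do 3 apply: addvS => //; exact: frame_span.
exists l; split=> [i j i10 j10|u]; first by apply: h1; rewrite m10.
have hN : forall k1 k2 k3 k4 k5 k6 : K, k1 *: (a * a) + (k2 *: (a * b) + (k3 *: (a * c) + (k4 *: (a * a * a) + (k5 *: (a * a * a * a) + k6 *: (a * a * b))))) \in (N ^+ 2)%VS.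
  have h3 : a * a * a \in (N ^+ 2)%VS by apply: (subvP (NpS lN 1)); exact: a3N.
  have h4 : a * a * a * a \in (N ^+ 2)%VS by apply: (subvP (NpS lN 1)); exact: (subvP SN3).
  have h5 : a * a * b \in (N ^+ 2)%VS by apply: (subvP (NpS lN 1)); exact: (subvP SN3).
  by move=> k1 k2 k3 k4 k5 k6; rewrite !memvD ?memvZ ?h3 ?h4 ?h5 ?NN.
have eB k (F : nat -> car A) : m = k -> \sum_(i < m) F i = \sum_(i < k) F i by move<-.
have := h2 u; rewrite (eB _ (fun i => pr (l i) u *: [:: 1; a; b; c; a * a; a * b; a * c; a * a * a; a * a * a * a; a * a * b]`_i) m10).
rewrite !big_ord_recl big_ord0 addr0 /= => eu.
by exists (pr (l 4%N) u *: (a * a) + (pr (l 5%N) u *: (a * b) + (pr (l 6%N) u *: (a * c) + (pr (l 7%N) u *: (a * a * a) + (pr (l 8%N) u *: (a * a * a * a) + pr (l 9%N) u *: (a * a * b)))))).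
Qed.

(** A term in [a^2] is impossible, because [a^2 u v = 0] while [a^4 <> 0]. *)
Lemma frame_prod u v : u \in vker -> v \in vker ->
  exists p q r s, s \in soc N /\ u * v = p *: (a * b) + q *: (a * c) + r *: (a * a * a) + s.
Proof.
move=> uV vV; have uN := vkerN uV; have vN := vkerN vV.
have := subvP frame_N2 _ (NN uN vN).
case/memv_addP=> ? /vlineP [k1 ->] [? /memv_addP [? /vlineP [k2 ->] [? /memv_addP [? /vlineP [k3 ->] [n nN ->]] ->]] e].
case/memv_addP: (subvP (nvker_N3 aN aV) n nN) => ? /vlineP [k4 ->] [s sS en].
exists k2, k3, k4, s; split=> //; have : a * a * (u * v) = 0.
  by rewrite mulrCA mulrC; apply: socM => //; rewrite mulrC vkerS // NN.
rewrite e mulrDr mulrDr mulrDr -!scalerAr.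
have -> : a * a * (a * b) = 0 by rewrite mulrCA mulrC; exact: socM.
have -> : a * a * (a * c) = 0 by rewrite mulrCA aac mulr0.
have -> : a * a * n = 0 by apply: (N50 (isT : 5 <= 2 + 3)%N) => //; exact: NN.
rewrite !scaler0 !addr0 mulrA => /eqP; rewrite scaler_eq0 (negbTE (a4_neq0 aN aV)) orbF => /eqP ->.
by rewrite scale0r add0r en !addrA.
Qed.

(** Take [p = a (a + k)]. The hypothesis on [k b] cancels [a^2 b] in [p b], so [p b] and [p c] are
    multiples of [a^4 = p a^2], and multiples of [a^2] correct [b] and [c]; moreover [p p = a^4]. *)
Lemma frame_corr k q1 r1 s1 q2 r2 s2 : k \in vker -> s1 \in soc N -> s2 \in soc N ->
  k * b = - (a * b) + (q1 *: (a * c) + r1 *: (a * a * a) + s1) ->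
  k * c = q2 *: (a * c) + r2 *: (a * a * a) + s2 -> goodA A.
Proof.
move=> kV s1S s2S e1 e2; have kN := vkerN kV; have a3 := a3N aN.
have aq (q r : K) s : s \in soc N -> a * (q *: (a * c) + r *: (a * a * a) + s) = r *: (a * a * a * a).
  move=> sS; rewrite !mulrDr [a * s]mulrC (socM sS aN) addr0 -!scalerAr !mulrA aac scaler0 add0r //.
pose p := a * a + a * k.
have pa : p * (a * a) = a * a * a * a.
  have -> : p * (a * a) = a * a * a * a + k * (a * a * a) by rewrite /p; ring.
  by rewrite (vker3 kV a3) addr0.
have pb : p * b = r1 *: (a * a * a * a).
  have -> : p * b = a * a * b + a * (k * b) by rewrite /p; ring.
  by rewrite e1 mulrDr aq // mulrN mulrA addrA subrr add0r.
have pc : p * c = r2 *: (a * a * a * a).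
  have -> : p * c = a * a * c + a * (k * c) by rewrite /p; ring.
  by rewrite e2 aq // aac add0r.
have pk : p * (a * k) = 0.
  have -> : p * (a * k) = k * (a * a * a) + k * (a * a) * k by rewrite /p; ring.
  by rewrite (vker3 kV a3) add0r; apply: socM => //; rewrite vkerS // NN.
apply: (@goodA_corr _ _ _ _ lN K0 IH (<[b]> + <[c]>)%VS a p).
- by apply: subv_trans frame_gen _; rewrite !addvA.
- by rewrite subv_add -!memvE bN.
- move=> u /memv_addP [? /vlineP [k1 ->] [? /vlineP [k2 ->] ->]].
  exists ((k1 * r1 + k2 * r2) *: (a * a)); first by rewrite memvZ ?NN.
  by rewrite mulrDr -!scalerAr pb pc pa !scalerA -scalerDl.
- by rewrite {2}/p mulrDr pa pk addr0 a4_neq0.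
by rewrite -dimv_eq0 dN.
Qed.

Variables (q1 r1 q2 r2 p3 q3 r3 : K) (s1 s2 s3 : car A).
Hypotheses (s1S : s1 \in soc N) (s2S : s2 \in soc N) (s3S : s3 \in soc N).
Hypothesis bb : b * b = q1 *: (a * c) + r1 *: (a * a * a) + s1.
Hypothesis bc : b * c = q2 *: (a * c) + r2 *: (a * a * a) + s2.
Hypothesis cc : c * c = p3 *: (a * b) + q3 *: (a * c) + r3 *: (a * a * a) + s3.

Let a4c z (q r : K) s : s \in soc N -> z = q *: (a * c) + r *: (a * a * a) + s -> a * z = r *: (a * a * a * a).
Proof.
by move=> sS ->; rewrite !mulrDr [a * s]mulrC (socM sS aN) addr0 -!scalerAr !mulrA aac scaler0 add0r.
Qed.
Let abb : a * (b * b) = r1 *: (a * a * a * a). Proof. exact: a4c bb. Qed.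
Let abc' : a * (b * c) = r2 *: (a * a * a * a). Proof. exact: a4c bc. Qed.
Let acc : a * (c * c) = p3 *: (a * a * b) + r3 *: (a * a * a * a).
Proof.
rewrite cc -!addrA mulrDr addrA (a4c (z := q3 *: (a * c) + r3 *: (a * a * a) + s3) s3S erefl) //.
by rewrite -scalerAr mulrA.
Qed.

(* Associativity forces [b * b] and [b * c] into the socle. *)
Lemma frame_degenerate : p3 != 0 -> r2 = 0 -> r3 = 0 -> goodA A.
Proof.
move=> p30 r20 r30; have a3 := a3N aN.
have t0 : a * a * b != 0 by apply: contraNneq aab => ->; exact: mem0v.
have q10 : q1 = 0.
  have : (b * b) * c = b * (b * c) by rewrite mulrA.
  rewrite bb bc r20 scale0r addr0 !mulrDl mulrDr (socM s1S cN) addr0 [b * s2]mulrC (socM s2S bN) addr0.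
  have -> : r1 *: (a * a * a) * c = 0 by rewrite -scalerAl mulrC (vker3 cV a3) scaler0.
  rewrite addr0 -!scalerAl -scalerAr.
  rewrite -[a * c * c]mulrA.
  have -> : b * (a * c) = a * (b * c) by rewrite mulrCA.
  rewrite acc abc' r20 r30 !scale0r addr0 scaler0 scalerA => /eqP.
  by rewrite scaler_eq0 (negbTE t0) orbF mulf_eq0 (negbTE p30) orbF => /eqP.
have : (b * c) * c = b * (c * c) by rewrite mulrA.
rewrite bc cc r20 r30 !scale0r !addr0 !mulrDl !mulrDr (socM s2S cN) addr0 [b * s3]mulrC (socM s3S bN) addr0.
rewrite -!scalerAl -!scalerAr.
have -> : a * c * c = a * (c * c) by rewrite mulrA.
have -> : b * (a * b) = a * (b * b) by rewrite mulrCA.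
have -> : b * (a * c) = a * (b * c) by rewrite mulrCA.
rewrite acc abc' abb r20 r30 !scale0r addr0 scaler0 addr0 !scalerA => e.
have q20 : q2 = 0.
  apply/eqP; apply: contraNT aab => h; have h' : q2 * p3 != 0 by rewrite mulf_neq0.
  by rewrite -[_ * b](scalerK h') e scalerA memvZ ?memv_line.
have r10 : r1 = 0.
  move/eqP: e; rewrite q20 mul0r scale0r eq_sym scaler_eq0 (negbTE (a4_neq0 aN aV)) orbF mulf_eq0 (negbTE p30) => /eqP //.
have [l [L hl]] := frame_coords.
have lS s : s \in soc N -> pr (l 7%N) s = 0.
  move=> sS; apply/eqP; rewrite -kprE; apply: (subvP _ s (subvP frame_soc s sS)).
  by rewrite subv_add -!memvE !kprE (L 7%N 9%N isT isT) (L 7%N 8%N isT isT) eqxx.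
have bbS : b * b \in soc N by rewrite bb q10 r10 !scale0r !add0r.
have bcS : b * c \in soc N by rewrite bc q20 r20 !scale0r !add0r.
have lb := L 7%N 2%N isT isT; have lc := L 7%N 3%N isT isT.
have lab := L 7%N 5%N isT isT; have lac := L 7%N 6%N isT isT.
rewrite /fvec /= in lb lc lab lac.
apply: (@goodA_lE1 _ _ _ _ lN K0 IH (<[b]> + <[c]>)%VS a (a * a * a) (l 7%N)).
- by apply: subv_trans frame_gen _; rewrite !addvA.
- by rewrite -dimv_eq0 dN.
- move=> u /memv_addP [? /vlineP [k1 ->] [? /vlineP [k2 ->] ->]].
  by rewrite mulrDr -!scalerAr (mulrC _ b) (mulrC _ c) (vker3 bV a3) (vker3 cV a3) !scaler0 addr0.
- move=> u v /memv_addP [? /vlineP [k1 ->] [? /vlineP [k2 ->] ->]].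
  have [x0 [x1 [x2 [x3 [n [nN ->]]]]]] : exists (x0 x1 x2 x3 : K) n, n \in (N ^+ 2)%VS /\ v = x0 *: 1 + (x1 *: a + (x2 *: b + (x3 *: c + n))).
    by have [n nN ev] := hl v; do 4 eexists; exists n; split; [| exact: ev].
  have hb : pr (l 7%N) (b * (x0 *: 1 + (x1 *: a + (x2 *: b + (x3 *: c + n))))) = 0.
    rewrite !mulrDr -!scalerAr mulr1 [b * a]mulrC !prD !prZ lb lab (lS _ bbS) (lS _ bcS) (lS _ (vkerS bV nN)).
    by rewrite !mulr0 !addr0.
  have hc : pr (l 7%N) (c * (x0 *: 1 + (x1 *: a + (x2 *: b + (x3 *: c + n))))) = 0.
    rewrite !mulrDr -!scalerAr mulr1 [c * a]mulrC [c * b]mulrC cc r30 scale0r addr0 !(prD, prZ) lc lac lab (lS _ s3S) (lS _ bcS) (lS _ (vkerS cV nN)).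
    by rewrite !(mulr0, addr0).
  by rewrite mulrDl prD -[k1 *: b * _]scalerAl -[k2 *: c * _]scalerAl !prZ hb hc !mulr0 addr0.
by rewrite (L 7%N 7%N isT isT) oner_neq0.
Qed.

(** As [b b] and [b c] have no term [a b] for [frame_corr] to use, one is created: [D] adds [t a b]
    to [b b], and its other terms restore associativity, under the three conditions on [y] and
    [rho]. *)
Lemma frame_deform (y rho : K) : y * r2 = r2 -> rho * r2 = y * r3 -> y * p3 = p3 -> goodA A.
Proof.
move=> c1 c2 c3; have a3 := a3N aN; have [e [e1 e0 es eM]] := loc_char lN.
have [l [L hl]] := frame_coords.
pose be := l 2%N; pose ga := l 3%N; pose de := l 5%N.
have lN2 i n : (i < 4)%N -> n \in (N ^+ 2)%VS -> pr (l i) n = 0.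
  move=> i4 nN; apply/eqP; rewrite -kprE; apply: (subvP _ n (subvP frame_span n nN)).
  rewrite !subv_add -!memvE !kprE; have i10 : (i < 10)%N by apply: leq_trans i4 _.
  rewrite (L i 4%N i10 isT) (L i 5%N i10 isT) (L i 6%N i10 isT) (L i 7%N i10 isT) (L i 8%N i10 isT) (L i 9%N i10 isT).
  by case: i i4 i10 => [|[|[|[|i]]]] // _ _; rewrite eqxx.
have dN30 n : n \in (N ^+ 3)%VS -> pr de n = 0.
  move=> nN; apply/eqP; rewrite -kprE; apply: (subvP _ n (subvP frame_N3 n nN)).
  by rewrite !subv_add -!memvE !kprE (L 5%N 7%N isT isT) (L 5%N 8%N isT isT) (L 5%N 9%N isT isT) eqxx.
have l1 i : (0 < i < 10)%N -> pr (l i) (1 : car A) = 0.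
  by case/andP => i0 i10; rewrite (L i 0%N i10 isT); case: i i0 i10.
have dec u : exists (al : K) n, n \in (N ^+ 2)%VS /\ u = pr e u *: 1 + (al *: a + (pr be u *: b + (pr ga u *: c + n))).
  have [n nN eu] := hl u; exists (pr (l 1%N) u), n; split=> //.
  have -> : pr e u = pr (l 0%N) u; last exact: eu.
  rewrite {1}eu !(prD, prZ) e1 mulr1 (e0 a) // (e0 b) // (e0 c) // (e0 n) ?(NpN lN (k := 2)) //.
  by rewrite !mulr0 !addr0.
have bM u v : pr be (u * v) = pr e u * pr be v + pr e v * pr be u.
  by apply: eM; [apply: l1 | move=> n; exact: lN2].
have gM u v : pr ga (u * v) = pr e u * pr ga v + pr e v * pr ga u.
  by apply: eM; [apply: l1 | move=> n; exact: lN2].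
pose al := l 1%N.
have alM u v : pr al (u * v) = pr e u * pr al v + pr e v * pr al u.
  by apply: eM; [apply: l1 | move=> n; exact: lN2].
have {}dec u : exists n, n \in (N ^+ 2)%VS /\ u = pr e u *: 1 + (pr al u *: a + (pr be u *: b + (pr ga u *: c + n))).
  have [k [n [nN eu]]] := dec u; exists n; split=> //.
  have -> : pr al u = k; last exact: eu.
  rewrite eu !(prD, prZ) l1 // (L 1%N 1%N isT isT) (L 1%N 2%N isT isT) (L 1%N 3%N isT isT) (lN2 1%N) //=.
  by rewrite !mulr0 mulr1 !addr0 add0r.
have dea : pr de a = 0 := L 5%N 1%N isT isT.
have deb : pr de b = 0 := L 5%N 2%N isT isT.
have dec' : pr de c = 0 := L 5%N 3%N isT isT.
have deaa : pr de (a * a) = 0 := L 5%N 4%N isT isT.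
have deab : pr de (a * b) = 1 := L 5%N 5%N isT isT.
have deac : pr de (a * c) = 0 := L 5%N 6%N isT isT.
have deaaa : pr de (a * a * a) = 0 := dN30 _ a3.
have deS s : s \in soc N -> pr de s = 0 by move=> /(subvP SN3) /dN30.
(* [de] reads the coefficient of [a b]; on products it picks up cross terms in [al], [be] and,
   through [c c], a term in [ga]. *)
have dM u v : pr de (u * v) = pr e u * pr de v + pr e v * pr de u + pr al u * pr be v + pr be u * pr al v + p3 * (pr ga u * pr ga v).
  have [n [nN eu]] := dec u; have [n' [nN' ev]] := dec v.
  have den : pr de u = pr de n by rewrite eu !(prD, prZ) l1 // dea deb dec' !mulr0 !add0r.
  have den' : pr de v = pr de n' by rewrite ev !(prD, prZ) l1 // dea deb dec' !mulr0 !add0r.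
  have h1 : pr de (n * v) = pr e v * pr de n.
    have [c0 [v' [vN' ev']]] := loc_dec lN v.
    have -> : pr e v = c0 by rewrite ev' prD prZ e1 mulr1 (e0 v') // addr0.
    by rewrite ev' mulrDr -scalerAr mulr1 prD prZ (dN30 (n * v')) ?addr0 //; exact: NM1.
  have h2 : pr de (a * v) = pr be v.
    rewrite {1}ev !mulrDr -!scalerAr mulr1 !(prD, prZ) dea deaa deab deac (dN30 (a * n')) ?mulr0 ?add0r ?addr0 ?mulr1 //; exact: N1M.
  have h3 : pr de (b * v) = pr al v.
    rewrite {1}ev !mulrDr -!scalerAr mulr1 [b * a]mulrC bb bc !(prD, prZ) deb deab deac deaaa (dN30 (b * n')) ?(deS s1) ?(deS s2) //; last exact: N1M.
    by ring.
  have h4 : pr de (c * v) = p3 * pr ga v.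
    rewrite {1}ev !mulrDr -!scalerAr mulr1 [c * a]mulrC [c * b]mulrC bc cc !(prD, prZ) dec' deab deac deaaa (dN30 (c * n')) ?(deS s3) ?(deS s2) //; last exact: N1M.
    by ring.
  rewrite {1}eu !mulrDl -!scalerAl mul1r !(prD, prZ) h1 h2 h3 h4 den; ring.
(* Coordinates along [a b], [a^2 b], [a c], [a^4], kept opaque so that associativity becomes four
   scalar identities. *)
have [V4 V4E] : exists V4 : K -> K -> K -> K -> car A, forall p q r s : K, V4 p q r s = p *: (a * b) + q *: (a * a * b) + r *: (a * c) + s *: (a * a * a * a) by eexists => p q r s; reflexivity.
have V4D (p q r s p' q' r' s' : K) : V4 p q r s + V4 p' q' r' s' = V4 (p + p') (q + q') (r + r') (s + s').
  by rewrite !V4E !scalerDl; ring.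
have V4Z (k p q r s : K) : k *: V4 p q r s = V4 (k * p) (k * q) (k * r) (k * s).
  by rewrite !V4E !scalerDr !scalerA.
have ha4 : a * a * a * a \in (N ^+ 2)%VS by apply: (subvP (NpS lN 1)); exact: (subvP SN3).
have ht : a * a * b \in (N ^+ 2)%VS by apply: (subvP (NpS lN 1)); exact: (subvP SN3).
have V4N (p q r s : K) : V4 p q r s \in (N ^+ 2)%VS by rewrite V4E !memvD ?memvZ ?ht ?ha4 ?NN.
have V4b (p q r s : K) : pr be (V4 p q r s) = 0 by rewrite lN2.
have V4g (p q r s : K) : pr ga (V4 p q r s) = 0 by rewrite lN2.
have V4d (p q r s : K) : pr de (V4 p q r s) = p.
  by rewrite V4E !(prD, prZ) deab deac (deS _ tS) (deS _ a4S) mulr1 !mulr0 !addr0.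
have V4M (p q r : K) w : V4 p q r 0 * w = V4 (p * pr e w) (p * pr al w + q * pr e w + r * pr ga w * p3)
    (r * pr e w) (p * (pr be w * r1 + pr ga w * r2) + r * (pr be w * r2 + pr ga w * r3)).
  have tw : a * a * b * w = pr e w *: (a * a * b) by exact: es.
  have [n [nN ew]] := dec w.
  have abn : a * b * n = 0 by rewrite -mulrA mulrC; apply: socM => //; rewrite vkerS.
  have acn : a * c * n = 0 by rewrite -mulrA mulrC; apply: socM => //; rewrite vkerS.
  have abw : a * b * w = pr e w *: (a * b) + pr al w *: (a * a * b) + (pr be w * r1 + pr ga w * r2) *: (a * a * a * a).
    rewrite {1}ew !mulrDr -!scalerAr mulr1 abn addr0 -[a * b * b]mulrA abb -[a * b * c]mulrA abc' !scalerA [a * b * a]mulrAC scalerDl.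
    by rewrite !addrA.
  have acw : a * c * w = pr e w *: (a * c) + (pr be w * r2 + pr ga w * r3) *: (a * a * a * a) + (pr ga w * p3) *: (a * a * b).
    rewrite {1}ew !mulrDr -!scalerAr mulr1 acn addr0 -[a * c * b]mulrA [c * b]mulrC abc' -[a * c * c]mulrA acc.
    rewrite [a * c * a]mulrAC aac scaler0 add0r scalerDr !scalerA scalerDl.
    by rewrite -!addrA; congr (_ + _); rewrite addrCA addrC -!addrA; congr (_ + _); rewrite addrC.
  rewrite !V4E scale0r addr0 !mulrDl -!scalerAl abw acw tw !scalerDr !scalerA.
  rewrite -[p * pr al w + _ + _]addrA !scalerDl -!scalerA; ring.
pose D (u v : 'rV[K]_m) : 'rV[K]_m := V4 (pr be u * pr be v) (pr be u * pr de v + pr de u * pr be v)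
  (y * (pr be u * pr ga v + pr ga u * pr be v) + rho * (pr ga u * pr ga v)) 0.
have DV t u v : t *: D u v = V4 (t * (pr be u * pr be v)) (t * (pr be u * pr de v + pr de u * pr be v))
  (t * (y * (pr be u * pr ga v + pr ga u * pr be v) + rho * (pr ga u * pr ga v))) 0.
  by rewrite /D V4Z mulr0.
have coD t : cocycle A (fun u v => t *: D u v).
  split=> [u v|u v w|k u v|v|u v w].
  - by rewrite !DV; congr V4; ring.
  - by rewrite !DV !prD V4D; congr V4; ring.
  - by rewrite !DV !prZ V4Z; congr V4; ring.
  - by rewrite !DV !l1 // !(mul0r, mulr0, addr0) V4E !scale0r !addr0.
  cbv beta; rewrite [u * (t *: D v w)]mulrC !DV !V4M !V4b !V4g !V4d !bM !gM !dM !V4D; congr V4; try by ring.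
    apply/eqP; rewrite -subr_eq0; apply/eqP.
    transitivity (t * (y * p3 - p3) * (pr be u * pr ga v * pr ga w - pr ga u * pr ga v * pr be w)); first by ring.
    by rewrite c3 subrr mulr0 mul0r.
  apply/eqP; rewrite -subr_eq0; apply/eqP.
  transitivity (t * ((y * r2 - r2) * (pr ga u * pr be v * pr be w - pr be u * pr be v * pr ga w) +
      (rho * r2 - y * r3) * (pr ga u * pr ga v * pr be w - pr be u * pr ga v * pr ga w))); first by ring.
  by rewrite c1 c2 !subrr !mul0r addr0 mulr0.
have co t : cocycle A (fun u v => t *: D u v + t ^+ 2 *: 0).
  have [d1 d2 d3 d4 d5] := coD t.
  split=> [u v|u v w|k u v|v|u v w]; cbv beta; rewrite !scaler0 !addr0; [exact: d1|exact: d2|exact: d3|exact: d4|exact: d5].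
apply: (@goodA_family K m A D (fun _ _ => 0) co).
apply: gen_mono (gen_neC 0) => t t0 At h1 hm'.
have hm (u v : car A) : cmul At u v = u * v + t *: D u v by rewrite hm' scaler0 addr0.
have [lNt subNt] : @localA K m At N /\ forall j u, (0 < j)%N -> u \in ((N : {vspace car At}) ^+ j)%VS -> (u : car A) \in (N ^+ j)%VS.
  apply: (deform_local lN h1 (G := fun u v => t *: D u v)) => [u v|j u v j0 uN vN]; first exact: hm.
  case: j j0 vN => [//|[|j]] _ vN; first by rewrite DV.
  have vN2 : v \in (N ^+ 2)%VS by apply: (subvP (Np_le lN (isT : 0 < 2)%N _)) vN.
  rewrite DV (lN2 2%N v) // (lN2 3%N v) // !mulr0 !addr0 !mulr0 V4E !scale0r addr0 add0r !addr0.
  have [->|j1] := posnP j; first by rewrite memvZ // (subvP SN3).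
  rewrite (dN30 v) ?mulr0 ?scale0r ?mem0v //.
  by apply: (subvP (Np_le lN (isT : 0 < 3)%N _)) vN; rewrite !ltnS.
have beab : pr be b = 1 := L 2%N 2%N isT isT.
have bea : pr be a = 0 := L 2%N 1%N isT isT.
have bec : pr be c = 0 := L 2%N 3%N isT isT.
have gaa : pr ga a = 0 := L 3%N 1%N isT isT.
have gab : pr ga b = 0 := L 3%N 2%N isT isT.
have gac : pr ga c = 1 := L 3%N 3%N isT isT.
have D0 u v : pr be u = 0 -> pr ga u = 0 -> pr de u = 0 \/ pr be v = 0 -> t *: D u v = 0.
  move=> h1' h2' h3'; rewrite DV h1' h2' !mul0r add0r; have -> : pr de u * pr be v = 0 by case: h3' => ->; rewrite ?mul0r ?mulr0.
  by rewrite !(addr0, mulr0) V4E !scale0r !addr0.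
have N20 n : n \in (N ^+ 2)%VS -> pr be n = 0 /\ pr ga n = 0 by move=> nN; split; apply: lN2.
have M0 u v : pr be u = 0 -> pr ga u = 0 -> pr de u = 0 \/ pr be v = 0 -> cmul At u v = (u : car A) * v.
  by move=> ? ? ?; rewrite hm D0 ?addr0.
(* This is [a (a + k)] for [k = - t^-1 b], as in [frame_corr]: the deformation term in the product
   of [p] and [b] cancels [a^2 b]. *)
pose p : car A := a * a - t^-1 *: (a * b).
have aaN := NN aN aN; have abN := NN aN bN.
have pN : p \in (N ^+ 2)%VS by rewrite memvB ?memvZ.
have [pb0 pg0] := N20 p pN.
have abt0 : a * (a * a * b) = 0 by rewrite mulrC; apply: socM.
have Mp n : n \in (N ^+ 2)%VS -> cmul At p n = p * n by move=> /N20 [? ?]; apply: M0 => //; right.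
have paa : cmul At p (a * a) = a * a * a * a.
  rewrite Mp // /p mulrBl -scalerAl; have -> : a * b * (a * a) = a * (a * a * b) by ring.
  by rewrite abt0 scaler0 subr0 !mulrA.
have pp : cmul At p p = a * a * a * a.
  rewrite Mp // {2}/p mulrBr -scalerAr.
  have -> : p * (a * a) = a * a * a * a by rewrite -Mp.
  have -> : p * (a * b) = a * (a * a * b) - t^-1 *: ((a * a * b) * b) by rewrite /p mulrBl -scalerAl; congr (_ - _ *: _); ring.
  by rewrite abt0 (socM tS bN) scaler0 subrr scaler0 subr0.
have pb : cmul At p b = (- (t^-1 * r1)) *: (a * a * a * a).
  rewrite hm DV pb0 pg0 !(mul0r, mulr0, add0r, addr0) beab mulr1 V4E !scale0r !(addr0, add0r).
  have -> : pr de p = - t^-1 by rewrite /p prD prN prZ deaa deab mulr1 sub0r.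
  rewrite mulrN mulfV // scaleN1r /p mulrBl -scalerAl -[a * b * b]mulrA abb addrAC subrr add0r scaleNr scalerA //.
have pc : cmul At p c = (- (t^-1 * r2)) *: (a * a * a * a).
  rewrite M0 //; last by right.
  by rewrite /p mulrBl -scalerAl -[a * b * c]mulrA abc' aac sub0r scaleNr scalerA.
pose W : {vspace car At} := ((N : {vspace car At}) ^+ 2)%VS.
have NW (u v : car A) : u \in N -> v \in N -> (cmul At u v : car At) \in W by move=> uN vN; exact: (@NN _ _ At N u v).
have aW (v : car A) : v \in N -> (a * v : car A) \in (W : {vspace 'rV[K]_m}).
  move=> vN; have : (a : car A) * v = cmul At a v by rewrite M0 //; left.
  by move=> ->; exact: NW.
have W2 n : n \in (N ^+ 2)%VS -> (n : car At) \in W.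
  by move=> /(subvP aN2) /line_mulP [v vN ->]; exact: aW.
pose U : {vspace car At} := (<[b : car At]> + <[c : car At]>)%VS.
have gt : ((N : {vspace car At}) <= <[a : car At]> + U + W)%VS.
  apply/subvP => u uN; have /memv_addP [? /vlineP [k1 ->] [? /memv_addP [? /vlineP [k2 ->] [? /memv_addP [? /vlineP [k3 ->] [n nN ->]] ->]] ->]] := subvP frame_gen u uN.
  have -> : k1 *: a + (k2 *: b + (k3 *: c + n)) = k1 *: a + (k2 *: b + k3 *: c) + n by rewrite !addrA.
  apply: (@memv_add _ (car At)); last exact: W2.
  apply: (@memv_add _ (car At)); first by apply: memvZ; exact: memv_line.
  by apply: (@memv_add _ (car At)); apply: memvZ; exact: memv_line.
have Zt (k : K) (u v : car A) : cmul At u (k *: v) = k *: cmul At u v.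
  by rewrite !(@cmulC _ _ At u) cmulZ.
have Dt (u v w : car A) : cmul At u (v + w) = cmul At u v + cmul At u w.
  by rewrite !(@cmulC _ _ At u) cmulDl.
apply: (@goodA_corr K m At N lNt K0 IH U a p gt).
- by rewrite subv_add -!memvE; apply/andP; split; [exact: bN | exact: cN].
- move=> u /memv_addP [? /vlineP [k1 ->] [? /vlineP [k2 ->] ->]].
  exists ((k1 * (- (t^-1 * r1)) + k2 * (- (t^-1 * r2))) *: (a * a)); first by apply: W2; rewrite memvZ.
  transitivity (cmul At p (k1 *: b + k2 *: c)); first by [].
  transitivity (cmul At p ((k1 * (- (t^-1 * r1)) + k2 * (- (t^-1 * r2))) *: (a * a))); last by [].
  by rewrite Dt !Zt pb pc paa !scalerA -scalerDl.
- by change (cmul At p p != 0); rewrite pp; exact: a4_neq0.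
by rewrite -dimv_eq0 dN.
Qed.

End Frame.

Lemma frame_shift a b c k z : frame a b c -> z \in vker -> a * a * z \in (N ^+ 4)%VS -> frame a (b + k *: z) c.
Proof.
move=> [[aN bV cV aN2] [cN2 aac aab]] zV az; split; split=> //; first by rewrite memvD ?memvZ.
rewrite mulrDr -scalerAr; apply: contra aab => h; rewrite -[_ * b](addrK (k *: (a * a * z))).
by rewrite memvB // memvZ // (subvP (a4_N4 aN (mult_nvker aN2))).
Qed.

(** [frame_deform] applies with [y = 1] if [r2 <> 0] and with [y = 0] if [r2 = p3 = 0]. In the
    remaining case a shift of [b] by a multiple of [a^2] makes [r3 = 0], which leads to
    [frame_degenerate]. *)
Lemma goodA_frame0 a b c (q1 r1 q2 r2 p3 q3 r3 : K) s1 s2 s3 : frame a b c ->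
  s1 \in soc N -> s2 \in soc N -> s3 \in soc N ->
  b * b = q1 *: (a * c) + r1 *: (a * a * a) + s1 ->
  b * c = q2 *: (a * c) + r2 *: (a * a * a) + s2 ->
  c * c = p3 *: (a * b) + q3 *: (a * c) + r3 *: (a * a * a) + s3 -> goodA A.
Proof.
move=> F s1S s2S s3S e1 e2 e3; have [[aN bV cV aN2] [cN2 aac aab]] := F.
have [r20|r20] := eqVneq r2 0; last first.
  by apply: (frame_deform F s1S s2S s3S e1 e2 e3 (y := 1) (rho := r3 / r2)); rewrite ?mul1r ?divfK.
have [p30|p30] := eqVneq p3 0.
  by apply: (frame_deform F s1S s2S s3S e1 e2 e3 (y := 0) (rho := 0)); rewrite ?p30 ?r20 ?mul0r.
pose k := r3 / p3; have kp : p3 * k = r3 by rewrite mulrC divfK.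
have aaN := NN aN aN; have aaV := subvP N2_vker _ aaN.
have aaaaN : a * a * (a * a) \in (N ^+ 4)%VS by exact: (@NpM _ _ _ N 2 2).
have F' := frame_shift k F aaV aaaaN; clearbody k; have [X eX] := al_ex A k.
apply: (frame_degenerate F' (q1 := q1) (r1 := r1) (s1 := s1 + (2%:R * k) *: (a * a * b) + (k * k) *: (a * a * (a * a)))
  (q2 := q2) (r2 := 0) (s2 := s2) (p3 := p3) (q3 := q3) (r3 := 0) (s3 := s3)) => //.
- rewrite !memvD ?memvZ //; first by rewrite mulrC vkerS.
  exact: (subvP N4_soc).
- have -> : (b + k *: (a * a)) * (b + k *: (a * a)) = b * b + ((2%:R * k) *: (a * a * b) + (k * k) *: (a * a * (a * a))).
    by rewrite -!scalerA !eX !scaler_nat; ring.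
  by rewrite e1 !addrA.
- by rewrite mulrDl -scalerAl aac scaler0 addr0 e2 r20.
by rewrite e3 mulrDr -scalerAr scalerDr scalerA kp mulrA scale0r; ring.
Qed.

(** The coefficients of [a b] in [b b], [b c], [c c] form a symmetric matrix of size 2. If it can be
    solved for the right side [(-1, 0)], the solution is the [k] of [frame_corr]; if not, at most a
    shift of [b] by a multiple of [c] gives [p1 = p2 = 0]. *)
Lemma goodA_frame a b c : frame a b c -> goodA A.
Proof.
move=> F; have [[aN bV cV aN2] [cN2 aac aab]] := F; have bN := vkerN bV; have cN := vkerN cV.
have acN4 : a * a * c \in (N ^+ 4)%VS by rewrite aac mem0v.
have [p1 [q1 [r1 [s1 [s1S e1]]]]] := frame_prod F bV bV.
have [p2 [q2 [r2 [s2 [s2S e2]]]]] := frame_prod F bV cV.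
have [p3 [q3 [r3 [s3 [s3S e3]]]]] := frame_prod F cV cV.
have e2' : c * b = p2 *: (a * b) + q2 *: (a * c) + r2 *: (a * a * a) + s2 by rewrite mulrC.
have hcorr (k k' : K) : k * p1 + k' * p2 = -1 -> k * p2 + k' * p3 = 0 -> goodA A.
  move=> h1 h2; apply: (frame_corr F (k := k *: b + k' *: c) (q1 := k * q1 + k' * q2) (r1 := k * r1 + k' * r2)
    (s1 := k *: s1 + k' *: s2) (q2 := k * q2 + k' * q3) (r2 := k * r2 + k' * r3) (s2 := k *: s2 + k' *: s3)).
  - by rewrite memvD ?memvZ.
  - by rewrite memvD ?memvZ.
  - by rewrite memvD ?memvZ.
  - rewrite mulrDl -!scalerAl e1 e2' !scalerDr !scalerA -[- (a * b)]scaleN1r -h1 !scalerDl; ring.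
  rewrite mulrDl -!scalerAl e2 e3 !scalerDr !scalerA.
  have -> : (k * p2) *: (a * b) = - (k' * p3) *: (a * b) by rewrite -[k * p2](addrK (k' * p3)) h2 sub0r.
  by rewrite scaleNr !scalerDl; ring.
have [p30|p30] := eqVneq p3 0.
  have [p20|p20] := eqVneq p2 0; last first.
    by apply: (hcorr 0 (- p2^-1)); rewrite ?p30 ?mul0r ?mulr0 ?add0r // mulNr mulVf.
  have [p10|p10] := eqVneq p1 0; last first.
    by apply: (hcorr (- p1^-1) 0); rewrite ?p20 ?mul0r ?mulr0 ?addr0 // mulNr mulVf.
  apply: (goodA_frame0 F s1S s2S s3S _ _ e3); rewrite ?e1 ?e2 ?p10 ?p20 ?scale0r ?add0r //.
have [D0|D0] := eqVneq (p1 * p3 - p2 * p2) 0; last first.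
  apply: (hcorr (- (p3 / (p1 * p3 - p2 * p2))) (p2 / (p1 * p3 - p2 * p2))).
    transitivity (- ((p1 * p3 - p2 * p2) / (p1 * p3 - p2 * p2))); first by ring.
    by rewrite divff.
  by ring.
pose k := - (p2 / p3); have kp : k * p3 = - p2 by rewrite mulNr divfK.
have h1 : p1 + 2%:R * k * p2 + k * k * p3 = 0.
  apply: (mulIf p30); rewrite mul0r.
  transitivity ((p1 * p3 - p2 * p2) + (k * p3 + p2) ^+ 2); first by ring.
  by rewrite D0 kp addNr expr0n addr0.
clearbody k; have F' := frame_shift k F cV acN4.
have [X eX] := al_ex A k.
apply: (goodA_frame0 F' (q1 := q1 + 2%:R * k * q2 + k * k * q3) (r1 := r1 + 2%:R * k * r2 + k * k * r3)
  (s1 := s1 + (2%:R * k) *: s2 + (k * k) *: s3) (q2 := q2 + k * q3) (r2 := r2 + k * r3) (s2 := s2 + k *: s3)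
  (p3 := p3) (q3 := q3 - k * p3) (r3 := r3) (s3 := s3)) => //.
- by rewrite !memvD ?memvZ.
- by rewrite !memvD ?memvZ.
- have -> : (b + k *: c) * (b + k *: c) = b * b + (2%:R * k) *: (b * c) + (k * k) *: (c * c).
    by rewrite -!scalerA !eX !scaler_nat; ring.
  rewrite e1 e2 e3 !scalerDr !scalerA.
  have -> : p1 *: (a * b) = (- (2%:R * k * p2) - (k * k * p3)) *: (a * b).
    by congr (_ *: _); apply/eqP; rewrite -subr_eq0; apply/eqP; rewrite -[RHS]h1; ring.
  by rewrite !scalerDl !scaleNr; ring.
- rewrite mulrDl -scalerAl e2 e3 !scalerDr !scalerA kp !scalerDl scaleNr; ring.
by rewrite e3 mulrDr -scalerAr scalerDr scalerBl scalerA [p3 * k]mulrC; ring.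
Qed.

(** Either [net3] gives a multiplier, hence a frame, or two elements generate [N] modulo those [c]
    with [c N] in [N^3], and some such [c] is outside [N^2]. *)
Lemma goodA_alpha : goodA A.
Proof.
have [||[a aN aN2]|[a [b [aN bN g h]]]] := @net3 _ _ _ _ lN K0 (N :&: transp N (N ^+ 3))%VS.
- by rewrite dN2 dN3.
- by move=> c cN h; rewrite memv_cap cN; apply/transpP.
- have aN2' : (N ^+ 2 <= <[a]> * N)%VS.
    apply: (nakayama lN) => [u v|].
      move=> /line_mulP [w wN ->]; rewrite -mulrA; apply: mem_line_mul.
      by have := @Np_ideal _ _ _ _ lN 1 w v isT; rewrite expv1; apply.
    apply: subv_trans aN2 _; apply: addvS => //; rewrite -[(N ^+ 3)%VS]/(N * N ^+ 2)%VS //.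
  by have [b [c F]] := ex_frame aN aN2'; exact: goodA_frame F.
have [cc|] := boolP (N :&: transp N (N ^+ 3) <= N ^+ 2)%VS.
  have : (N <= <[a]> + (<[b]> + N ^+ 2))%VS by apply: subv_trans g _; rewrite -addvA; do 2 apply: addvS => //.
  move/dimvS; rewrite leqNgt dN => /negP; case; apply: leq_ltn_trans (dim_line_le _ _) _.
  by apply: (@leq_ltn_trans 8%N) => //; rewrite ltnS; apply: leq_trans (dim_line_le _ _) _; rewrite dN2.
case/subvPn=> c; rewrite memv_cap => /andP [cN /transpP cT] cN2.
exact: (goodA_alpha_net cN cN2 cT).
Qed.

End Alpha.

Section TwoStepProjection.
Variables (K : closedFieldType) (m : nat) (A : calg K m) (N : {vspace car A}).
Hypothesis lN : localA N.
Hypothesis K0 : [pchar K] =i pred0.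
Hypothesis IH : forall k, (k < m)%N -> CM K k.
Implicit Types (u v w x y z s : car A) (U V W X Y : {vspace car A}).

(* [E v = l1 v *: a + l2 v *: (a * b)], with [l1 v = l2 (b * v)], commutes with [b] and [c]
   and has [\tr E = \tr (E * E) = 2]. *)
Lemma goodA_two_step a b c : (2 < m)%N -> (N <= <[a]> + (<[b]> + <[c]>) + N ^+ 2)%VS ->
  c * a = 0 -> a * b * b = 0 -> a * b \notin ((<[b * b]> + <[c]>) * fullv)%VS -> goodA A.
Proof.
move=> m2 g ca abb abU; have [l2 [l2ab l2U]] := pr_sep abU.
have [l1 l1E] : exists l1, forall v, pr l1 v = pr l2 (b * v).
  by apply: lin_pr => k u v; rewrite mulrDr -scalerAr prD prZ.
have l2c v : pr l2 (c * v) = 0.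
  by apply: l2U; apply: memv_mul; rewrite ?memvf // (subvP (addvSr _ _)) ?memv_line.
have l2b v : pr l2 (b * (b * v)) = 0.
  by apply: l2U; rewrite mulrA; apply: memv_mul; rewrite ?memvf // (subvP (addvSl _ _)) ?memv_line.
pose E : 'M[K]_m := l1 *m (a : 'rV_m) + l2 *m (a * b : 'rV_m).
have vL (l : 'cV[K]_m) (p v : 'rV[K]_m) : v *m (l *m p) = pr l v *: p.
  by rewrite mulmxA [v *m l]mx11_scalar mul_scalar_mx.
have vE (v : 'rV_m) : v *m E = pr l1 v *: (a : 'rV_m) + pr l2 v *: (a * b : 'rV_m) by rewrite mulmxDr !vL.
have tL (l : 'cV[K]_m) (p : 'rV[K]_m) : \tr (l *m p) = pr l p.
  by rewrite mxtrace_mulC [in LHS](mx11_scalar (p *m l)) mxtrace_scalar.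
have l1a : pr l1 a = 1 by rewrite l1E mulrC.
have l1ab : pr l1 (a * b) = 0 by rewrite l1E mulrC abb pr0.
apply: (goodA_E IH (gen_full lN (U := <[a]> + (<[b]> + <[c]>)) g) (E := E)).
  move=> u v /memv_addP [? /vlineP [k1 ->] [? /vlineP [k2 ->] ->]]; rewrite !vE.
  have e1 : pr l1 (v * (k1 *: b + k2 *: c)) = 0.
    rewrite l1E mulrDr -!scalerAr mulrDr -!scalerAr prD !prZ [v * b]mulrC l2b.
    have -> : b * (v * c) = c * (b * v) by ring.
    by rewrite l2c !mulr0 addr0.
  have e2 : pr l2 (v * (k1 *: b + k2 *: c)) = k1 * pr l1 v.
    by rewrite mulrDr -!scalerAr prD !prZ [v * b]mulrC [v * c]mulrC -l1E l2c mulr0 addr0.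
  rewrite e1 e2 scale0r add0r mulrDl -!scalerAl !mulrDr -!scalerAr abb [a * c]mulrC ca.
  have -> : a * b * c = 0 by rewrite mulrC mulrA ca mul0r.
  by rewrite !scaler0 !addr0 scaler0 addr0 scalerA mulrC.
have trE : \tr E = 2%:R by rewrite mxtraceD !tL l1a l2ab.
have trEE : \tr (E *m E) = 2%:R.
  rewrite {1}/E mulmxDl -!mulmxA !vE l1a l2ab l1ab !scale1r scale0r add0r.
  by rewrite mulmxDr -scalemxAr !mxtraceD mxtraceZ !tL l1a l1ab l2ab mulr0 addr0.
rewrite trE trEE -subr_eq0; have -> : m%:R * 2%:R - 2%:R ^+ 2 = ((m - 2) * 2)%N%:R :> K.
  by rewrite natrM natrB; [ring | exact: ltnW].
have F : ((m - 2) * 2)%N = ((m - 2) * 2).-1.+1 by rewrite prednK // muln_gt0 subn_gt0 m2.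
by rewrite F; exact: natK_neq0.
Qed.

End TwoStepProjection.

(** * Socle meeting N^3 only in N^4 *)

Section Beta.
Variables (K : closedFieldType) (m : nat) (A : calg K m) (N : {vspace car A}).
Hypothesis lN : localA N.
Hypothesis K0 : [pchar K] =i pred0.
Hypothesis IH : forall k, (k < m)%N -> CM K k.
Hypothesis dN : \dim N = 9%N.
Hypothesis dN2 : \dim (N ^+ 2) = 6%N.
Hypothesis dN3 : \dim (N ^+ 3) = 3%N.
Hypothesis dN4 : \dim (N ^+ 4) = 1%N.
Hypothesis SN2 : (soc N <= N ^+ 2)%VS.
Hypothesis SN4 : (soc N :&: N ^+ 3 <= N ^+ 4)%VS.
Hypothesis dS : (\dim (soc N) <= 2)%N.
Hypothesis dV : \dim (vker N) = 7%N.
Implicit Types (u v w x y z s : car A) (U V W X Y : {vspace car A}).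
Let N5z i j u v : (5 <= i + j)%N -> u \in (N ^+ i)%VS -> v \in (N ^+ j)%VS -> u * v = 0.
Proof. exact: N50. Qed.
Let SNM s v : s \in soc N -> v \in N -> s * v = 0. Proof. by move=> /annP h /h. Qed.
Let N4S z : z \in (N ^+ 4)%VS -> z \in soc N.
Proof. by move=> zN; apply/annP => w wN; apply: (N5z (isT : 5 <= 4 + 1)%N) => //; rewrite expv1. Qed.

(** The radical of the symmetric form on [N^2] with values in the line [N^4]. *)
Definition nrad := (N ^+ 2 :&: ann (N ^+ 2))%VS.

Lemma nradP u : reflect (u \in (N ^+ 2)%VS /\ forall n, n \in (N ^+ 2)%VS -> u * n = 0) (u \in nrad).
Proof. by rewrite memv_cap; apply: (iffP andP) => -[h1 /annP h2]. Qed.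

Lemma nrad0 u n : u \in nrad -> n \in (N ^+ 2)%VS -> u * n = 0.
Proof. by case/nradP => _; apply. Qed.

Lemma N3_nrad : (N ^+ 3 <= nrad)%VS.
Proof.
apply/subvP => z zN; apply/nradP; split=> [|n nN]; first exact: (subvP (NpS lN 1)).
exact: (N5z (isT : 5 <= 3 + 2)%N).
Qed.

Lemma vkerN4 u n : u \in vker N -> n \in (N ^+ 2)%VS -> u * n \in (N ^+ 4)%VS.
Proof.
move=> uV nN; apply: (subvP SN4); rewrite memv_cap (vkerS uV nN) /=.
by apply: N1M => //; exact: vkerN uV.
Qed.

Lemma nradN4 z u : z \in nrad -> u \in N -> z * u \in (N ^+ 4)%VS.
Proof.
move=> zD uN; have [zN _] := nradP _ zD; apply: (subvP SN4); rewrite memv_cap (NM1 zN uN) andbT.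
by apply/annP => w wN; rewrite -mulrA; apply: nrad0 zD _; exact: NN.
Qed.

Lemma vker_nrad u v : u \in vker N -> v \in N -> u * v \in nrad.
Proof.
move=> uV vN; have uN := vkerN uV; apply/nradP; split=> [|n nN]; first exact: NN.
by rewrite mulrAC; apply: SNM vN; apply: N4S; exact: vkerN4.
Qed.

Definition bframe a b := [/\ a \in N, b \in N & (N <= <[a]> + (<[b]> + vker N))%VS].

Lemma bframe_C a b : bframe a b -> bframe b a.
Proof. by case=> aN bN g; split=> //; rewrite addvA [(<[b]> + _)%VS]addvC -addvA. Qed.

Lemma bframe_shift k a b : bframe a b -> bframe (a + k *: b) b.
Proof.
case=> aN bN g; split=> //; first by rewrite memvD ?memvZ.
apply: subv_trans g _; rewrite subv_add addvSr andbT -memvE -{1}[a](addrK (k *: b)).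
by apply: memv_add; rewrite ?memv_line // -scaleNr; apply: (subvP (addvSl _ _)); rewrite memvZ ?memv_line.
Qed.

Lemma bframe_nvker a b : bframe a b -> a \notin vker N.
Proof.
case=> aN bN g; apply/negP => h; have : (N <= <[b]> + vker N)%VS.
  by apply: subv_trans g _; rewrite subv_add subvv andbT -memvE (subvP (addvSr _ _)).
by move/dimvS; rewrite leqNgt dN => /negP; apply; apply: leq_ltn_trans (dim_line_le _ _) _; rewrite dV.
Qed.

Lemma bframe_N2 a b : bframe a b -> (N ^+ 2 <= <[a * a]> + (<[a * b]> + (<[b * b]> + nrad)))%VS.
Proof.
case=> aN bN g; apply/subvP; apply: (N2_ind K0).
- exact: mem0v.
- by move=> u v; exact: memvD.
- by move=> j u; exact: memvZ.
move=> u /(subvP g) /memv_addP [? /vlineP [k1 ->] [? /memv_addP [? /vlineP [k2 ->] [v vV ->]] ->]].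
have [X1 e1] := al_ex A k1; have [X2 e2] := al_ex A k2.
have -> : (k1 *: a + (k2 *: b + v)) * (k1 *: a + (k2 *: b + v)) = (k1 * k1) *: (a * a) + ((k1 * k2 * 2%:R) *: (a * b)
   + ((k2 * k2) *: (b * b) + v * (2%:R *: (k1 *: a + k2 *: b) + v))).
  by rewrite -!scalerA !e1 !e2 !scaler_nat; ring.
do 3 (apply: memv_add; first by rewrite memvZ ?memv_line).
by apply: vker_nrad; rewrite // !memvD ?memvZ ?memvD ?memvZ // (vkerN vV).
Qed.

Lemma bframe_N3 a b : bframe a b ->
  (N ^+ 3 <= <[a * a * a]> + (<[a * a * b]> + (<[a * b * b]> + (<[b * b * b]> + N ^+ 4))))%VS.
Proof.
case=> aN bN g; apply/subvP; apply: (N3_ind K0).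
- exact: mem0v.
- by move=> u v; exact: memvD.
- by move=> j u; exact: memvZ.
move=> u /(subvP g) /memv_addP [? /vlineP [k1 ->] [? /memv_addP [? /vlineP [k2 ->] [v vV ->]] ->]].
have [X1 e1] := al_ex A k1; have [X2 e2] := al_ex A k2.
have -> : (k1 *: a + (k2 *: b + v)) * (k1 *: a + (k2 *: b + v)) * (k1 *: a + (k2 *: b + v)) =
   (k1 * k1 * k1) *: (a * a * a) + ((k1 * k1 * k2 * 3%:R) *: (a * a * b) + ((k1 * k2 * k2 * 3%:R) *: (a * b * b)
   + ((k2 * k2 * k2) *: (b * b * b) + v * (3%:R *: ((k1 *: a + k2 *: b) * (k1 *: a + k2 *: b)) + 3%:R *: ((k1 *: a + k2 *: b) * v) + v * v)))).
  by rewrite -!scalerA !e1 !e2 !scaler_nat; ring.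
do 4 (apply: memv_add; first by rewrite memvZ ?memv_line).
have vN := vkerN vV; have wN : k1 *: a + k2 *: b \in N by rewrite memvD ?memvZ.
by apply: vkerN4 => //; rewrite !memvD ?memvZ ?NN.
Qed.

(* Otherwise [a] would annihilate [N ^+ 3]. *)
Lemma bframe_quartic a b : bframe a b -> a * b * b * b = 0 -> a * a * b * b = 0 ->
  a * a * a * a != 0 \/ a * a * a * b != 0.
Proof.
move=> F h1 h2; have [aN bN g] := F; apply: NNPP => /not_or_and [/negP/negPn/eqP h3 /negP/negPn/eqP h4].
case/negP: (bframe_nvker F); apply/vkerP; split=> // n /(subvP (bframe_N3 F)).
case/memv_addP=> ? /vlineP [k1 ->] [? /memv_addP [? /vlineP [k2 ->] [? /memv_addP [? /vlineP [k3 ->] [? /memv_addP [? /vlineP [k4 ->] [n' nN' ->]] ->]] ->]] ->].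
rewrite !mulrDr -!scalerAr [a * n']mulrC (SNM (N4S nN') aN).
have -> : a * (a * a * a) = a * a * a * a by ring.
have -> : a * (a * a * b) = a * a * a * b by ring.
have -> : a * (a * b * b) = a * a * b * b by ring.
have -> : a * (b * b * b) = a * b * b * b by ring.
by rewrite h1 h2 h3 h4 !scaler0 !addr0.
Qed.

Lemma N4_line w : w \in (N ^+ 4)%VS -> w != 0 -> (N ^+ 4 <= <[w]>)%VS.
Proof. by move=> wN w0; apply: eq_sub_dim; rewrite -?memvE // dN4 dim_vline w0. Qed.

Lemma ex_vker_line : exists c, [/\ c \in vker N, c \notin (N ^+ 2)%VS & (vker N <= <[c]> + N ^+ 2)%VS].
Proof.
have [c cV cN2] : exists2 c, c \in vker N & c \notin (N ^+ 2)%VS by apply: dim_lt_ex; rewrite dN2 dV.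
exists c; split=> //; apply: eq_sub_dim; last by rewrite dim_line_add // dN2 dV.
by rewrite subv_add -memvE cV N2_vker.
Qed.

(** Take [p = a^2]: [p p = a^4] is nonzero by [bframe_quartic], and [p b], [p c] fall into [N^4],
    the line of [a^4], where a multiple of [a^2] corrects them. *)
Lemma goodA_beta_distinct a b : bframe a b -> a * b \in nrad -> goodA A.
Proof.
move=> F abD; have [aN bN g] := F; have [c [cV cN2 gc]] := ex_vker_line.
have ab0 n : n \in (N ^+ 2)%VS -> a * b * n = 0 by exact: nrad0.
have a4 : a * a * a * a != 0.
  case: (bframe_quartic F) => //; first by rewrite -[a * b * b * b]mulrA ab0 ?NN.
    have -> : a * a * b * b = a * b * (a * b) by ring.
    by rewrite ab0 ?NN.
  have -> : a * a * a * b = a * b * (a * a) by ring.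
    by rewrite ab0 ?NN ?eqxx.
have a4N : a * a * a * a \in (N ^+ 4)%VS by do 2 apply: NM1 => //; exact: NN.
have N4a := N4_line a4N a4; have cN := vkerN cV; have aaN := NN aN aN.
apply: (@goodA_corr _ _ _ _ lN K0 IH (<[b]> + <[c]>)%VS a (a * a)).
- by apply: subv_trans g _; rewrite -!addvA; do 2 apply: addvS => //.
- by rewrite subv_add -!memvE bN.
- move=> u /memv_addP [? /vlineP [k1 ->] [? /vlineP [k2 ->] ->]].
  have : a * a * (k1 *: b + k2 *: c) \in (N ^+ 4)%VS.
    rewrite mulrDr -!scalerAr memvD ?memvZ //; last by rewrite mulrC vkerN4.
    by rewrite -mulrA mulrC; exact: nradN4.
  move=> /(subvP N4a) /vlineP [k ->]; exists (k *: (a * a)); first by rewrite memvZ.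
  by rewrite -scalerAr !mulrA.
- by rewrite mulrA.
by rewrite -dimv_eq0 dN.
Qed.

Lemma ex_bframe : exists a b, bframe a b.
Proof.
have [a aN aV] : exists2 a, a \in N & a \notin vker N by apply: dim_lt_ex; rewrite dN dV.
have [b bN bV] : exists2 b, b \in N & b \notin (<[a]> + vker N)%VS.
  by apply: dim_lt_ex; rewrite dN dim_line_add // dV.
exists a, b; split=> //; rewrite addvA [(<[a]> + _)%VS]addvC -addvA; apply: eq_sub_dim; last by rewrite !dim_line_add // dV dN.
by rewrite !subv_add -!memvE aN bN capvSl.
Qed.

(** [N^2] has dimension six and [nrad] at least four, so [a^2], [a b], [b^2] are dependent modulo
    [nrad]. *)
Lemma nrad_relation a b : bframe a b -> (3 < \dim nrad)%N ->
  exists p q r : K, ~ [/\ p = 0, q = 0 & r = 0] /\ p *: (a * a) + q *: (a * b) + r *: (b * b) \in nrad.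
Proof.
move=> F d; have [aN bN g] := F.
have [h|h1] := boolP (b * b \in nrad).
  by exists 0, 0, 1; rewrite !scale0r !add0r scale1r; split=> // -[_ _ /eqP]; rewrite oner_eq0.
have [/memv_addP [? /vlineP [k ->] [z zD e]]|h2] := boolP (a * b \in (<[b * b]> + nrad)%VS).
  exists 0, 1, (- k); split=> [[_ /eqP]|]; first by rewrite oner_eq0.
  by rewrite scale0r add0r scale1r e scaleNr addrAC subrr add0r.
have [/memv_addP [? /vlineP [k ->] [? /memv_addP [? /vlineP [k' ->] [z zD ->]] e]]|h3] := boolP (a * a \in (<[a * b]> + (<[b * b]> + nrad))%VS).
  exists 1, (- k), (- k'); split=> [[/eqP]|]; first by rewrite oner_eq0.
  rewrite scale1r e !scaleNr.
  have -> : k *: (a * b) + (k' *: (b * b) + z) - k *: (a * b) - k' *: (b * b) = z by ring.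
  exact: zD.
have : (<[a * a]> + (<[a * b]> + (<[b * b]> + nrad)) <= N ^+ 2)%VS.
  by rewrite !subv_add -!memvE !NN // capvSl.
by move/dimvS; rewrite !dim_line_add // dN2 !ltnS leqNgt d.
Qed.

Lemma nrad_factor a b : bframe a b -> (3 < \dim nrad)%N ->
  exists u v, [/\ u \in N, v \in N, u \notin vker N, v \notin vker N & u * v \in nrad].
Proof.
move=> F d; have [aN bN g] := F; have [p [q [r [nz rel]]]] := nrad_relation F d.
have aV := bframe_nvker F; have bV := bframe_nvker (bframe_C F).
have scl (k : K) u : k != 0 -> k *: u \in nrad -> u \in nrad.
  by move=> k0 h; rewrite -[u](scalerK k0) memvZ.
have sV (k : K) : a + k *: b \notin vker N := bframe_nvker (bframe_shift k F).
have [p0|p0] := eqVneq p 0.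
  have [q0|q0] := eqVneq q 0.
    exists b, b; split=> //; apply: (scl r); last by move: rel; rewrite p0 q0 !scale0r !add0r.
    by apply/eqP => r0; apply: nz.
  exists (a + (r / q) *: b), b; split=> //; first by rewrite memvD ?memvZ.
  apply: (scl q) => //; move: rel; rewrite p0 scale0r add0r; apply: mem_eq.
  by rewrite mulrDl -scalerAl scalerDr scalerA mulrCA divff // mulr1.
have [z hz] : exists z : K, z ^+ 2 = - (q / p) * z - r / p.
  have [z] := @solve_monicpoly K 2 (fun i => if i == 0%N then - (r / p) else - (q / p)) isT.
  by move=> e; exists z; rewrite e !big_ord_recl big_ord0 /= /bump /= expr0 mulr1 expr1 addr0 addrC.
exists (a + (- z) *: b), (a + (q / p + z) *: b); split=> //; try by rewrite memvD ?memvZ.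
apply: (scl p) => //; move: rel; apply: mem_eq.
have [X eX] := al_ex A z; have [Y eY] := al_ex A (q / p + z).
have -> : (a + - z *: b) * (a + (q / p + z) *: b) = a * a + (- z + (q / p + z)) *: (a * b) + ((- z) * (q / p + z)) *: (b * b).
  by rewrite [(- z + _) *: _]scalerDl -scalerA !scaleNr !eX !eY; ring.
have -> : - z + (q / p + z) = q / p by rewrite addrC addrK.
have -> : - z * (q / p + z) = r / p.
  by transitivity (- (q / p) * z - z ^+ 2); [ring | rewrite hz; ring].
by rewrite !scalerDr !scalerA ![p * (_ / p)]mulrCA divff // !mulr1.
Qed.

(** Terms containing [b b] die against [N^2], so [(a - j b)^4 = a^4 - 4 j a^3 b], and [j] is chosen
    to make this 0. *)
Lemma double_frame a b : bframe a b -> b * b \in nrad ->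
  exists a, [/\ bframe a b, a * a * a * a = 0 & a * a * a * b != 0].
Proof.
move=> F bbD; have [aN bN g] := F.
have bb0 n : n \in (N ^+ 2)%VS -> b * b * n = 0 by exact: nrad0.
have nz : a * a * a * b != 0.
  apply/eqP => h; case: (bframe_quartic (bframe_C F)).
  - by rewrite -h; ring.
  - have -> : b * b * a * a = b * b * (a * a) by ring.
    by rewrite bb0 ?NN.
  - by rewrite -[b * b * b * b]mulrA bb0 ?NN ?eqxx.
  by rewrite -[b * b * b * a]mulrA bb0 ?NN ?eqxx.
have nN n1 n2 : n1 \in N -> n2 \in N -> n1 * n2 * (a * b) \in (N ^+ 4)%VS.
  by move=> ? ?; apply: (@NpM _ _ _ N 2 2); exact: NN.
have wN : a * a * a * b \in (N ^+ 4)%VS by rewrite -mulrA; exact: nN.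
have a4N : a * a * a * a \in (N ^+ 4)%VS by do 2 apply: NM1 => //; exact: NN.
have /vlineP [k ek] := subvP (N4_line wN nz) _ a4N.
pose j := k / 4%:R; have j4 : 4%:R * j = k by rewrite mulrC divfK // natK_neq0.
have bbaa : b * b * (a * a) = 0 by rewrite bb0 ?NN.
have bbab : b * b * (a * b) = 0 by rewrite bb0 ?NN.
have bbbb : b * b * (b * b) = 0 by rewrite bb0 ?NN.
clearbody j; have [X eX] := al_ex A j.
exists (a + (- j) *: b); split; first exact: bframe_shift.
  transitivity (a * a * a * a - (4%:R * j) *: (a * a * a * b) + X * X * (6%:R * (b * b * (a * a)) - 4%:R * X * (b * b * (a * b)) + X * X * (b * b * (b * b)))).
    by rewrite -scalerA scaler_nat scaleNr !eX; ring.
  by rewrite j4 ek subrr bbaa bbab bbbb !mulr0 subr0 addr0 mulr0 addr0.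
have -> : (a + - j *: b) * (a + - j *: b) * (a + - j *: b) * b = a * a * a * b - X * (3%:R * (b * b * (a * a)) - 3%:R * X * (b * b * (a * b)) + X * X * (b * b * (b * b))).
  by rewrite scaleNr !eX; ring.
by rewrite bbaa bbab bbbb !mulr0 subr0 addr0 mulr0 subr0.
Qed.

Section Double.
Variables a b : car A.
Hypothesis F : bframe a b.
Hypothesis bbD : b * b \in nrad.
Hypothesis a4 : a * a * a * a = 0.
Hypothesis w0 : a * a * a * b != 0.
Let w := a * a * a * b.
Let aN : a \in N. Proof. by case: F. Qed.
Let bN : b \in N. Proof. by case: F. Qed.
Let wN : w \in (N ^+ 4)%VS. Proof. by do 2 apply: NM1 => //; exact: NN. Qed.
Let N4w : (N ^+ 4 <= <[w]>)%VS. Proof. exact: N4_line. Qed.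
Let aaN3 : a * a * a \in (N ^+ 3)%VS. Proof. by apply: NM1 => //; exact: NN. Qed.
Let abN3 : a * a * b \in (N ^+ 3)%VS. Proof. by apply: NM1 => //; exact: NN. Qed.
Let aa_b : a * a * a * b = w. Proof. by []. Qed.
Let ab_a : a * a * b * a = w. Proof. by rewrite /w; ring. Qed.
Let ab_b : a * a * b * b = 0.
Proof.
have -> : a * a * b * b = b * b * (a * a) by ring.
by rewrite nrad0 ?NN.
Qed.
Let abD : a * b \notin nrad.
Proof.
apply: contra w0 => h; have -> : a * a * a * b = a * b * (a * a) by ring.
by rewrite nrad0 ?NN.
Qed.

Lemma double_N3 : (N ^+ 3 <= <[a * a * a]> + (<[a * a * b]> + <[w]>))%VS.
Proof.
apply: subv_trans (bframe_N3 F) _; do 2 apply: addvS => //; rewrite !subv_add N4w andbT -!memvE.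
by rewrite !(subvP N4w) // -?mulrA 1?mulrC; apply: nradN4.
Qed.

Lemma double_N2 : (N ^+ 2 <= <[a * a]> + (<[a * b]> + nrad))%VS.
Proof.
by apply: subv_trans (bframe_N2 F) _; do 2 apply: addvS => //; rewrite subv_add subvv andbT -memvE.
Qed.

(** Products of an element of [nrad] with [a] and [b] are multiples of [w]. They are removed by
    means of [a^2 b] and [a^3], whose products with [(a, b)] are [(w, 0)] and [(0, w)]. *)
Lemma double_ex_q : exists q, [/\ q \in nrad, q \notin (N ^+ 3)%VS, q * a = 0, q * b = 0 & (nrad <= <[q]> + N ^+ 3)%VS].
Proof.
have aaD : a * a \notin (<[a * b]> + nrad)%VS.
  apply/negP => /memv_addP [? /vlineP [k ->] [d dD e]]; have : a * a * (a * b) = 0.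
    rewrite e mulrDl -scalerAl (nrad0 dD (NN aN bN)) addr0.
    have -> : a * b * (a * b) = a * a * b * b by ring.
    by rewrite ab_b scaler0.
  by move/eqP; rewrite mulrA; apply/negP.
have dD : \dim nrad = 4%N.
  have h1 := dimvS double_N2; rewrite !dim_line_add // dN2 in h1.
  have : (<[a * a]> + (<[a * b]> + nrad) <= N ^+ 2)%VS by rewrite !subv_add -!memvE !NN // capvSl.
  move/dimvS; rewrite !dim_line_add // dN2 => h2; apply/eqP; rewrite eqn_leq.
  by rewrite -2!ltnS h2 -[(4 <= _)%N]/(6 <= _.+2)%N h1.
have [q0 q0D q0N] : exists2 q0, q0 \in nrad & q0 \notin (N ^+ 3)%VS by apply: dim_lt_ex; rewrite dN3 dD.
have /vlineP [x ex] := subvP N4w _ (nradN4 q0D aN).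
have /vlineP [y ey] := subvP N4w _ (nradN4 q0D bN).
pose q := q0 - x *: (a * a * b) - y *: (a * a * a).
have qD : q \in nrad by rewrite !memvB ?memvZ // (subvP N3_nrad).
have qN : q \notin (N ^+ 3)%VS.
  apply: contra q0N => h; have -> : q0 = q + (x *: (a * a * b) + y *: (a * a * a)) by rewrite /q; ring.
  by apply: memvD; [exact: h | rewrite memvD ?memvZ].
exists q; split=> //.
- by rewrite !mulrBl -!scalerAl ex ab_a a4 scaler0 subrr subr0.
- by rewrite !mulrBl -!scalerAl ey ab_b aa_b scaler0 subr0 subrr.
apply: eq_sub_dim; first by rewrite subv_add -memvE qD N3_nrad.
by rewrite dim_line_add // dN3 dD.
Qed.

(** The products of [a b] and [a^2] with [(a^2, a b)] are [(w, 0)] and [(0, w)], so both products of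
    [c] can be corrected to 0 inside [N^2]. *)
Lemma double_ex_c : exists c, [/\ c \in vker N, c \notin (N ^+ 2)%VS, (vker N <= <[c]> + N ^+ 2)%VS, c * (a * a) = 0 & c * (a * b) = 0].
Proof.
have [c0 [cV cN2 gc]] := ex_vker_line.
have /vlineP [x ex] := subvP N4w _ (vkerN4 cV (NN aN aN)).
have /vlineP [y ey] := subvP N4w _ (vkerN4 cV (NN aN bN)).
pose z := x *: (a * b) + y *: (a * a); have zN : z \in (N ^+ 2)%VS by rewrite memvD ?memvZ ?NN.
exists (c0 - z); split.
- by rewrite memvB // (subvP (N2_vker lN dN4)).
- by apply: contra cN2 => h; rewrite -[c0](subrK z) memvD.
- apply: subv_trans gc _; rewrite subv_add addvSr andbT -memvE -{1}[c0](subrK z).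
  by apply: memv_add => //; exact: memv_line.
- rewrite mulrBl ex mulrDl -!scalerAl.
  have -> : a * b * (a * a) = w by rewrite /w; ring.
  have -> : a * a * (a * a) = a * a * a * a by ring.
  by rewrite a4 scaler0 addr0 subrr.
rewrite mulrBl ey mulrDl -!scalerAl.
have -> : a * b * (a * b) = a * a * b * b by ring.
have -> : a * a * (a * b) = w by rewrite /w; ring.
by rewrite ab_b scaler0 add0r subrr.
Qed.

Variables q c : car A.
Hypothesis qD : q \in nrad.
Hypothesis qN3 : q \notin (N ^+ 3)%VS.
Hypothesis qa : q * a = 0.
Hypothesis qb : q * b = 0.
Hypothesis gq : (nrad <= <[q]> + N ^+ 3)%VS.
Hypothesis cV : c \in vker N.
Hypothesis cN2 : c \notin (N ^+ 2)%VS.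
Hypothesis gc : (vker N <= <[c]> + N ^+ 2)%VS.
Hypothesis caa : c * (a * a) = 0.
Hypothesis cab : c * (a * b) = 0.
Let cN : c \in N. Proof. exact: vkerN cV. Qed.
Let qN2 : q \in (N ^+ 2)%VS. Proof. by case/nradP: qD. Qed.
Let qN : q \in N. Proof. exact: (NpN lN (k := 2)). Qed.
Let c3 n : n \in (N ^+ 3)%VS -> c * n = 0. Proof. exact: vker3. Qed.

Lemma double_gen : (N <= <[a]> + (<[b]> + (<[c]> + N ^+ 2)))%VS.
Proof. by case: F => _ _ g; apply: subv_trans g _; do 2 apply: addvS => //. Qed.

Lemma double_c_indep : c \notin (<[a]> + (<[b]> + N ^+ 2))%VS.
Proof.
apply/negP => h; have : (N <= <[a]> + (<[b]> + N ^+ 2))%VS.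
  apply: subv_trans double_gen _; rewrite !subv_add -!memvE h.
  rewrite (subvP (addvSl _ _)) ?memv_line //= (subvP (addvSr _ _)) ?(subvP (addvSl _ _)) ?memv_line //=.
  by apply: subv_trans (addvSr _ _); exact: addvSr.
move/dimvS; rewrite leqNgt dN => /negP; apply; apply: leq_ltn_trans (dim_line_le _ _) _.
by apply: (@leq_ltn_trans 8%N) => //; rewrite ltnS; apply: leq_trans (dim_line_le _ _) _; rewrite dN2.
Qed.

(** If [q c = 0], then [q] is a second socle element and [c] kills [N^2]. So [X] is the line of [c],
    and the correction [z] is taken in the span of [a^2 b] and [a^3]. *)
Lemma goodA_double_T2 : q * c = 0 -> goodA A.
Proof.
move=> qc; have wS := N4S wN.
have qS : q \in soc N.
  apply/annP => u /(subvP double_gen) /memv_addP [? /vlineP [k1 ->] [? /memv_addP [? /vlineP [k2 ->] [? /memv_addP [? /vlineP [k3 ->] [n nN ->]] ->]] ->]].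
  by rewrite !mulrDr -!scalerAr qa qb qc (nrad0 qD nN) !scaler0 !addr0.
have dS2 : \dim (soc N) = 2%N.
  have : (<[q]> + <[w]> <= soc N)%VS by rewrite subv_add -!memvE qS.
  move/dimvS; rewrite dim_line_add ?dim_vline ?w0 => [h|]; first by apply/eqP; rewrite eqn_leq dS h.
  apply: contra qN3; apply/subvP; rewrite -memvE; exact: (subvP (NpS lN 2)).
have c0 n : n \in (N ^+ 2)%VS -> c * n = 0.
  case/(subvP double_N2)/memv_addP=> ? /vlineP [k1 ->] [? /memv_addP [? /vlineP [k2 ->] [d /(subvP gq) /memv_addP [? /vlineP [k3 ->] [n' nN' ->]] ->]] ->].
  by rewrite !mulrDr -!scalerAr caa cab [c * q]mulrC qc (c3 nN') !scaler0 !addr0.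
have cS v : v \in N -> c * v \in soc N by move=> vN; apply/annP => u uN; rewrite -mulrA c0 ?NN.
apply: (@goodA_T2X _ _ _ _ lN K0 IH <[c]>%VS (<[a]> + <[b]>)%VS dS2 SN2).
- by rewrite -memvE.
- by rewrite -memvE.
- by rewrite subv_add -!memvE aN.
- by apply: subv_trans double_gen _; rewrite [(<[c]> + (_ + _))%VS]addvC !addvA.
- apply/subvP => x; rewrite memv_cap -addvA => /andP [/vlineP [k ->] h].
  have [->|k0] := eqVneq k 0; first by rewrite scale0r mem0v.
  by case/negP: double_c_indep; rewrite -[c](scalerK k0) memvZ.
- by move=> u n /vlineP [k ->] nN; rewrite -scalerAl c0 // scaler0.
- by move=> u v /vlineP [k ->] /vlineP [k' ->]; rewrite -scalerAl memvZ // cS // memvZ.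
move=> x s s' l l' /vlineP [k ->] sS sS' [l1 l2 l3 l4 le].
have xS v : v \in N -> (k *: c) * v \in soc N by move=> vN; rewrite -scalerAl memvZ ?cS.
move: (k *: c) xS => x' xS.
pose g : {poly K} := (pr l' w)%:P - (pr l w) *: 'X.
have gE t : g.[t] = pr l' w - t * pr l w by rewrite /g hornerD hornerN hornerZ hornerC hornerX mulrC.
have g0 : g != 0.
  apply: contraNneq w0 => h; rewrite -/w (le w wS).
  have h0 : pr l' w = 0 by have := gE 0; rewrite h horner0 mul0r subr0.
  have := gE 1; rewrite h horner0 h0 mul1r sub0r => /esym/eqP; rewrite oppr_eq0 => /eqP ->.
  by rewrite !scale0r addr0.
apply: gen_mono (gen_ne g0) => t gt.
have inl u : u \in soc N -> pr l' u = t * pr l u -> u \in <[s + t *: s']>%VS.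
  move=> uS e; apply/vlineP; exists (pr l u); rewrite {1}(le u uS) e scalerDr scalerA mulrC //.
(* Determined by the vanishing of [l' - t l] at [x' * v - ka v *: w]. *)
pose ka v := (pr l' (x' * v) - t * pr l (x' * v)) / g.[t].
have kE v : ka v * (pr l' w - t * pr l w) = pr l' (x' * v) - t * pr l (x' * v) by rewrite -gE /ka divfK.
pose z := ka a *: (a * a * b) + ka b *: (a * a * a).
have zN3 : z \in (N ^+ 3)%VS by rewrite memvD ?memvZ.
have za : z * a = ka a *: w by rewrite mulrDl -!scalerAl ab_a a4 scaler0 addr0.
have zb : z * b = ka b *: w by rewrite mulrDl -!scalerAl ab_b aa_b scaler0 add0r.
have zv v : v \in N -> z * v = ka v *: w -> (x' - z) * v \in <[s + t *: s']>%VS.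
  move=> vN e; apply: inl; first by rewrite mulrBl e memvB ?memvZ ?xS.
  rewrite mulrBl e !prD !prN !prZ; apply/eqP; rewrite -subr_eq0; apply/eqP.
  transitivity (pr l' (x' * v) - t * pr l (x' * v) - ka v * (pr l' w - t * pr l w)); first by ring.
  by rewrite kE subrr.
exists z; split.
- exact: (subvP (NpS lN 1)).
- by move=> n nN; apply: (N5z (isT : 5 <= 3 + 2)%N).
- by move=> v /vlineP [k' ->]; rewrite -scalerAr [z * c]mulrC c3 // scaler0.
move=> v /memv_addP [? /vlineP [k1 ->] [? /vlineP [k2 ->] ->]].
by rewrite mulrDr -!scalerAr memvD ?memvZ // zv.
Qed.

(** The deformation adds [t q] to [c c]. For general [t] the new square of [c] has a nonzero
    component along [q], which allows generators with [c' a' = 0] and [a' b' b' = 0], as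
    [goodA_two_step] demands. *)
Lemma goodA_double_deform : q * c = w -> goodA A.
Proof.
move=> qc; have [e [e1 e0 es eM]] := loc_char lN.
have cU : c \notin (<[1 : car A]> + (<[a]> + (<[b]> + N ^+ 2)))%VS.
  apply/negP => /memv_addP [? /vlineP [k ->] [u uU ec]].
  have [k0|k0] := eqVneq k 0; first by case/negP: double_c_indep; rewrite ec k0 scale0r add0r.
  case/negP: (loc1 lN); rewrite -[1](scalerK k0) memvZ //.
  have -> : k *: 1 = c - u by rewrite ec addrK.
  rewrite memvB //; move: uU; apply/subvP; by rewrite !subv_add -!memvE aN bN NpS.
have [ga [gac gaU]] := pr_sep cU.
have ga1 : pr ga (1 : car A) = 0 by apply: gaU; rewrite (subvP (addvSl _ _)) ?memv_line.
have gaU' u : u \in (<[a]> + (<[b]> + N ^+ 2))%VS -> pr ga u = 0 by move=> h; apply: gaU; rewrite (subvP (addvSr _ _)).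
have gaN n : n \in (N ^+ 2)%VS -> pr ga n = 0.
  by move=> h; apply: gaU'; do 2 apply: (subvP (addvSr _ _)).
have gaa : pr ga a = 0 by apply: gaU'; rewrite (subvP (addvSl _ _)) ?memv_line.
have gab : pr ga b = 0.
  by apply: gaU'; rewrite (subvP (addvSr _ _)) // (subvP (addvSl _ _)) ?memv_line.
have gM := eM ga ga1 gaN.
have qM v : q * v = pr e v *: q + pr ga v *: w.
  have [x [v' [vN' ev]]] := loc_dec lN v.
  case/memv_addP: (subvP double_gen v' vN') => ? /vlineP [k1 ->] [? /memv_addP [? /vlineP [k2 ->] [? /memv_addP [? /vlineP [k3 ->] [n nN ->]] ->]] ev'].
  have gv : pr ga v = k3 by rewrite ev ev' !(prD, prZ) ga1 gaa gab gac (gaN n nN) !mulr0 !addr0 !add0r mulr1.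
  have ev1 : pr e v = x by rewrite ev prD prZ e1 mulr1 (e0 v') // addr0.
  rewrite ev1 gv ev ev' !mulrDr -!scalerAr mulr1 qa qb qc (nrad0 qD nN) !scaler0 !addr0 !add0r //.
pose D (u v : 'rV[K]_m) : 'rV[K]_m := (pr ga u * pr ga v) *: (q : 'rV_m).
have co t : cocycle A (fun u v => t *: D u v + t ^+ 2 *: 0).
  have gq0 : pr ga q = 0 := gaN q qN2.
  have [V VE] : exists V : K -> K -> car A, forall x y : K, V x y = x *: q + y *: w by eexists => x y; reflexivity.
  have DV u v : t *: D u v + t ^+ 2 *: 0 = V (t * (pr ga u * pr ga v)) 0.
    by rewrite VE scaler0 scale0r !addr0 /D scalerA.
  have VD (x y x' y' : K) : V x y + V x' y' = V (x + x') (y + y') by rewrite !VE !scalerDl; ring.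
  have VZ (k x y : K) : k *: V x y = V (k * x) (k * y) by rewrite !VE scalerDr !scalerA.
  have VM (x : K) v : V x 0 * v = V (x * pr e v) (x * pr ga v).
    by rewrite !VE scale0r addr0 -scalerAl qM scalerDr !scalerA.
  have Vg (x : K) : pr ga (V x 0) = 0 by rewrite VE scale0r addr0 prZ gq0 mulr0.
  split=> [u v|u v x|k u v|v|u v x].
  - by rewrite !DV; congr V; ring.
  - by rewrite !DV !prD VD; congr V; ring.
  - by rewrite !DV !prZ VZ; congr V; ring.
  - by rewrite !DV ga1 !(mul0r, mulr0) VE !scale0r addr0.
  cbv beta; rewrite [u * (_ + _ : 'rV_m)]mulrC !DV !VM !Vg !gM !VD; congr V; ring.
have qdec z : z \in nrad -> exists (k : K) n, n \in (N ^+ 3)%VS /\ z = k *: q + n.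
  by move=> /(subvP gq) /memv_addP [? /vlineP [k ->] [n nN ->]]; exists k, n.
have [al [n1 [nN1 eca]]] := qdec _ (vker_nrad cV aN).
have [ka [n2 [nN2 ecc]]] := qdec _ (vker_nrad cV cN).
apply: (@goodA_family K m A D (fun _ _ => 0) co).
apply: gen_mono (gen_neC (- ka)) => t kt At h1 hm'.
have hm (u v : car A) : cmul At u v = u * v + (t * (pr ga u * pr ga v)) *: q.
  by rewrite hm' scaler0 addr0 /D scalerA.
have M0 (u v : car A) : pr ga v = 0 -> cmul At u v = u * v by move=> h; rewrite hm h !mulr0 scale0r addr0.
have [lNt subNt] : @localA K m At N /\ forall j u, (0 < j)%N -> u \in ((N : {vspace car At}) ^+ j)%VS -> (u : car A) \in (N ^+ j)%VS.
  apply: (deform_local lN h1 hm') => j u v j0 uN vN.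
  rewrite scaler0 addr0 /D scalerA; case: j j0 vN => [//|[|j]] _ vN; first by rewrite memvZ.
  have vN2 : v \in (N ^+ 2)%VS by apply: (subvP (Np_le lN (isT : 0 < 2)%N _)) vN.
  by rewrite (gaN v vN2) !mulr0 scale0r mem0v.
have kt0 : ka + t != 0 by rewrite addrC addr_eq0.
(* [k] cancels the component along [q] in the new product of [c] and [a - k c]; the rest lies in
   [N^3] and is absorbed by the change [z] of [c]. *)
pose k := al / (ka + t); have kE : k * ka + k * t = al by rewrite -mulrDr divfK.
clearbody k; pose a' := a - k *: c; have aN' : a' \in N by rewrite memvB ?memvZ.
have e1' : c * a' - (k * t) *: q = n1 - k *: n2.
  by rewrite mulrBr -scalerAr eca ecc scalerDr scalerA -kE scalerDl; ring.
have : n1 - k *: n2 \in (N ^+ 3)%VS by rewrite memvB ?memvZ.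
case/(subvP double_N3)/memv_addP=> ? /vlineP [x1 ->] [? /memv_addP [? /vlineP [x2 ->] [? /vlineP [x3 ->] ->]] en].
pose z := x1 *: (a * a) + x2 *: (a * b) + x3 *: (a * a * b).
have aabN2 : a * a * b \in (N ^+ 2)%VS by exact: (subvP (NpS lN 1)).
have zN2 : z \in (N ^+ 2)%VS by rewrite !memvD ?memvZ ?aabN2 ?NN.
have zc : z * c = 0 by rewrite mulrC !mulrDr -!scalerAr caa cab (c3 abN3) !scaler0 !addr0.
have za' : z * a' = n1 - k *: n2.
  rewrite mulrBr -scalerAr zc scaler0 subr0 en !mulrDl -!scalerAl ab_a.
  by rewrite (_ : a * b * a = a * a * b) ?addrA //; ring.
pose c' := c - z; have cN' : c' \in N by rewrite memvB // (NpN lN (k := 2)).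
have gaz : pr ga z = 0 by exact: gaN.
have gac' : pr ga c' = 1 by rewrite prD prN gaz subr0.
have gaa' : pr ga a' = - k by rewrite prD prN prZ gaa gac mulr1 sub0r.
have ca' : cmul At c' a' = 0.
  rewrite hm gac' gaa' mulrBl za' mul1r mulrN scaleNr [t * k]mulrC.
  have -> : c * a' = n1 - k *: n2 + (k * t) *: q by rewrite -e1' subrK.
  by rewrite [_ + _ - (n1 - _)]addrAC subrr add0r subrr.
have abb_w : a * b * b \in (N ^+ 4)%VS by rewrite -mulrA mulrC; exact: nradN4.
have cbb_w : c * (b * b) \in (N ^+ 4)%VS by rewrite mulrC; exact: nradN4.
have : a * b * b - k *: (c * (b * b)) \in <[w]>%VS by rewrite (subvP N4w) // memvB ?memvZ.
(* Replacing [b] by [b - xi a^2] changes the coefficient [y] of [w] in [a' b b] by [- 2 xi]. *)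
case/vlineP=> y ey; pose xi := y / 2%:R; have xiE : 2%:R * xi = y by rewrite mulrC divfK // natK_neq0.
clearbody xi; pose b' := b - xi *: (a * a).
have aaN := NN aN aN; have abN := NN aN bN.
have bN' : b' \in N by rewrite memvB ?memvZ // (NpN lN (k := 2)).
have gab' : pr ga b' = 0 by rewrite prD prN prZ gab (gaN _ aaN) mulr0 subr0.
have bb' : b' * b' = b * b - (2%:R * xi) *: (a * a * b).
  have [X eX] := al_ex A xi; rewrite -scalerA scaler_nat /b' !eX.
  transitivity (b * b - X * (a * a * b) *+ 2 + X * X * (a * a * a * a)); first by ring.
  by rewrite a4 mulr0 addr0.
have bbD' : b' * b' \in nrad by rewrite bb' memvB ?memvZ // (subvP N3_nrad).
have ab' : a' * b' = a * b - (k *: (c * b) + xi *: (a * a * a)).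
  rewrite /a' /b' mulrBl !mulrBr -!scalerAr -!scalerAl caa !scaler0 subr0.
  by rewrite [a * (a * a)]mulrA opprD; ring.
have abb' : a' * b' * b' = 0.
  rewrite -mulrA bb' mulrBr -scalerAr [a' * (b * b)]mulrBl -scalerAl [a * (b * b)]mulrA ey xiE.
  rewrite [a' * _]mulrBl -scalerAl (c3 abN3) scaler0 subr0 [a * (a * a * b)]mulrC ab_a subrr //.
have gbb' : pr ga (b' * b') = 0 by apply: gaN; case/nradP: bbD'.
have cD v : v \in N -> c' * v \in nrad.
  by move=> vN; rewrite mulrBl; apply: memvB; [exact: vker_nrad | apply: (subvP N3_nrad); exact: NM1].
(* The ideal of [b' b'] and [c'] for the new product will be shown to lie in [<c'> + nrad]. *)
have abU : a' * b' \notin (<[c']> + nrad)%VS.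
  apply/negP => /memv_addP [? /vlineP [j ->] [d dD ed]].
  have [dN2' _] := nradP _ dD.
  have j0 : j = 0.
    apply/eqP; apply: contraNT cN2 => h; rewrite -[c](subrK z) memvD // -[c - z](scalerK h) memvZ //.
    have -> : j *: c' = a' * b' - d by rewrite ed addrK.
    by rewrite memvB ?NN.
  case/negP: abD; have -> : a * b = d + (k *: (c * b) + xi *: (a * a * a)).
    by rewrite -(add0r d) -(scale0r c') -j0 -ed ab' subrK.
  apply: memvD => //; apply: memvD; apply: memvZ; [exact: vker_nrad | exact: (subvP N3_nrad)].
pose Nt : {vspace car At} := N.
pose W : {vspace car At} := (Nt ^+ 2)%VS.
have NW (u v : car A) : u \in N -> v \in N -> (cmul At u v : car At) \in W by move=> uN vN; exact: (@NN _ _ At Nt u v).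
have NW0 (u v : car A) : u \in N -> v \in N -> pr ga v = 0 -> (u * v : 'rV_m) \in (W : {vspace 'rV[K]_m}).
  by move=> uN vN h; rewrite -M0 //; exact: NW.
have N3W n : n \in (N ^+ 3)%VS -> (n : 'rV_m) \in (W : {vspace 'rV[K]_m}).
  case/(subvP double_N3)/memv_addP=> ? /vlineP [y1 ->] [? /memv_addP [? /vlineP [y2 ->] [? /vlineP [y3 ->] ->]] ->].
  have aaa : a * a * a \in N := NpN lN (isT : 0 < 3)%N aaN3.
  apply: (@memvD _ (car At)); first by apply: (@memvZ _ (car At)); apply: NW0 => //; exact: (NpN lN (k := 2)).
  apply: (@memvD _ (car At)); apply: (@memvZ _ (car At)); apply: NW0 => //; exact: (NpN lN (k := 2)).
have qW : (q : 'rV_m) \in (W : {vspace 'rV[K]_m}).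
  have h : cmul At c c - n2 = (ka + t) *: q by rewrite hm gac !mulr1 ecc [_ + n2 + _]addrAC addrK -scalerDl.
  rewrite -[q](scalerK kt0) -h; apply: (@memvZ _ (car At)); apply: (@memvB _ (car At)); [exact: NW | exact: N3W].
have W2 n : n \in (N ^+ 2)%VS -> (n : 'rV_m) \in (W : {vspace 'rV[K]_m}).
  case/(subvP double_N2)/memv_addP=> ? /vlineP [k1 ->] [? /memv_addP [? /vlineP [k2 ->] [d /(subvP gq) /memv_addP [? /vlineP [k3 ->] [n' nN' ->]] ->]] ->].
  apply: (@memvD _ (car At)); first by apply: (@memvZ _ (car At)); exact: NW0.
  apply: (@memvD _ (car At)); first by apply: (@memvZ _ (car At)); exact: NW0.
  by apply: (@memvD _ (car At)); [apply: (@memvZ _ (car At)) | exact: N3W].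
have m10 : m = 10%N by rewrite -(dimN lN) dN.
apply: (@goodA_two_step K m At Nt lNt K0 IH a' b' c').
- by rewrite m10.
- apply/subvP => u uN; have /memv_addP [? /vlineP [k1 ->] [? /memv_addP [? /vlineP [k2 ->] [? /memv_addP [? /vlineP [k3 ->] [n nN ->]] ->]] ->]] := subvP double_gen u uN.
  have -> : k1 *: a + (k2 *: b + (k3 *: c + n)) = k1 *: a' + (k2 *: b' + (k3 + k1 * k) *: c') + (n + (k2 * xi) *: (a * a) + (k3 + k1 * k) *: z).
    by rewrite /a' /b' /c' !(scalerBr, scalerA, scalerDl); ring.
  apply: (@memv_add _ (car At)); last by apply: W2; rewrite !memvD ?memvZ.
  apply: (@memv_add _ (car At)); first by apply: memvZ; exact: memv_line.
  by apply: (@memv_add _ (car At)); apply: memvZ; exact: memv_line.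
- exact: ca'.
- change (cmul At (cmul At a' b') b' = 0); rewrite (M0 a' b' gab') M0 //.
apply/negP => h; case/negP: abU; have eab : cmul At a' b' = a' * b' by rewrite M0.
have {h} : (cmul At a' b' : car At) \in ((<[(b' : car At) * b']> + <[c' : car At]>) * fullv)%VS := h.
rewrite prodvDl => /memv_addP [x /line_mulP [u _ ex] [x' /line_mulP [u' _ ex'] ee]].
have {x ex x' ex' ee} -> : a' * b' = cmul At c' u' + cmul At (cmul At b' b') u.
  by rewrite -eab ee ex ex' addrC.
have [j [u1 [uN1 eu]]] := loc_dec lN u'.
have qD' (j' : K) : j' *: q \in nrad by rewrite memvZ.
have -> : cmul At c' u' + cmul At (cmul At b' b') u = j *: c' + (c' * u1 + (t * (pr ga c' * pr ga u')) *: q + b' * b' * u).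
  rewrite (M0 b' b' gab') !hm gbb' mul0r mulr0 scale0r addr0 {1}eu mulrDr -scalerAr mulr1 !addrA; exact: erefl.
apply: (@memv_add _ (car A)); first by rewrite memvZ ?memv_line.
apply: (@memvD _ (car A)); first by apply: (@memvD _ (car A)); [exact: cD | exact: qD'].
have [j' [u2 [uN2 ->]]] := loc_dec lN u.
rewrite mulrDr -scalerAr mulr1 memvD ?memvZ // (subvP N3_nrad) // NM1 //.
by case/nradP: bbD'.
Qed.

End Double.

(** If [nrad = N^3], the form on [N^2/N^3] is nondegenerate, so an element [c] of [vker] outside
    [N^2] can be corrected to kill [N^2]; the socle is then a line and [goodA_T1] applies. Otherwise
    some [u v] lies in [nrad], and the cases differ in whether [u], [v] are independent modulo
    [vker]. *)
Lemma goodA_beta : goodA A.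
Proof.
have [a0 [b0 F0]] := ex_bframe.
have [d|d] := leqP (\dim nrad) 3.
  have DN3 : (nrad <= N ^+ 3)%VS by apply: eq_sub_dim; rewrite ?N3_nrad // dN3.
  have [c [cV cN2 gc]] := ex_vker_line; have cN := vkerN cV.
  have [w wN w0] : exists2 w, w \in (N ^+ 4)%VS & w != 0.
    by exists (vpick (N ^+ 4)%VS); rewrite ?memv_pick // vpick0 -dimv_eq0 dN4.
  have N4w := N4_line wN w0.
  have [phi [phiw _]] : exists l : 'cV[K]_m, pr l w = 1 /\ forall v, v \in 0%VS -> pr l v = 0.
    by apply: pr_sep; rewrite memv0.
  have phi0 u : u \in (N ^+ 4)%VS -> pr phi u = 0 -> u = 0.
    by move=> /(subvP N4w) /vlineP [k ->]; rewrite prZ phiw mulr1 => ->; rewrite scale0r.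
  have N22 u v : u \in (N ^+ 2)%VS -> v \in (N ^+ 2)%VS -> u * v \in (N ^+ 4)%VS by exact: (@NpM _ _ _ N 2 2).
  have [l lE] : exists l, forall v, pr l v = pr phi (c * v).
    by apply: lin_pr => k u v; rewrite mulrDr -scalerAr prD prZ.
  pose W := (N ^+ 2 :\: N ^+ 3)%VS.
  have W2 : (W <= N ^+ 2)%VS by exact: diffvSl.
  have [v vW h|z zN hz] := @pair_surj _ _ A (N ^+ 2)%VS W phi l.
    have vN := subvP W2 v vW; apply/eqP; rewrite -memv0 -(capv_diff (N ^+ 2)%VS (N ^+ 3)%VS) memv_cap vW /=.
    apply: (subvP DN3); apply/nradP; split=> // n nN; rewrite mulrC; apply: phi0; [exact: N22 | exact: h].
  have cz n : n \in (N ^+ 2)%VS -> (c - z) * n = 0.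
    rewrite -(addv_diff_cap (N ^+ 2)%VS (N ^+ 3)%VS) => /memv_addP [n1 n1W [n2]].
    rewrite memv_cap => /andP [_ n2N] ->; have n1N := subvP W2 n1 n1W.
    rewrite mulrDr [_ * n2]mulrBl (vker3 cV n2N) (N5z (isT : 5 <= 2 + 3)%N zN n2N) subr0 addr0 mulrBl.
    by apply: phi0; [apply: memvB; [exact: vkerN4 | exact: N22] | rewrite prD prN -lE hz // subrr].
  have dS1 : \dim (soc N) = 1%N.
    apply/eqP; rewrite eqn_leq lt0n dimv_eq0 (soc_neq0 lN) andbT -dN4; apply: dimvS.
    apply/subvP => s sS; apply: (subvP SN4); rewrite memv_cap sS; apply: (subvP DN3); apply/nradP.
    by split=> [|n nN]; [exact: (subvP SN2) | apply: SNM => //; exact: (NpN lN (k := 2))].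
  apply: (@goodA_T1 _ _ _ _ lN K0 IH (c - z) dS1 SN2) => //.
    by rewrite memvB // (NpN lN (k := 2)).
  by apply: contra cN2 => h; rewrite -[c](subrK z) memvD.
have [u [v [uN vN uV vV uvD]]] := nrad_factor F0 d.
have [h|h] := boolP (v \in (<[u]> + vker N)%VS); last first.
  apply: (goodA_beta_distinct (a := u) (b := v)) => //; split=> //.
  rewrite addvA [(<[u]> + _)%VS]addvC -addvA; apply: eq_sub_dim; last by rewrite !dim_line_add // dV dN.
  by rewrite !subv_add -!memvE uN vN capvSl.
case/memv_addP: h => ? /vlineP [k ->] [z zV ev].
have k0 : k != 0 by apply: contraNneq vV => h; rewrite ev h scale0r add0r.
have uuD : u * u \in nrad.
  rewrite -[u * u](scalerK k0) memvZ //; have -> : k *: (u * u) = u * v - z * u.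
    by rewrite ev mulrDr -scalerAr [u * z]mulrC addrK.
  by apply: memvB => //; exact: vker_nrad.
have [a aN au] : exists2 a, a \in N & a \notin (<[u]> + vker N)%VS.
  by apply: dim_lt_ex; rewrite dN dim_line_add // dV.
have F : bframe a u.
  split=> //; apply: eq_sub_dim; last by rewrite !dim_line_add // dV dN.
  by rewrite !subv_add -!memvE aN uN capvSl.
have [a' [F' a4 w0]] := double_frame F uuD.
have [q [qD qN3 qa qb gq]] := double_ex_q F' uuD a4 w0.
have [c [cV cN2 gc caa cab]] := double_ex_c F' uuD a4 w0.
have cN := vkerN cV.
have wN : a' * a' * a' * u \in (N ^+ 4)%VS by case: F' => aN' _ _; do 2 apply: NM1 => //; exact: NN.
have /vlineP [s es] := subvP (N4_line wN w0) _ (nradN4 qD cN).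
have [s0|s0] := eqVneq s 0.
  by apply: (goodA_double_T2 F' uuD a4 w0 qD qN3 qa qb gq cV cN2 gc caa cab); rewrite es s0 scale0r.
have si0 : s^-1 != 0 by rewrite invr_eq0.
apply: (goodA_double_deform F' uuD a4 w0 (q := s^-1 *: q) _ _ _ _ cV cN2 gc caa cab).
- by rewrite memvZ.
- by rewrite -scalerAl qa scaler0.
- by rewrite -scalerAl qb scaler0.
- apply: subv_trans gq _; rewrite subv_add addvSr andbT -memvE; apply: (subvP (addvSl _ _)).
  by apply/vlineP; exists s; rewrite scalerA divff // scale1r.
by rewrite -scalerAl es scalerA mulVf // scale1r.
Qed.

End Beta.

(** * All local algebras of dimension at most ten *)

Section AllCases.
Variable K : closedFieldType.
Hypothesis K0 : [pchar K] =i pred0.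

(** The pairing of [N] with [N^3] into the line [N^4] gives
    [9 - dim vker = 3 - dim (soc N :&: N^3)]. The last dimension is 1 or 2, and these are the two
    cases treated above. *)
Lemma goodA_13321 m (A : calg K m) (N : {vspace car A}) : localA N -> (forall k, (k < m)%N -> CM K k) ->
  (soc N <= N ^+ 2)%VS -> (\dim (soc N) <= 2)%N -> \dim N = 9%N -> \dim (N ^+ 2) = 6%N ->
  \dim (N ^+ 3) = 3%N -> \dim (N ^+ 4) = 1%N -> goodA A.
Proof.
move=> lN IH SN2 dS dN dN2 dN3 dN4.
have N5 := N5 lN dN4; have N4S z : z \in (N ^+ 4)%VS -> z \in (soc N :&: N ^+ 3)%VS.
  move=> zN; rewrite memv_cap (subvP (NpS lN 2) _ zN) andbT; apply/annP => w wN.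
  by apply/eqP; rewrite -memv0 -N5; exact: NM1.
have [w wN w0] : exists2 w, w \in (N ^+ 4)%VS & w != 0.
  by exists (vpick (N ^+ 4)%VS); rewrite ?memv_pick // vpick0 -dimv_eq0 dN4.
have N4w : (N ^+ 4 <= <[w]>)%VS by apply: eq_sub_dim; rewrite -?memvE // dN4 dim_vline w0.
have [phi [phiw _]] : exists l : 'cV[K]_m, pr l w = 1 /\ forall v, v \in (0%VS : {vspace car A}) -> pr l v = 0.
  by apply: pr_sep; rewrite memv0.
have phi0 u : u \in (N ^+ 4)%VS -> pr phi u = 0 -> u = 0.
  by move=> /(subvP N4w) /vlineP [k ->]; rewrite prZ phiw mulr1 => ->; rewrite scale0r.
have h1 : (\dim N + \dim (soc N :&: N ^+ 3) <= \dim (vker N) + \dim (N ^+ 3))%N.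
  apply: (@pair_dim _ _ A N (vker N) (N ^+ 3)%VS (soc N :&: N ^+ 3)%VS phi); first exact: capvSr.
    move=> u z uN; rewrite memv_cap => /andP [/annP zS _]; by rewrite mulrC zS // pr0.
  move=> u uN h; apply/vkerP; split=> // n nN; apply: phi0; [exact: N1M | exact: h].
have h2 : (\dim (N ^+ 3) + \dim (vker N) <= \dim (soc N :&: N ^+ 3) + \dim N)%N.
  apply: (@pair_dim _ _ A (N ^+ 3)%VS (soc N :&: N ^+ 3)%VS N (vker N) phi); first exact: capvSl.
    by move=> u z uN zV; rewrite mulrC (vker3 zV uN) pr0.
  move=> u uN h; rewrite memv_cap uN andbT; apply/annP => n nN; apply: phi0; [exact: NM1 | exact: h].
have h3 : (1 <= \dim (soc N :&: N ^+ 3))%N by have := dimvS (introT subvP N4S); rewrite dN4.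
have h4 : (\dim (soc N :&: N ^+ 3) <= \dim (soc N))%N by apply: dimvS; exact: capvSl.
have G (v t s : nat) : (9 + t <= v + 3)%N -> (3 + v <= t + 9)%N -> (1 <= t)%N -> (t <= s)%N -> (s <= 2)%N ->
  [/\ v = 8%N, t = 2%N & s = 2%N] \/ v = 7%N /\ t = 1%N.
  clear; move=> g1 g2 g3 g4 g5; have e : v = (6 + t)%N by lia.
  have [t2|t1] : t = 2%N \/ t = 1%N by lia.
    by left; split; lia.
  by right; split; lia.
rewrite dN dN3 in h1 h2; have [[dV dT dS2]|[dV dT]] := G _ _ _ h1 h2 h3 h4 dS.
  apply: (goodA_alpha lN K0 IH dN dN2 dN3 dN4 _ dS2 dV).
  have : (soc N <= soc N :&: N ^+ 3)%VS by apply: eq_sub_dim; [exact: capvSl | rewrite dT dS2].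
  by move=> h; apply: subv_trans h _; exact: capvSr.
apply: (goodA_beta lN K0 IH dN dN2 dN3 dN4 SN2 _ dS dV).
by apply: eq_sub_dim; [apply/subvP; exact: N4S | rewrite dT dN4].
Qed.

Lemma CM_le10 m : (m <= 10)%N -> CM K m.
Proof.
elim/ltn_ind: m => m IHm m10; have IH k : (k < m)%N -> CM K k by move=> km; apply: IHm => //; apply: leq_trans (ltnW km) m10.
apply: CM_of_local => // A N f lN cf; have dS := cogen_soc lN cf.
have [N0|N0] := eqVneq N 0%VS; first exact: (goodA_m1 lN N0).
have [SN2|/subvPn [s sS sN]] := boolP (soc N <= N ^+ 2)%VS; last exact: (goodA_soc0 lN K0 IH sS sN).
have [e2|e3] := leqP (\dim N) (\dim (N ^+ 2)).+2; first exact: (goodA_e_le2 lN K0 IH e2).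
have {}e3 : (\dim (N ^+ 2) + 3 <= \dim N)%N by rewrite addn3.
have [N3|N3] := eqVneq (N ^+ 3)%VS 0%VS; first exact: (goodA_N3_0 lN K0 IH SN2 dS e3 N3).
have [N4|N4] := eqVneq (N ^+ 4)%VS 0%VS; first exact: (goodA_N4_0 lN K0 IH SN2 dS e3 m10 N3 N4).
have N2 : (N ^+ 2 != 0)%VS by apply: contraNneq N3 => h; rewrite -subv0 -h NpS.
have d40 : (0 < \dim (N ^+ 4))%N by rewrite lt0n dimv_eq0.
have d34 := Np_lt lN (isT : (0 < 3)%N) N3; have d23 := Np_lt lN (isT : (0 < 2)%N) N2.
have dN := dimN lN.
have [h|n31] := eqVneq (\dim (N ^+ 3)) (\dim (N ^+ 4)).+1; first exact: (goodA_h3_1 lN K0 IH N4 h).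
have [h|n21] := eqVneq (\dim (N ^+ 2)) (\dim (N ^+ 3)).+1.
  by have := h2_1 lN K0 h; rewrite leqNgt ltn_neqAle eq_sym n31 d34.
(* If [N^2/N^3] has dimension two, so has [N^3/N^4], by [h2_2]. Otherwise the steps are at least 3,
   3, 2, 1, whose sum is 9, so all are equalities. *)
have G (d d2 d3 d4 : nat) : d.+1 = m -> (m <= 10)%N -> (d2 + 3 <= d)%N -> (0 < d4)%N -> (d4 < d3)%N -> (d3 < d2)%N ->
  d3 != d4.+1 -> d2 != d3.+1 -> (d2 = d3.+2 -> (d3 <= d4.+2)%N) ->
  [/\ d2 = (d3 + 2)%N, (d4 + 2)%N = d3 & (d4 <= 2)%N] \/ [/\ d = 9%N, d2 = 6%N, d3 = 3%N & d4 = 1%N].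
  clear; move=> h1 h2 h3 h4 h5 h6 h7 h8 h9; have [e|e] := eqVneq d2 d3.+2; last by right; split; lia.
  by have h10 := h9 e; left; split; lia.
have h22 := h2_2 lN K0.
have [[x1 x2 x3]|[y1 y2 y3 y4]] := G _ _ _ _ dN m10 e3 d40 d34 d23 n31 n21 h22.
  exact: (goodA_h2_2 lN K0 IH N4 x1 x2 x3 e3 dS SN2).
exact: (goodA_13321 lN IH SN2 dS y1 y2 y3 y4).
Qed.

End AllCases.

(** * From finite schemes to commuting matrices *)

Lemma max_step (P : nat -> Prop) r : P 0%N -> ~ P r.+1 -> exists2 k, (k <= r)%N & P k /\ ~ P k.+1.
Proof.
elim: r => [|r IHr] P0 Pr; first by exists 0%N.
have [h|h] := classic (P r.+1); first by exists r.+1.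
by have [k kr hk] := IHr P0 h; exists k => //; exact: leqW.
Qed.

Section LinearForms.
Variables (K : closedFieldType) (n : nat).
Local Notation Poly := {mpoly K[n.+1]}.

Lemma ex_notin (s : seq K) : exists c, c \notin s.
Proof.
have g : gen (fun t : K => forall c, c \in s -> t != c).
  elim: s => [|c s IHs]; first exact: gen_all.
  apply: gen_mono (gen_and (gen_neC c) IHs) => t [tc ts] x; rewrite inE => /orP [/eqP -> //|]; exact: ts.
by have [t ht] := gen_ex g; exists t; apply/negP => /ht; rewrite eqxx.
Qed.

(** Linear forms on the moment curve: any [n + 1] of them are independent, by Vandermonde. *)
Definition lin (c : K) : Poly := \sum_(i < n.+1) c ^+ i *: 'X_i.

Lemma lin_homog c : lin c \is 1.-homog.
Proof. by apply: rpred_sum => i _; rewrite rpredZ // dhomogX; apply/eqP; exact: mdeg1. Qed.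

Lemma homogX (p : Poly) t k : p \is t.-homog -> p ^+ k \is (t * k).-homog.
Proof.
move=> h; elim: k => [|k IHk]; first by rewrite muln0 expr0 dhomog1.
by rewrite exprS mulnS dhomogM.
Qed.

Lemma var_lin (s : seq K) (i : 'I_n.+1) : uniq s -> size s = n.+1 -> exists a : 'I_n.+1 -> K,
  'X_i = \sum_(j < n.+1) a j *: lin s`_j.
Proof.
move=> us ss; pose v : 'rV[K]_n.+1 := \row_j s`_j; pose V := Vandermonde n.+1 v.
have Vu : V \in unitmx.
  rewrite unitmxE det_Vandermonde unitfE; apply/prodf_neq0 => j _; apply/prodf_neq0 => k jk.
  by rewrite !mxE subr_eq0 nth_uniq ?ss // gtn_eqF.
exists (fun j => invmx V j i).
under eq_bigr do rewrite /lin scaler_sumr; rewrite exchange_big /=.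
under eq_bigr => k _.
  under eq_bigr do rewrite scalerA mulrC.
  rewrite -scaler_suml.
  have -> : \sum_(j < n.+1) s`_j ^+ k * invmx V j i = (k == i)%:R.
    have := congr1 (fun M : 'M_n.+1 => M k i) (mulmxV Vu); rewrite !mxE => <-.
    by apply: eq_bigr => j _; rewrite !mxE.
  over.
by rewrite (bigD1 i) //= eqxx scale1r big1 ?addr0 // => k /negPf ->; rewrite scale0r.
Qed.

End LinearForms.

Section SchemeIdeal.
Variables (K : closedFieldType) (n r : nat).
Local Notation Poly := {mpoly K[n.+1]}.
Variable I : Poly -> Prop.
Hypothesis FS : finite_scheme_ideal r I.

Let I0 : I 0. Proof. by case: FS => [[[]]]. Qed.
Let ID f g : I f -> I g -> I (f + g). Proof. by case: FS => [[[_ []]]] h *; apply: h. Qed.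
Let IM f g : I g -> I (f * g). Proof. by case: FS => [[[_ [_ h]]]] *; apply: h. Qed.
Let IMr f g : I f -> I (f * g). Proof. by rewrite mulrC; exact: IM. Qed.
Let IZ k f : I f -> I (k *: f). Proof. by rewrite -mul_mpolyC; exact: IM. Qed.
Let IN f : I f -> I (- f). Proof. by rewrite -scaleN1r; exact: IZ. Qed.
Let IB f g : I f -> I g -> I (f - g). Proof. by move=> *; apply: ID => //; exact: IN. Qed.
Let Isum (T : Type) (s : seq T) (P : pred T) F : (forall x, P x -> I (F x)) -> I (\sum_(x <- s | P x) F x).
Proof. by move=> h; elim/big_rec: _ => // x f Px; apply: ID; exact: h. Qed.
Let Isat f : (exists k, forall i : 'I_n.+1, I ('X_i ^+ k * f)) -> I f.
Proof. by case: FS => _ [h _]; exact: h. Qed.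
Let Ihil t (g : 'I_r.+1 -> Poly) : (forall j, g j \is t.-homog) ->
    exists c : 'I_r.+1 -> K, (exists j, c j != 0) /\ I (\sum_(j < r.+1) c j *: g j).
Proof. by case: FS => _ [_ h]; exact: h. Qed.

Let Ieq f g : I (f - g) -> I f -> I g.
Proof. by move=> h hf; rewrite -(subKr f g); exact: IB. Qed.

Definition tors (f p : Poly) := exists k, I (p ^+ k * f).

Lemma tors_le f p k k' : (k <= k')%N -> I (p ^+ k * f) -> I (p ^+ k' * f).
Proof. by move=> /subnK <- h; rewrite exprD -mulrA; exact: IM. Qed.

Lemma torsD f p q : tors f p -> tors f q -> tors f (p + q).
Proof.
move=> [k hk] [k' hk']; exists (k + k')%N; rewrite exprDn mulr_suml; apply: Isum => i _.
rewrite mulrnAl -mulr_natl; apply: IM; have [ki|ik] := leqP k (k + k' - i).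
  by rewrite mulrAC; apply: IMr; exact: tors_le hk.
by rewrite -mulrA; apply: IM; apply: tors_le hk'; lia.
Qed.

Lemma torsZ f k p : tors f p -> tors f (k *: p).
Proof. by case=> j hj; exists j; rewrite exprZn -scalerAl; exact: IZ. Qed.

(** Any [n + 1] of the forms [lin c] span the variables. If powers of all of them sent [f] into [I],
    powers of the variables would too, and [I] is saturated. *)
Lemma tors_size f (s : seq K) : uniq s -> (forall c, c \in s -> tors f (lin n c)) -> ~ I f -> (size s <= n)%N.
Proof.
move=> us hs nf; rewrite leqNgt; apply/negP => sn; apply: nf.
pose s' := take n.+1 s; have ss : size s' = n.+1 by rewrite size_takel.
have us' : uniq s' by exact: take_uniq.
have hX (i : 'I_n.+1) : tors f 'X_i.
  have [a ->] := var_lin i us' ss; elim/big_rec: _ => [|j p _ hp].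
    by exists 1%N; rewrite expr1 mul0r.
  apply: torsD => //; apply: torsZ; apply: hs; apply: (@mem_take n.+1); apply: mem_nth; rewrite ss //.
have [k hk] := fun_choice hX; apply: Isat; exists (\max_i k i) => i.
by apply: tors_le (hk i); exact: leq_bigmax.
Qed.

(** Choose a multiple [g f0] outside [I] that powers of as many [lin c] as possible send into [I];
    by [tors_size] there are at most [n]. By maximality no further [lin c] sends a homogeneous
    multiple of it from outside [I] into [I]. *)
Lemma ex_stable f0 : ~ I f0 -> exists t g (s : seq K), [/\ g \is t.-homog, ~ I (g * f0) &
  forall c u h, c \notin s -> h \is u.-homog -> ~ I (h * (g * f0)) -> ~ I (lin n c * (h * (g * f0)))].
Proof.
move=> nf; pose P k := exists t g (s : seq K), [/\ g \is t.-homog, ~ I (g * f0), uniq s, size s = k &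
  forall c, c \in s -> tors (g * f0) (lin n c)].
have [||k _ [[t [g [s [gt ng us ss hs]]]] nP]] := @max_step P n.
- by exists 0%N, 1, [::]; rewrite mul1r; split=> //; exact: dhomog1.
- by case=> t [g [s [_ ng us ss hs]]]; have := tors_size us hs ng; rewrite ss ltnn.
exists t, g, s; split=> // c u h cs hu nh hI; apply: nP; exists (u + t)%N, (h * g), (c :: s).
split=> /=; rewrite ?cs ?ss //; [exact: dhomogM | by rewrite -mulrA |].
move=> x; rewrite inE -mulrA => /orP [/eqP ->|/hs [j hj]]; first by exists 1%N; rewrite expr1.
by exists j; rewrite mulrCA; exact: IM.
Qed.

(** If every form [lin x] is a zero divisor, there are [f_0, ..., f_r], each killed modulo [I] by
    its own linear form, while that form is a nonzerodivisor on the multiples of the earlier ones.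
    Raised to a common degree they contradict the bound on the Hilbert function. *)
Lemma ex_nonzerodivisor : exists c, forall f t, f \is t.-homog -> I (lin n c * f) -> I f.
Proof.
apply: NNPP => nex; have bad c : exists t f, [/\ f \is t.-homog, I (lin n c * f) & ~ I f].
  have /not_all_ex_not [f hf] := not_ex_all_not _ _ nex c.
  have [t ht] := not_all_ex_not _ _ hf; have [h1 h2] := imply_to_and _ _ ht.
  by exists t, f; have [h3 h4] := imply_to_and _ _ h2.
pose Q k := exists (t : nat -> nat) (f : nat -> Poly) (c : nat -> K) (s : seq K),
  [/\ forall i, (i < k)%N -> f i \is (t i).-homog /\ ~ I (f i), forall i, (i < k)%N -> I (lin n (c i) * f i),
    forall i x u h, (i < k)%N -> x \notin s -> h \is u.-homog -> ~ I (h * f i) -> ~ I (lin n x * (h * f i))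
    & forall i j u h, (i < j)%N -> (j < k)%N -> h \is u.-homog -> ~ I (h * f i) -> ~ I (lin n (c j) * (h * f i))].
have QS k : Q k -> Q k.+1.
  case=> t [f [c [s [h1 h2 h3 h4]]]]; have [x xs] := ex_notin s.
  have [t' [f' [ft' lf' nf']]] := bad x; have [t'' [g [s' [gt ng hg]]]] := ex_stable nf'.
  pose up (T : Type) (F : nat -> T) y i := if i == k then y else F i.
  have upk T (F : nat -> T) y : up T F y k = y by rewrite /up eqxx.
  have upi T (F : nat -> T) y i : (i < k)%N -> up T F y i = F i by move=> ik; rewrite /up ltn_eqF.
  exists (up nat t (t'' + t')%N), (up Poly f (g * f')), (up K c x), (s ++ s'); split.
  - move=> i; rewrite ltnS leq_eqVlt => /orP [/eqP ->|ik]; last by rewrite !upi //; exact: h1.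
    by rewrite !upk; split=> //; exact: dhomogM.
  - move=> i; rewrite ltnS leq_eqVlt => /orP [/eqP ->|ik]; last by rewrite !upi //; exact: h2.
    by rewrite !upk mulrCA; exact: IM.
  - move=> i y u h; rewrite mem_cat negb_or ltnS leq_eqVlt => /orP [/eqP ->|ik] /andP [ys ys'].
      by rewrite upk; exact: hg.
    by rewrite upi //; exact: h3.
  move=> i j u h ij; rewrite ltnS leq_eqVlt => /orP [/eqP jk|jk]; last first.
    by rewrite !upi // ?(ltn_trans ij) //; exact: h4.
  by move: ij; rewrite jk => ik; rewrite upk upi //; exact: h3.
have Q0 : Q 0%N by exists (fun=> 0%N), (fun=> 0), (fun=> 0), [::].
have Qall k : Q k by elim: k.
have [t [f [c [s [h1 h2 h3 h4]]]]] := Qall r.+1; have [x xs] := ex_notin s.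
pose T := \max_(i < r.+1) t i; pose g (i : 'I_r.+1) := lin n x ^+ (T - t i) * f i.
have gT i : g i \is T.-homog.
  have e : ((1 * (T - t i)) + t i)%N = T by rewrite mul1n subnK // leq_bigmax.
  by rewrite -e; apply: dhomogM; [apply: homogX; exact: lin_homog | case: (h1 i (ltn_ord i))].
have nlin k (i : 'I_r.+1) : ~ I (lin n x ^+ k * f i).
  elim: k => [|k IHk]; first by rewrite mul1r; case: (h1 i (ltn_ord i)).
  by rewrite exprS -mulrA; apply: h3 => //; apply: homogX; exact: lin_homog.
have [a [[i0 ai0] aI]] := Ihil gT.
case: (@arg_minnP _ i0 (fun i => a i != 0) (fun i => i : nat) ai0) => i ai imin.
(* [i] is the first index with a nonzero coefficient; the product of the later forms kills all later
   terms but not the one at [i]. *)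
pose L := \prod_(j < r.+1 | (i < j)%N) lin n (c j).
have nL : ~ I (L * g i).
  suff [u [_ h]] : exists u, L \is u.-homog /\ ~ I (L * g i) by [].
  rewrite /L; elim/big_rec: _ => [|j p ij [u [pu np]]].
    by exists 0%N; rewrite mul1r; split; [exact: dhomog1 | exact: nlin].
  exists (1 + u)%N; split; first by apply: dhomogM => //; exact: lin_homog.
  rewrite -mulrA {1}/g [p * _]mulrA; apply: (h4 i j (u + 1 * (T - t i))%N) => //.
    by apply: dhomogM => //; apply: homogX; exact: lin_homog.
  by rewrite -mulrA.
apply: nL; have : I (L * \sum_(j < r.+1) a j *: g j) by exact: IM.
rewrite (bigD1 i) //= mulrDr => h.
have : I (L * (a i *: g i)).
  rewrite -[X in I X](addrK (L * \sum_(j < r.+1 | j != i) a j *: g j)); apply: IB => //.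
  rewrite mulr_sumr; apply: Isum => j ji; have [->|aj] := eqVneq (a j) 0; first by rewrite scale0r mulr0.
  have ij : (i < j)%N by rewrite ltn_neqAle eq_sym ji imin.
  rewrite -scalerAr; apply: IZ; rewrite /L (bigD1 j) //= mulrAC mulrC; apply: IM.
  by rewrite /g mulrCA; apply: IM; exact: h2.
by rewrite -scalerAr => /(@IZ (a i)^-1); rewrite scalerA mulVf // scale1r.
Qed.

(* [l] is a nonzerodivisor modulo [I] and the [g j] are a basis of the largest graded piece
   of the quotient; [X i] is multiplication by ['X_i / l] on it. *)
Lemma ideal_matrices : exists k (X : 'I_n.+1 -> 'M[K]_k) (v0 : 'rV[K]_k), [/\ (k <= r)%N,
  forall i j, X i *m X j = X j *m X i &
  forall d (s : seq (K * seq 'I_n.+1)), (forall x, x \in s -> size x.2 = d) ->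
    \sum_(x <- s) x.1 *: (v0 *m mword X x.2) = 0 -> I (\sum_(x <- s) x.1 *: \prod_(i <- x.2) 'X_i)].
Proof.
have [c nz] := ex_nonzerodivisor; pose l := lin n c.
have lh k : l ^+ k \is k.-homog by have := homogX k (lin_homog n c); rewrite mul1n.
have nzk k f t : f \is t.-homog -> I (l ^+ k * f) -> I f.
  move=> ft; elim: k => [|k IHk]; first by rewrite mul1r.
  by rewrite exprS -mulrA => /(nz _ (k + t)%N) h; apply: IHk; apply: h; exact: dhomogM.
pose P k := exists t (g : 'I_k -> Poly), (forall j, g j \is t.-homog) /\
  forall a : 'I_k -> K, I (\sum_j a j *: g j) -> forall j, a j = 0.
(* [T] is a degree in which the quotient has its largest dimension [k]; powers of [l] then identify
   this piece with every later one. *)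
have [||k kr [[T [g [gT gI]]] nP]] := @max_step P r.
- by exists 0%N, (fun=> 0); split=> [j|a _ j]; case: j.
- by case=> t [g [gt gi]]; have [a [[j /eqP aj] aI]] := Ihil gt; exact: aj (gi a aI j).
pose cb (v : 'rV[K]_k) := \sum_j v 0 j *: g j.
have cbD u v : cb (u + v) = cb u + cb v.
  by rewrite /cb -big_split; apply: eq_bigr => j _; rewrite mxE scalerDl.
have cbZ x v : cb (x *: v) = x *: cb v.
  by rewrite /cb scaler_sumr; apply: eq_bigr => j _; rewrite mxE scalerA.
have cbh v : cb v \is T.-homog by apply: rpred_sum => j _; rewrite rpredZ.
have cb0 : cb 0 = 0 by rewrite /cb big1 // => j _; rewrite mxE scale0r.
have cbI s v : I (l ^+ s * cb v) -> v = 0.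
  move=> /(nzk _ _ _ (cbh v)) /gI h; by apply/rowP => j; rewrite mxE h.
have coord s f : f \is (T + s).-homog -> exists x, I (f - l ^+ s * cb x).
  move=> fT; pose g' (j : 'I_k.+1) := if unlift ord0 j is Some i then l ^+ s * g i else f.
  have g'h j : g' j \is (T + s).-homog.
    by rewrite /g'; case: unliftP => [i _|_] //; rewrite addnC; exact: dhomogM.
  have [a [ha [j0 aj0]]] : exists a : 'I_k.+1 -> K, I (\sum_j a j *: g' j) /\ exists j, a j <> 0.
    apply: NNPP => h; apply: nP; exists (T + s)%N, g'; split=> // a ha j.
    by apply: NNPP => aj; apply: h; exists a; split=> //; exists j.
  have eS : \sum_j a j *: g' j = a ord0 *: f + l ^+ s * cb (\row_i a (lift ord0 i)).
    rewrite big_ord_recl /g' unlift_none; congr (_ + _); rewrite /cb mulr_sumr.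
    by apply: eq_bigr => i _; rewrite liftK mxE scalerAr.
  rewrite eS in ha; have [a0|a0] := eqVneq (a ord0) 0.
    move: ha; rewrite a0 scale0r add0r => /cbI /rowP h; case: aj0.
    by case: (unliftP ord0 j0) => [i ->|-> //]; have := h i; rewrite !mxE.
  exists (- (a ord0)^-1 *: (\row_i a (lift ord0 i))).
  have := IZ (a ord0)^-1 ha; rewrite scalerDr scalerA mulVf // scale1r cbZ scaleNr mulrN opprK.
  by rewrite scalerAr.
have hX0 (p : 'I_n.+1 * 'I_k) : exists y, I ('X_(p.1) * g p.2 - l ^+ 1 * cb y).
  apply: coord; rewrite addnC; apply: dhomogM => //; by rewrite dhomogX; apply/eqP; exact: mdeg1.
have [h hX] := fun_choice hX0.
pose X i : 'M[K]_k := \matrix_(j, m) h (i, j) 0 m.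
have key i v : I ('X_i * cb v - l * cb (v *m X i)).
  have -> : v *m X i = \sum_j v 0 j *: h (i, j).
    by rewrite mulmx_sum_row; apply: eq_bigr => j _; congr (_ *: _); apply/rowP => m; rewrite !mxE.
  have -> : cb (\sum_j v 0 j *: h (i, j)) = \sum_j v 0 j *: cb (h (i, j)).
    by elim/big_rec2: _ => [|j y1 y2 _ <-]; rewrite ?cb0 // cbD cbZ.
  rewrite /cb !mulr_sumr -sumrB; apply: Isum => j _.
  by rewrite -!scalerAr -scalerBr; apply: IZ; have := hX (i, j); rewrite expr1.
have word w v : I ((\prod_(i <- w) 'X_i) * cb v - l ^+ size w * cb (v *m mword X w)).
  elim: w v => [|i w IHw] v /=; first by rewrite big_nil !mul1r mulmx1 subrr.
  have -> : \prod_(j <- i :: w) 'X_j * cb v - l ^+ (size w).+1 * cb (v *m (X i *m mword X w)) =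
    \prod_(j <- w) 'X_j * ('X_i * cb v - l * cb (v *m X i)) +
    l * (\prod_(j <- w) 'X_j * cb (v *m X i) - l ^+ size w * cb (v *m X i *m mword X w)).
    by rewrite big_cons mulmxA exprS; ring.
  by apply: ID; [apply: IM | apply: IM].
have comm i j : X i *m X j = X j *m X i.
  apply/row_matrixP => m; rewrite !rowE; apply/eqP; rewrite -subr_eq0; apply/eqP.
  apply: (cbI 2%N); have := IB (word [:: j; i] (delta_mx 0 m)) (word [:: i; j] (delta_mx 0 m)).
  rewrite !big_cons !big_nil /= !mulmx1 => hI; rewrite -scaleN1r cbD cbZ scaleN1r.
  by move: hI; congr I; ring.
(* The vector of 1, that is, of [l^T / l^T]. *)
have [v0 hv0] : exists v0, I (l ^+ T - l ^+ 0 * cb v0) by apply: coord; rewrite addn0.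
rewrite mul1r in hv0.
exists k, X, v0; split=> // d s hs s0.
have sh : \sum_(x <- s) x.1 *: \prod_(i <- x.2) ('X_i : Poly) \is d.-homog.
  rewrite big_seq; apply: rpred_sum => x xs; rewrite rpredZ // -(hs x xs).
  elim: (x.2) => [|i w IHw] /=; first by rewrite big_nil dhomog1.
  rewrite big_cons; apply: (@dhomogM _ _ mdeg 1 'X_i (size w)) => //.
  by rewrite dhomogX; apply/eqP; exact: mdeg1.
apply: (nzk T _ d sh); apply: (Ieq (f := l ^+ d * cb 0)); last by rewrite cb0 mulr0.
rewrite -s0.
have -> : cb (\sum_(x <- s) x.1 *: (v0 *m mword X x.2)) = \sum_(x <- s) x.1 *: cb (v0 *m mword X x.2).
  by elim/big_rec2: _ => [|x y1 y2 _ <-]; rewrite ?cb0 // cbD cbZ.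
rewrite !mulr_sumr -sumrB big_seq; apply: Isum => x xs.
rewrite -!scalerAr -scalerBr; apply: IZ; rewrite -(hs x xs) -opprB; apply: IN.
have -> : l ^+ T * \prod_(i <- x.2) 'X_i - l ^+ size x.2 * cb (v0 *m mword X x.2) =
   \prod_(i <- x.2) 'X_i * (l ^+ T - cb v0) + (\prod_(i <- x.2) 'X_i * cb v0 - l ^+ size x.2 * cb (v0 *m mword X x.2)).
  by ring.
by apply: ID => //; exact: IM.
Qed.

End SchemeIdeal.

Lemma functional_factor (K : fieldType) (T : finType) k (M : T -> 'rV[K]_k) (W : T -> K) :
  (forall a : T -> K, \sum_x a x *: M x = 0 -> \sum_x a x * W x = 0) ->
  exists f : 'cV[K]_k, forall x, (M x *m f) 0 0 = W x.
Proof.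
move=> h; pose Mx := \matrix_(i < #|T|, j < k) M (enum_val i) 0 j.
pose Wx := \col_(i < #|T|) W (enum_val i).
have hC : (Wx^T <= Mx^T)%MS.
  rewrite submxE; apply/eqP/rowP => j; rewrite !mxE; set C := cokermx _.
  have := h (fun x => C (enum_rank x) j); rewrite [\sum_x _ *: _](reindex_onto enum_val enum_rank) /=; last by move=> x _; exact: enum_rankK.
  rewrite [\sum_x _ * _](reindex_onto enum_val enum_rank) /=; last by move=> x _; exact: enum_rankK.
  under [LHS]eq_bigl do rewrite enum_valK eqxx.
  move=> hh; rewrite -[RHS]hh.
    apply: eq_big => [i|i _]; first by rewrite enum_valK eqxx.
    by rewrite !mxE enum_valK mulrC.
  have /matrixP MC := mulmx_coker Mx^T; apply/rowP => m; rewrite summxE mxE.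
  have e := MC m j; rewrite !mxE in e; rewrite -[RHS]e; apply: eq_big => [i|i _]; first by rewrite ?enum_valK ?eqxx.
  by rewrite !mxE enum_valK mulrC.
exists (Wx^T *m pinvmx Mx^T)^T => x.
have /(congr1 trmx) := mulmxKpV hC; rewrite trmx_mul !trmxK => /matrixP /(_ (enum_rank x) 0).
rewrite [RHS]mxE enum_rankK => <-; rewrite !mxE; apply: eq_bigr => j _; rewrite !mxE enum_rankK //.
Qed.

Section Words.
Variable n : nat.

Definition mnm_word (m : 'X_{1..n.+1}) : seq 'I_n.+1 := flatten [seq nseq (m i) i | i <- enum 'I_n.+1].

Lemma mnm_wordE (R : comPzRingType) (F : 'I_n.+1 -> R) m : \prod_(i <- mnm_word m) F i = \prod_i F i ^+ m i.
Proof.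
rewrite big_flatten big_map /= big_enum /=; apply: eq_bigr => i _.
by rewrite big_nseq -Monoid.iteropE /=.
Qed.

Lemma size_mnm_word m : size (mnm_word m) = mdeg m.
Proof.
rewrite size_flatten /shape -map_comp sumnE big_map big_enum mdegE /=.
by apply: eq_bigr => i _; rewrite size_nseq.
Qed.

End Words.

Section SchemeSpan.
Variables (K : closedFieldType) (n d r : nat).

(** A linear relation among the vectors [v0 X^a], over the monomials of degree [d], puts a form into
    [I], and [w b] kills it; so [w b] factors through these vectors. *)
Lemma scheme_matfam (I : {mpoly K[n.+1]} -> Prop) (w : bool -> vidx n d -> K) : finite_scheme_ideal r I ->
  (forall b, in_span_scheme I (w b)) ->
  exists k (X : 'I_n.+1 -> 'M[K]_k) v0 f, [/\ (k <= r)%N, forall i j, X i *m X j = X j *m X i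
    & forall b a, w b a = matfam X v0 f (b, mnm_word (vmon a))].
Proof.
move=> FS wI; have [k [X [v0 [kr comm hI]]]] := ideal_matrices FS.
have hb b : exists f : 'cV[K]_k, forall a : vidx n d, ((v0 *m mword X (mnm_word (vmon a))) *m f) 0 0 = w b a.
  apply: functional_factor => a a0.
  pose s := [seq (a x, mnm_word (vmon x)) | x <- index_enum (vidx n d)].
  have dx (x : vidx n d) : mdeg (vmon x) = d by apply/eqP; exact: (valP x).
  have sI : I (\sum_x a x *: 'X_[vmon x]).
    have sz x : x \in s -> size x.2 = d by move=> /mapP [y _ ->] /=; rewrite size_mnm_word dx.
    have := hI d s sz; rewrite /s !big_map /= => /(_ a0).
    by under eq_bigr do rewrite mnm_wordE -mpolyXE_id.
  have sh : \sum_x a x *: ('X_[vmon x] : {mpoly K[n.+1]}) \is d.-homog.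
    by apply: rpred_sum => x _; rewrite rpredZ // dhomogX; apply/eqP; exact: dx.
  rewrite -[RHS](wI b _ sI sh); apply: eq_bigr => x _; congr (_ * _).
  rewrite raddf_sum (bigD1 x) //= mcoeffZ mcoeffX eqxx mulr1 big1 ?addr0 // => y yx.
  rewrite mcoeffZ mcoeffX; case: eqP => [e|]; last by rewrite mulr0.
  by case/eqP: yx; do 2 apply: val_inj.
have [f hf] := fun_choice hb; exists k, X, v0, f; split=> // b a.
by rewrite -hf /matfam.
Qed.

End SchemeSpan.

(** * Secant and cactus planes *)

Section Pluecker.
Variables (K : closedFieldType) (n d : nat).
Local Notation plane := ((vidx n d -> K) * (vidx n d -> K))%type.
Local Notation PlPoly := {mpoly K[#|{: pidx n d}|]}.
Implicit Types (P : plane) (Q : PlPoly).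

Definition mkplane (Psi : bool * vidx n d -> K) : plane := (fun a => Psi (false, a), fun a => Psi (true, a)).

Lemma pf_exp (I : Type) (F : (I -> K) -> K) k : polyfun F -> polyfun (fun Psi => F Psi ^+ k).
Proof.
move=> hF; elim: k => [|k IHk]; first by apply: (pf_ext (pf_const _ 1)) => Psi; rewrite expr0.
by apply: (pf_ext (pf_mul hF IHk)) => Psi; rewrite exprS.
Qed.

Lemma pf_pluecker Q : polyfun (fun Psi => Q.@[pluecker (mkplane Psi)]).
Proof.
apply: (pf_ext (F := fun Psi => \sum_(m <- msupp Q) Q@_m * \prod_i pluecker (mkplane Psi) i ^+ m i)); last first.
  by move=> Psi; rewrite mevalE.
apply: pf_sum => m; apply: pf_mul; first exact: pf_const.
apply: pf_prod => k; apply: pf_exp; rewrite /pluecker /=.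
set x := (enum_val k).1; set y := (enum_val k).2.
apply: (pf_ext (F := fun Psi => Psi (false, x) * Psi (true, y) + (-1) * (Psi (false, y) * Psi (true, x)))); last first.
  by move=> Psi; rewrite mulN1r.
apply: pf_add; first by apply: pf_mul; exact: pf_coord.
by apply: pf_mul; [exact: pf_const | apply: pf_mul; exact: pf_coord].
Qed.

Lemma pluecker_plane_ok P k : pluecker P k != 0 -> plane_ok P.
Proof.
move=> h a b hab; set x := (enum_val k).1; set y := (enum_val k).2.
have h1 := hab x; have h2 := hab y; have e : pluecker P k = P.1 x * P.2 y - P.1 y * P.2 x by [].
split; apply: (mulIf h); rewrite mul0r e.
  transitivity ((a * P.1 x + b * P.2 x) * P.2 y - (a * P.1 y + b * P.2 y) * P.2 x); first by ring.
  by rewrite h1 h2 !mul0r subrr.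
transitivity (P.1 x * (a * P.1 y + b * P.2 y) - P.1 y * (a * P.1 x + b * P.2 x)); first by ring.
by rewrite h1 h2 !mulr0 subrr.
Qed.

Lemma plane_ok_pluecker P : plane_ok P -> exists k, pluecker P k != 0.
Proof.
move=> ok; apply: NNPP => /not_ex_all_not h.
have e x y : P.1 x * P.2 y = P.1 y * P.2 x.
  have /negP/negPn/eqP := h (enum_rank (x, y)); rewrite /pluecker enum_rankK /= => /eqP.
  by rewrite subr_eq0 => /eqP.
have [v0|/not_all_ex_not [x0 /eqP vx]] := classic (forall x, P.2 x = 0).
  have [|_ /eqP] := ok 0 1; first by move=> x; rewrite v0 mul0r mulr0 addr0.
  by rewrite oner_eq0.
have [|/eqP v0 _] := ok (P.2 x0) (- P.1 x0).
  by move=> x; rewrite mulNr [P.2 x0 * _]mulrC e subrr.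
by case/negP: vx.
Qed.

Lemma meval_scale N (Q : {mpoly K[N]}) t s (v : 'I_N -> K) : Q \is t.-homog ->
  Q.@[fun i => s * v i] = s ^+ t * Q.@[v].
Proof.
rewrite dhomogE => /allP h; rewrite !mevalE mulr_sumr big_seq [RHS]big_seq.
apply: eq_bigr => m /h /eqP <-; rewrite mulrCA; congr (_ * _).
by rewrite /= mdegE -prodrXr -big_split; apply: eq_bigr => i _; rewrite exprMn.
Qed.

Lemma closure_sub S P : S P -> plane_ok P -> gr_closure S P.
Proof. by move=> SP ok; split=> // Q t _; apply. Qed.

End Pluecker.

Section Secant.
Variables (K : closedFieldType) (n d r : nat).
Hypotheses (n1 : (0 < n)%N) (d1 : (0 < d)%N) (r2 : (1 < r)%N).
Local Notation plane := ((vidx n d -> K) * (vidx n d -> K))%type.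
Local Notation PlPoly := {mpoly K[#|{: pidx n d}|]}.
Implicit Types (P : plane) (Q : PlPoly).

Lemma vmon_deg (a : vidx n d) : mdeg (vmon a) = d.
Proof. by apply/eqP; exact: (valP a). Qed.

Lemma veronese0 (y : 'I_n.+1 -> K) (a : vidx n d) : (forall i, y i = 0) -> veronese y a = 0.
Proof.
move=> y0; have : mdeg (vmon a) != 0%N by rewrite vmon_deg -lt0n.
rewrite mdegE sum_nat_eq0 => /forallPn [i]; rewrite /= => ai.
by rewrite /veronese (bigD1 i) //= y0 expr0n (negPf ai) mul0r.
Qed.

Definition unit_point (i k : 'I_n.+1) : K := (k == i)%:R.

Lemma ex_vidx (i : 'I_n.+1) : exists a : vidx n d, forall k, veronese (unit_point k) a = (k == i)%:R.
Proof.
have hd : mdeg (U_(i) *+ d)%MM = d by rewrite mdegMn mdeg1 mul1n.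
have hb : (mdeg (U_(i) *+ d)%MM < d.+1)%N by rewrite hd.
have hv : mdeg (bmnm (BMultinom hb)) == d by rewrite /= hd.
exists (exist _ (BMultinom hb) hv) => k; rewrite /veronese /vmon /=.
rewrite (bigD1 i) //= big1 => [|j ji]; last by rewrite mulmnE mnm1E eq_sym (negPf ji) mul0n expr0.
by rewrite mulmnE mnm1E eqxx mul1n mulr1 /unit_point eq_sym; case: eqP; rewrite ?expr1n // expr0n eqn0Ngt d1.
Qed.

Lemma ex_secant : exists P : plane, secant_set r P.
Proof.
pose i1 : 'I_n.+1 := inord 1; have i01 : (ord0 : 'I_n.+1) != i1.
  by apply/eqP => /(congr1 val); rewrite /= inordK.
have [a0 ha0] := ex_vidx ord0; have [a1 ha1] := ex_vidx i1.
exists (veronese (unit_point ord0), veronese (unit_point i1)); split.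
  move=> a b h; have := h a0; have := h a1; rewrite /= !ha0 !ha1 !eqxx [i1 == _]eq_sym (negPf i01).
  by rewrite !mulr0 !mulr1 add0r addr0.
have r0 := ltnW r2; pose p (j : 'I_r) := if (j : nat) == 0%N then unit_point ord0 else unit_point i1.
exists p; split=> [j|].
  rewrite /p; case: ifP => _; [exists ord0 | exists i1]; by rewrite /unit_point eqxx oner_eq0.
split.
  exists (fun j => ((j : nat) == 0%N)%:R) => x; rewrite (bigD1 (Ordinal r0)) //= mul1r big1 ?addr0 // => j j0.
  have /negPf -> : (j : nat) != 0%N by apply: contra j0 => /eqP h; apply/eqP; exact: val_inj.
  by rewrite mul0r.
exists (fun j => ((j : nat) == 1%N)%:R) => x; rewrite (bigD1 (Ordinal r2)) //= mul1r big1 ?addr0 // => j j1.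
have /negPf -> : (j : nat) != 1%N by apply: contra j1 => /eqP h; apply/eqP; exact: val_inj.
by rewrite mul0r.
Qed.

(** A pair of combinations of [r] points need not be a secant plane: it may be linearly dependent,
    and some of the points may be zero vectors. *)
Lemma zsum_secant Q t (Phi : bool * seq 'I_n.+1 -> K) : Q \is t.-homog ->
  (forall P, secant_set r P -> Q.@[pluecker P] = 0) -> zsum r Phi ->
  Q.@[pluecker (mkplane (fun x : bool * vidx n d => Phi (x.1, mnm_word (vmon x.2))))] = 0.
Proof.
move=> Qt hQ [c [y hPhi]]; set P := mkplane _.
have [ok|nok] := classic (plane_ok P); last first.
  (* All Pluecker coordinates vanish. A homogeneous [Q] that vanishes at a true secant plane
     vanishes at the origin, in degree 0 as well. *)
  have [P' sP'] := ex_secant; have e : pluecker P =1 fun k => 0 * pluecker P' k.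
    by move=> k; rewrite mul0r; apply/eqP; apply: contraT => /pluecker_plane_ok.
  by rewrite (meval_eq _ e) (meval_scale 0 _ Qt) hQ ?mulr0.
(* A zero vector contributes nothing because [d > 0]; it is replaced by a coordinate point with
   coefficient 0. *)
apply: hQ; split=> //; pose z j := [forall i, y j i == 0].
exists (fun j => if z j then unit_point ord0 else y j); split=> [j|].
  case: ifP => [_|/negbT]; first by exists ord0; rewrite /unit_point eqxx oner_eq0.
  by rewrite negb_forall => /existsP.
have E b (x : vidx n d) : Phi (b, mnm_word (vmon x)) = \sum_(j < r) (if z j then 0 else c j b) * veronese (if z j then unit_point ord0 else y j) x.
  rewrite hPhi; apply: eq_bigr => j _; rewrite mnm_wordE; case: ifP => // zj.
  rewrite mul0r (_ : \prod_i _ = 0) ?mulr0 //; apply: (veronese0 (y := y j)) => i.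
  by apply/eqP; have /forallP := zj; apply.
by split; eexists => x; rewrite /P /=; exact: E.
Qed.

(** An equation of the secant planes pulls back to a polynomial function on families of words, where
    [CM_le10] shows that it vanishes. *)
Lemma cactus_closure P : [pchar K] =i pred0 -> (r <= 10)%N -> cactus_set r P -> gr_closure (@secant_set K n d r) P.
Proof.
move=> K0 r10 [ok [I [FS [s1 s2]]]]; split=> // Q t Qt hQ.
pose w (b : bool) := if b then P.2 else P.1.
have [|k [X [v0 [f [kr comm hw]]]]] := scheme_matfam (w := w) FS; first by case.
have gr : good r (matfam X v0 f).
  by apply: (good_leq kr); apply: (CM_le10 K0) => //; exact: leq_trans kr r10.
pose F (Psi : bool * seq 'I_n.+1 -> K) := Q.@[pluecker (mkplane (fun x : bool * vidx n d => Psi (x.1, mnm_word (vmon x.2))))].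
have pF : polyfun F.
  apply: (pf_comp (G := fun Psi (x : bool * vidx n d) => Psi (x.1, mnm_word (vmon x.2))) (pf_pluecker Q)) => x.
  exact: pf_coord.
have := gr F pF; rewrite /F => <-; last by move=> Psi; exact: (zsum_secant Qt hQ).
exact: (polyfun_eq (Psi := fun x : bool * vidx n d => w x.1 x.2) (pf_pluecker Q)).
Qed.

Lemma homog_vidx (f : {mpoly K[n.+1]}) : f \is d.-homog -> f = \sum_(a : vidx n d) f@_(vmon a) *: 'X_[vmon a].
Proof.
move=> fd; apply/mpolyP => m; rewrite raddf_sum /=.
have [md|md] := eqVneq (mdeg m) d; last first.
  rewrite (dhomog_nemf_coeff fd md) big1 // => a _; rewrite mcoeffZ mcoeffX.
  by case: eqP => [e|]; rewrite ?mulr0 //; case/eqP: md; rewrite -e vmon_deg.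
have hb : (mdeg m < d.+1)%N by rewrite md.
have hv : mdeg (bmnm (BMultinom hb)) == d by rewrite /= md.
pose a : vidx n d := exist _ (BMultinom hb) hv.
rewrite (bigD1 a) //= mcoeffZ mcoeffX eqxx mulr1 big1 ?addr0 // => b ba.
rewrite mcoeffZ mcoeffX; case: eqP => [e|]; last by rewrite mulr0.
by case/eqP: ba; do 2 apply: val_inj.
Qed.

Lemma meval_span (p : 'I_r -> 'I_n.+1 -> K) (w : vidx n d -> K) (f : {mpoly K[n.+1]}) : in_span_points p w ->
  f \is d.-homog -> (forall j, f.@[p j] = 0) -> \sum_a f@_(vmon a) * w a = 0.
Proof.
case=> c hw fd f0; under eq_bigr do rewrite hw mulr_sumr.
rewrite exchange_big big1 //= => j _; under eq_bigr do rewrite mulrCA.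
rewrite -mulr_sumr; have -> : \sum_(a : vidx n d) f@_(vmon a) * veronese (p j) a = f.@[p j]; last by rewrite f0 mulr0.
transitivity ((\sum_(a : vidx n d) f@_(vmon a) *: 'X_[vmon a]).@[p j]); last by rewrite -homog_vidx.
rewrite raddf_sum /=; apply: eq_bigr => a _.
by rewrite mevalZ mevalX.
Qed.

Lemma hcomp_meval (f : {mpoly K[n.+1]}) (v : 'I_n.+1 -> K) s :
  f.@[fun i => s * v i] = \sum_(t < (msize f).+1) s ^+ t * (hcomp t f).@[v].
Proof.
have hh (t : nat) : (hcomp t f).@[v] = \sum_(m <- msupp f | mdeg m == t) f@_m * \prod_i v i ^+ m i.
  by rewrite /hcomp raddf_sum /=; apply: eq_bigr => m _; rewrite mevalZ mevalX.
under [RHS]eq_bigr do rewrite hh mulr_sumr big_mkcond.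
rewrite exchange_big /= mevalE big_seq [RHS]big_seq; apply: eq_bigr => m mf.
have mt : (mdeg m < (msize f).+1)%N by rewrite ltnS ltnW // msize_mdeg_lt.
rewrite (bigD1 (Ordinal mt)) //= eqxx [X in _ + X]big1 ?addr0 => [|t ht]; last first.
  by rewrite ifN //; apply: contra ht => /eqP e; apply/eqP; apply: val_inj; rewrite /= e.
rewrite [RHS]mulrCA; congr (_ * _); rewrite mdegE -prodrXr -big_split.
by apply: eq_bigr => i _; rewrite exprMn.
Qed.

Lemma hcomp_homog (f : {mpoly K[n.+1]}) t : hcomp t f \is t.-homog.
Proof. by apply: rpred_sum => m /eqP e; rewrite rpredZ // dhomogX; apply/eqP. Qed.

(* Vanishing on the whole lines through the [p j] makes the ideal homogeneous. *)
Lemma secant_cactus P : secant_set r P -> cactus_set r P.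
Proof.
case=> ok [p [pnz [s1 s2]]]; split=> //.
pose I (f : {mpoly K[n.+1]}) := forall j s, f.@[fun i => s * p j i] = 0.
have Id f : I f -> forall j, f.@[p j] = 0.
  by move=> h j; rewrite -(h j 1); apply: meval_eq => i; rewrite mul1r.
have Ih f t : f \is t.-homog -> (forall j, f.@[p j] = 0) -> I f.
  by move=> ft h j s; rewrite (meval_scale _ _ ft) h mulr0.
exists I; split; last by split=> f hf fd; [exact: (meval_span s1 fd (Id f hf)) | exact: (meval_span s2 fd (Id f hf))].
split; [|split].
- split; first split.
  + by move=> j s; rewrite meval0.
  + split=> [f g hf hg j s|f g hg j s]; first by rewrite mevalD hf hg addr0.
    by rewrite mevalM hg mulr0.
  move=> f t hf; apply: (Ih _ t); first exact: hcomp_homog.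
  move=> j; pose q : {poly K} := \poly_(k < (msize f).+1) (hcomp k f).@[p j].
  have q0 : q = 0.
    apply: poly_eq0 => s; rewrite -(hf j s) hcomp_meval /q horner_poly.
    by apply: eq_bigr => k _; rewrite mulrC.
  have [tf|tf] := ltnP t (msize f).+1; first by have := coef_poly (msize f).+1 (fun k => (hcomp k f).@[p j]) t; rewrite -/q q0 coef0 tf.
  rewrite /hcomp big_seq_cond big1 ?meval0 // => m /andP [mf /eqP mt].
  by have := msize_mdeg_lt mf; rewrite mt ltnNge (ltnW tf).
- move=> f [k hk] j; have [i pi] := pnz j.
  have h s : s != 0 -> f.@[fun i0 => s * p j i0] = 0.
    move=> s0; have := hk i j s; rewrite mevalM rmorphXn /= mevalXU => /eqP.
    by rewrite mulf_eq0 expf_eq0 mulf_eq0 (negPf s0) (negPf pi) andbF => /eqP.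
  pose q : {poly K} := \poly_(k < (msize f).+1) (hcomp k f).@[p j].
  have qE s : q.[s] = f.@[fun i => s * p j i].
    by rewrite hcomp_meval /q horner_poly; apply: eq_bigr => k' _; rewrite mulrC.
  have q0 : q = 0 by apply: poly_gen0; apply: gen_mono (gen_neC 0) => s s0; rewrite qE h.
  by move=> s; rewrite -qE q0 horner0.
(* [r + 1] forms evaluated at [r] points: some nontrivial combination vanishes at all of them. *)
move=> t g gt; pose M : 'M[K]_(r.+1, r) := \matrix_(j, k) (g j).@[p k].
have kM : kermx M != 0.
  by rewrite -mxrank_eq0 mxrank_ker -lt0n subn_gt0 ltnS rank_leq_col.
have /rowV0Pn [v vk v0] := kM; exists (fun j => v 0 j); split.
  by apply/existsP; apply: contraNT v0; rewrite negb_exists => /forallP h; apply/eqP/rowP => j; rewrite mxE; apply/eqP; rewrite -[_ == _]negbK.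
apply: (Ih _ t); first by apply: rpred_sum => j _; apply: rpredZ; exact: gt.
move=> k; move/sub_kermxP: vk => /matrixP /(_ 0 k); rewrite !mxE => <-.
by rewrite raddf_sum /=; apply: eq_bigr => j _; rewrite mevalZ mxE.
Qed.

Lemma cactus_eq_secant P : [pchar K] =i pred0 -> (r <= 10)%N ->
  grassmann_cactus r P <-> @grassmann_secant K n d r P.
Proof.
move=> K0 r10; split=> -[ok h]; split=> // Q t Qt hQ; apply: (h Q t Qt) => P' hP'.
  by case: (cactus_closure K0 r10 hP') => _ hh; exact: (hh Q t Qt hQ).
by apply: hQ; exact: secant_cactus.
Qed.

(* Two secant planes are joined by a rational curve of secant planes. *)
Lemma secant_irreducible : gr_irreducible (@grassmann_secant K n d r).
Proof.
split; first by have [P sP] := ex_secant; exists P; apply: closure_sub => //; case: sP.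
move=> Z1 Z2 [F1 [hF1 hZ1]] [F2 [hF2 hZ2]] Z12; apply: NNPP => /not_or_and [n1' n2'].
have sep (Z : plane -> Prop) (F : PlPoly -> Prop) : (forall Q, F Q -> exists t, Q \is t.-homog) ->
    (forall P, Z P <-> plane_ok P /\ forall Q, F Q -> Q.@[pluecker P] = 0) ->
    ~ (forall P, grassmann_secant r P -> Z P) -> exists P Q, [/\ secant_set r P, F Q & Q.@[pluecker P] != 0].
  move=> hF hZ nZ; apply: NNPP => nex; apply: nZ => P [ok h]; apply/hZ; split=> // Q FQ.
  have [t Qt] := hF Q FQ; apply: (h Q t Qt) => P' sP'.
  by apply/eqP; apply: contraT => h'; case: nex; exists P', Q.
have [P1 [Q1 [[ok1 [p1 [pnz1 [[a1 e1] [b1 f1]]]]] FQ1 nQ1]]] := sep _ _ hF1 hZ1 n1'.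
have [P2 [Q2 [[ok2 [p2 [pnz2 [[a2 e2] [b2 f2]]]]] FQ2 nQ2]]] := sep _ _ hF2 hZ2 n2'.
(* Points and coefficients are joined linearly. That [Q1], [Q2] do not vanish, that the plane is
   nondegenerate and that no point is zero are generic conditions on [t], each satisfied at 0 or at
   1. *)
pose seg (x y : K) : {poly K} := x%:P + (y - x) *: 'X.
have segE x y t : (seg x y).[t] = x + (y - x) * t by rewrite hornerD hornerC hornerZ hornerX.
pose pt j i := seg (p1 j i) (p2 j i).
pose ct (b : bool) j := if b then seg (b1 j) (b2 j) else seg (a1 j) (a2 j).
pose W (x : bool * vidx n d) : {poly K} := \sum_(j < r) ct x.1 j * \prod_i pt j i ^+ vmon x.2 i.
have WE x t : (W x).[t] = \sum_(j < r) (ct x.1 j).[t] * veronese (fun i => (pt j i).[t]) x.2.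
  rewrite /W horner_sum; apply: eq_bigr => j _; rewrite hornerM horner_prod; congr (_ * _).
  by apply: eq_bigr => i _; rewrite horner_exp.
pose Pt t : plane := mkplane (fun x => (W x).[t]).
have veq (y y' : 'I_n.+1 -> K) (a : vidx n d) : y =1 y' -> veronese y a = veronese y' a.
  by move=> h; apply: eq_bigr => i _; rewrite h.
have P1E : (forall x, (Pt 0).1 x = P1.1 x) /\ forall x, (Pt 0).2 x = P1.2 x.
  split=> x; rewrite /= WE ?e1 ?f1; apply: eq_bigr => j _; rewrite /ct /= segE mulr0 addr0; congr (_ * _);
  by apply: veq => i; rewrite segE mulr0 addr0.
have P2E : (forall x, (Pt 1).1 x = P2.1 x) /\ forall x, (Pt 1).2 x = P2.2 x.
  split=> x; rewrite /= WE ?e2 ?f2; apply: eq_bigr => j _; rewrite /ct /= segE mulr1 addrC subrK; congr (_ * _);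
  by apply: veq => i; rewrite segE mulr1 addrC subrK.
have plE (P P' : plane) k : (forall x, P.1 x = P'.1 x) -> (forall x, P.2 x = P'.2 x) -> pluecker P k = pluecker P' k.
  by move=> h1 h2; rewrite /pluecker !h1 !h2.
have gQ Q t0 : Q.@[pluecker (Pt t0)] != 0 -> gen (fun t => Q.@[pluecker (Pt t)] != 0).
  have [q hq] := pf_poly W (pf_pluecker Q); rewrite hq => /gen_bad; apply: gen_mono => t.
  by rewrite hq.
have g1 : gen (fun t => Q1.@[pluecker (Pt t)] != 0).
  by apply: (gQ _ 0); rewrite (meval_eq (v2 := pluecker P1)) // => k; apply: plE; case: P1E.
have g2 : gen (fun t => Q2.@[pluecker (Pt t)] != 0).
  by apply: (gQ _ 1); rewrite (meval_eq (v2 := pluecker P2)) // => k; apply: plE; case: P2E.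
have g3 : gen (fun t => plane_ok (Pt t)).
  have [k hk] := plane_ok_pluecker ok1.
  have : gen (fun t => ('X_k : PlPoly).@[pluecker (Pt t)] != 0).
    by apply: (gQ _ 0); rewrite mevalXU (plE _ P1); case: P1E.
  by apply: gen_mono => t; rewrite mevalXU; exact: pluecker_plane_ok.
have g4 : gen (fun t => forall j : 'I_r, exists i, (pt j i).[t] != 0).
  apply: gen_fin => j; have [i hi] := pnz1 j.
  apply: (gen_mono _ (gen_bad (p := pt j i) (t0 := 0) _)); first by move=> t ht; exists i.
  by rewrite segE mulr0 addr0.
have [t [[h1 h2] [h3 h4]]] := gen_ex (gen_and (gen_and g1 g2) (gen_and g3 g4)).
have sPt : secant_set r (Pt t).
  split=> //; exists (fun j i => (pt j i).[t]); split=> //.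
  by split; [exists (fun j => (ct false j).[t]) | exists (fun j => (ct true j).[t])] => x; rewrite /= WE.
case: (Z12 (Pt t)); first exact: closure_sub.
  by move/hZ1 => [_ /(_ _ FQ1)] /eqP; rewrite (negPf h1).
by move/hZ2 => [_ /(_ _ FQ2)] /eqP; rewrite (negPf h2).
Qed.

End Secant.

Lemma irreducible_ext (K : fieldType) (n d : nat) (Z Z' : (vidx n d -> K) * (vidx n d -> K) -> Prop) :
  (forall P, Z' P <-> Z P) -> gr_irreducible Z -> gr_irreducible Z'.
Proof.
move=> e [[P ZP] h]; split; first by exists P; apply/e.
move=> Z1 Z2 c1 c2 h12; case: (h Z1 Z2 c1 c2) => [P' /e /h12 //|hh|hh]; [left|right] => P' /e; exact: hh.
Qed.

Unset Implicit Arguments.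
Theorem theorem5p3 (K : closedFieldType) (hK : [pchar K] =i pred0)
    (r n d : nat) (hr : r = 9%N \/ r = 10%N) (hn : (4 <= n)%N) (hd : (1 <= d)%N) :
  @gr_irreducible K n d (@grassmann_cactus K n d r) /\
  (forall P, @grassmann_cactus K n d r P <-> @grassmann_secant K n d r P).
Proof.
have n0 : (0 < n)%N by case: n hn.
have r2 : (1 < r)%N by case: hr => ->.
have r10 : (r <= 10)%N by case: hr => ->.
have e P := cactus_eq_secant n0 hd r2 P hK r10.
by split=> //; apply: irreducible_ext e _; exact: secant_irreducible.
Qed.
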